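(* There are no smooth nontrivial self-similar solutions to the hyperbolic Yang--Mills equation defined on the whole (open) forward light cone $C=\{(t,x)\in\mathbb R^{1+4}:|x|<t\}$ which have finite energy. That is, if $A$ is a smooth $\mathfrak g$-valued connection 1-form on $C$ with $\mathbf D^\alpha F_{\alpha\beta}=0$, $\iota_SF=0$ and finite energy, then $F\equiv0$.
   Context: $\mathbf G$ is a compact noncommutative Lie group with Lie algebra $\mathfrak g$ equipped with a bi-invariant inner product. $\mathbb R^{1+4}$ carries the Minkowski metric $\mathrm{diag}(-1,1,1,1,1)$. For a connection $A_\alpha$: $\mathbf D_\alpha B=\partial_\alpha B+[A_\alpha,B]$, $F_{\alpha\beta}=\partial_\alpha A_\beta-\partial_\beta A_\alpha+[A_\alpha,A_\beta]$. $S=x^\alpha\partial_\alpha=t\partial_t+x\cdot\partial_x$ is the scaling vector field and $(\iota_SF)_\beta=S^\alpha F_{\alpha\beta}$; self-similar means $\iota_SF=0$. Finite energy means $\int_{|x|<t}\sum_{\alpha<\beta}|F_{\alpha\beta}(t,x)|^2dx<\infty$ (for self-similar solutions this quantity is independent of $t>0$). Nontrivial means $F\not\equiv0$. No regularity up to the boundary $\partial C$ is assumed. *)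

(* Defs.v *)
From HB Require Import structures.
From mathcomp Require Import all_boot all_order all_algebra.
From mathcomp Require Import all_classical all_reals all_analysis.
Set Implicit Arguments.
Unset Strict Implicit.
Unset Printing Implicit Defensive.
Import Order.TTheory GRing.Theory Num.Theory.
Import numFieldNormedType.Exports.
Local Open Scope classical_set_scope.
Local Open Scope ring_scope.

(* C^infty on an open set U: every iterated directional derivative is
   differentiable (hence continuous) at every point of U.  Values of f outside
   U are irrelevant. *)
Definition smooth_on (R : realType) (V W : normedModType R)
    (U : set V) (f : V -> W) : Prop :=
  forall (vs : seq V) (x : V), U x ->
    differentiable (foldr (fun v (g : V -> W) => 'D_v g) f vs) x.

#[short(type="topologicalGroupType")]
HB.structure Definition TopologicalGroup := {G of Group G & Topological G}.

Record chart (R : realType) (n : nat) (G : topologicalType) := Chart {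
  dom : set G;
  coord : G -> 'rV[R]_n;
  param : 'rV[R]_n -> G;
  dom_open : open dom;
  img_open : open (coord @` dom);
  coordK : {in dom, cancel coord param};
  coord_continuous : {within dom, continuous coord};
  param_continuous : {within coord @` dom, continuous param} }.

Definition img (R : realType) (n : nat) (G : topologicalType)
  (c : chart R n G) : set 'rV[R]_n := coord c @` dom c.

(* Group operations are assumed continuous separately, so that the domains on
   which their coordinate expressions are required to be smooth are open. *)
Record is_lie_group (R : realType) (n : nat) (G : topologicalGroupType)
    (atlas : set (chart R n G)) : Prop := IsLieGroup {
  lie_hausdorff : hausdorff_space G;
  lie_cover : forall g : G, exists2 c, atlas c & dom c g;
  lie_compat : forall c d, atlas c -> atlas d ->
    smooth_on [set u | img c u /\ dom d (param c u)] (coord d \o param c);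
  lie_mul_continuous : continuous (fun p : G * G => (p.1 * p.2)%g);
  lie_inv_continuous : continuous (fun g : G => (g^-1)%g);
  lie_mul_smooth : forall c1 c2 c3, atlas c1 -> atlas c2 -> atlas c3 ->
    smooth_on
      [set p : 'rV[R]_n * 'rV[R]_n | [/\ img c1 p.1, img c2 p.2 &
                                dom c3 (param c1 p.1 * param c2 p.2)%g]]
      (fun p => coord c3 (param c1 p.1 * param c2 p.2)%g);
  lie_inv_smooth : forall c d, atlas c -> atlas d ->
    smooth_on [set u | img c u /\ dom d ((param c u)^-1)%g]
      (fun u => coord d ((param c u)^-1)%g) }.

(* The Lie algebra is T_1 G, identified with 'rV[R]_n through a chart e around
   the unit. *)
Section LieAlgebra.
Context (R : realType) (n : nat) (G : topologicalGroupType) (e : chart R n G).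

(* The left-invariant vector field with value Y at the unit, read in e: the
   derivative of left translation by [param e u], applied to Y. *)
Definition left_invariant_field (Y u : 'rV[R]_n) : 'rV[R]_n :=
  'D_Y (fun v => coord e (param e u * param e v)%g) (coord e 1%g).

(* Value at the unit of the commutator of the vector fields. *)
Definition lie_bracket (X Y : 'rV[R]_n) : 'rV[R]_n :=
  'D_X (left_invariant_field Y) (coord e 1%g)
  - 'D_Y (left_invariant_field X) (coord e 1%g).

Definition lie_Ad (g : G) (X : 'rV[R]_n) : 'rV[R]_n :=
  'D_X (fun v => coord e (g * param e v * g^-1)%g) (coord e 1%g).

(* An inner product on T_1 G extends to a bi-invariant metric on G exactly when
   it is Ad-invariant. *)
Record is_biinvariant_inner_product (ip : 'rV[R]_n -> 'rV[R]_n -> R) : Prop :=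
  IsBiinvariantInnerProduct {
  ip_sym : forall X Y, ip X Y = ip Y X;
  ip_linear : forall (a : R) X Y Z, ip (a *: X + Y) Z = a * ip X Z + ip Y Z;
  ip_posdef : forall X, X != 0 -> 0 < ip X X;
  ip_Ad : forall g X Y, ip (lie_Ad g X) (lie_Ad g Y) = ip X Y }.

End LieAlgebra.

(* Points of R^{1+4} are row vectors; coordinate 0 is time.  The norm `|_| of
   the library on row vectors is the sup norm, so the Euclidean norm of the
   space part is spelled out. *)
Definition space_norm (R : realType) (p : 'rV[R]_5) : R :=
  Num.sqrt (\sum_(i < 4) p 0 (lift ord0 i) ^+ 2).

Definition light_cone (R : realType) : set 'rV[R]_5 :=
  [set p | space_norm p < p 0 0].

(* Minkowski metric; it is its own inverse, so it also raises indices. *)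
Definition minkowski (R : realType) : 'M[R]_5 :=
  diag_mx (\row_i (if i == 0 then -1 else 1)).

Definition pderiv (R : realType) (n : nat) (a : 'I_5)
    (B : 'rV[R]_5 -> 'rV[R]_n) : 'rV[R]_5 -> 'rV[R]_n :=
  'D_(delta_mx 0 a) B.

Section YangMills.
Context (R : realType) (n : nat) (G : topologicalGroupType) (e : chart R n G).
Variable A : 'I_5 -> 'rV[R]_5 -> 'rV[R]_n.

Definition covariant_deriv (a : 'I_5) (B : 'rV[R]_5 -> 'rV[R]_n) :
    'rV[R]_5 -> 'rV[R]_n :=
  fun p => pderiv a B p + lie_bracket e (A a p) (B p).

Definition curvature (a b : 'I_5) : 'rV[R]_5 -> 'rV[R]_n :=
  fun p => pderiv a (A b) p - pderiv b (A a) p + lie_bracket e (A a p) (A b p).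

Definition yang_mills : Prop := forall (b : 'I_5) p, light_cone p ->
  \sum_a \sum_c minkowski R a c *: covariant_deriv c (curvature a b) p = 0.

Definition self_similar : Prop := forall (b : 'I_5) p, light_cone p ->
  \sum_a p 0 a *: curvature a b p = 0.

End YangMills.

Definition R4 (R : realType) : Type :=
  (measurableTypeR R * measurableTypeR R * measurableTypeR R
   * measurableTypeR R)%type.

Definition lebesgue_measure4 (R : realType) :=
  (((@lebesgue_measure R \x @lebesgue_measure R) \x @lebesgue_measure R)
   \x @lebesgue_measure R)%E.

Definition spacetime_point (R : realType) (t : R) (x : R4 R) : 'rV[R]_5 :=
  \row_i [:: t; x.1.1.1; x.1.1.2; x.1.2; x.2]`_i.

Definition energy (R : realType) (n : nat) (G : topologicalGroupType)
    (e : chart R n G) (ip : 'rV[R]_n -> 'rV[R]_n -> R)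
    (A : 'I_5 -> 'rV[R]_5 -> 'rV[R]_n) (t : R) : \bar R :=
  (\int[@lebesgue_measure4 R]_(x in [set x | (space_norm (spacetime_point t x) < t)%R])
    (\sum_(a < 5) \sum_(b < 5 | (a < b)%N)
      ip (curvature e A a b (spacetime_point t x))
         (curvature e A a b (spacetime_point t x)))%R%:E)%E.

(* Main.v *)
(** A self-similar connection is determined by its pullback [a] to the surface
    t = (1 + |y|^2) / 2, x = y, with |y| < 1, and because Yang-Mills theory is
    conformally invariant in dimension 4, [a] solves the Euclidean Yang-Mills
    equation on the unit ball.  The energy flux through this surface is at most
    the energy of the disc t = 1, which bounds the integral of the squared radial
    curvature of [a] against 1 / (1 - |y|); the Pohozaev identity (the stress
    tensor is trace free and divergence free) transfers the bound to the whole
    curvature f.  Epsilon-regularity improves it to |f| = O((1 - |y|)^(-3/2)).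

    Let q be the squared norm of the self-dual or of the anti-self-dual part of f.
    The Yang-Mills and Bianchi equations express the radial derivative of this
    part by rotational derivatives, so that, for a radial weight phi, the mean
    v(r) of q(r y) against phi satisfies r (r v')' >= (r v')^2 / v up to an error
    controlled by the pointwise bound.  Hence the frequency r v' / v is bounded below
    by a function integrable up to r = 1, and v(r) <= c v(1) for r < 1, uniformly in
    phi.  Taking for phi truncations of 1 / (1 - |y|^2) keeps v(1) bounded, whereas
    v(r) diverges logarithmically unless q vanishes on the sphere of radius r.  Thus
    f = 0. *)

Require Import Defs.
From HB Require Import structures.
From mathcomp Require Import all_boot all_order all_algebra.
From mathcomp Require Import all_classical all_reals all_analysis.
From mathcomp Require Import measurable_realfun ring lra.
Set Implicit Arguments.
Unset Strict Implicit.
Unset Printing Implicit Defensive.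
Import Order.TTheory GRing.Theory Num.Theory.
Import numFieldNormedType.Exports.
Local Open Scope classical_set_scope.
Local Open Scope ring_scope.

(** The exponent 3/2 is decisive. Finite energy without the weight would give only |f| = O((1 -
    |y|)^(-2)), and this error, integrated once for the frequency and once more for ln v, diverges
    logarithmically at r = 1. With the weight 1 / (1 - |y|), a ball of radius about d at distance
    about d from the boundary has energy O(d); hence the smallness required by epsilon-regularity is
    automatic near the boundary, and |f|^2 = O(d / d^4). The splitting of f serves the convexity.
    For each part the equations read: radial derivative = a curl in the rotation fields. Against a
    radial weight, which rotations preserve, this curl is formally symmetric, so the second radial
    derivative of v is four times the mean of the squared radial derivative, up to the commutator of
    radial and rotational covariant derivatives, which is a curvature. Cauchy-Schwarz then gives (r
    v')^2 / v. The flat equation appears because the surface t = (1 + |y|^2) / 2 is, ray by ray, the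
    Poincare ball model of hyperbolic space, which is conformal to the Euclidean ball. *)

Lemma is_derive_along (R : realType) (V W : normedModType R) (f : V -> W)
    (y v : V) (t : R) (d : W) :
  is_derive (y + t *: v) v f d -> is_derive t 1 (fun s : R => f (y + s *: v)) d.
Proof.
move=> [+ <-]; rewrite /derivable /derive => H.
have E : (fun h : R => h^-1 *: (f (h *: v + (y + t *: v)) - f (y + t *: v))) =
  (fun h : R => h^-1 *: (f (y + (h *: (1 : R) + t) *: v) - f (y + t *: v))).
  apply/funext => h; congr (_ *: (f _ - _)).
  by rewrite [h *: (1 : R)]mulr1 scalerDl addrCA.
by split; rewrite /derivable /derive -E.
Qed.

#[local] Opaque derive.

(** * Smooth functions and their derivatives *)

Section calculus.
Context {R : realType}.

Lemma differentiable_near0 (V W : normedModType R) (h : V -> W) (x : V) :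
  (\forall y \near x, h y = 0) -> differentiable h x.
Proof.
move=> h0.
have hx : h x = 0 by exact: (nbhs_singleton h0).
have c0 : continuous (0 : V -> W) by move=> y; exact: cvg_cst.
have E : h \o shift x = cst (h x) + (\0 : {linear V -> W}) +o_ 0 id.
  apply/eqaddoP => _/posnumP[e]; near=> y.
  have hy : h (y + x) = 0.
    near: y; move: h0; rewrite (near_shift 0 x) /= => h0.
    by apply: filterS h0 => y; rewrite /= subr0.
  rewrite [X in `|X|](_ : _ = h (y + x) - (h x + 0)) // hy hx addr0 subrr.
  by rewrite normr0 mulr_ge0.
have D := @diff_unique R V W h (\0 : {linear V -> W}) x c0 E.
apply/diff_locallyP; rewrite D; split=> //.
Unshelve. all: by end_near. Qed.

Lemma near_eq_differentiable (V W : normedModType R) (f g : V -> W) (x : V) :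
  (\forall y \near x, f y = g y) -> differentiable f x -> differentiable g x.
Proof.
move=> fg df; have -> : g = f + (g - f) by rewrite addrC subrK.
apply: differentiableD; [exact: df|apply: differentiable_near0].
by apply: filterS fg => y; rewrite !fctE => ->; rewrite subrr.
Qed.

Lemma derive_linear_dir (V W : normedModType R) (f : V -> W) (x v w : V) (c : R) :
  differentiable f x -> 'D_(c *: v + w) f x = c *: 'D_v f x + 'D_w f x.
Proof. by move=> df; rewrite !deriveE// linearP. Qed.

Lemma derive_lincomb (V W : normedModType R) (f g : V -> W) (x v : V) (c : R) :
  differentiable f x -> differentiable g x ->
  'D_v (fun y => c *: f y + g y) x = c *: 'D_v f x + 'D_v g x.
Proof.
move=> df dg; have df' := @diff_derivable _ _ _ _ _ v df; have dg' := @diff_derivable _ _ _ _ _ v dg.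
have := @deriveD R V W (fun y => c *: f y) g x v (@derivableZ _ _ _ _ c _ _ df') dg'.
by rewrite (@deriveZ R V W f c x v df').
Qed.

Lemma derive_comp (E V W : normedModType R) (f : V -> W) (g : E -> V) (x v : E) :
  differentiable g x -> differentiable f (g x) ->
  'D_v (fun y => f (g y)) x = 'D_('D_v g x) f (g x).
Proof.
move=> dg df; have dc := @differentiable_comp R E V W g f x dg df.
have E1 := @diff_comp R E V W g f x dg df.
rewrite (deriveE _ df) (deriveE _ dg) -[LHS]/('D_v (f \o g) x) (deriveE _ dc).
by rewrite E1.
Qed.

Lemma derive_sum_dir (V W : normedModType R) (f : V -> W) (x : V) (I : finType)
    (v : I -> V) (c : I -> R) :
  differentiable f x ->
  'D_(\sum_i c i *: v i) f x = \sum_i c i *: 'D_(v i) f x.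
Proof.
move=> df; rewrite deriveE// linear_sum; apply: eq_bigr => i _.
by rewrite linearZ deriveE.
Qed.

Lemma differentiable_bilin_comp (U V W E : normedModType R) (B : U -> V -> W)
    (f : E -> U) (g : E -> V) (x : E) :
  (forall v, linear (B ^~ v)) -> (forall u, linear (B u)) ->
  continuous (fun p : U * V => B p.1 p.2) ->
  differentiable f x -> differentiable g x ->
  is_diff x (fun y => B (f y) (g y))
    (fun v => B ('d f x v) (g x) + B (f x) ('d g x v)).
Proof.
move=> Bl Br Bc df dg.
have Bbil : bilinear_for (GRing.Scale.Law.clone _ _ *:%R _)
  (GRing.Scale.Law.clone _ _ *:%R _) B.
  by split=> [v|u] a y z /=; rewrite ?Bl ?Br.
pose bM := bilinear_isBilinear.Build R U V W _ _ B Bbil.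
pose b : {bilinear U -> V -> W} := HB.pack B bM.
have dp := @differentiable_pair R E U V f g x df dg.
have db := @differentiable_bilin R U V W b (f x, g x) Bc.
apply: DiffDef.
  exact: (@differentiable_comp R E (U * V)%type W (fun y => (f y, g y))
    (fun p => b p.1 p.2) x dp db).
rewrite -[LHS]/('d ((fun p => b p.1 p.2) \o (fun y => (f y, g y))) x : E -> W).
rewrite diff_comp// diff_pair//.
rewrite (_ : ('d _ _ : U * V -> W) = (fun q => b (f x) q.2 + b q.1 (g x))); last first.
  exact: (@diff_bilin R U V W b (f x, g x) Bc).
by apply/funext => v /=; rewrite addrC.
Qed.

Section bilinear.
Context (U V W E : normedModType R) (B : U -> V -> W).
Hypotheses (Bl : forall v, linear (B ^~ v)) (Br : forall u, linear (B u))
  (Bc : continuous (fun p : U * V => B p.1 p.2)).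

Lemma differentiable_bilin2 (f : E -> U) (g : E -> V) (x : E) :
  differentiable f x -> differentiable g x ->
  differentiable (fun y => B (f y) (g y)) x.
Proof. by move=> df dg; have [] := differentiable_bilin_comp Bl Br Bc df dg. Qed.

Lemma derive_bilin2 (f : E -> U) (g : E -> V) (x v : E) :
  differentiable f x -> differentiable g x ->
  'D_v (fun y => B (f y) (g y)) x = B ('D_v f x) (g x) + B (f x) ('D_v g x).
Proof.
move=> df dg; have H := differentiable_bilin_comp Bl Br Bc df dg.
rewrite (deriveE _ (@ex_diff _ _ _ _ _ _ _ H)) (@diff_val _ _ _ _ _ _ _ H).
by rewrite (deriveE _ df) (deriveE _ dg).
Qed.

End bilinear.

Lemma derive_sum_scale (I : finType) (V W : normedModType R) (c : I -> V -> R)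
    (F : I -> V -> W) (x v : V) :
  (forall i, differentiable (c i) x) -> (forall i, differentiable (F i) x) ->
  'D_v (fun y => \sum_i c i y *: F i y) x =
  \sum_i ('D_v (c i) x *: F i x + c i x *: 'D_v (F i) x).
Proof.
move=> dc dF.
have Z i : is_derive x v (fun y => c i y *: F i y) ('D_v (c i) x *: F i x + c i x *: 'D_v (F i) x).
  have sl u : linear ( *:%R u : W -> W) by move=> a p q; rewrite scalerDr !scalerA mulrC.
  have sr (u : W) : linear ( *:%R ^~ u : R -> W) by move=> a p q; rewrite scalerDl scalerA.
  apply: DeriveDef.
    apply: diff_derivable.
    exact: (@differentiable_bilin2 R W W V *:%R sr sl (@scale_continuous _ _) _ _ _ (dc i) (dF i)).
  exact: (@derive_bilin2 R W W V *:%R sr sl (@scale_continuous _ _) _ _ _ v (dc i) (dF i)).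
have S (r : seq I) : is_derive x v (fun y => \sum_(i <- r) c i y *: F i y)
   (\sum_(i <- r) ('D_v (c i) x *: F i x + c i x *: 'D_v (F i) x)).
  elim: r => [|i r IH].
    rewrite big_nil; under eq_fun do rewrite big_nil; exact: is_derive_cst.
  rewrite big_cons; under eq_fun do rewrite big_cons; exact: is_deriveD.
by have [_] := S (index_enum I).
Qed.

Lemma differentiable_sum_scale (I : finType) (V W : normedModType R) (c : I -> V -> R)
    (F : I -> V -> W) (x : V) :
  (forall i, differentiable (c i) x) -> (forall i, differentiable (F i) x) ->
  differentiable (fun y => \sum_i c i y *: F i y) x.
Proof.
move=> dc dF.
have Z i : differentiable (fun y => c i y *: F i y) x.
  have sl u : linear ( *:%R u : W -> W) by move=> a p q; rewrite scalerDr !scalerA mulrC.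
  have sr (u : W) : linear ( *:%R ^~ u : R -> W) by move=> a p q; rewrite scalerDl scalerA.
  exact: (@differentiable_bilin2 R W W V *:%R sr sl (@scale_continuous _ _) _ _ _ (dc i) (dF i)).
elim: (index_enum I) => [|i r IH].
  under eq_fun do rewrite big_nil; exact: differentiable_cst.
under eq_fun do rewrite big_cons; exact: differentiableD.
Qed.

(** Smoothness of finite order: directional derivatives of order up to [k] are differentiable on
    [U]. Derivatives of products and compositions contain the original factors again, so closure
    properties are proved by induction on [k], with [csmoothW] lowering the order of those
    factors. *)
Fixpoint csmooth (k : nat) (V W : normedModType R) (U : set V) (f : V -> W) : Prop :=
  (forall x, U x -> differentiable f x) /\
  (if k is k'.+1 then forall v, csmooth k' U ('D_v f) else True).

Lemma smooth_onP (V W : normedModType R) (U : set V) (f : V -> W) :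
  smooth_on U f <-> forall k, csmooth k U f.
Proof.
split=> [sf k|sf vs].
  elim: k f sf => [|k IH] f sf /=; split; try by move=> x Ux; exact: (sf [::]).
    by [].
  move=> v; apply: IH => vs x Ux.
  by have := sf (rcons vs v) x Ux; rewrite foldr_rcons.
elim/last_ind: vs f sf => [|vs v IH] f sf x Ux /=.
  by have [+ _] := sf 0; apply.
by rewrite foldr_rcons; apply: IH => // k; have [_] := sf k.+1; apply.
Qed.

Lemma csmooth_diff k (V W : normedModType R) (U : set V) (f : V -> W) x :
  csmooth k U f -> U x -> differentiable f x.
Proof. by case: k => [|k] [+ _]; apply. Qed.

Lemma csmoothW k (V W : normedModType R) (U : set V) (f : V -> W) :
  csmooth k.+1 U f -> csmooth k U f.
Proof.
elim: k f => [|k IH] f [df sf]; split=> //; move=> v; exact: IH.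
Qed.

Lemma csmooth_eq k (V W : normedModType R) (U : set V) (f g : V -> W) :
  open U -> (forall x, U x -> f x = g x) -> csmooth k U f -> csmooth k U g.
Proof.
move=> oU; elim: k f g => [|k IH] f g fg [df sf]; split=> //; try (move=> x Ux;
  apply: near_eq_differentiable (df x Ux); near=> y; apply: fg; near: y;
  exact: open_nbhs_nbhs).
move=> v; apply: IH (sf v) => x Ux; apply: near_eq_derive; near=> y.
by apply: fg; near: y; exact: open_nbhs_nbhs.
Unshelve. all: by end_near. Qed.

Lemma csmooth_cst k (V W : normedModType R) (U : set V) (c : W) :
  csmooth k U (fun=> c).
Proof.
elim: k c => [|k IH] c; split=> //; try (by move=> x _; exact: differentiable_cst).
move=> v; have -> : 'D_v (fun=> c) = (fun=> 0) :> (V -> W).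
  by apply/funext => x; exact: derive_cst.
exact: IH.
Qed.

Lemma csmoothD k (V W : normedModType R) (U : set V) (f g : V -> W) :
  open U -> csmooth k U f -> csmooth k U g -> csmooth k U (fun x => f x + g x).
Proof.
move=> oU; elim: k f g => [|k IH] f g [df sf] [dg sg]; split=> //; try (by move=> x Ux;
  apply: differentiableD; [exact: df|exact: dg]).
move=> v; apply: (@csmooth_eq _ _ _ _ (fun x => 'D_v f x + 'D_v g x)) => //; last exact: IH (sf v) (sg v).
by move=> x Ux; rewrite deriveD//; apply: diff_derivable; [exact: df|exact: dg].
Qed.

Lemma csmooth_sum k (V W : normedModType R) (U : set V) (I : Type) (r : seq I)
    (P : pred I) (f : I -> V -> W) :
  open U -> (forall i, P i -> csmooth k U (f i)) ->
  csmooth k U (fun x => \sum_(i <- r | P i) f i x).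
Proof.
move=> oU sf; elim: r => [|i r IH].
  under eq_fun do rewrite big_nil; exact: csmooth_cst.
under eq_fun do rewrite big_cons.
have [Pi|nPi] := boolP (P i); last exact: IH.
by apply: csmoothD => //; exact: sf.
Qed.

Lemma csmooth_bilin k (E U V W : normedModType R) (O : set E) (B : U -> V -> W)
    (f : E -> U) (g : E -> V) :
  open O ->
  (forall v, linear (B ^~ v)) -> (forall u, linear (B u)) ->
  continuous (fun p : U * V => B p.1 p.2) ->
  csmooth k O f -> csmooth k O g -> csmooth k O (fun y => B (f y) (g y)).
Proof.
move=> oO Bl Br Bc.
elim: k f g => [|k IH] f g sf sg; split=> //; try (by move=> x Ox;
    apply: differentiable_bilin2 => //; [exact: csmooth_diff sf Ox|exact: csmooth_diff sg Ox]).
move=> v; have [df sf'] := sf; have [dg sg'] := sg.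
apply: (@csmooth_eq _ _ _ _ (fun y => B ('D_v f y) (g y) + B (f y) ('D_v g y))) => //.
  by move=> x Ox; rewrite derive_bilin2//; [exact: df|exact: dg].
apply: csmoothD => //; first exact: IH (sf' v) (csmoothW sg).
exact: IH (csmoothW sf) (sg' v).
Qed.

Lemma csmooth_lin k (E U W : normedModType R) (O : set E) (l : U -> W)
    (f : E -> U) :
  open O -> linear l -> continuous l -> csmooth k O f ->
  csmooth k O (fun y => l (f y)).
Proof.
move=> oO ll lc.
pose lM := GRing.isLinear.Build R U W _ l ll.
pose L : {linear U -> W} := HB.pack l lM.
have dl u : differentiable l u by exact: (@linear_differentiable R U W L u lc).
have D (f' : E -> U) x : differentiable f' x -> differentiable (fun y => l (f' y)) x.
  by move=> df; apply: (@differentiable_comp R E U W f' l).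
elim: k f => [|k IH] f [df sf]; split=> //; try (by move=> x Ox; apply/D/df).
move=> v; apply: (@csmooth_eq _ _ _ _ (fun y => l ('D_v f y))) => //; last exact: IH (sf v).
move=> x Ox; rewrite [RHS]deriveE; last exact/D/df.
rewrite (@diff_comp R E U W f l) //=; last exact: df.
by rewrite (@diff_lin R U W L (f x) lc) deriveE//; exact: df.
Qed.

Lemma csmoothZ k (V W : normedModType R) (U : set V) (c : V -> R) (f : V -> W) :
  open U -> csmooth k U c -> csmooth k U f -> csmooth k U (fun x => c x *: f x).
Proof.
move=> oU; apply: (@csmooth_bilin k V R W W U *:%R) => //.
- by move=> v a x y; rewrite scalerDl scalerA.
- by move=> u a x y; rewrite scalerDr !scalerA mulrC.
- exact: scale_continuous.
Qed.

Lemma csmoothM k (V : normedModType R) (U : set V) (c f : V -> R) :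
  open U -> csmooth k U c -> csmooth k U f -> csmooth k U (fun x => c x * f x).
Proof. exact: csmoothZ. Qed.

Lemma csmooth_coord k (V : normedModType R) (U : set V) m n (f : V -> 'M[R]_(m, n)) i j :
  open U -> csmooth k U f -> csmooth k U (fun x => f x i j).
Proof.
move=> oU; apply: (@csmooth_lin k V _ _ U (fun M : 'M[R]_(m, n) => M i j)) => //.
  by move=> a x y; rewrite !mxE.
exact: coord_continuous.
Qed.

Lemma csmooth_id k (V : normedModType R) (U : set V) : open U -> csmooth k U (@id V).
Proof.
move=> oU; case: k => [|k]; split=> // v.
apply: (@csmooth_eq _ _ _ _ (fun=> v)) => //; last exact: csmooth_cst.
by move=> x _; rewrite derive_id.
Qed.

Lemma derive_comp_rV (E W : normedModType R) m (f : 'rV[R]_m -> W) (g : E -> 'rV[R]_m)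
    (x v : E) :
  differentiable g x -> differentiable f (g x) ->
  'D_v (fun y => f (g y)) x =
  \sum_a 'D_v g x 0 a *: 'D_(delta_mx 0 a) f (g x).
Proof.
move=> dg df; rewrite -[LHS]/('D_v (f \o g) x) deriveE; last exact: differentiable_comp.
rewrite diff_comp//= -deriveE// -deriveE// {1}(row_sum_delta ('D_v g x)).
exact: derive_sum_dir.
Qed.

(** The chain rule in coordinates writes the derivative as a sum of products of a derivative of [g]
    and a composition with a derivative of [f], each smooth to one order less. Coordinates are the
    reason for a middle space of row vectors. *)
Lemma csmooth_comp k (E W : normedModType R) m (O : set E) (Q : set 'rV[R]_m)
    (f : 'rV[R]_m -> W) (g : E -> 'rV[R]_m) :
  open O -> (forall x, O x -> Q (g x)) ->
  csmooth k Q f -> csmooth k O g -> csmooth k O (fun x => f (g x)).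
Proof.
move=> oO OQ; elim: k f g OQ => [|k IH] f g OQ sf sg; split=> //; try (by move=> x Ox;
    apply: (@differentiable_comp R E _ W g f);
    [exact: csmooth_diff sg Ox|exact: csmooth_diff sf (OQ _ Ox)]).
move=> v; have [df sf'] := sf; have [dg sg'] := sg.
apply: (@csmooth_eq _ _ _ _ (fun x => \sum_a 'D_v g x 0 a *: 'D_(delta_mx 0 a) f (g x))) => //.
  by move=> x Ox; rewrite derive_comp_rV//; [exact: dg|exact/df/OQ].
apply: csmooth_sum => // a _; apply: csmoothZ => //.
  exact: csmooth_coord oO (sg' v).
exact: IH _ _ OQ (sf' _) (csmoothW sg).
Qed.

Lemma is_derive_line (V W : normedModType R) (g : V -> W) (y v : V) (s : R) :
  differentiable g (y + s *: v) ->
  is_derive s 1 (fun t : R => g (y + t *: v)) ('D_v g (y + s *: v)).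
Proof.
move=> dg; have dl : is_diff s (fun t : R => y + t *: v) (fun t => t *: v).
  have := @is_diffD R _ _ (cst y) (fun t : R => t *: v) 0 _ s _ (is_diff_scalel s v).
  by rewrite add0r; apply; exact: is_diff_cst.
have dgl : differentiable (fun t : R => g (y + t *: v)) s.
  by apply: (@differentiable_comp R R V W (fun t => y + t *: v) g) => //; exact: ex_diff.
apply: DeriveDef; first exact: diff_derivable.
have E := @diff_comp R R V W (fun t => y + t *: v) g s (@ex_diff _ _ _ _ _ _ _ dl) dg.
rewrite (deriveE _ dgl) -[X in 'd X _]/(g \o (fun t : R => y + t *: v)) E /=.
by rewrite (@diff_val _ _ _ _ _ _ _ dl) scale1r deriveE.
Qed.

Lemma is_derive_continuous (F : R -> R) (dF x : R) :
  is_derive x 1 F dF -> {for x, continuous F}.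
Proof. by case=> + _; move=> /derivable1_diffP /differentiable_continuous. Qed.

Lemma MVT_closed (F dF : R -> R) (a b : R) : a <= b ->
  (forall x, a <= x <= b -> is_derive x 1 F (dF x)) ->
  exists2 c, a <= c <= b & F b - F a = dF c * (b - a).
Proof.
move=> ab Fd; have [||c] := @MVT_segment R F dF a b ab.
- by move=> z; rewrite in_itv /= => /andP[z0 zh]; apply: Fd; rewrite !ltW.
- apply: continuous_in_subspaceT => z; rewrite inE/= in_itv/= => /Fd.
  exact: is_derive_continuous.
by rewrite in_itv/= => ch E; exists c.
Qed.

(** The mean value theorem is applied along [v] to the increment of [f] in direction [w], and then
    along [w] to ['D_v f]. *)
Lemma second_difference_MVT (V : normedModType R) (U : set V) (f : V -> R) (x v w : V) (h : R) :
  csmooth 2 U f -> 0 < h ->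
  (forall s t : R, 0 <= s <= h -> 0 <= t <= h -> U (x + s *: v + t *: w)) ->
  exists s t : R, [/\ 0 <= s <= h, 0 <= t <= h &
    f (x + h *: v + h *: w) - f (x + h *: v) - (f (x + h *: w) - f x) =
    h * h * 'D_w ('D_v f) (x + s *: v + t *: w)].
Proof.
move=> [df sf] h0 Ust.
have hh : 0 <= h <= h by rewrite lexx ltW.
have h00 : (0 : R) <= 0 <= h by rewrite lexx ltW.
pose F s := f (x + h *: w + s *: v) - f (x + s *: v).
pose dF s := 'D_v f (x + h *: w + s *: v) - 'D_v f (x + s *: v).
have Ft s : 0 <= s <= h -> is_derive s 1 F (dF s).
  move=> sh; apply: is_deriveB; apply: is_derive_line; apply: df.
    by rewrite addrAC; exact: Ust.
  by have := Ust s 0 sh h00; rewrite scale0r addr0.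
have [s sh EF] := MVT_closed (ltW h0) Ft.
pose G t := 'D_v f (x + s *: v + t *: w).
pose dG t := 'D_w ('D_v f) (x + s *: v + t *: w).
have Gt t : 0 <= t <= h -> is_derive t 1 G (dG t).
  by move=> th; apply: is_derive_line; have [+ _] := sf v; apply; exact: Ust.
have [t th EG] := MVT_closed (ltW h0) Gt.
exists s, t; split=> //.
move: EF; rewrite /F /dF !scale0r !addr0 subr0 => EF.
have {}EF : f (x + h *: v + h *: w) - f (x + h *: v) - (f (x + h *: w) - f x) =
  ('D_v f (x + h *: w + s *: v) - 'D_v f (x + s *: v)) * h.
  by rewrite -EF [x + h *: w + _]addrAC.
rewrite EF; move: EG; rewrite /G /dG scale0r addr0 subr0 [x + h *: w + _]addrAC => ->.
by ring.
Qed.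

Lemma near_box (V : normedModType R) (x v w : V) (N : set V) : nbhs x N ->
  exists2 h : R, 0 < h &
    forall s t, 0 <= s <= h -> 0 <= t <= h -> N (x + s *: v + t *: w).
Proof.
move=> Nx.
have cp : {for (0, 0) : R * R, continuous (fun p : R * R => x + p.1 *: v + p.2 *: w)}.
  apply: cvgD; [apply: cvgD; first exact: cvg_cst|]; apply: cvgZr_tmp;
  by [exact: cvg_fst|exact: cvg_snd].
have : nbhs (0, 0) ((fun p : R * R => x + p.1 *: v + p.2 *: w) @^-1` N).
  by apply: cp; rewrite /= !scale0r !addr0.
move=> /nbhs_ballP[d /= d0 dP].
exists (d / 2); first by rewrite divr_gt0.
move=> s t /andP[s0 sh] /andP[t0 th]; apply: (dP (s, t)).
have hd : d / 2 < d by rewrite ltr_pdivrMr// ltr_pMr// ltr1n.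
by split => /=; rewrite /ball/= sub0r normrN ger0_norm//; apply: le_lt_trans hd.
Qed.

(** The limit step of Clairaut's theorem: by continuity, agreement at two unrelated points of
    arbitrarily small boxes at [x] becomes agreement at [x]. *)
Lemma continuous_box_eq (V : normedModType R) (A B : V -> R) (x v w : V) (N : set V) :
  {for x, continuous A} -> {for x, continuous B} -> nbhs x N ->
  (forall h : R, 0 < h ->
    (forall s t, 0 <= s <= h -> 0 <= t <= h -> N (x + s *: v + t *: w)) ->
    exists s t s' t', [/\ 0 <= s <= h, 0 <= t <= h, 0 <= s' <= h, 0 <= t' <= h &
      A (x + s *: v + t *: w) = B (x + s' *: v + t' *: w)]) ->
  A x = B x.
Proof.
move=> cA cB Nx AB; apply/eqP; rewrite -subr_eq0 -normr_le0; apply/ler_addgt0Pl => e e0.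
rewrite addr0; have e20 : 0 < e / 2 by rewrite divr_gt0.
move/cvgrPdist_lt : cA => /(_ _ e20) N1; move/cvgrPdist_lt : cB => /(_ _ e20) N2.
have [h h0 P] := near_box v w (filterI Nx (filterI N1 N2)).
have [|s [t [s' [t' [sh th s'h t'h E]]]]] := AB h h0.
  by move=> s t sh th; have [] := P s t sh th.
have [_ [HA _]] := P s t sh th; have [_ [_]] := P s' t' s'h t'h.
rewrite /= -E => HB.
rewrite (_ : A x - B x = (A x - A (x + s *: v + t *: w))
  - (B x - A (x + s *: v + t *: w))); last by ring.
by rewrite (le_trans (ler_normB _ _))// (splitr e) ltW// ltrD.
Qed.

(** The second difference is symmetric in [v] and [w]; divided by [h * h], it is a value of either
    mixed derivative at some point of the box. *)
Lemma derive_swap_R (V : normedModType R) (U : set V) (f : V -> R) (x v w : V) :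
  open U -> csmooth 2 U f -> U x -> 'D_v ('D_w f) x = 'D_w ('D_v f) x.
Proof.
move=> oU sf Ux.
have ct u z : {for x, continuous ('D_u ('D_z f) : V -> R)}.
  by apply: differentiable_continuous; have [_ /(_ z)[_ /(_ u)[+ _]]] := sf; exact.
have NU : nbhs x U by exact: open_nbhs_nbhs.
apply: (@continuous_box_eq V ('D_v ('D_w f)) ('D_w ('D_v f)) x v w U (ct v w) (ct w v) NU) => h h0 Uh.
have [s [t [sh th E1]]] := @second_difference_MVT V U f x v w h sf h0 Uh.
have Uh' s' t' : 0 <= s' <= h -> 0 <= t' <= h -> U (x + s' *: w + t' *: v).
  by move=> ? ?; rewrite addrAC; exact: Uh.
have [t' [s' [th' sh' E2]]] := @second_difference_MVT V U f x w v h sf h0 Uh'.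
exists s', t', s, t; apply: And5 sh' th' sh th _.
have hh : h * h != 0 by rewrite mulf_neq0// gt_eqF.
have key (k a b c d : R) : k != 0 -> c = k * a -> d = k * b -> c = d -> a = b.
  by move=> k0 -> -> /(mulfI k0).
have -> : x + s' *: v + t' *: w = x + t' *: w + s' *: v by rewrite addrAC.
refine (key _ _ _ _ _ hh E2 E1 _).
by rewrite [x + h *: w + _]addrAC; clear; move: (f _) (f _) (f _) (f _) => *; ring.
Qed.

Lemma derive_coord (V : normedModType R) m n (f : V -> 'M[R]_(m, n)) x v i j :
  differentiable f x -> 'D_v f x i j = 'D_v (fun y => f y i j) x.
Proof. by move=> df; rewrite derive_mx ?mxE//; exact: diff_derivable. Qed.

Lemma derive_swap (V : normedModType R) (U : set V) m n (f : V -> 'M[R]_(m, n)) (x v w : V) :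
  open U -> csmooth 2 U f -> U x -> 'D_v ('D_w f) x = 'D_w ('D_v f) x.
Proof.
move=> oU sf Ux; apply/matrixP => i j.
have D u z : 'D_u ('D_z f) x i j = 'D_u ('D_z (fun y => f y i j)) x.
  rewrite derive_coord; last by have [_ /(_ z)[+ _]] := sf; exact.
  apply: near_eq_derive; near=> y; apply: derive_coord.
  by have [+ _] := sf; apply; near: y; exact: open_nbhs_nbhs.
refine (etrans (D v w) (etrans _ (esym (D w v)))).
exact: (derive_swap_R v w oU (csmooth_coord i j oU sf) Ux).
Unshelve. all: by end_near. Qed.

End calculus.

Lemma differentiable_id (R : realType) (V : normedModType R) (x : V) : differentiable (@id V) x.
Proof. exact: (@ex_diff _ _ _ _ _ _ _ (is_diff_id x)). Qed.

Section pair_calculus.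
Context {R : realType} (U V W E : normedModType R).

Lemma derive_comp_pair (m : U * V -> W) (g : E -> U) (h : E -> V) (x v : E) :
  differentiable g x -> differentiable h x -> differentiable m (g x, h x) ->
  'D_v (fun y => m (g y, h y)) x = 'D_('D_v g x, 'D_v h x) m (g x, h x).
Proof.
move=> dg dh dm; have dp := differentiable_pair dg dh.
have E1 := @diff_comp R E (U * V)%type W (fun y => (g y, h y)) m x dp dm.
have dc := @differentiable_comp R E (U * V)%type W (fun y => (g y, h y)) m x dp dm.
rewrite (deriveE _ dm) (deriveE _ dg) (deriveE _ dh).
by rewrite -[LHS]/('D_v (m \o (fun y => (g y, h y))) x) (deriveE _ dc) E1 /= diff_pair.
Qed.

Lemma differentiable_comp_pair (m : U * V -> W) (g : E -> U) (h : E -> V) (x : E) :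
  differentiable g x -> differentiable h x -> differentiable m (g x, h x) ->
  differentiable (fun y => m (g y, h y)) x.
Proof.
move=> dg dh dm.
exact: (@differentiable_comp R E (U * V)%type W (fun y => (g y, h y)) m x (differentiable_pair dg dh) dm).
Qed.

End pair_calculus.

(** * The bracket of a Lie group in a chart *)

Section local_group.
Context {R : realType} (n : nat).
Local Notation V := 'rV[R]_n.
Variables (m : V * V -> V) (e0 : V) (O : set (V * V)).
Hypotheses (oO : open O) (O0 : O (e0, e0)) (sm : forall k, csmooth k O m)
  (mA : forall u v w, O (u, v) -> O (v, w) -> m (m (u, v), w) = m (u, m (v, w)))
  (mx1 : forall u, O (u, e0) -> m (u, e0) = u)
  (m1x : forall v, O (e0, v) -> m (e0, v) = v).

(* [L], [B], [S] and [T] are kept abstract: unfolding derivatives during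
   unification is prohibitively slow. *)
Variables (L B : V -> V -> V) (S T : V -> V -> V -> V).
Hypotheses (L_def : forall Y u, L Y u = 'D_Y (fun v => m (u, v)) e0)
  (B_def : forall X Y, B X Y = 'D_X (L Y) e0)
  (S_def : forall u Y Z, S u Y Z = 'D_(0, Y) ('D_(0, Z) m) (u, e0))
  (T_def : forall Z X Y, T Z X Y = 'D_X ('D_Y (L Z)) e0).

Lemma near_left u v : O (u, v) -> \forall x \near u, O (x, v).
Proof.
move=> Ouv; have N : nbhs (u, v) O by exact: open_nbhs_nbhs.
have C : {for u, continuous (fun x : V => (x, v))}.
  apply: differentiable_continuous; apply: differentiable_pair; last exact: differentiable_cst.
  exact: differentiable_id.
exact: C.
Qed.

Lemma near_right u v : O (u, v) -> \forall x \near v, O (u, x).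
Proof.
move=> Ouv; have N : nbhs (u, v) O by exact: open_nbhs_nbhs.
have C : {for v, continuous (fun x : V => (u, x))}.
  apply: differentiable_continuous; apply: differentiable_pair; first exact: differentiable_cst.
  exact: differentiable_id.
exact: C.
Qed.

Let dm u v : O (u, v) -> differentiable m (u, v).
Proof. by move=> H; exact: csmooth_diff (sm 0) H. Qed.

Lemma dir_left k (F : V * V -> V) (w v : V) : csmooth k.+1 O F -> csmooth k O ('D_(w, v) F).
Proof. by move=> [_]; apply. Qed.

Let N := [set u | O (u, e0)].

Lemma open_slice : open N.
Proof. by rewrite openE => u Nu; exact: near_left. Qed.

Lemma csmooth_slice k (F : V * V -> V) : csmooth k O F -> csmooth k N (fun u => F (u, e0)).
Proof.
elim: k F => [|k IH] F [dF sF]; split=> //; try (by move=> u Nu;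
  apply: (@differentiable_comp_pair R V V V V F id (fun=> e0));
   [exact: differentiable_id|exact: differentiable_cst|exact: dF]).
move=> v; apply: (@csmooth_eq R k V V N (fun u => 'D_(v, 0) F (u, e0))).
- exact: open_slice.
- move=> u Nu; rewrite (@derive_comp_pair R V V V V F id (fun=> e0)).
  + by rewrite derive_id derive_cst.
  + exact: differentiable_id.
  + exact: differentiable_cst.
  + exact: dF.
- exact: IH (sF _).
Qed.

Let LE Y u : N u -> L Y u = 'D_(0, Y) m (u, e0).
Proof.
move=> Nu; rewrite L_def (@derive_comp_pair R V V V V m (fun=> u) id).
- by rewrite derive_id derive_cst.
- exact: differentiable_cst.
- exact: differentiable_id.
- exact: dm.
Qed.

Let sL k Y : csmooth k N (L Y).
Proof.
apply: (@csmooth_eq R k V V N (fun u => 'D_(0, Y) m (u, e0))).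
- exact: open_slice.
- by move=> u Nu; rewrite LE.
- exact: csmooth_slice (dir_left 0 Y (sm k.+1)).
Qed.

Let dL Y u : N u -> differentiable (L Y) u.
Proof. by move=> Nu; exact: csmooth_diff (sL 0 Y) Nu. Qed.

Let L1 Y : L Y e0 = Y.
Proof.
rewrite L_def (@near_eq_derive _ _ _ (fun v => m (e0, v)) id) ?derive_id//.
by apply: filterS (near_right O0) => v; exact: m1x.
Qed.

Let L_linear c Y Z u : N u -> L (c *: Y + Z) u = c *: L Y u + L Z u.
Proof.
move=> Nu; rewrite !LE//.
have -> : ((0, c *: Y + Z) : V * V) = c *: ((0, Y) : V * V) + (0, Z).
  by congr pair; rewrite /= scaler0 addr0.
exact/derive_linear_dir/dm.
Qed.

Let Bl c X Y Z : B (c *: X + Y) Z = c *: B X Z + B Y Z.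
Proof. by rewrite !B_def; exact/derive_linear_dir/dL. Qed.

Let near_N : \forall u \near e0, N u.
Proof. by apply: open_nbhs_nbhs; split; [exact: open_slice|]. Qed.

Let Br c X Y Z : B Z (c *: X + Y) = c *: B Z X + B Z Y.
Proof.
have E : \forall u \near e0, L (c *: X + Y) u = c *: L X u + L Y u.
  by apply: filterS near_N => u; exact: L_linear.
have N0 : N e0 by [].
rewrite !B_def; exact: (etrans (near_eq_derive Z E) (derive_lincomb Z c (dL X N0) (dL Y N0))).
Qed.

Let expand (D : V -> V) (W : V) : (forall c X Y, D (c *: X + Y) = c *: D X + D Y) ->
  D W = \sum_a W 0 a *: D (delta_mx 0 a).
Proof.
move=> Dl; pose DM := GRing.isLinear.Build R V V _ D Dl.
pose DL : {linear V -> V} := HB.pack D DM.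
rewrite -[LHS]/(DL W) {1}(row_sum_delta W) linear_sum; apply: eq_bigr => a _.
by rewrite linearZ.
Qed.

Let dm_expand u v W : O (u, v) ->
  'D_(0, W) m (u, v) = \sum_a W 0 a *: 'D_(0, delta_mx 0 a) m (u, v).
Proof.
move=> Ouv; apply: (@expand (fun W => 'D_(0, W) m (u, v))) => c X Y.
have -> : ((0, c *: X + Y) : V * V) = c *: ((0, X) : V * V) + (0, Y).
  by congr pair; rewrite /= scaler0 addr0.
exact/derive_linear_dir/dm.
Qed.

Let near_mul u : N u -> \forall v \near e0, [/\ O (u, v), N v & N (m (u, v))].
Proof.
move=> Nu.
have C : {for e0, continuous (fun v => m (u, v))}.
  apply: differentiable_continuous; apply: differentiable_comp_pair.
  - exact: differentiable_cst.
  - exact: differentiable_id.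
  - exact: dm.
have M : \forall v \near e0, N (m (u, v)).
  by apply: C; rewrite /= mx1//; apply: open_nbhs_nbhs; split => //; exact: open_slice.
by apply: filterS3 (near_right Nu) near_N M.
Qed.

(** Associativity, differentiated in the last factor at the unit. *)
Lemma left_invariant Z u v : O (u, v) -> N v -> N (m (u, v)) ->
  L Z (m (u, v)) = 'D_(0, L Z v) m (u, v).
Proof.
move=> Ouv Nv Nm.
have E : \forall w \near e0, m (m (u, v), w) = m (u, m (v, w)).
  by apply: filterS (near_right Nv) => w Ovw; exact: mA.
have E1 : L Z (m (u, v)) = 'D_Z (fun w => m (u, m (v, w))) e0.
  by rewrite L_def; exact: near_eq_derive Z E.
have dv : differentiable (fun w => m (v, w)) e0.
  by apply: differentiable_comp_pair; [exact: differentiable_cst|exact: differentiable_id|exact: dm].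
have Om : O (u, m (v, e0)) by rewrite mx1.
have E2 := @derive_comp_pair R V V V V m (fun=> u) (fun w => m (v, w)) e0 Z
   (differentiable_cst _ _) dv (dm Om).
rewrite (derive_cst u e0 Z) -(L_def Z v) (mx1 Nv) in E2.
exact: etrans E1 E2.
Qed.

(** Left-invariance, differentiated in [v] at the unit along [Y]. The derivative of [L Z]
    contributes [L (B Y Z) u]; the derivative of the differential of [m] contributes the second
    derivative [S u Y Z]. *)
Lemma field_derive Y Z u : N u -> 'D_(L Y u) (L Z) u = L (B Y Z) u + S u Y Z.
Proof.
move=> Nu.
have E : \forall v \near e0, L Z (m (u, v)) = \sum_a L Z v 0 a *: 'D_(0, delta_mx 0 a) m (u, v).
  apply: filterS (near_mul Nu) => v [Ouv Nv Nm].
  by rewrite left_invariant// dm_expand.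
have dLm : differentiable (L Z) (m (u, e0)) by rewrite mx1//; exact: dL.
have dmu : differentiable (fun v => m (u, v)) e0.
  by apply: differentiable_comp_pair; [exact: differentiable_cst|exact: differentiable_id|exact: dm].
have E1 : 'D_Y (fun v => L Z (m (u, v))) e0 = 'D_(L Y u) (L Z) u.
  by have := derive_comp Y dmu dLm; rewrite (mx1 Nu) -(L_def Y u).
have dc a : differentiable (fun v => L Z v 0 a) e0.
  exact: (@differentiable_comp R V V R (L Z) (fun M : V => M 0 a) e0 (dL Z O0) (differentiable_coord _ _ _)).
have sF a : csmooth 0 O ('D_(0, delta_mx 0 a) m) by exact: dir_left (sm 1).
have dF a : differentiable (fun v => 'D_(0, delta_mx 0 a) m (u, v)) e0.
  apply: (@differentiable_comp_pair R V V V V ('D_(0, delta_mx 0 a) m) (fun=> u) id).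
  - exact: differentiable_cst.
  - exact: differentiable_id.
  - exact: csmooth_diff (sF a) Nu.
have E4 a : 'D_Y (fun v => L Z v 0 a) e0 = B Y Z 0 a.
  by rewrite B_def (derive_coord _ _ _ (dL Z O0)).
have E3 a : 'D_Y (fun v => 'D_(0, delta_mx 0 a) m (u, v)) e0 = 'D_(0, Y) ('D_(0, delta_mx 0 a) m) (u, e0).
  have := @derive_comp_pair R V V V V ('D_(0, delta_mx 0 a) m) (fun=> u) id e0 Y
    (differentiable_cst _ _) (differentiable_id _) (csmooth_diff (sF a) Nu).
  by rewrite (derive_cst u e0 Y) (derive_id e0 Y).
have H : forall c X X', 'D_(0, Y) ('D_(0, c *: X + X') m) (u, e0) =
   c *: 'D_(0, Y) ('D_(0, X) m) (u, e0) + 'D_(0, Y) ('D_(0, X') m) (u, e0).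
  move=> c X X'.
  have EE : \forall p \near (u, e0), 'D_(0, c *: X + X') m p = c *: 'D_(0, X) m p + 'D_(0, X') m p.
    have NO : nbhs (u, e0) O by exact: open_nbhs_nbhs.
    apply: filterS NO => p Op.
    have -> : ((0, c *: X + X') : V * V) = c *: ((0, X) : V * V) + (0, X').
      by congr pair; rewrite /= scaler0 addr0.
    by apply: derive_linear_dir; case: p Op => p q; exact: dm.
  refine (etrans (near_eq_derive _ EE) (derive_lincomb _ c _ _)).
    exact: csmooth_diff (dir_left 0 X (sm 1)) Nu.
  exact: csmooth_diff (dir_left 0 X' (sm 1)) Nu.
rewrite -E1 (etrans (near_eq_derive Y E) (derive_sum_scale Y dc dF)) big_split/=.
apply: f_equal2.
  rewrite (LE _ Nu) (dm_expand _ Nu); apply: eq_bigr => a _; by rewrite E4.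
rewrite S_def (expand Z H); apply: eq_bigr => a _; by rewrite L1 E3.
Qed.

Let S_sym u Y Z : N u -> S u Y Z = S u Z Y.
Proof. by rewrite !S_def; exact: derive_swap oO (sm 2). Qed.

Let br X Y := B X Y - B Y X.

(** [S u Y Z] is symmetric in [Y] and [Z] by Clairaut's theorem and drops out of the commutator. *)
Lemma field_bracket Y Z u : N u ->
  'D_(L Y u) (L Z) u - 'D_(L Z u) (L Y) u = L (br Y Z) u.
Proof.
move=> Nu; rewrite !field_derive// (S_sym Z Y Nu) opprD addrACA subrr addr0.
have -> : br Y Z = (-1) *: B Z Y + B Y Z by rewrite /br scaleN1r addrC.
by rewrite (L_linear _ _ _ Nu) scaleN1r addrC.
Qed.

Let derive_field X Y Z : 'D_X (fun u => 'D_(L Y u) (L Z) u) e0 = B (B X Y) Z + T Z X Y.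
Proof.
have E : \forall u \near e0, 'D_(L Y u) (L Z) u = \sum_a L Y u 0 a *: 'D_(delta_mx 0 a) (L Z) u.
  apply: filterS near_N => u Nu; apply: (expand (D := fun W => 'D_W (L Z) u)) => c P Q.
  exact/derive_linear_dir/dL.
have dc a : differentiable (fun v => L Y v 0 a) e0.
  exact: (@differentiable_comp R V V R (L Y) (fun M : V => M 0 a) e0 (dL Y O0) (differentiable_coord _ _ _)).
have dF a : differentiable ('D_(delta_mx 0 a) (L Z)) e0.
  by have [_ /(_ (delta_mx 0 a))[+ _]] := sL 1 Z; apply.
rewrite (etrans (near_eq_derive X E) (derive_sum_scale X dc dF)) big_split/=; congr (_ + _).
  rewrite (expand (D := fun W => B W Z)); last by move=> c P Q; exact: Bl.
  have E4 a : 'D_X (fun v => L Y v 0 a) e0 = B X Y 0 a.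
    by rewrite B_def (derive_coord _ _ _ (dL Y O0)).
  by apply: eq_bigr => a _; rewrite E4 (B_def (delta_mx 0 a) Z).
rewrite T_def (expand (D := fun W => 'D_X ('D_W (L Z)) e0)).
  by apply: eq_bigr => a _; rewrite L1.
move=> c P Q.
have EE : \forall u \near e0, 'D_(c *: P + Q) (L Z) u = c *: 'D_P (L Z) u + 'D_Q (L Z) u.
  by apply: filterS near_N => u Nu; apply: derive_linear_dir; exact: dL.
have dD W : differentiable ('D_W (L Z)) e0 by have [_ /(_ W)[+ _]] := sL 1 Z; apply.
exact: (etrans (near_eq_derive _ EE) (derive_lincomb _ c (dD P) (dD Q))).
Qed.

Let T_sym Z X Y : T Z X Y = T Z Y X.
Proof. by rewrite !T_def; exact: derive_swap open_slice (sL 2 Z) O0. Qed.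

(** Differentiating [field_bracket] at the unit expresses [B X (br Y Z)] by iterated [B] and second
    derivatives [T]. In the cyclic sum the [T] cancel by their symmetry and the iterated [B] cancel
    in pairs. *)
Lemma local_group_jacobi X Y Z : br X (br Y Z) + br Y (br Z X) + br Z (br X Y) = 0.
Proof.
have dD Y' Z' : differentiable (fun u => 'D_(L Y' u) (L Z') u) e0.
  have E : \forall u \near e0, \sum_a L Y' u 0 a *: 'D_(delta_mx 0 a) (L Z') u = 'D_(L Y' u) (L Z') u.
    apply: filterS near_N => u Nu; apply/esym; apply: (expand (D := fun W => 'D_W (L Z') u)) => c P Q.
    exact/derive_linear_dir/dL.
  apply: near_eq_differentiable E _.
  have sS : csmooth 0 N (fun u => \sum_a L Y' u 0 a *: 'D_(delta_mx 0 a) (L Z') u).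
    apply: csmooth_sum; first exact: open_slice.
    move=> a _; apply: csmoothZ; first exact: open_slice.
      exact: csmooth_coord open_slice (sL 0 Y').
    by have [_ /(_ (delta_mx 0 a))] := sL 1 Z'.
  exact: csmooth_diff sS O0.
have K X' Y' Z' : B X' (br Y' Z') =
    B (B X' Y') Z' + T Z' X' Y' - (B (B X' Z') Y' + T Y' X' Z').
  rewrite -!derive_field B_def.
  have E : \forall u \near e0, L (br Y' Z') u = (-1) *: 'D_(L Z' u) (L Y') u + 'D_(L Y' u) (L Z') u.
    by apply: filterS near_N => u Nu; rewrite -field_bracket// scaleN1r addrC.
  have := derive_lincomb X' (-1) (dD Z' Y') (dD Y' Z').
  move/(etrans (near_eq_derive X' E)) => /= ->.
  by rewrite scaleN1r addrC.
have M P Q W : B (br P Q) W = B (B P Q) W - B (B Q P) W.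
  have -> : br P Q = (-1) *: B Q P + B P Q by rewrite /br scaleN1r addrC.
  by rewrite Bl scaleN1r addrC.
rewrite {1 3 5}/br !K !M (T_sym Z X Y) (T_sym Y X Z) (T_sym X Y Z).
apply/matrixP => i j; rewrite !mxE; ring.
Qed.

Lemma local_bracket_linear c X Y Z : br (c *: X + Y) Z = c *: br X Z + br Y Z.
Proof.
by rewrite /br Bl Br; apply/matrixP => i j; rewrite !mxE; ring.
Qed.

(** [Ad1] obtains [Ad u X] from [L X u] by right translation with the inverse, and serves for
    differentiability. [Ad2] is the same relation solved for [L X u]; it is free of the inverse and
    serves to compute the derivative. *)
Variables (Ad : V -> V -> V) (iv : V -> V).
Hypotheses (iv0 : iv e0 = e0) (div : differentiable iv e0)
  (Ad1 : \forall u \near e0, O (u, iv u) /\ forall X, Ad u X = 'D_(L X u, 0) m (u, iv u))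
  (Ad2 : \forall u \near e0, O (e0, u) /\ forall X, L X u = 'D_(Ad u X, 0) m (e0, u)).

Let dm_expandl u v W : O (u, v) ->
  'D_(W, 0) m (u, v) = \sum_a W 0 a *: 'D_(delta_mx 0 a, 0) m (u, v).
Proof.
move=> Ouv; apply: (@expand (fun W => 'D_(W, 0) m (u, v))) => c X Y.
have -> : ((c *: X + Y, 0) : V * V) = c *: ((X, 0) : V * V) + (Y, 0).
  by congr pair; rewrite /= scaler0 addr0.
exact/derive_linear_dir/dm.
Qed.

Let dm1 W : 'D_(W, 0) m (e0, e0) = W.
Proof.
have := @derive_comp_pair R V V V V m id (fun=> e0) e0 W
    (differentiable_id _) (differentiable_cst _ _) (dm O0).
rewrite (derive_cst e0 e0 W) (derive_id e0 W) => <-.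
have E : \forall u \near e0, m (u, e0) = id u by apply: filterS near_N => u; exact: mx1.
by rewrite (near_eq_derive W E) derive_id.
Qed.

Lemma local_Ad_unit X : Ad e0 X = X.
Proof. by have [_ /(_ X)] := nbhs_singleton Ad2; rewrite L1 dm1. Qed.

Lemma differentiable_Ad X : differentiable (fun u => Ad u X) e0.
Proof.
have E : \forall u \near e0, \sum_a L X u 0 a *: 'D_(delta_mx 0 a, 0) m (u, iv u) = Ad u X.
  by apply: filterS Ad1 => u [Ou ->]; rewrite -dm_expandl.
apply: near_eq_differentiable E _.
have dc a : differentiable (fun v => L X v 0 a) e0.
  exact: (@differentiable_comp R V V R (L X) (fun M : V => M 0 a) e0 (dL X O0) (differentiable_coord _ _ _)).
have dF a : differentiable (fun u => 'D_(delta_mx 0 a, 0) m (u, iv u)) e0.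
  apply: (@differentiable_comp_pair R V V V V ('D_(delta_mx 0 a, 0) m) id iv).
  - exact: differentiable_id.
  - exact: div.
  - rewrite iv0; exact: csmooth_diff (dir_left (delta_mx 0 a) 0 (sm 1)) O0.
exact: differentiable_sum_scale.
Qed.

(** [Ad2] is differentiated along [Z] at the unit. Its left side gives [B Z X]; its right side gives
    the wanted derivative plus a mixed second derivative of [m], which is [B X Z] after exchanging
    the order. *)
Lemma derive_Ad Z X : 'D_Z (fun u => Ad u X) e0 = br Z X.
Proof.
have E : \forall u \near e0, L X u = \sum_a Ad u X 0 a *: 'D_(delta_mx 0 a, 0) m (e0, u).
  by apply: filterS Ad2 => u [Ou ->]; rewrite -dm_expandl.
have dA := differentiable_Ad X.
have dc a : differentiable (fun u => Ad u X 0 a) e0.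
  exact: (@differentiable_comp R V V R (fun u => Ad u X) (fun M : V => M 0 a) e0 dA (differentiable_coord _ _ _)).
have sF W : csmooth 0 O ('D_(W, 0) m) by exact: dir_left (sm 1).
have sG W : csmooth 0 O ('D_(0, W) m) by exact: dir_left (sm 1).
have dF a : differentiable (fun u => 'D_(delta_mx 0 a, 0) m (e0, u)) e0.
  apply: (@differentiable_comp_pair R V V V V ('D_(delta_mx 0 a, 0) m) (fun=> e0) id).
  - exact: differentiable_cst.
  - exact: differentiable_id.
  - exact: csmooth_diff (sF _) O0.
have E4 a : 'D_Z (fun v => Ad v X 0 a) e0 = ('D_Z (fun u => Ad u X) e0) 0 a.
  by rewrite (derive_coord _ _ _ dA).
have E3 a : 'D_Z (fun v => 'D_(delta_mx 0 a, 0) m (e0, v)) e0 = 'D_(delta_mx 0 a, 0) ('D_(0, Z) m) (e0, e0).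
  have := @derive_comp_pair R V V V V ('D_(delta_mx 0 a, 0) m) (fun=> e0) id e0 Z
    (differentiable_cst _ _) (differentiable_id _) (csmooth_diff (sF _) O0).
  rewrite (derive_cst e0 e0 Z) (derive_id e0 Z) => H.
  exact: (etrans H (derive_swap _ _ oO (sm 2) O0)).
have BXZ : B X Z = \sum_a X 0 a *: 'D_(delta_mx 0 a, 0) ('D_(0, Z) m) (e0, e0).
  have H W : 'D_(W, 0) ('D_(0, Z) m) (e0, e0) = B W Z.
    have := @derive_comp_pair R V V V V ('D_(0, Z) m) id (fun=> e0) e0 W
      (differentiable_id _) (differentiable_cst _ _) (csmooth_diff (sG Z) O0).
    rewrite (derive_cst e0 e0 W) (derive_id e0 W) B_def => <-.
    have EL : \forall u \near e0, 'D_(0, Z) m (u, e0) = L Z u.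
      by apply: filterS near_N => u Nu; rewrite LE.
    exact: near_eq_derive W EL.
  rewrite (expand (D := fun W => B W Z)); last by move=> c P Q; exact: Bl.
  by apply: eq_bigr => a _; rewrite H.
have := near_eq_derive Z E; rewrite -(B_def Z X) (derive_sum_scale Z dc dF) big_split/=.
have -> : \sum_(i < n) 'D_Z (fun v => Ad v X 0 i) e0 *: 'D_(delta_mx 0 i, 0) m (e0, e0)
   = 'D_Z (fun u => Ad u X) e0.
  rewrite -[RHS]dm1 (dm_expandl _ O0); apply: eq_bigr => a _; by rewrite E4.
have -> : \sum_(i < n) Ad e0 X 0 i *: 'D_Z (fun v => 'D_(delta_mx 0 i, 0) m (e0, v)) e0 = B X Z.
  rewrite BXZ; apply: eq_bigr => a _; by rewrite E3 local_Ad_unit.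
by rewrite /br => ->; rewrite addrK.
Qed.

End local_group.

Lemma csmooth_sub (R : realType) k (V W : normedModType R) (U U' : set V) (f : V -> W) :
  (forall x, U' x -> U x) -> csmooth k U f -> csmooth k U' f.
Proof.
move=> UU; elim: k f => [|k IH] f [df sf]; split=> //; try (by move=> x /UU; exact: df).
by move=> v; exact: IH (sf v).
Qed.

Lemma csmooth_fst (R : realType) k (V W : normedModType R) :
  csmooth k [set: V * W] fst.
Proof.
apply: (@csmooth_lin R k _ _ _ _ fst id) => //; [exact: openT|by move=> x; exact: cvg_fst|].
exact: csmooth_id openT.
Qed.

Lemma csmooth_snd (R : realType) k (V W : normedModType R) :
  csmooth k [set: V * W] snd.
Proof.
apply: (@csmooth_lin R k _ _ _ _ snd id) => //; [exact: openT|by move=> x; exact: cvg_snd|].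
exact: csmooth_id openT.
Qed.

Lemma continuous_bilinear (R : realType) (n : nat) (W : normedModType R)
    (B : 'rV[R]_n -> 'rV[R]_n -> W) :
  (forall v, linear (B ^~ v)) -> (forall u, linear (B u)) ->
  continuous (fun p : 'rV[R]_n * 'rV[R]_n => B p.1 p.2).
Proof.
move=> Bl Br.
have E : (fun p : 'rV[R]_n * 'rV[R]_n => B p.1 p.2) =
  (fun p => \sum_i p.1 0 i *: \sum_j p.2 0 j *: B (delta_mx 0 i) (delta_mx 0 j)).
  apply/funext => -[u v] /=.
  pose BlM := GRing.isLinear.Build R _ W _ (B ^~ v) (Bl v).
  pose BlL : {linear 'rV[R]_n -> W} := HB.pack (B ^~ v) BlM.
  rewrite -[LHS]/(BlL u) {1}(row_sum_delta u) linear_sum; apply: eq_bigr => i _.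
  rewrite linearZ; congr (_ *: _); rewrite /=.
  pose BrM := GRing.isLinear.Build R _ W _ (B (delta_mx 0 i)) (Br (delta_mx 0 i)).
  pose BrL : {linear 'rV[R]_n -> W} := HB.pack (B (delta_mx 0 i)) BrM.
  rewrite -[LHS]/(BrL v) {1}(row_sum_delta v) linear_sum; apply: eq_bigr => j _.
  by rewrite linearZ.
rewrite E => p; apply: differentiable_continuous.
have oT : open [set: 'rV[R]_n * 'rV[R]_n] by exact: openT.
have H : csmooth 0 setT (fun p : 'rV[R]_n * 'rV[R]_n => \sum_i p.1 0 i *: \sum_j p.2 0 j *: B (delta_mx 0 i) (delta_mx 0 j)).
  apply: csmooth_sum => // i _; apply: csmoothZ => //.
    exact: csmooth_coord oT (csmooth_fst 0 _ _).
  apply: csmooth_sum => // j _.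
  exact: csmoothZ oT (csmooth_coord 0 j oT (csmooth_snd 0 _ _)) (csmooth_cst 0 _ _).
exact: csmooth_diff H _.
Qed.

(** * The Lie algebra of the group: Jacobi identity and invariant inner product *)

Section lie_group.
Context {R : realType} (n : nat) (G : topologicalGroupType)
  (atlas : set (chart R n G)) (G_lie : is_lie_group atlas)
  (e : chart R n G) (atlas_e : atlas e) (dom_e : dom e 1%g).
Local Notation V := 'rV[R]_n.

Let c := Defs.coord e.
Let q := param e.
Let e0 : V := c 1%g.
Let m (p : V * V) : V := c (q p.1 * q p.2)%g.
Let Oset : set (V * V) := [set p | [/\ img e p.1, img e p.2 & dom e (q p.1 * q p.2)%g]].
(** The interior is open by definition, and [Oset_open] shows that nothing is lost. *)
Let O : set (V * V) := interior Oset.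

Let qK u : img e u -> c (q u) = u.
Proof. by move=> [g dg <-]; rewrite /q /c coordK ?inE. Qed.

Let cK g : dom e g -> q (c g) = g.
Proof. by move=> dg; rewrite /q /c coordK ?inE. Qed.

Let qdom u : img e u -> dom e (q u).
Proof. by move=> [g dg <-]; rewrite cK. Qed.

Let img_c g : dom e g -> img e (c g).
Proof. by move=> dg; exists g. Qed.

Let q0 : q e0 = 1%g. Proof. exact: cK. Qed.

Let cq u : img e u -> {for u, continuous q}.
Proof.
move=> iu; have := @param_continuous _ _ _ e.
by rewrite continuous_open_subspace; [apply; rewrite inE|exact: img_open].
Qed.

Let near_img u : img e u -> \forall x \near u, img e x.
Proof. by move=> iu; apply: open_nbhs_nbhs; split=> //; exact: img_open. Qed.

Let near_dom g : dom e g -> \forall x \near g, dom e x.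
Proof. by move=> iu; apply: open_nbhs_nbhs; split=> //; exact: dom_open. Qed.

Let cmul (T : topologicalType) (f h : T -> G) (x : T) :
  {for x, continuous f} -> {for x, continuous h} -> {for x, continuous (fun y => (f y * h y)%g)}.
Proof.
move=> cf ch.
apply: (@continuous_comp _ _ _ (fun y => (f y, h y)) (fun p : G * G => (p.1 * p.2)%g)).
  exact: cvg_pair.
exact: (lie_mul_continuous G_lie).
Qed.

Let cinv (T : topologicalType) (f : T -> G) (x : T) :
  {for x, continuous f} -> {for x, continuous (fun y => ((f y)^-1)%g)}.
Proof.
move=> cf; apply: (@continuous_comp _ _ _ f (fun g : G => (g^-1)%g)) => //.
exact: (lie_inv_continuous G_lie).
Qed.

Let Oset_open p : Oset p -> O p.
Proof.
move=> [i1 i2 d]; rewrite /O /interior.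
have C1 : {for p, continuous (fun p : V * V => q p.1)}.
  by apply: (@continuous_comp _ _ _ fst q); [exact: cvg_fst|exact: cq].
have C2 : {for p, continuous (fun p : V * V => q p.2)}.
  by apply: (@continuous_comp _ _ _ snd q); [exact: cvg_snd|exact: cq].
have N1 : \forall x \near p, img e x.1 by exact: (@cvg_fst _ _ _ _ _ _ (near_img i1)).
have N2 : \forall x \near p, img e x.2 by exact: (@cvg_snd _ _ _ _ _ _ (near_img i2)).
have N3 : \forall x \near p, dom e (q x.1 * q x.2)%g by exact: (cmul C1 C2 (near_dom d)).
by apply: filterS3 N1 N2 N3.
Qed.

Let Oset_unit u : img e u -> O (u, e0).
Proof.
move=> iu; apply: Oset_open; split => //=; first exact: img_c.
by rewrite q0 mulg1; exact: qdom.
Qed.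

Let unit_Oset u : img e u -> O (e0, u).
Proof.
move=> iu; apply: Oset_open; split => //=; first exact: img_c.
by rewrite q0 mul1g; exact: qdom.
Qed.

Let O_Oset p : O p -> Oset p.
Proof. exact: interior_subset. Qed.

Let oO : open O. Proof. exact: open_interior. Qed.

Let ie0 : img e e0. Proof. exact: img_c. Qed.

Let O0 : O (e0, e0). Proof. exact: Oset_unit. Qed.

Let sm k : csmooth k O m.
Proof.
have /smooth_onP/(_ k) H := lie_mul_smooth G_lie atlas_e atlas_e atlas_e.
exact: csmooth_sub O_Oset H.
Qed.

Let mA u v w : O (u, v) -> O (v, w) -> m (m (u, v), w) = m (u, m (v, w)).
Proof.
by move=> /O_Oset[_ _ /= d1] /O_Oset[_ _ /= d2]; rewrite /m /= !cK// mulgA.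
Qed.

Let mx1 u : O (u, e0) -> m (u, e0) = u.
Proof. by move=> /O_Oset[iu _ _]; rewrite /m /= q0 mulg1 qK. Qed.

Let m1x u : O (e0, u) -> m (e0, u) = u.
Proof. by move=> /O_Oset[_ iu _]; rewrite /m /= q0 mul1g qK. Qed.

Let iv u : V := c (q u)^-1%g.
Let Ad u X := lie_Ad e (q u) X.

Let L := left_invariant_field e.

Let near_inv : \forall u \near e0, dom e (q u)^-1%g.
Proof.
have H := cinv (cq ie0); apply: H; rewrite /= q0 invg1; exact: near_dom.
Qed.

Let O_iv u : img e u -> dom e (q u)^-1%g -> O (u, iv u).
Proof.
move=> iu du; apply: Oset_open; split => //=; first exact: img_c.
by rewrite /iv cK// mulgV.
Qed.

Let near_conj u : img e u -> dom e (q u)^-1%g -> \forall v \near e0,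
  c (q u * q v * (q u)^-1)%g = m (m (u, v), iv u).
Proof.
move=> iu du.
have C : {for e0, continuous (fun v => (q u * q v)%g)}.
  by apply: cmul; [exact: cst_continuous|exact: cq].
have N : \forall v \near e0, dom e (q u * q v)%g.
  by apply: C; rewrite /= q0 mulg1; apply: near_dom; exact: qdom.
by apply: filterS N => v d; rewrite /m /= /iv !cK.
Qed.

Let dm p : O p -> differentiable m p.
Proof. by move=> Op; exact: csmooth_diff (sm 0) Op. Qed.

Let d_mu u : img e u -> differentiable (fun v => m (u, v)) e0.
Proof.
move=> iu; apply: differentiable_comp_pair; [exact: differentiable_cst|exact: differentiable_id|].
exact/dm/Oset_unit.
Qed.

Let d_conj u : img e u -> dom e (q u)^-1%g ->
  differentiable (fun v => c (q u * q v * (q u)^-1)%g) e0.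
Proof.
move=> iu du.
have E : \forall v \near e0, m (m (u, v), iv u) = c (q u * q v * (q u)^-1)%g.
  by apply: filterS (near_conj iu du) => v ->.
apply: near_eq_differentiable E _.
apply: (@differentiable_comp_pair R V V V V m (fun v => m (u, v)) (fun=> iv u)).
- exact: d_mu.
- exact: differentiable_cst.
- by rewrite mx1; [exact/dm/O_iv|exact: Oset_unit].
Qed.

Let Ad1 : \forall u \near e0, O (u, iv u) /\ forall X, Ad u X = 'D_(L X u, 0) m (u, iv u).
Proof.
apply: filterS2 (near_img ie0) near_inv => u iu du; split=> [|X]; first exact: O_iv.
have Om : O (m (u, e0), iv u) by rewrite mx1; [exact: O_iv|exact: Oset_unit].
have := @derive_comp_pair R V V V V m (fun v => m (u, v)) (fun=> iv u) e0 X (d_mu iu)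
  (differentiable_cst _ _) (dm Om).
rewrite (derive_cst (iv u) e0 X) (mx1 (Oset_unit iu)) => <-.
exact: near_eq_derive X (near_conj iu du).
Qed.

Let Ad2 : \forall u \near e0, O (e0, u) /\ forall X, L X u = 'D_(Ad u X, 0) m (e0, u).
Proof.
apply: filterS2 (near_img ie0) near_inv => u iu du; split=> [|X]; first exact: unit_Oset.
pose k v := c (q u * q v * (q u)^-1)%g.
have k0 : k e0 = e0 by rewrite /k q0 mulg1 mulgV.
have Ok : O (k e0, u) by rewrite k0; exact: unit_Oset.
have := @derive_comp_pair R V V V V m k (fun=> u) e0 X (d_conj iu du)
  (differentiable_cst _ _) (dm Ok).
rewrite (derive_cst u e0 X) k0 => <-.
have C : {for e0, continuous (fun v => (q u * q v * (q u)^-1)%g)}.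
  by apply: cmul; [apply: cmul; [exact: cst_continuous|exact: cq]|exact: cst_continuous].
have N : \forall v \near e0, dom e (q u * q v * (q u)^-1)%g.
  by apply: C; rewrite /= q0 mulg1 mulgV; exact: near_dom.
have E : \forall v \near e0, m (u, v) = m (k v, u).
  by apply: filterS N => v d; rewrite /m /= /k cK// -mulgA mulVg mulg1.
exact: near_eq_derive X E.
Qed.

Let iv0 : iv e0 = e0. Proof. by rewrite /iv q0 invg1. Qed.

Let div : differentiable iv e0.
Proof.
have := lie_inv_smooth G_lie atlas_e atlas_e; move=> /(_ [::] e0); apply; split => //.
by rewrite -/q q0 invg1.
Qed.

Let B (X Y : V) : V := 'D_X (L Y) e0.
Let L_def (Y u : V) : L Y u = 'D_Y (fun v : V => m (u, v)) e0. Proof. by []. Qed.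
Let B_def (X Y : V) : B X Y = 'D_X (L Y) e0. Proof. by []. Qed.
Let bracketE X Y : lie_bracket e X Y = B X Y - B Y X. Proof. by []. Qed.

Lemma lie_bracket_linear a (X Y Z : V) :
  lie_bracket e (a *: X + Y) Z = a *: lie_bracket e X Z + lie_bracket e Y Z.
Proof.
have H := local_bracket_linear oO O0 sm L_def B_def a X Y Z; cbv beta in H.
by rewrite (bracketE (_ + _)) (bracketE X) (bracketE Y).
Qed.

Lemma lie_bracketC (X Y : V) : lie_bracket e X Y = - lie_bracket e Y X.
Proof. by rewrite /lie_bracket opprB. Qed.

Lemma lie_bracket_jacobi (X Y Z : V) : lie_bracket e X (lie_bracket e Y Z)
  + lie_bracket e Y (lie_bracket e Z X) + lie_bracket e Z (lie_bracket e X Y) = 0.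
Proof.
pose S (u Y Z : V) : V := 'D_(0, Y) ('D_(0, Z) m) (u, e0).
pose T (Z X Y : V) : V := 'D_X ('D_Y (L Z)) e0.
have S_def : forall u P Q, S u P Q = 'D_(0, P) ('D_(0, Q) m) (u, e0) := fun _ _ _ => erefl.
have T_def : forall P Q M, T P Q M = 'D_Q ('D_M (L P)) e0 := fun _ _ _ => erefl.
have H := local_group_jacobi oO O0 sm mA mx1 m1x L_def B_def S_def T_def X Y Z.
cbv beta in H.
by rewrite (bracketE Y Z) (bracketE Z X) (bracketE X Y) (bracketE X) (bracketE Y) (bracketE Z).
Qed.

Lemma lie_Ad_unit (X : V) : Ad e0 X = X.
Proof. exact: (local_Ad_unit oO O0 sm mx1 m1x L_def Ad2). Qed.

Lemma differentiable_lie_Ad (X : V) : differentiable (fun u => Ad u X) e0.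
Proof. exact: (differentiable_Ad oO O0 sm L_def iv0 div Ad1). Qed.

Lemma derive_lie_Ad (Z X : V) : 'D_Z (fun u => Ad u X) e0 = lie_bracket e Z X.
Proof.
rewrite bracketE.
exact: (derive_Ad oO O0 sm mx1 m1x L_def B_def iv0 div Ad1 Ad2 Z X).
Qed.

Variable (ip : V -> V -> R).
Hypothesis (ip_inv : is_biinvariant_inner_product e ip).

Lemma ip_linearl Y : linear (ip ^~ Y).
Proof. by move=> a X Z; rewrite (ip_linear ip_inv). Qed.

Lemma ip_linearr X : linear (ip X).
Proof. by move=> a Y Z; rewrite !(ip_sym ip_inv X) (ip_linear ip_inv). Qed.

(** Infinitesimal Ad-invariance: [ip (Ad u X) (Ad u Y)] is constant in [u], and the left side is its
    derivative at the unit along [Z]. *)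
Lemma ip_bracket X Y Z :
  ip (lie_bracket e Z X) Y + ip X (lie_bracket e Z Y) = 0.
Proof.
have dX := differentiable_lie_Ad X; have dY := differentiable_lie_Ad Y.
have C := continuous_bilinear ip_linearl ip_linearr.
have := @derive_bilin2 R V V _ V ip ip_linearl ip_linearr C _ _ _ Z dX dY.
rewrite !derive_lie_Ad !lie_Ad_unit => <-.
rewrite (_ : (fun u => _) = (fun=> ip X Y)); first exact: derive_cst.
by apply/funext => u; exact: (ip_Ad ip_inv).
Qed.

End lie_group.

(** * Integration by parts in four variables *)

(* In the library the canonical sigma-finite structure of [m1 \x m2] is shadowed
   by the one for subprobabilities, so a named copy of the product is needed. *)
Section sigma_prod.
Context d1 d2 (T1 : measurableType d1) (T2 : measurableType d2) (R : realType)
  (m1 : {sigma_finite_measure set T1 -> \bar R})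
  (m2 : {sigma_finite_measure set T2 -> \bar R}).

Definition sigma_prod : set (T1 * T2) -> \bar R := (m1 \x m2)%E.

HB.instance Definition _ := Measure.on sigma_prod.

Let sigma_prod_sigma_finite : sigma_finite setT sigma_prod.
Proof.
have /sigma_finiteP[F [TF ndF Foo]] := sigma_finiteT m1.
have /sigma_finiteP[G [TG ndG Goo]] := sigma_finiteT m2.
exists (fun n => F n `*` G n); last first.
  move=> k; have [mF Fk] := Foo k; have [mG Gk] := Goo k.
  split; first exact: measurableX.
  by rewrite /sigma_prod product_measure1E// lte_mul_pinfty// ge0_fin_numE.
apply/seteqP; split=> // -[x y] _.
have [n _ Fx] : (\bigcup_n F n) x by rewrite -TF.
have [k _ Gy] : (\bigcup_n G n) y by rewrite -TG.
exists (maxn n k) => //; split => /=.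
- by move: Fx; apply/subsetPset/ndF/leq_maxl.
- by move: Gy; apply/subsetPset/ndG/leq_maxr.
Qed.

HB.instance Definition _ := Measure_isSigmaFinite.Build _ _ _ sigma_prod
  sigma_prod_sigma_finite.

End sigma_prod.

Section integral.
Context {R : realType}.
Implicit Types (f g : 'rV[R]_4 -> R).

Definition vec4 (x : R4 R) : 'rV[R]_4 :=
  \row_i [:: x.1.1.1; x.1.1.2; x.1.2; x.2]`_i.

(** Real valued, so that identities between integrals can be solved arithmetically; additivity and
    comparison are proved below for the integrands in [cc]. *)
Definition integral4 (f : 'rV[R]_4 -> R) : R :=
  (\int[@lebesgue_measure4 R]_x f (vec4 x))%R.

Lemma measurable_vec4_coord i :
  measurable_fun [set: R4 R] (fun x => vec4 x 0 i).
Proof.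
under eq_fun do rewrite mxE.
case: i => [[|[|[|[|//]]]] ?] /=.
- apply: (measurableT_comp (f := fst)) => //.
  apply: (measurableT_comp (f := fst)) => //.
- apply: (measurableT_comp (f := snd)) => //.
  apply: (measurableT_comp (f := fst)) => //.
- apply: (measurableT_comp (f := snd)) => //.
- exact: (measurable_snd).
Qed.

Lemma measurable_vec4_ball (c : 'rV[R]_4) (e : R) : measurable (vec4 @^-1` ball c e).
Proof.
have [e0|e0] := lerP e 0.
  rewrite (_ : _ @^-1` _ = set0) //; apply/seteqP; split=> // x [/=].
  by rewrite ltNge e0.
rewrite (_ : _ @^-1` _ = \bigcap_(i in [set: 'I_4])
    ((fun x => vec4 x 0 i) @^-1` ball (c 0 i) e)).
  apply: fin_bigcap_measurable => // i _; rewrite -[X in measurable X]setTI.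
  by apply: measurable_vec4_coord => //; exact: measurable_ball.
apply/seteqP; split=> x /=.
  by move=> [_ B] i _; exact: B.
by move=> B; split=> // i j; rewrite (ord1 i); exact: B.
Qed.

(** [R4] carries a product sigma-algebra, row vectors only a topology. They are matched by writing
    an open set as a countable union of sup-norm balls with rational centres and radii, whose
    preimages are boxes. *)
Lemma measurable_vec4_open (O : set 'rV[R]_4) : open O ->
  measurable (vec4 @^-1` O).
Proof.
move=> oO.
pose q (p : 'rV[rat]_4 * rat) : set 'rV[R]_4 := ball (map_mx ratr p.1 : 'rV[R]_4) (ratr p.2).
pose F n : set 'rV[R]_4 := oapp q set0 (unpickle n).
have -> : vec4 @^-1` O = \bigcup_(n in [set n | F n `<=` O]) (vec4 @^-1` F n).
  apply/seteqP; split=> [x /= Ox|x [p /= pO]]; last exact: pO.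
  have /nbhs_ballP[e /= e0 eO] : nbhs (vec4 x) O by exact: open_nbhs_nbhs.
  have [r] := @rat_in_itvoo R 0 (e / 2) ltac:(by rewrite divr_gt0).
  rewrite in_itv/= => /andP[r0 re].
  have /choice[c cP] : forall i, exists s : rat, `|vec4 x 0 i - ratr s| < ratr r.
    move=> i; have [s] := @rat_in_itvoo R (vec4 x 0 i - ratr r) (vec4 x 0 i + ratr r)
      ltac:(by rewrite ltrD2l gtrN).
    by rewrite in_itv/= => /andP[s1 s2]; exists s; rewrite ltr_distlC; apply/andP; split; lra.
  have B : ball (map_mx ratr (\row_i c i) : 'rV[R]_4) (ratr r) (vec4 x).
    by split=> // i j; rewrite (ord1 i) mxE mxE /ball/= distrC; exact: cP.
  exists (pickle ((\row_i c i) : 'rV[rat]_4, r)); rewrite /F/= pickleK//= => z Bz; apply: eO.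
  apply: (@le_ball _ _ _ (ratr r + ratr r)); first by rewrite (splitr e) lerD// ltW.
  by apply: ball_triangle Bz; apply: ball_sym.
apply: bigcup_measurable => n _; rewrite /F; case: (unpickle n) => [p|] /=.
  exact: measurable_vec4_ball.
by rewrite preimage_set0.
Qed.

Lemma measurable_vec4_continuous (D : set 'rV[R]_4) f : open D ->
  (forall y, D y -> {for y, continuous f}) ->
  measurable_fun (vec4 @^-1` D) (fun x => f (vec4 x)).
Proof.
move=> oD cf; apply: (measurability _ (RGenOpens.measurableE R)).
move=> _ [_ [a [b ->] <-]] /=.
rewrite (_ : _ `&` _ = vec4 @^-1` (D `&` f @^-1` `]a, b[%classic)) //.
apply: measurable_vec4_open.
rewrite openE => y [Dy fy]; apply: filterI; first exact: open_nbhs_nbhs.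
by apply: (cf y Dy); apply: open_nbhs_nbhs; split => //; exact: interval_open.
Qed.

Definition normsq m (y : 'rV[R]_m) : R := \sum_i y 0 i ^+ 2.

Lemma normsq_ge0 m (y : 'rV[R]_m) : 0 <= normsq y.
Proof. by apply: sumr_ge0 => i _; exact: sqr_ge0. Qed.

Lemma csmooth_normsq k m (U : set 'rV[R]_m) : open U -> csmooth k U (@normsq m).
Proof.
move=> oU; apply: csmooth_sum => // i _; under eq_fun do rewrite expr2.
by apply: csmoothM => //; apply: csmooth_coord => //; exact: csmooth_id.
Qed.

Lemma csmooth_continuous k (V W : normedModType R) (U : set V) (f : V -> W) (y : V) :
  csmooth k U f -> U y -> {for y, continuous f}.
Proof. by move=> sf Uy; apply: differentiable_continuous; exact: csmooth_diff sf Uy. Qed.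

Lemma continuous_normsq m : continuous (@normsq m).
Proof. by move=> y; exact: (csmooth_continuous (csmooth_normsq 0 openT)). Qed.

Definition box (M : R) : set (R4 R) := [set x | forall i, `|vec4 x 0 i| <= M].

Lemma boxE M : box M = `[- M, M]%classic `*` `[- M, M]%classic `*` `[- M, M]%classic `*` `[- M, M]%classic.
Proof.
apply/seteqP; split => -[[[a b] c] d] /=.
  move=> H; have := (H (@Ordinal 4 0 isT), H (@Ordinal 4 1 isT), H (@Ordinal 4 2 isT), H (@Ordinal 4 3 isT)).
  by rewrite !mxE/= !ler_norml => -[[[H0 H1] H2] H3]; rewrite /= !in_itv.
rewrite /= !in_itv/= => -[[[H0 H1] H2] H3] i; rewrite mxE ler_norml.
by case: i => [[|[|[|[|//]]]] ?].
Qed.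

Lemma measurable_box M : measurable (box M).
Proof. by rewrite boxE; do 3! apply: measurableX => //. Qed.

Lemma measure_box M : (lebesgue_measure4 (box M) < +oo)%E.
Proof.
have mI : (@lebesgue_measure R `[(- M)%R, M]%classic < +oo)%E.
  by rewrite lebesgue_measure_itv; case: ifP => // _; rewrite -EFinB ltry.
have mI0 : (0 <= @lebesgue_measure R `[(- M)%R, M]%classic)%E by [].
have mIf : @lebesgue_measure R `[- M, M]%classic \is a fin_num by rewrite ge0_fin_numE.
rewrite boxE /lebesgue_measure4.
rewrite product_measure1E//=; last by do 2 apply: measurableX => //.
rewrite product_measure1E//=; last by apply: measurableX => //.
rewrite product_measure1E//=.
by rewrite -ge0_fin_numE ?fin_numM// !mule_ge0.
Qed.

Lemma normsq_coord m (y : 'rV[R]_m) i : y 0 i ^+ 2 <= normsq y.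
Proof. by rewrite /normsq (bigD1 i)//= lerDl sumr_ge0// => j _; exact: sqr_ge0. Qed.

Lemma normsq_coord_le m (y : 'rV[R]_m) (M : R) i : normsq y <= M -> `|y 0 i| <= M + 1.
Proof.
move=> yM; have := le_trans (normsq_coord y i) yM.
rewrite -real_normK ?num_real// => H.
have := normr_ge0 (y 0 i); set z := `|_| in H *.
have := sqr_ge0 (z - 1); rewrite sqrrB1; lra.
Qed.

Lemma compact_normsq m (M : R) : compact [set y : 'rV[R]_m | normsq y <= M].
Proof.
apply: bounded_closed_compact.
  exists (M + 1); split; first exact: num_real.
  move=> B MB y /= yM; rewrite /Num.Def.normr/= mx_normrE.
  have [M0|M0] := lerP 0 M.
    apply: bigmax_le; first lra.
    by move=> [i j] _ /=; rewrite ord1; apply: le_trans (ltW MB); exact: normsq_coord_le.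
  by have := le_lt_trans yM M0; rewrite ltNge normsq_ge0.
rewrite (_ : mkset _ = @normsq m @^-1` [set r | r <= M]) //.
apply: closed_comp; last exact: closed_le.
by move=> y _; exact: continuous_normsq.
Qed.

Definition cc f := continuous f /\ exists M, forall y, M <= normsq y -> f y = 0.

Lemma compact_bound m (g : 'rV[R]_m -> R) (M : R) :
  (forall y, normsq y <= M -> {for y, continuous g}) ->
  exists2 C : R, 0 <= C & forall y, normsq y <= M -> `|g y| <= C.
Proof.
move=> cg; have [ne|ne] := pselect (exists y, normsq (y : 'rV[R]_m) <= M); last first.
  by exists 0 => // y yM; exfalso; apply: ne; exists y.
have [y0 y0M] := ne.
have [|||c cM cE] := @EVT_max_rV R m (fun y => `|g y|) [set y | normsq y <= M].
- by exists y0.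
- exact: compact_normsq.
- apply: continuous_in_subspaceT => y; rewrite inE /= => yM.
  by apply: continuous_comp; [exact: cg|exact: norm_continuous].
by exists (`|g c|) => // y yM; apply: cE; rewrite inE.
Qed.

Lemma cc_bound f : cc f -> exists2 C : R, 0 <= C & forall y, `|f y| <= C.
Proof.
move=> [cf [M f0]]; have [|C C0 fC] := @compact_bound 4 f M; first by move=> y _; exact: cf.
exists C => // y; have [yM|yM] := lerP (normsq y) M; first exact: fC.
by rewrite f0 ?normr0// ltW.
Qed.

Lemma integrable_supported f (M C : R) :
  measurable_fun [set: R4 R] (fun x => f (vec4 x)) ->
  (forall y, M <= normsq y -> f y = 0) -> (forall y, `|f y| <= C) ->
  (@lebesgue_measure4 R).-integrable [set: R4 R] (fun x => (f (vec4 x))%:E).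
Proof.
move=> mf f0 fC.
rewrite (_ : (fun x => _) = (fun x : R4 R => (f (vec4 x))%:E) \_ (box (M + 1))).
  apply/(integrable_mkcond _ (measurable_box (M + 1))).
  apply: measurable_bounded_integrable.
  - exact: measurable_box.
  - exact: measure_box.
  - by apply: measurable_funTS.
  - by exists C; split; [exact: num_real|move=> B CB x _; exact: le_trans (fC _) (ltW CB)].
apply/funext => x; rewrite patchE; case: ifPn => //.
rewrite notin_setE /box /= => /existsNP[i]; move/negP; rewrite -ltNge => Hi.
rewrite f0 //; have [//|/ltW H] := lerP M (normsq (vec4 x)).
by have := normsq_coord_le i H; rewrite leNgt Hi.
Qed.

Lemma cc_integrable f : cc f ->
  (@lebesgue_measure4 R).-integrable [set: R4 R] (fun x => (f (vec4 x))%:E).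
Proof.
move=> ccf; have [C C0 fC] := cc_bound ccf; have [cf [M f0]] := ccf.
apply: (integrable_supported _ f0 fC).
have := @measurable_vec4_continuous setT f openT (fun y _ => cf y).
by rewrite preimage_setT.
Qed.

Lemma ccD f g : cc f -> cc g -> cc (fun y => f y + g y).
Proof.
move=> [cf [M f0]] [cg [N g0]]; split; first by move=> y; exact: (cvgD (cf y) (cg y)).
by exists (Num.max M N) => y; rewrite ge_max => /andP[yM yN]; rewrite f0// g0// addr0.
Qed.

Lemma ccZ f (c : R) : cc f -> cc (fun y => c * f y).
Proof.
move=> [cf [M f0]]; split; last by exists M => y /f0 ->; rewrite mulr0.
by move=> y; exact: (cvgM (cvg_cst c) (cf y)).
Qed.

Lemma cc0 : cc (fun=> 0).
Proof. by split; [exact: cst_continuous|exists 0]. Qed.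

Lemma cc_sum (I : Type) (r : seq I) (F : I -> 'rV[R]_4 -> R) :
  (forall i, cc (F i)) -> cc (fun y => \sum_(i <- r) F i y).
Proof.
move=> cF; elim: r => [|i r IH]; first by under eq_fun do rewrite big_nil; exact: cc0.
by under eq_fun do rewrite big_cons; exact: ccD.
Qed.

(** This allows functions meaningful only in the unit ball to be integrated over the whole space:
    where [chi] vanishes, the values of [g] are irrelevant. *)
Lemma cc_cut (chi g : 'rV[R]_4 -> R) (k : R) : continuous chi ->
  (forall y, k <= normsq y -> chi y = 0) ->
  (forall y, normsq y <= k -> {for y, continuous g}) ->
  cc (fun y => chi y * g y).
Proof.
move=> cc_ c0 cg; split; last by exists k => y /c0 ->; rewrite mul0r.
move=> y; have [yk|yk] := lerP (normsq y) k.
  exact: (cvgM (cc_ y) (cg y yk)).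
have N : \forall z \near y, 0 = chi z * g z.
  have := @continuous_normsq 4 y; move/cvgr_gt => /(_ _ yk) H.
  by apply: filterS H => z /ltW/c0 ->; rewrite mul0r.
rewrite /continuous_at (c0 y (ltW yk)) mul0r.
have Z : (fun=> 0 : R) z @[z --> y] --> (0 : R) by exact: (@cst_continuous _ _ (0 : R) y).
exact: cvg_trans (near_eq_cvg N) Z.
Qed.

Lemma integral4D f g : cc f -> cc g ->
  integral4 (fun y => f y + g y) = integral4 f + integral4 g.
Proof. by move=> cf cg; rewrite /integral4 RintegralD//; exact: cc_integrable. Qed.

Lemma integral4Z f (c : R) : cc f -> integral4 (fun y => c * f y) = c * integral4 f.
Proof. by move=> cf; rewrite /integral4 RintegralZl//; exact: cc_integrable. Qed.

Lemma integral4_0 : integral4 (fun=> 0) = 0.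
Proof. by rewrite -[in RHS](mul0r (integral4 (fun=> 0))) -integral4Z ?mul0r//; exact: cc0. Qed.

Lemma integral4_sum (I : Type) (r : seq I) (F : I -> 'rV[R]_4 -> R) :
  (forall i, cc (F i)) ->
  integral4 (fun y => \sum_(i <- r) F i y) = \sum_(i <- r) integral4 (F i).
Proof.
move=> cF; elim: r => [|i r IH].
  by under [X in integral4 X]eq_fun do rewrite big_nil; rewrite integral4_0 big_nil.
under [X in integral4 X]eq_fun do rewrite big_cons.
by rewrite integral4D ?big_cons ?IH//; exact: cc_sum.
Qed.

Lemma integral4_le f g : cc f -> cc g -> (forall y, f y <= g y) ->
  integral4 f <= integral4 g.
Proof. by move=> cf cg fg; apply: le_Rintegral => //; exact: cc_integrable. Qed.

Lemma integral4_ge0 f : (forall y, 0 <= f y) -> 0 <= integral4 f.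
Proof. by move=> f0; apply: Rintegral_ge0. Qed.

(** The hypothesis concerns integrable sections only. Almost all sections are such by Fubini, and
    their integrability is what is needed to apply the lemma again to each of them. *)
Lemma integral_prod_eq0_right d1 d2 (T1 : measurableType d1) (T2 : measurableType d2)
    (m1 : {sigma_finite_measure set T1 -> \bar R})
    (m2 : {sigma_finite_measure set T2 -> \bar R}) (F : T1 * T2 -> \bar R) :
  (m1 \x m2)%E.-integrable setT F ->
  (forall x, m2.-integrable setT (fun y => F (x, y)) -> (\int[m2]_y F (x, y) = 0)%E) ->
  (\int[m1 \x m2]_z F z = 0)%E.
Proof.
move=> iF F0; rewrite -integral12_prod_meas1//.
transitivity (\int[m1]_x (cst 0 x : \bar R))%E; last exact: integral0.
apply: (@ae_eq_integral _ _ _ m1 setT) => //.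
- by have := integrable_fubini_F iF; exact: measurable_int.
- have := ae_integrable1 iF; apply: filterS => x H _ /=.
  exact: F0.
Qed.

Lemma integral_prod_eq0_left d1 d2 (T1 : measurableType d1) (T2 : measurableType d2)
    (m1 : {sigma_finite_measure set T1 -> \bar R})
    (m2 : {sigma_finite_measure set T2 -> \bar R}) (F : T1 * T2 -> \bar R) :
  (m1 \x m2)%E.-integrable setT F ->
  (forall y, m1.-integrable setT (fun x => F (x, y)) -> (\int[m1]_x F (x, y) = 0)%E) ->
  (\int[m1 \x m2]_z F z = 0)%E.
Proof.
move=> iF F0; rewrite -integral21_prod_meas1//.
transitivity (\int[m2]_x (cst 0 x : \bar R))%E; last exact: integral0.
apply: (@ae_eq_integral _ _ _ m2 setT) => //.
- exact: measurable_fubini_G iF.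
- have := ae_integrable2 iF; apply: filterS => x H _ /=.
  exact: F0.
Qed.

Lemma integral_deriv_eq0 (h dh : R -> R) (M : R) : 0 < M ->
  (forall t : R, is_derive t 1 h (dh t)) -> continuous dh ->
  (forall t : R, M <= `|t| -> h t = 0 /\ dh t = 0) ->
  (\int[@lebesgue_measure R]_t (dh t)%:E = 0)%E.
Proof.
move=> M0 hd cdh h0.
have ch t : {for t, continuous h} by exact: is_derive_continuous (hd t).
have -> : (fun t => (dh t)%:E) = (fun t => (dh t)%:E) \_ `[- M, M]%classic.
  apply/funext => t; rewrite patchE; case: ifPn => //.
  rewrite notin_setE /= in_itv/= => /negP; rewrite -ler_norml -ltNge => /ltW.
  by move=> /h0[_ ->].
rewrite -integral_mkcond (@continuous_FTC2 R dh h); last first.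
- by move=> t _; rewrite derive1E; have [_ ->] := hd t.
- split=> [t _||].
  + by have [] := hd t.
  + by apply: cvg_at_right_filter; exact: ch.
  + by apply: cvg_at_left_filter; exact: ch.
- by apply: continuous_subspaceT.
- by rewrite gtrN.
have [-> _] : h M = 0 /\ dh M = 0 by apply: h0; rewrite ler_norm.
have [-> _] : h (- M) = 0 /\ dh (- M) = 0 by apply: h0; rewrite normrN ler_norm.
by rewrite subee.
Qed.

Lemma normsq_line_far m (y : 'rV[R]_m) i (M : R) : exists2 N : R, 0 < N &
  forall t, N <= `|t| -> M <= normsq (y + t *: delta_mx 0 i).
Proof.
(* Beyond this value of [|t|] the [i]-th coordinate is at least [|M| + 1] in absolute value, and the
   square of that is at least [M]. *)
exists (`|y 0 i| + `|M| + 1).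
  by rewrite ltr_wpDl// addr_ge0.
move=> t Nt; apply: le_trans (normsq_coord _ i); rewrite !mxE !eqxx mulr1.
apply: (le_trans (ler_norm M)).
have H : `|M| + 1 <= `|y 0 i + t|.
  have := ler_normB (y 0 i + t) (y 0 i); rewrite addrAC subrr add0r => H.
  by have := le_trans Nt H; lra.
rewrite -real_normK ?num_real//; apply: (@le_trans _ _ ((`|M| + 1) ^+ 2)).
  have := normr_ge0 M; set z := `|M| => z0; rewrite expr2; nra.
by rewrite ler_sqr// nnegrE ?addr_ge0.
Qed.

Lemma integral_line_eq0 (f fi : 'rV[R]_4 -> R) i (y : 'rV[R]_4) :
  cc f -> cc fi -> (forall z, is_derive z (delta_mx 0 i) f (fi z)) ->
  (\int[@lebesgue_measure R]_t (fi (y + t *: delta_mx 0 i))%:E = 0)%E.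
Proof.
move=> [cf [M f0]] [cfi [N fi0]] fd.
have [P P0 HP] := normsq_line_far y i (Num.max M N).
apply: (@integral_deriv_eq0 (fun t => f (y + t *: delta_mx 0 i)) _ P P0).
- by move=> t; apply: is_derive_along.
- move=> t; apply: (@continuous_comp _ _ _ (fun t : R => y + t *: delta_mx 0 i) fi); last exact: cfi.
  apply: cvgD; first exact: cvg_cst.
  by apply: cvgZr_tmp; exact: cvg_id.
- by move=> t /HP; rewrite ge_max => /andP[/f0 -> /fi0 ->].
Qed.

Section iterated.
Context d0 d1 d2 d3 (T0 : measurableType d0) (T1 : measurableType d1)
  (T2 : measurableType d2) (T3 : measurableType d3)
  (m0 : {sigma_finite_measure set T0 -> \bar R})
  (m1 : {sigma_finite_measure set T1 -> \bar R})
  (m2 : {sigma_finite_measure set T2 -> \bar R})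
  (m3 : {sigma_finite_measure set T3 -> \bar R}) (F : T0 * T1 * T2 * T3 -> \bar R).
Let m01 : {sigma_finite_measure set _ -> \bar R} := sigma_prod m0 m1.
Let m012 : {sigma_finite_measure set _ -> \bar R} := sigma_prod m01 m2.
Hypothesis iF : (m0 \x m1 \x m2 \x m3)%E.-integrable setT F.

Lemma integral_prod4_eq0_0 : (forall b c d, (\int[m0]_a F (a, b, c, d) = 0)%E) ->
  (\int[m0 \x m1 \x m2 \x m3]_z F z = 0)%E.
Proof.
move=> F0; apply: (@integral_prod_eq0_left _ _ _ _ m012 m3 F iF) => d H.
apply: (@integral_prod_eq0_left _ _ _ _ m01 m2 _ H) => c {}H.
apply: (@integral_prod_eq0_left _ _ _ _ m0 m1 _ H) => b {}H.
exact: F0.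
Qed.

Lemma integral_prod4_eq0_1 : (forall a c d, (\int[m1]_b F (a, b, c, d) = 0)%E) ->
  (\int[m0 \x m1 \x m2 \x m3]_z F z = 0)%E.
Proof.
move=> F0; apply: (@integral_prod_eq0_left _ _ _ _ m012 m3 F iF) => d H.
apply: (@integral_prod_eq0_left _ _ _ _ m01 m2 _ H) => c {}H.
apply: (@integral_prod_eq0_right _ _ _ _ m0 m1 _ H) => a {}H.
exact: F0.
Qed.

Lemma integral_prod4_eq0_2 : (forall a b d, (\int[m2]_c F (a, b, c, d) = 0)%E) ->
  (\int[m0 \x m1 \x m2 \x m3]_z F z = 0)%E.
Proof.
move=> F0; apply: (@integral_prod_eq0_left _ _ _ _ m012 m3 F iF) => d H.
apply: (@integral_prod_eq0_right _ _ _ _ m01 m2 _ H) => -[a b] {}H.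
exact: F0.
Qed.

Lemma integral_prod4_eq0_3 : (forall a b c, (\int[m3]_d F (a, b, c, d) = 0)%E) ->
  (\int[m0 \x m1 \x m2 \x m3]_z F z = 0)%E.
Proof.
move=> F0; apply: (@integral_prod_eq0_right _ _ _ _ m012 m3 F iF) => -[[a b] c] H.
exact: F0.
Qed.

End iterated.

(** By Fubini it suffices to integrate along lines parallel to the [i]-th axis, where the
    fundamental theorem of calculus gives 0; the four cases only differ in the position of that
    variable in the iterated product. *)
Lemma integral4_derive_eq0 (f fi : 'rV[R]_4 -> R) i :
  cc f -> cc fi -> (forall z, is_derive z (delta_mx 0 i) f (fi z)) ->
  integral4 fi = 0.
Proof.
move=> cf cfi fd; rewrite /integral4 /Rintegral.
suff -> : (\int[@lebesgue_measure4 R]_x (fi (vec4 x))%:E = 0)%E by [].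
have H := cc_integrable cfi.
have L y := integral_line_eq0 y cf cfi fd.
case: i fd L => [[|[|[|[|//]]]] ii] fd L.
- apply: (integral_prod4_eq0_0 H) => b c d.
  rewrite -[RHS](L (vec4 (0, b, c, d))); apply: eq_integral => a _; congr (fi _)%:E.
  by apply/rowP => -[[|[|[|[|//]]]] jj]; rewrite !mxE /= ?mulr1 ?mulr0 ?addr0 ?add0r.
- apply: (integral_prod4_eq0_1 H) => a c d.
  rewrite -[RHS](L (vec4 (a, 0, c, d))); apply: eq_integral => b _; congr (fi _)%:E.
  by apply/rowP => -[[|[|[|[|//]]]] jj]; rewrite !mxE /= ?mulr1 ?mulr0 ?addr0 ?add0r.
- apply: (integral_prod4_eq0_2 H) => a b d.
  rewrite -[RHS](L (vec4 (a, b, 0, d))); apply: eq_integral => c _; congr (fi _)%:E.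
  by apply/rowP => -[[|[|[|[|//]]]] jj]; rewrite !mxE /= ?mulr1 ?mulr0 ?addr0 ?add0r.
- apply: (integral_prod4_eq0_3 H) => a b c.
  rewrite -[RHS](L (vec4 (a, b, c, 0))); apply: eq_integral => d _; congr (fi _)%:E.
  by apply/rowP => -[[|[|[|[|//]]]] jj]; rewrite !mxE /= ?mulr1 ?mulr0 ?addr0 ?add0r.
Qed.

End integral.

(** * Positive parts, integration by parts, differentiation under the integral *)

Section integral_tools.
Context {R : realType}.
Implicit Types (f g : 'rV[R]_4 -> R).

Definition pos (x : R) : R := Num.max 0 x.

Lemma pos_ge0 x : 0 <= pos x.
Proof. by rewrite le_max lexx. Qed.

Lemma pos_nneg x : 0 <= x -> pos x = x.
Proof. by move=> x0; rewrite /pos max_r. Qed.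

Lemma pos0 x : x <= 0 -> pos x = 0.
Proof. by move=> x0; rewrite /pos max_l. Qed.

Lemma le_pos x : x <= pos x.
Proof. by rewrite le_max lexx orbT. Qed.

Lemma continuous_pos : continuous pos.
Proof.
have -> : pos = (fun x => 2^-1 * (x + `|x|)).
  apply/funext => x; rewrite /pos; case: (lerP 0 x) => x0; first by rewrite ger0_norm//; field.
  by rewrite ltr0_norm// subrr mulr0.
move=> x; apply: cvgM; first exact: cvg_cst.
by apply: cvgD; [exact: cvg_id|exact: norm_continuous].
Qed.

(** Exponents from 2 on make the positive part continuously differentiable; the cutoffs, weights and
    kernels below are built from such powers. *)
Lemma is_derive_pos n (x : R) :
  is_derive x 1 (fun x : R => pos x ^+ n.+2) (n.+2%:R * pos x ^+ n.+1).
Proof.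
have [x0|x0|<-] := ltgtP 0 x.
- apply: (@near_eq_is_derive R _ _ (fun x : R => x ^+ n.+2)).
    have := lt_nbhsr x0; apply: filterS => y /= y0.
    by rewrite pos_nneg// ltW.
  rewrite pos_nneg ?ltW//.
  apply: DeriveDef; first exact: exprn_derivable.
  by rewrite exp_derive /GRing.scale/= mulr1.
- apply: (@near_eq_is_derive R _ _ (fun=> 0)).
    have := lt_nbhsl x0; apply: filterS => y /= y0.
    by rewrite pos0 ?ltW// expr0n.
  rewrite pos0 ?ltW// expr0n/= mulr0; exact: is_derive_cst.
rewrite pos0// expr0n /= mulr0.
have H : h^-1 *: (pos (h *: (1 : R) + 0) ^+ n.+2 - pos 0 ^+ n.+2) @[h --> 0^'] --> (0 : R).
  have C : (fun h : R => pos h ^+ n.+1) h @[h --> 0^'] --> pos 0 ^+ n.+1.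
    apply: cvg_within_filter.
    apply: (@continuous_comp _ _ _ pos (fun x : R => x ^+ n.+1)); first exact: continuous_pos.
    exact: exprn_continuous.
  rewrite pos0// expr0n /= in C.
  apply: cvg_trans C; apply: near_eq_cvg; near=> h.
  have h0 : h != 0 by near: h; exact: nbhs_dnbhs_neq.
  have -> : h *: (1 : R) + 0 = h by rewrite addr0 [LHS]mulr1.
  have -> : pos 0 ^+ n.+2 = 0 by rewrite pos0// expr0n.
  rewrite subr0 [in RHS]exprS /GRing.scale/= mulrA.
  have [hp|hn] := lerP 0 h; first by rewrite (pos_nneg hp) mulVf// mul1r.
  by rewrite pos0 ?ltW// expr0n/= mulr0.
by apply: DeriveDef; [apply/cvg_ex; exists 0|exact: cvg_lim H].
Unshelve. all: by end_near. Qed.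

Lemma is_derive_near0 (V : normedModType R) (f : V -> R) (x v : V) :
  (\forall y \near x, f y = 0) -> is_derive x v f 0.
Proof.
move=> f0; apply: (@near_eq_is_derive R V _ (fun=> 0) f) => //.
by apply: filterS f0 => y ->.
Qed.

Lemma continuous_radial m (phi : R -> R) : continuous phi ->
  continuous (fun y : 'rV[R]_m => phi (normsq y)).
Proof.
move=> cphi y; exact: (@continuous_comp _ _ _ (@normsq R m) phi y (@continuous_normsq R m y) (cphi _)).
Qed.

Lemma near_normsq_gt m (y : 'rV[R]_m) (k : R) : k < normsq y ->
  \forall z \near y, k < normsq z.
Proof. by move=> yk; have := @continuous_normsq R m y; move/cvgr_gt; exact. Qed.

Lemma integral4_parts (chi dchi g dg : 'rV[R]_4 -> R) (k : R) i :
  continuous chi -> continuous dchi ->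
  (forall y, is_derive y (delta_mx 0 i) chi (dchi y)) ->
  (forall y, k <= normsq y -> chi y = 0) ->
  (forall y, k <= normsq y -> dchi y = 0) ->
  (forall y, normsq y <= k -> {for y, continuous g}) ->
  (forall y, normsq y <= k -> {for y, continuous dg}) ->
  (forall y, normsq y <= k -> is_derive y (delta_mx 0 i) g (dg y)) ->
  integral4 (fun y => dchi y * g y) + integral4 (fun y => chi y * dg y) = 0.
Proof.
move=> cchi cdchi dchiE c0 dc0 cg cdg dgE.
rewrite -integral4D; [|exact: cc_cut cdchi dc0 cg|exact: cc_cut cchi c0 cdg].
apply: (@integral4_derive_eq0 R (fun y => chi y * g y) _ i).
- exact: cc_cut cchi c0 cg.
- by apply: ccD; [exact: cc_cut cdchi dc0 cg|exact: cc_cut cchi c0 cdg].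
move=> y; have [yk|yk] := lerP (normsq y) k.
  have := @is_deriveM R _ chi g y _ _ _ (dchiE y) (dgE y yk).
  by move/is_derive_eq; apply; rewrite addrC mulrC.
rewrite c0 ?dc0 ?ltW// !mul0r addr0; apply: is_derive_near0.
by apply: filterS (near_normsq_gt yk) => z /ltW/c0 ->; rewrite mul0r.
Qed.

Lemma integral4_gt0 f (y0 : 'rV[R]_4) :
  cc f -> (forall y, 0 <= f y) -> 0 < f y0 -> 0 < integral4 f.
Proof.
move=> ccf f0 fy0; have iF := cc_integrable ccf; have [cf _] := ccf.
have c0 : 0 < f y0 / 2 by rewrite divr_gt0.
have /nbhs_ballP[e /= e0 eP] : nbhs y0 [set y | f y0 / 2 < f y].
  by have := cf y0; move/cvgr_gt; apply; rewrite ltr_pdivrMr// ltr_pMr// ltr1n.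
(* A box with sides [e] centred at [y0]: it lies in the sup-norm ball of radius [e], where [f]
   exceeds half of [f y0], and its measure is [e^4]. *)
pose I j : set (measurableTypeR R) := `[y0 0 j - e / 2, y0 0 j + e / 2]%classic.
pose B : set (R4 R) := I (Ordinal (isT : 0 < 4)%N) `*` I (Ordinal (isT : 1 < 4)%N) `*` I (Ordinal (isT : 2 < 4)%N) `*` I (Ordinal (isT : 3 < 4)%N).
have mI j : lebesgue_measure (I j) = e%:E.
  rewrite /I lebesgue_measure_itv/= lte_fin ltrD2l gtrN ?divr_gt0// -EFinB; congr _%:E.
  by field.
have mI' j : measurable (I j) by exact: measurable_itv.
have mB : measurable B by do 3! (apply: measurableX; last exact: mI').
have mBE : lebesgue_measure4 B = (e * e * e * e)%:E.
  rewrite /B /lebesgue_measure4.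
  rewrite product_measure1E /=; [|by do 2! (apply: measurableX; last exact: mI')|exact: mI'].
  rewrite product_measure1E /=; [|by apply: measurableX; exact: mI'|exact: mI'].
  rewrite product_measure1E /=; [|exact: mI'|exact: mI'].
  by rewrite !EFinM !mI.
have Bf x : B x -> f y0 / 2 <= f (vec4 x).
  case: x => -[[a b] c] d /= -[[[/= Ha Hb] Hc] Hd].
  apply/ltW/eP; split => // i j; rewrite (ord1 i) mxE /ball/=.
  have K (z w : R) : z - e / 2 <= w <= z + e / 2 -> `|z - w| < e.
    move=> /andP[z1 z2]; apply: (@le_lt_trans _ _ (e / 2)).
      by rewrite ler_norml; apply/andP; split; lra.
    by rewrite ltr_pdivrMr// ltr_pMr// ltr1n.
  move: Ha Hb Hc Hd; rewrite /I /= !in_itv/= => Ha Hb Hc Hd.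
  by case: j => [[|[|[|[|//]]]] jj] /=; apply: K;
    rewrite (bool_irrelevance jj isT).
have mf : measurable_fun setT (fun x => (f (vec4 x))%:E) by exact: measurable_int iF.
have : (0 < \int[@lebesgue_measure4 R]_x (f (vec4 x))%:E)%E.
  apply: (@lt_le_trans _ _ (\int[@lebesgue_measure4 R]_(x in B) (f y0 / 2)%:E)%E).
    rewrite integral_cst//= -[X in (_ * X)%E]/(lebesgue_measure4 B) mBE -EFinM lte_fin !mulr_gt0//.
  apply: (@le_trans _ _ (\int[@lebesgue_measure4 R]_(x in B) (f (vec4 x))%:E)%E).
    apply: ge0_le_integral => //.
    - by move=> x _; rewrite lee_fin ltW.
    - by apply: measurable_funTS.
  by apply: ge0_subset_integral => //; move=> x _; rewrite lee_fin.
have /fineK <- : (\int[@lebesgue_measure4 R]_x (f (vec4 x))%:E)%E \is a fin_num.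
  exact: integrable_fin_num.
by rewrite lte_fin.
Qed.

Lemma compact_bound_param (F : R * 'rV[R]_4 -> R) (u v k : R) : u <= v ->
  (forall s y, u <= s <= v -> normsq y <= k -> {for (s, y), continuous F}) ->
  exists2 C : R, 0 <= C & forall s y, u <= s <= v -> normsq y <= k -> `|F (s, y)| <= C.
Proof.
move=> uv cF.
have [ne|ne] := pselect (exists y : 'rV[R]_4, normsq y <= k); last first.
  by exists 0 => // s y _ yk; exfalso; apply: ne; exists y.
have [y0 y0k] := ne.
pose K : set (R * 'rV[R]_4) := `[u, v]%classic `*` [set y | normsq y <= k].
have [|||c cK cE] := @compact_EVT_max _ R (fun p => `|F p|) K.
- by exists (u, y0); split => //=; rewrite in_itv/= lexx.
- by apply: compact_setX; [exact: segment_compact|exact: compact_normsq].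
- apply: continuous_in_subspaceT => -[s y]; rewrite inE /K /= => -[]; rewrite in_itv/= => su yk.
  by apply: (@continuous_comp _ _ _ F (@Num.norm _ R)); [exact: cF|exact: norm_continuous].
exists (`|F c|) => // s y su yk; by apply: cE; rewrite inE; split.
Qed.

Lemma integral4_is_derive (F dF : R -> 'rV[R]_4 -> R) (u v k s : R) :
  (forall s y, u < s < v -> normsq y <= k -> is_derive s 1 (F ^~ y) (dF s y)) ->
  (forall s y, u < s < v -> k <= normsq y -> F s y = 0) ->
  (forall s y, u < s < v -> k <= normsq y -> dF s y = 0) ->
  (forall s, u < s < v -> cc (F s)) ->
  (forall s y, u < s < v -> normsq y <= k ->
     {for (s, y), continuous (fun p : R * 'rV[R]_4 => dF p.1 p.2)}) ->
  u < s < v -> is_derive s 1 (fun s => integral4 (F s)) (integral4 (dF s)).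
Proof.
move=> Fd F0 dF0 ccF cdF /andP[us sv].
pose a := (u + s) / 2; pose b := (s + v) / 2.
have ua : u < a by rewrite /a; lra.
have as_ : a < s by rewrite /a; lra.
have sb : s < b by rewrite /b; lra.
have bv : b < v by rewrite /b; lra.
have J r : a <= r <= b -> u < r < v.
  by move=> /andP[ar rb]; rewrite (lt_le_trans ua ar) (le_lt_trans rb bv).
have J' r : r \in `]a, b[ -> u < r < v.
  by rewrite in_itv/= => /andP[ar rb]; apply: J; rewrite !ltW.
have [C C0 dFC] := @compact_bound_param (fun p => dF p.1 p.2) a b k
  (ltW (lt_trans as_ sb)) (fun r y rab yk => cdF r y (J r rab) yk).
have Fd' r y : u < r < v -> is_derive r 1 (F ^~ y) (dF r y).
  move=> ur; have [yk|/ltW yk] := lerP (normsq y) k; first exact: Fd.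
  rewrite dF0//; apply: is_derive_near0.
  have H : \forall t \near r, t \in `]u, v[ by apply: near_in_itvoo; rewrite in_itv.
  by apply: filterS H => t; rewrite in_itv/= => tu; rewrite F0.
have sJ : `]a, b[%classic s by rewrite /= in_itv/= as_ sb.
have iF r : `]a, b[%classic r -> (@lebesgue_measure4 R).-integrable setT (EFin \o (fun x => F r (vec4 x))).
  by move=> /J' rJ; apply: cc_integrable; exact: ccF.
have dFx r x : `]a, b[%classic r -> [set: R4 R] x -> derivable (fun t => F t (vec4 x)) r 1.
  by move=> /J' rJ _; have [] := Fd' r (vec4 x) rJ.
(* An integrable majorant in [cc]: it is at least [C] where [normsq y <= k], and beyond that the
   derivative vanishes. *)
pose G (y : 'rV[R]_4) : R := C * pos (k + 1 - normsq y).
have ccG : cc G.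
  split; last by exists (k + 1) => y ky; rewrite /G pos0 ?mulr0// subr_le0.
  apply: (@continuous_radial 4 (fun t => C * pos (k + 1 - t))) => t.
  apply: cvgM; first exact: cvg_cst.
  apply: (@continuous_comp _ _ _ (fun t : R => k + 1 - t) pos); last exact: continuous_pos.
  by apply: cvgB; [exact: cvg_cst|exact: cvg_id].
pose G' (x : R4 R) : R := G (vec4 x).
have G'0 x : 0 <= G' x by rewrite mulr_ge0// pos_ge0.
have iG : (@lebesgue_measure4 R).-integrable setT (EFin \o G') by exact: cc_integrable.
have GdF r x : `]a, b[%classic r -> [set: R4 R] x -> `|partial1of2 (fun t x => F t (vec4 x)) r x| <= G' x.
  move=> rJ _; rewrite partial1of2E; have rJ' := J' _ rJ.
  have [_ ->] := Fd' r (vec4 x) rJ'.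
  have [xk|/ltW xk] := lerP (normsq (vec4 x)) k; last by rewrite dF0// normr0.
  apply: (@le_trans _ _ C); last first.
    rewrite /G' /G ler_peMr// pos_nneg; lra.
  by apply: dFC => //; move: rJ; rewrite /= in_itv/= => /andP[/ltW -> /ltW ->].
have D := derivable_under_integral measurableT sJ iF dFx G'0 iG GdF.
have E := differentiation_under_integral measurableT sJ iF dFx G'0 iG GdF.
apply: DeriveDef; first exact: D.
rewrite -derive1E [LHS]E; apply: eq_Rintegral => x _.
by rewrite partial1of2E; have [_ ->] := Fd' s (vec4 x) (J' _ sJ).
Qed.

End integral_tools.

(** * Smooth functions and partial derivatives on an open set *)

Section smooth_closure.
Context {R : realType}.
Implicit Types (V W : normedModType R).

Lemma smooth_on_diff V W (U : set V) (f : V -> W) x :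
  smooth_on U f -> U x -> differentiable f x.
Proof. by move=> sf; apply: (sf [::]). Qed.

Lemma smooth_on_continuous V W (U : set V) (f : V -> W) x :
  smooth_on U f -> U x -> {for x, continuous f}.
Proof. by move=> sf Ux; apply: differentiable_continuous; exact: smooth_on_diff sf Ux. Qed.

Lemma smooth_on_derive V W (U : set V) (f : V -> W) v :
  smooth_on U f -> smooth_on U ('D_v f).
Proof.
move=> /smooth_onP sf; apply/smooth_onP => k.
by have [_] := sf k.+1; exact.
Qed.

Lemma smooth_on_eq V W (U : set V) (f g : V -> W) : open U ->
  (forall x, U x -> f x = g x) -> smooth_on U f -> smooth_on U g.
Proof.
by move=> oU fg /smooth_onP sf; apply/smooth_onP => k; exact: csmooth_eq oU fg (sf k).
Qed.

Lemma smooth_on_cst V W (U : set V) (c : W) : smooth_on U (fun=> c).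
Proof. by apply/smooth_onP => k; exact: csmooth_cst. Qed.

Lemma smooth_onD V W (U : set V) (f g : V -> W) : open U ->
  smooth_on U f -> smooth_on U g -> smooth_on U (fun x => f x + g x).
Proof.
by move=> oU /smooth_onP sf /smooth_onP sg; apply/smooth_onP => k; exact: csmoothD.
Qed.

Lemma smooth_on_sum V W (U : set V) (I : Type) (r : seq I) (P : pred I) (f : I -> V -> W) :
  open U -> (forall i, smooth_on U (f i)) ->
  smooth_on U (fun x => \sum_(i <- r | P i) f i x).
Proof.
move=> oU sf; apply/smooth_onP => k; apply: csmooth_sum => // i _.
by have /smooth_onP := sf i; exact.
Qed.

Lemma smooth_onZ V W (U : set V) (c : V -> R) (f : V -> W) : open U ->
  smooth_on U c -> smooth_on U f -> smooth_on U (fun x => c x *: f x).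
Proof.
by move=> oU /smooth_onP sf /smooth_onP sg; apply/smooth_onP => k; exact: csmoothZ.
Qed.

Lemma smooth_onM V (U : set V) (c f : V -> R) : open U ->
  smooth_on U c -> smooth_on U f -> smooth_on U (fun x => c x * f x).
Proof. exact: smooth_onZ. Qed.

Lemma smooth_onN V W (U : set V) (f : V -> W) : open U ->
  smooth_on U f -> smooth_on U (fun x => - f x).
Proof.
move=> oU sf; apply: (smooth_on_eq oU (f := fun x => (fun=> -1) x *: f x)).
  by move=> x _; rewrite scaleN1r.
by apply: smooth_onZ => //; exact: smooth_on_cst.
Qed.

Lemma smooth_onB V W (U : set V) (f g : V -> W) : open U ->
  smooth_on U f -> smooth_on U g -> smooth_on U (fun x => f x - g x).
Proof. by move=> oU sf sg; apply: smooth_onD => //; exact: smooth_onN. Qed.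

Lemma smooth_onX V (U : set V) (f : V -> R) k : open U ->
  smooth_on U f -> smooth_on U (fun x => f x ^+ k).
Proof.
move=> oU sf; elim: k => [|k IH].
  by under eq_fun do rewrite expr0; exact: smooth_on_cst.
by under eq_fun do rewrite exprS; exact: smooth_onM.
Qed.

Lemma smooth_on_bilin n (E W : normedModType R) (O : set E)
    (B : 'rV[R]_n -> 'rV[R]_n -> W) (f g : E -> 'rV[R]_n) : open O ->
  (forall v, linear (B ^~ v)) -> (forall u, linear (B u)) ->
  smooth_on O f -> smooth_on O g -> smooth_on O (fun y => B (f y) (g y)).
Proof.
move=> oO Bl Br /smooth_onP sf /smooth_onP sg; apply/smooth_onP => k.
by apply: csmooth_bilin => //; exact: continuous_bilinear.
Qed.

Lemma smooth_on_coord m (U : set 'rV[R]_m) i : open U ->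
  smooth_on U (fun y => y 0 i).
Proof.
by move=> oU; apply/smooth_onP => k; apply: csmooth_coord => //; exact: csmooth_id.
Qed.

Lemma smooth_on_normsq m (U : set 'rV[R]_m) : open U -> smooth_on U (@normsq R m).
Proof. by move=> oU; apply/smooth_onP => k; exact: csmooth_normsq. Qed.

Lemma smooth_on_comp (E W : normedModType R) m (O : set E) (Q : set 'rV[R]_m)
    (f : 'rV[R]_m -> W) (g : E -> 'rV[R]_m) :
  open O -> (forall x, O x -> Q (g x)) ->
  smooth_on Q f -> smooth_on O g -> smooth_on O (fun x => f (g x)).
Proof.
move=> oO OQ /smooth_onP sf /smooth_onP sg; apply/smooth_onP => k.
exact: csmooth_comp oO OQ (sf k) (sg k).
Qed.

End smooth_closure.

(* Sealed, because unfolding the library's derivative makes conversion explode. *)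
HB.lock Definition pd (R : realType) (m : nat) (W : normedModType R) (i : 'I_m)
  (f : 'rV[R]_m -> W) : 'rV[R]_m -> W := 'D_(delta_mx 0 i) f.

Lemma pdE (R : realType) m (W : normedModType R) (i : 'I_m) (f : 'rV[R]_m -> W) :
  'D_(delta_mx 0 i) f = pd i f.
Proof. by rewrite pd.unlock. Qed.

Section partial_derivatives.
Context {R : realType} {m : nat} {U : set 'rV[R]_m} (oU : open U).
Implicit Types (W : normedModType R) (i j : 'I_m).

Lemma smooth_on_pd W i (f : 'rV[R]_m -> W) : smooth_on U f -> smooth_on U (pd i f).
Proof. by rewrite -pdE; exact: smooth_on_derive. Qed.

Lemma is_derive_pd W i (f : 'rV[R]_m -> W) y : smooth_on U f -> U y ->
  is_derive y (delta_mx 0 i) f (pd i f y).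
Proof.
move=> sf Uy; rewrite -pdE; apply: DeriveDef => //.
apply: diff_derivable; exact: smooth_on_diff sf Uy.
Qed.

Lemma is_derive_pdE W i (f : 'rV[R]_m -> W) y d :
  is_derive y (delta_mx 0 i) f d -> pd i f y = d.
Proof. by move=> H; rewrite -pdE; exact: (@derive_val _ _ _ _ _ _ _ H). Qed.

Lemma pd_eq W i (f g : 'rV[R]_m -> W) y : (forall x, U x -> f x = g x) -> U y ->
  pd i f y = pd i g y.
Proof.
move=> fg Uy; rewrite -!pdE; apply: near_eq_derive.
by apply: filterS (open_nbhs_nbhs (conj oU Uy)) => x /fg.
Qed.

Lemma pd_cst W i (c : W) y : pd i (fun=> c) y = 0.
Proof. by rewrite -pdE; exact: derive_cst. Qed.

Lemma pdD W i (f g : 'rV[R]_m -> W) y : smooth_on U f -> smooth_on U g -> U y ->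
  pd i (fun x => f x + g x) y = pd i f y + pd i g y.
Proof.
move=> sf sg Uy; apply: is_derive_pdE.
exact: is_deriveD (is_derive_pd i sf Uy) (is_derive_pd i sg Uy).
Qed.

Lemma pd_sum W i (I : Type) (r : seq I) (f : I -> 'rV[R]_m -> W) y :
  (forall k, smooth_on U (f k)) -> U y ->
  pd i (fun x => \sum_(k <- r) f k x) y = \sum_(k <- r) pd i (f k) y.
Proof.
move=> sf Uy; elim: r => [|k r IH].
  rewrite big_nil -[RHS](pd_cst i (0 : W) y).
  by apply: pd_eq Uy => x _; rewrite big_nil.
rewrite big_cons -IH -pdD//; last exact: smooth_on_sum.
by apply: pd_eq Uy => x _; rewrite big_cons.
Qed.

Lemma pd_bilin n W (B : 'rV[R]_n -> 'rV[R]_n -> W) (f g : 'rV[R]_m -> 'rV[R]_n) i y :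
  (forall v, linear (B ^~ v)) -> (forall u, linear (B u)) ->
  smooth_on U f -> smooth_on U g -> U y ->
  pd i (fun x => B (f x) (g x)) y = B (pd i f y) (g y) + B (f y) (pd i g y).
Proof.
move=> Bl Br sf sg Uy; rewrite -!pdE.
exact: (derive_bilin2 Bl Br (continuous_bilinear Bl Br) _
  (smooth_on_diff sf Uy) (smooth_on_diff sg Uy)).
Qed.

Lemma pdZ W (c : 'rV[R]_m -> R) (f : 'rV[R]_m -> W) i y :
  smooth_on U c -> smooth_on U f -> U y ->
  pd i (fun x => c x *: f x) y = pd i c y *: f y + c y *: pd i f y.
Proof.
move=> sc sf Uy; rewrite -!pdE.
have Bl : forall v : W, linear ( *:%R^~ v : R -> W).
  by move=> v a x z; rewrite scalerDl scalerA.
have Br : forall u : R, linear ( *:%R u : W -> W).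
  by move=> u a x z; rewrite scalerDr !scalerA mulrC.
have H := derive_bilin2 Bl Br (@scale_continuous _ _) (delta_mx 0 i)
  (smooth_on_diff sc Uy) (smooth_on_diff sf Uy).
exact: H.
Qed.

Lemma pdM (c f : 'rV[R]_m -> R) i y : smooth_on U c -> smooth_on U f -> U y ->
  pd i (fun x => c x * f x) y = pd i c y * f y + c y * pd i f y.
Proof. exact: pdZ. Qed.

Lemma pdN W i (f : 'rV[R]_m -> W) y : smooth_on U f -> U y ->
  pd i (fun x => - f x) y = - pd i f y.
Proof.
by move=> sf Uy; apply: is_derive_pdE; exact: is_deriveN (is_derive_pd i sf Uy).
Qed.

Lemma pdB W i (f g : 'rV[R]_m -> W) y : smooth_on U f -> smooth_on U g -> U y ->
  pd i (fun x => f x - g x) y = pd i f y - pd i g y.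
Proof. by move=> sf sg Uy; rewrite pdD ?pdN//; exact: smooth_onN. Qed.

Lemma pd_coord i j y : pd i (fun x : 'rV[R]_m => x 0 j) y = (i == j)%:R.
Proof.
rewrite -pdE -(derive_coord _ _ _ (differentiable_id _)) derive_id mxE eqxx/=.
by rewrite eq_sym.
Qed.

Lemma pd_normsq i (y : 'rV[R]_m) : U y -> pd i (@normsq R m) y = 2 * y 0 i.
Proof.
move=> Uy.
rewrite (_ : normsq (m:=m) = fun x : 'rV[R]_m => \sum_j x 0 j * x 0 j); last first.
  by apply/funext => x; apply: eq_bigr => j _; rewrite expr2.
have sc j : smooth_on U (fun x : 'rV[R]_m => x 0 j) by exact: smooth_on_coord.
rewrite (@pd_sum R i 'I_m _ (fun j x => x 0 j * x 0 j))//; last by move=> j; exact: smooth_onM.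
rewrite (bigD1 i)//= pdM// pd_coord eqxx mul1r mulr1 big1 ?addr0 ?mulr_natl ?mulr2n//.
by move=> j /negPf ji; rewrite pdM// pd_coord eq_sym ji mul0r mulr0 addr0.
Qed.

Lemma pd_swap n (f : 'rV[R]_m -> 'rV[R]_n) i j y : smooth_on U f -> U y ->
  pd i (pd j f) y = pd j (pd i f) y.
Proof.
by move=> /smooth_onP sf Uy; rewrite -!pdE; exact: derive_swap oU (sf 2%N) Uy.
Qed.

Lemma pd_swap_R (f : 'rV[R]_m -> R) i j y : smooth_on U f -> U y ->
  pd i (pd j f) y = pd j (pd i f) y.
Proof.
by move=> /smooth_onP sf Uy; rewrite -!pdE; exact: derive_swap_R oU (sf 2%N) Uy.
Qed.

Lemma pd_comp W k (Q : set 'rV[R]_k) (f : 'rV[R]_k -> W) (g : 'rV[R]_m -> 'rV[R]_k) i y :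
  (forall x, U x -> Q (g x)) -> smooth_on Q f -> smooth_on U g -> U y ->
  pd i (fun x => f (g x)) y = \sum_b pd i (fun x => g x 0 b) y *: pd b f (g y).
Proof.
move=> UQ sf sg Uy; have dg := smooth_on_diff sg Uy.
rewrite -pdE (derive_comp_rV _ dg (smooth_on_diff sf (UQ _ Uy))).
by apply: eq_bigr => b _; rewrite -!pdE (derive_coord _ _ _ dg).
Qed.

End partial_derivatives.

Ltac smooth := repeat first
  [ done
  | match goal with
    | |- smooth_on _ (fun=> ?c) => apply: smooth_on_cst
    | |- smooth_on _ (fun x => _ + _) => apply: smooth_onD
    | |- smooth_on _ (fun x => - _) => apply: smooth_onN
    | |- smooth_on _ (fun x => _ *: _) => apply: smooth_onZ
    | |- smooth_on _ (fun x => _ * _) => apply: smooth_onM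
    | |- smooth_on _ (fun x => _ ^+ _) => apply: smooth_onX
    | |- smooth_on _ (fun x => fun_of_matrix x _ _) => apply: smooth_on_coord
    | |- smooth_on _ (fun x => bigop _ _ _) => apply: smooth_on_sum => [|?]
    | |- smooth_on _ (pd _ _) => apply: smooth_on_pd
    | |- smooth_on _ (fun x => pd _ _ x) => apply: smooth_on_pd
    end
  | solve [auto] ].

Lemma normsq0 (R : realType) m : normsq (0 : 'rV[R]_m) = 0.
Proof. by rewrite /normsq big1// => i _; rewrite mxE expr0n. Qed.

(** * Connections and curvature *)

(** All that the analysis retains of the group. The last field is the infinitesimal form of
    Ad-invariance; it makes the inner product compatible with covariant derivatives ([pd_ip]). *)
Record metric_lie_algebra (R : realType) := MetricLieAlgebra {
  la_dim : nat;
  br : 'rV[R]_la_dim -> 'rV[R]_la_dim -> 'rV[R]_la_dim;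
  ip : 'rV[R]_la_dim -> 'rV[R]_la_dim -> R;
  la_br_linear : forall a X Y Z, br (a *: X + Y) Z = a *: br X Z + br Y Z;
  brC : forall X Y, br X Y = - br Y X;
  la_jacobi : forall X Y Z, br X (br Y Z) + br Y (br Z X) + br Z (br X Y) = 0;
  ipC : forall X Y, ip X Y = ip Y X;
  la_ip_linear : forall a X Y Z, ip (a *: X + Y) Z = a * ip X Z + ip Y Z;
  ip_gt0 : forall X, X != 0 -> 0 < ip X X;
  la_ip_br : forall X Y Z, ip (br Z X) Y + ip X (br Z Y) = 0 }.

Section lie_algebra.
Context {R : realType} {g : metric_lie_algebra R}.
Local Notation V := 'rV[R]_(la_dim g).
Implicit Types (X Y Z : V).

Lemma br_linearl Y : linear (fun X => br X Y).
Proof. by move=> a X Z; rewrite la_br_linear. Qed.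

Lemma br_linearr X : linear (br X : V -> V).
Proof. by move=> a Y Z; rewrite brC la_br_linear opprD -scalerN -!brC. Qed.

Lemma ip_linl Y : linear (fun X => ip X Y : R^o).
Proof. by move=> a X Z; rewrite la_ip_linear. Qed.

Lemma ip_linr X : linear (ip X : V -> R^o).
Proof. by move=> a Y Z; rewrite ipC la_ip_linear -!(ipC X). Qed.

Lemma brDl X Y Z : br (X + Y) Z = br X Z + br Y Z.
Proof. by rewrite -[X]scale1r la_br_linear !scale1r. Qed.
Lemma br0l Z : br 0 Z = 0 :> V.
Proof. by apply: (addrI (br 0 Z)); rewrite -brDl !addr0. Qed.
Lemma brZl a X Z : br (a *: X) Z = a *: br X Z.
Proof. by rewrite -[_ *: X]addr0 la_br_linear br0l addr0. Qed.
Lemma brNl X Z : br (- X) Z = - br X Z.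
Proof. by rewrite -scaleN1r brZl scaleN1r. Qed.
Lemma brBl X Y Z : br (X - Y) Z = br X Z - br Y Z.
Proof. by rewrite brDl brNl. Qed.
Lemma brDr X Y Z : br Z (X + Y) = br Z X + br Z Y.
Proof. by rewrite brC brDl opprD -!(brC Z). Qed.
Lemma br0r Z : br Z 0 = 0 :> V.
Proof. by rewrite brC br0l oppr0. Qed.
Lemma brZr a X Z : br Z (a *: X) = a *: br Z X.
Proof. by rewrite brC brZl -scalerN -brC. Qed.
Lemma brNr X Z : br Z (- X) = - br Z X.
Proof. by rewrite -scaleN1r brZr scaleN1r. Qed.
Lemma brBr X Y Z : br Z (X - Y) = br Z X - br Z Y.
Proof. by rewrite brDr brNr. Qed.
Lemma br_suml (I : Type) (r : seq I) (F : I -> V) Z :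
  br (\sum_(i <- r) F i) Z = \sum_(i <- r) br (F i) Z.
Proof. by elim: r => [|i r IH]; rewrite ?big_nil ?br0l// !big_cons brDl IH. Qed.
Lemma br_sumr (I : Type) (r : seq I) (F : I -> V) Z :
  br Z (\sum_(i <- r) F i) = \sum_(i <- r) br Z (F i).
Proof. by elim: r => [|i r IH]; rewrite ?big_nil ?br0r// !big_cons brDr IH. Qed.

Lemma ipDl X Y Z : ip (X + Y) Z = ip X Z + ip Y Z.
Proof. by rewrite -[X]scale1r la_ip_linear !scale1r mul1r. Qed.
Lemma ip0l Z : ip 0 Z = 0.
Proof. by apply: (addrI (ip 0 Z)); rewrite -ipDl !addr0. Qed.
Lemma ipZl a X Z : ip (a *: X) Z = a * ip X Z.
Proof. by rewrite -[_ *: X]addr0 la_ip_linear ip0l addr0. Qed.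
Lemma ipNl X Z : ip (- X) Z = - ip X Z.
Proof. by rewrite -scaleN1r ipZl mulN1r. Qed.
Lemma ipBl X Y Z : ip (X - Y) Z = ip X Z - ip Y Z.
Proof. by rewrite ipDl ipNl. Qed.
Lemma ipDr X Y Z : ip Z (X + Y) = ip Z X + ip Z Y.
Proof. by rewrite ipC ipDl !(ipC Z). Qed.
Lemma ip0r Z : ip Z 0 = 0.
Proof. by rewrite ipC ip0l. Qed.
Lemma ipZr a X Z : ip Z (a *: X) = a * ip Z X.
Proof. by rewrite ipC ipZl (ipC Z). Qed.
Lemma ipNr X Z : ip Z (- X) = - ip Z X.
Proof. by rewrite ipC ipNl (ipC Z). Qed.
Lemma ipBr X Y Z : ip Z (X - Y) = ip Z X - ip Z Y.
Proof. by rewrite ipDr ipNr. Qed.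
Lemma ip_suml (I : Type) (r : seq I) (F : I -> V) Z :
  ip (\sum_(i <- r) F i) Z = \sum_(i <- r) ip (F i) Z.
Proof. by elim: r => [|i r IH]; rewrite ?big_nil ?ip0l// !big_cons ipDl IH. Qed.
Lemma ip_sumr (I : Type) (r : seq I) (F : I -> V) Z :
  ip Z (\sum_(i <- r) F i) = \sum_(i <- r) ip Z (F i).
Proof. by elim: r => [|i r IH]; rewrite ?big_nil ?ip0r// !big_cons ipDr IH. Qed.

Lemma ip_ge0 X : 0 <= ip X X.
Proof. by case: (eqVneq X 0) => [->|/ip_gt0/ltW//]; rewrite ip0l. Qed.

Lemma ip_eq0 X : ip X X = 0 -> X = 0.
Proof. by case: (eqVneq X 0) => // /ip_gt0 + E; rewrite E ltxx. Qed.

Lemma brDerive X Y Z : br X (br Y Z) = br (br X Y) Z + br Y (br X Z).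
Proof.
have := la_jacobi X Y Z; rewrite (brC Z (br X Y)) (brC Z X) brNr => /eqP.
by rewrite -addrA addr_eq0 opprD !opprK addrC => /eqP.
Qed.

Lemma ip_young X Y (l : R) : 0 < l -> 2 * ip X Y <= l * ip X X + l^-1 * ip Y Y.
Proof.
move=> l0; have := ip_ge0 (l *: X - Y).
rewrite ipBl !ipBr !ipZl !ipZr (ipC Y X) => H.
rewrite -(ler_pM2l l0) mulrDr mulrA (mulrA l l^-1) divff ?gt_eqF// mul1r; nra.
Qed.

Lemma ip_CS X Y : `|2 * ip X Y| <= ip X X + ip Y Y.
Proof.
have H W : 2 * ip W Y <= ip W W + ip Y Y.
  by have := ip_young W Y ltr01; rewrite invr1 !mul1r.
rewrite ler_norml H andbT.
by have := H (- X); rewrite !ipNl ipNr opprK; lra.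
Qed.

Lemma ip_coercive : exists2 K : R, 0 < K & forall X, normsq X <= K * ip X X.
Proof.
have ci : continuous (fun X : V => ip X X).
  have sid : smooth_on [set: V] id by apply/smooth_onP => k; exact: csmooth_id openT.
  move=> X; exact: smooth_on_continuous (smooth_on_bilin openT ip_linl ip_linr sid sid) I.
(* The added bump keeps [d] positive at 0, so that [1 / d] is continuous, hence bounded, on the
   closed unit ball; on the unit sphere the bump is 0 and [d X = ip X X]. *)
pose d X := ip X X + pos (2^-1 - normsq X).
have d0 X : 0 < d X.
  rewrite /d; case: (eqVneq X 0) => [->|X0]; last first.
    by rewrite ltr_pwDl ?ip_gt0 ?pos_ge0.
  have h0 : 0 < 2^-1 :> R by lra.
  by rewrite ip0l add0r normsq0 subr0; exact: lt_le_trans h0 (le_pos _).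
have cd : continuous (fun X => (d X)^-1).
  move=> X; have dX : d X != 0 by rewrite gt_eqF.
  suff cdX : {for X, continuous d} by exact: (cvgV dX cdX).
  have cp : {for X, continuous (fun X : V => pos (2^-1 - normsq X))}.
    apply: (@continuous_comp _ _ _ (fun X : V => 2^-1 - normsq X) pos); last exact: continuous_pos.
    have cn : {for X, continuous (@normsq R (la_dim g))} by exact: continuous_normsq.
    exact: (cvgB (@cst_continuous _ _ (2^-1 : R) X) cn).
  exact: (cvgD (ci X) cp).
have [C C0 HC] := @compact_bound R _ (fun X : V => (d X)^-1) 1 (fun y _ => cd y).
exists (C + 1); first by rewrite ltr_wpDl.
move=> X; case: (eqVneq (normsq X) 0) => [->|X0].
  by rewrite mulr_ge0 ?ip_ge0// addr_ge0.
have NX : 0 < normsq X by rewrite lt_neqAle eq_sym X0 normsq_ge0.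
pose a := (Num.sqrt (normsq X))^-1.
have a2 : a ^+ 2 * normsq X = 1.
  by rewrite exprVn sqr_sqrtr ?normsq_ge0// mulVf.
have E : normsq (a *: X) = 1.
  rewrite -a2 /normsq mulr_sumr; apply: eq_bigr => i _; by rewrite mxE exprMn.
have := HC (a *: X); rewrite E => /(_ (lexx _)); rewrite /d E pos0 ?addr0; last by lra.
rewrite ipZl ipZr ger0_norm; last by rewrite invr_ge0 !mulr_ge0 ?ip_ge0// invr_ge0 sqrtr_ge0.
have iX : 0 < ip X X by apply: ip_gt0; apply: contra_neq X0 => ->; exact: normsq0.
rewrite mulrA -expr2 => H.
have a2p : 0 < a ^+ 2 by rewrite exprn_gt0// invr_gt0 sqrtr_gt0.
have p : 0 < a ^+ 2 * ip X X by exact: mulr_gt0.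
have {}H : 1 <= C * (a ^+ 2 * ip X X) by rewrite -ler_pdivrMr// mul1r.
rewrite -(ler_pM2l a2p) a2 mulrCA mulrDl mul1r.
by apply: le_trans H _; rewrite lerDl ltW.
Qed.

(** The source of the cubic curvature estimates below. The constant depends on the algebra alone,
    not on a connection; bounds on squared norms avoid square roots of [ip X X]. *)
Lemma ip_br_bound : exists2 C : R, 0 <= C & forall X Y Z (a b c : R),
  0 <= a -> 0 <= b -> 0 <= c -> ip X X <= a ^+ 2 -> ip Y Y <= b ^+ 2 -> ip Z Z <= c ^+ 2 ->
  `|ip X (br Y Z)| <= C * (a * b * c).
Proof.
have [K K0 HK] := ip_coercive.
pose k : R := Num.sqrt K.
have k0 : 0 <= k by exact: sqrtr_ge0.
have Hk X (a : R) i : 0 <= a -> ip X X <= a ^+ 2 -> `|X 0 i| <= k * a.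
  move=> a0 Ha; rewrite -ler_sqr ?nnegrE ?mulr_ge0// real_normK ?num_real//.
  rewrite exprMn sqr_sqrtr ?(ltW K0)//; apply: le_trans (normsq_coord X i) _.
  by apply: le_trans (HK X) _; rewrite ler_pM2l.
pose S : R := \sum_i \sum_j \sum_l
  `|ip (delta_mx 0 i : V) (br (delta_mx 0 j) (delta_mx 0 l))|.
have S0 : 0 <= S by do 3 (apply: sumr_ge0 => ? _).
exists (S * k ^+ 3); first by rewrite mulr_ge0// exprn_ge0.
move=> X Y Z a b c a0 b0 c0 Ha Hb Hc.
have -> : ip X (br Y Z) = \sum_i \sum_j \sum_l X 0 i * (Y 0 j * (Z 0 l *
   ip (delta_mx 0 i : V) (br (delta_mx 0 j) (delta_mx 0 l)))).
  rewrite {1}(row_sum_delta X) ip_suml; apply: eq_bigr => i _.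
  rewrite {1}(row_sum_delta Y) br_suml ip_sumr; apply: eq_bigr => j _.
  rewrite {1}(row_sum_delta Z) br_sumr ip_sumr; apply: eq_bigr => l _.
  by rewrite brZl brZr !ipZl !ipZr.
rewrite -mulrA /S mulr_suml; apply: le_trans (ler_norm_sum _ _ _) _; apply: ler_sum => i _.
rewrite mulr_suml; apply: le_trans (ler_norm_sum _ _ _) _; apply: ler_sum => j _.
rewrite mulr_suml; apply: le_trans (ler_norm_sum _ _ _) _; apply: ler_sum => l _.
rewrite !normrM mulrA mulrA [leRHS]mulrC ler_wpM2r//.
have -> : k ^+ 3 * (a * b * c) = k * a * (k * b) * (k * c) by ring.
by rewrite !ler_pM ?mulr_ge0 ?normr_ge0// Hk.
Qed.

End lie_algebra.

(* Sealed, so that rewriting with linearity lemmas does not look inside. *)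
HB.lock Definition cov (R : realType) (g : metric_lie_algebra R) (m : nat)
    (A : 'I_m -> 'rV[R]_m -> 'rV[R]_(la_dim g)) (i : 'I_m)
    (B : 'rV[R]_m -> 'rV[R]_(la_dim g)) : 'rV[R]_m -> 'rV[R]_(la_dim g) :=
  fun y => pd i B y + br (A i y) (B y).

HB.lock Definition curv (R : realType) (g : metric_lie_algebra R) (m : nat)
    (A : 'I_m -> 'rV[R]_m -> 'rV[R]_(la_dim g)) (i j : 'I_m) :
    'rV[R]_m -> 'rV[R]_(la_dim g) :=
  fun y => pd i (A j) y - pd j (A i) y + br (A i y) (A j y).

Section gauge.
Context {R : realType} {g : metric_lie_algebra R} {m : nat}.
Local Notation V := 'rV[R]_(la_dim g).
Variables (A : 'I_m -> 'rV[R]_m -> V).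

Lemma covE i B : cov A i B = fun y => pd i B y + br (A i y) (B y).
Proof. by rewrite cov.unlock. Qed.

Lemma curvE i j : curv A i j = fun y => pd i (A j) y - pd j (A i) y + br (A i y) (A j y).
Proof. by rewrite curv.unlock. Qed.

Local Notation cov := (cov A).
Local Notation curv := (curv A).

Context {O : set 'rV[R]_m} (oO : open O) (sA : forall i, smooth_on O (A i)).

Lemma smooth_on_br (B B' : 'rV[R]_m -> V) :
  smooth_on O B -> smooth_on O B' -> smooth_on O (fun y => br (B y) (B' y)).
Proof. exact: smooth_on_bilin oO br_linearl br_linearr. Qed.

Lemma smooth_on_ip (B B' : 'rV[R]_m -> V) :
  smooth_on O B -> smooth_on O B' -> smooth_on O (fun y => ip (B y) (B' y)).
Proof. exact: (smooth_on_bilin oO ip_linl ip_linr). Qed.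

Lemma smooth_on_cov i B : smooth_on O B -> smooth_on O (cov i B).
Proof.
by move=> sB; rewrite covE; apply: smooth_onD => //; [exact: smooth_on_pd|exact: smooth_on_br].
Qed.

Lemma smooth_on_curv i j : smooth_on O (curv i j).
Proof.
rewrite curvE; apply: smooth_onD => //; last exact: smooth_on_br.
by apply: smooth_onB => //; exact: smooth_on_pd.
Qed.

Lemma pd_br i (B B' : 'rV[R]_m -> V) y : smooth_on O B -> smooth_on O B' -> O y ->
  pd i (fun x => br (B x) (B' x)) y = br (pd i B y) (B' y) + br (B y) (pd i B' y).
Proof. exact: pd_bilin br_linearl br_linearr. Qed.

Lemma cov_eq i (B B' : 'rV[R]_m -> V) y : (forall x, O x -> B x = B' x) -> O y ->
  cov i B y = cov i B' y.
Proof. by move=> BB Oy; rewrite !covE (pd_eq oO i BB Oy) BB. Qed.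

Lemma cov0 i y : cov i (fun=> 0) y = 0.
Proof. by rewrite !covE pd_cst br0r addr0. Qed.

Lemma covD i B B' y : smooth_on O B -> smooth_on O B' -> O y ->
  cov i (fun x => B x + B' x) y = cov i B y + cov i B' y.
Proof. by move=> sB sB' Oy; rewrite !covE (pdD i sB sB' Oy) brDr addrACA. Qed.

Lemma covN i B y : smooth_on O B -> O y -> cov i (fun x => - B x) y = - cov i B y.
Proof. by move=> sB Oy; rewrite !covE (pdN i sB Oy) brNr opprD. Qed.

Lemma covB i B B' y : smooth_on O B -> smooth_on O B' -> O y ->
  cov i (fun x => B x - B' x) y = cov i B y - cov i B' y.
Proof. by move=> sB sB' Oy; rewrite covD ?covN//; exact: smooth_onN. Qed.

Lemma covZ i (c : 'rV[R]_m -> R) B y : smooth_on O c -> smooth_on O B -> O y ->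
  cov i (fun x => c x *: B x) y = pd i c y *: B y + c y *: cov i B y.
Proof. by move=> sc sB Oy; rewrite !covE (pdZ i sc sB Oy) brZr scalerDr addrA. Qed.

Lemma cov_sum i (I : Type) (r : seq I) (B : I -> 'rV[R]_m -> V) y :
  (forall k, smooth_on O (B k)) -> O y ->
  cov i (fun x => \sum_(k <- r) B k x) y = \sum_(k <- r) cov i (B k) y.
Proof. by move=> sB Oy; rewrite covE (pd_sum oO i r sB Oy) br_sumr -big_split;
  apply: eq_bigr => k _; rewrite covE. Qed.

Lemma pd_ip i B B' y : smooth_on O B -> smooth_on O B' -> O y ->
  pd i (fun x => ip (B x) (B' x)) y = ip (cov i B y) (B' y) + ip (B y) (cov i B' y).
Proof.
move=> sB sB' Oy; rewrite (pd_bilin (B := @ip R g) i ip_linl ip_linr sB sB' Oy).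
by rewrite !covE ipDl ipDr addrACA la_ip_br addr0.
Qed.

Lemma curvC i j y : curv i j y = - curv j i y.
Proof. by rewrite !curvE (brC (A i y)) opprD opprB. Qed.

Lemma cov_comm i j B y : smooth_on O B -> O y ->
  cov i (cov j B) y - cov j (cov i B) y = br (curv i j y) (B y).
Proof.
move=> sB Oy.
have E k l : cov k (cov l B) y = pd k (pd l B) y + (br (pd k (A l) y) (B y) +
    br (A l y) (pd k B y)) + (br (A k y) (pd l B y) + br (A k y) (br (A l y) (B y))).
  rewrite !covE (pdD k (smooth_on_pd l sB) (smooth_on_br (sA l) sB) Oy).
  by rewrite pd_br// brDr.
rewrite !E (pd_swap oO j i sB Oy) (brDerive (A i y) (A j y)) !curvE brDl brBl.
by apply/rowP => k; rewrite !mxE; ring.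
Qed.

(** Second derivatives cancel by Clairaut's theorem, terms with one derivative and one bracket by
    antisymmetry, and double brackets by the Jacobi identity. *)
Lemma bianchi i j k y : O y ->
  cov i (curv j k) y + cov j (curv k i) y + cov k (curv i j) y = 0.
Proof.
move=> Oy.
have E a b c : cov a (curv b c) y = pd a (pd b (A c)) y - pd a (pd c (A b)) y
    + (br (pd a (A b) y) (A c y) + br (A b y) (pd a (A c) y))
    + (br (A a y) (pd b (A c) y) - br (A a y) (pd c (A b) y) + br (A a y) (br (A b y) (A c y))).
  have s1 := smooth_on_pd b (sA c); have s2 := smooth_on_pd c (sA b).
  rewrite !covE !curvE (pdD a (smooth_onB oO s1 s2) (smooth_on_br (sA b) (sA c)) Oy).
  rewrite (pdB oO a s1 s2 Oy).
  by rewrite pd_br// brDr brBr.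
rewrite !E (pd_swap oO i j (sA k) Oy) (pd_swap oO i k (sA j) Oy) (pd_swap oO j k (sA i) Oy).
have J := la_jacobi (A i y) (A j y) (A k y).
rewrite (brC (A j y) (pd i (A k) y)) (brC (A k y) (pd j (A i) y)) (brC (A i y) (pd k (A j) y)).
rewrite (brC (A j y) (pd k (A i) y)) (brC (A k y) (pd i (A j) y)) (brC (A i y) (pd j (A k) y)).
rewrite -[RHS]J.
by apply/rowP => l; rewrite !mxE; ring.
Qed.

End gauge.

Lemma smooth_on_row (R : realType) (E : normedModType R) m (U : set E)
    (f : E -> 'rV[R]_m) : open U ->
  (forall b, smooth_on U (fun y => f y 0 b)) -> smooth_on U f.
Proof.
move=> oU sf; apply: (smooth_on_eq oU (f := fun y => \sum_b f y 0 b *: delta_mx 0 b)).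
  by move=> y _; rewrite -row_sum_delta.
apply: smooth_on_sum => // b; apply: smooth_onZ => //; exact: smooth_on_cst.
Qed.

Lemma eqNr_eq0 (R : realType) (V : lmodType R) (X : V) : X = - X -> X = 0.
Proof.
move=> /eqP; rewrite -addr_eq0 -mulr2n -scaler_nat scaler_eq0 pnatr_eq0/=.
by move/eqP.
Qed.

(** * Reduction to the unit ball *)

Section pullback.
Context {R : realType} {g : metric_lie_algebra R} {k m : nat}.
Local Notation V := 'rV[R]_(la_dim g).
Variables (A : 'I_k -> 'rV[R]_k -> V) (Phi : 'rV[R]_m -> 'rV[R]_k).

Definition pull (i : 'I_m) : 'rV[R]_m -> V :=
  fun y => \sum_b pd i (fun x => Phi x 0 b) y *: A b (Phi y).

Context {O : set 'rV[R]_k} (oO : open O) (sA : forall b, smooth_on O (A b))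
  {U : set 'rV[R]_m} (oU : open U) (sPhi : smooth_on U Phi)
  (UO : forall y, U y -> O (Phi y)).

Lemma smooth_on_Phi b : smooth_on U (fun y => Phi y 0 b).
Proof.
by apply/smooth_onP => j; apply: csmooth_coord => //; move/smooth_onP: sPhi; exact.
Qed.

Lemma smooth_on_pull i : smooth_on U (pull i).
Proof.
apply: smooth_on_sum => // b; apply: smooth_onZ => //.
  by apply: smooth_on_pd; exact: smooth_on_Phi.
exact: smooth_on_comp UO (sA b) sPhi.
Qed.

Lemma cov_pull i (B : 'rV[R]_k -> V) y : smooth_on O B -> U y ->
  cov pull i (fun x => B (Phi x)) y =
  \sum_b pd i (fun x => Phi x 0 b) y *: cov A b B (Phi y).
Proof.
move=> sB Uy; rewrite covE (pd_comp i UO sB sPhi Uy) /pull br_suml -big_split/=.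
by apply: eq_bigr => b _; rewrite covE brZl scalerDr.
Qed.

Lemma curv_pull i j y : U y -> curv pull i j y = \sum_b \sum_c
  (pd i (fun x => Phi x 0 b) y * pd j (fun x => Phi x 0 c) y) *: curv A b c (Phi y).
Proof.
move=> Uy; pose a i b := pd i (fun x => Phi x 0 b) y.
have E i' j' : pd i' (pull j') y = \sum_c pd i' (pd j' (fun x => Phi x 0 c)) y *: A c (Phi y)
    + \sum_b \sum_c (a i' b * a j' c) *: pd b (A c) (Phi y).
  have sd c : smooth_on U (pd j' (fun x => Phi x 0 c)) by apply: smooth_on_pd; exact: smooth_on_Phi.
  have sAP c : smooth_on U (fun y => A c (Phi y)) by exact: smooth_on_comp UO (sA c) sPhi.
  rewrite exchange_big -big_split /=.
  rewrite (@pd_sum R m U oU _ i' _ _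
     (fun b y => pd j' (fun x => Phi x 0 b) y *: A b (Phi y))) => [|c|//]; last exact: smooth_onZ.
  apply: eq_bigr => c _; rewrite (pdZ i' (sd c) (sAP c) Uy) (pd_comp i' UO (sA c) sPhi Uy).
  rewrite scaler_sumr; congr (_ + _); apply: eq_bigr => b _.
  by rewrite scalerA mulrC.
have EB : br (pull i y) (pull j y) = \sum_b \sum_c (a i b * a j c) *: br (A b (Phi y)) (A c (Phi y)).
  rewrite br_suml; apply: eq_bigr => b _; rewrite br_sumr; apply: eq_bigr => c _.
  by rewrite brZl brZr scalerA.
have ED : \sum_b \sum_c (a j b * a i c) *: pd b (A c) (Phi y) =
   \sum_b \sum_c (a i b * a j c) *: pd c (A b) (Phi y).
  by rewrite exchange_big; do 2 (apply: eq_bigr => ? _); rewrite mulrC.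
have ES : \sum_c pd i (pd j (fun x => Phi x 0 c)) y *: A c (Phi y) =
  \sum_c pd j (pd i (fun x => Phi x 0 c)) y *: A c (Phi y).
  by apply: eq_bigr => c _; rewrite (pd_swap_R oU i j (smooth_on_Phi c) Uy).
rewrite curvE !E EB ED ES opprD addrACA subrr add0r -sumrB -big_split/=.
apply: eq_bigr => b _; rewrite -sumrB -big_split/=; apply: eq_bigr => c _.
by rewrite -scalerBr -scalerDr curvE.
Qed.

End pullback.

#[local] Opaque pull.

Section cone.
Context {R : realType}.

Definition event (tau : R) (x : 'rV[R]_4) : 'rV[R]_5 :=
  \row_b oapp (fun i => x 0 i) tau (unlift ord0 b).

Lemma event0 tau x : event tau x 0 ord0 = tau.
Proof. by rewrite mxE unlift_none. Qed.

Lemma eventS tau x i : event tau x 0 (lift ord0 i) = x 0 i.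
Proof. by rewrite mxE liftK. Qed.

Lemma row5P (p q : 'rV[R]_5) : p 0 ord0 = q 0 ord0 ->
  (forall i, p 0 (lift ord0 i) = q 0 (lift ord0 i)) -> p = q.
Proof.
by move=> h0 hS; apply/rowP => b; case: (unliftP ord0 b) => [i ->|->].
Qed.

Lemma light_coneE (p : 'rV[R]_5) : light_cone p <->
  0 < p 0 ord0 /\ \sum_(i < 4) p 0 (lift ord0 i) ^+ 2 < p 0 ord0 ^+ 2.
Proof.
have S0 : 0 <= \sum_(i < 4) p 0 (lift ord0 i) ^+ 2 by apply: sumr_ge0 => i _; exact: sqr_ge0.
rewrite /light_cone /=; rewrite /space_norm; split=> [H|[p0 H]].
  have p0 : 0 < p 0 ord0 by exact: le_lt_trans (sqrtr_ge0 _) H.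
  split=> //; rewrite -[ltLHS]sqr_sqrtr// ltr_pXn2r// ?nnegrE ?sqrtr_ge0// ltW//.
by rewrite -(ltr_pXn2r (n:=2))// ?nnegrE ?sqrtr_ge0 ?(ltW p0)// sqr_sqrtr.
Qed.

Lemma light_cone_event tau x :
  light_cone (event tau x) <-> 0 < tau /\ normsq x < tau ^+ 2.
Proof.
rewrite light_coneE event0 /normsq.
by under eq_bigr do rewrite eventS.
Qed.

Lemma open_light_cone : open (@light_cone R).
Proof.
have -> : @light_cone R = [set p | 0 < p 0 ord0] `&`
    [set p | 0 < p 0 ord0 ^+ 2 - \sum_(i < 4) p 0 (lift ord0 i) ^+ 2].
  apply/seteqP; split=> p; rewrite light_coneE /= subr_gt0//.
have H (f : 'rV[R]_5 -> R) : smooth_on setT f -> open [set p | 0 < f p].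
  move=> sf; apply: (@open_comp _ _ f [set x | 0 < x]); last exact: open_gt.
  by move=> p _; exact: smooth_on_continuous sf I.
have oT : open [set: 'rV[R]_5] by exact: openT.
apply: openI; apply: H; first exact: smooth_on_coord.
by apply: smooth_onB => //; smooth.
Qed.

(** Here [t^2 - |x|^2 = ((1 - |y|^2) / 2)^2]. Divided by [(1 - |y|^2) / 2], this is the Poincare
    ball parametrization of the unit hyperboloid; without the division, the time component is a
    polynomial and the space component is [y] itself. *)
Definition hyperboloid (y : 'rV[R]_4) : 'rV[R]_5 := event ((1 + normsq y) / 2) y.

Definition unit_ball : set 'rV[R]_4 := [set y | normsq y < 1].

Lemma open_unit_ball : open unit_ball.
Proof.
apply: (@open_comp _ _ (@normsq R 4) [set x | x < 1]); last exact: open_lt.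
by move=> p _; exact: continuous_normsq.
Qed.

Lemma hyperboloid_cone y : unit_ball y -> light_cone (hyperboloid y).
Proof.
rewrite /unit_ball /= => Uy; apply/light_cone_event; have := normsq_ge0 y => y0.
by split; first lra; rewrite expr2; nra.
Qed.

Lemma smooth_on_hyperboloid : smooth_on unit_ball hyperboloid.
Proof.
have oU := open_unit_ball.
apply: smooth_on_row => // b; case: (unliftP ord0 b) => [i ->|->].
  by under eq_fun do rewrite eventS; exact: smooth_on_coord.
under eq_fun do rewrite event0.
apply: smooth_onM; smooth; exact: smooth_on_normsq.
Qed.

Lemma pd_hyperboloid0 i y : unit_ball y ->
  pd i (fun x => hyperboloid x 0 ord0) y = y 0 i.
Proof.
move=> Uy; have oU := open_unit_ball.
under eq_fun do rewrite event0.
have s1 : smooth_on unit_ball (fun=> 1 : R) by exact: smooth_on_cst.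
have s2 := smooth_on_normsq oU.
have s3 : smooth_on unit_ball (fun=> 2^-1 : R) by exact: smooth_on_cst.
rewrite (pdM i (smooth_onD oU s1 s2) s3 Uy) (pdD i s1 s2 Uy) !pd_cst (pd_normsq oU i Uy).
by rewrite mulr0 addr0 add0r mulrAC divff ?mul1r// pnatr_eq0.
Qed.

Lemma pd_hyperboloidS i j y :
  pd i (fun x => hyperboloid x 0 (lift ord0 j)) y = (i == j)%:R.
Proof. by under eq_fun do rewrite eventS; exact: pd_coord. Qed.

Lemma sum_delta_scale (V : lmodType R) (I : finType) (i : I) (f : I -> V) :
  \sum_j (i == j)%:R *: f j = f i.
Proof.
rewrite (bigD1 i)//= eqxx scale1r big1 ?addr0// => j /negPf ji.
by rewrite eq_sym ji scale0r.
Qed.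

End cone.

Section reduction.
Context {R : realType} {g : metric_lie_algebra R}.
Local Notation V := 'rV[R]_(la_dim g).
Variable A : 'I_5 -> 'rV[R]_5 -> V.
Local Notation C := (@light_cone R).
Local Notation l := (lift ord0).
Local Notation z := (@ord0 4).
Hypothesis sA : forall b, smooth_on C (A b).
Hypothesis YM : forall b p, C p ->
  \sum_(i < 4) cov A (l i) (curv A (l i) b) p = cov A z (curv A z b) p.
Hypothesis SS : forall b p, C p -> \sum_a p 0 a *: curv A a b p = 0.
Let oC : open C := open_light_cone.
Local Notation F := (curv A).
Let sF a b : smooth_on C (F a b) := smooth_on_curv oC sA a b.

Let FC a b p : F a b p = - F b a p. Proof. exact: curvC. Qed.

Let cov_anti c a b p : C p -> cov A c (F a b) p = - cov A c (F b a) p.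
Proof.
move=> Cp; rewrite -(covN A c (sF b a) Cp).
by apply: (cov_eq A oC c _ Cp) => x _; exact: curvC.
Qed.

Let curv_diag a p : F a a p = 0.
Proof. exact/eqNr_eq0/curvC. Qed.

Lemma self_similar_cov a b p : C p -> \sum_c p 0 c *: cov A a (F c b) p = - F a b p.
Proof.
move=> Cp; have sc c : smooth_on C (fun x : 'rV[R]_5 => x 0 c) by exact: smooth_on_coord.
have := cov_eq A oC a (fun x => @SS b x) Cp; rewrite cov0.
rewrite (cov_sum A oC a _ (fun c => smooth_onZ oC (sc c) (sF c b)) Cp).
under eq_bigr do rewrite (covZ A a (sc _) (sF _ b) Cp) pd_coord.
by rewrite big_split/= sum_delta_scale addrC => /eqP; rewrite addr_eq0 => /eqP.
Qed.

(** The Bianchi identity contracted with the position vector: each of the two terms in which the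
    derivative has a free index gives back [F a b p] by [self_similar_cov]. Thus the curvature is
    covariantly homogeneous of degree -2. *)
Lemma curv_homogeneous a b p : C p -> \sum_c p 0 c *: cov A c (F a b) p = - 2 *: F a b p.
Proof.
move=> Cp.
have E1 : \sum_c p 0 c *: cov A a (F b c) p = F a b p.
  rewrite -[RHS]opprK -(self_similar_cov a b Cp) -sumrN.
  by apply: eq_bigr => c _; rewrite (cov_anti a b c Cp) scalerN.
have E2 : \sum_c p 0 c *: cov A b (F c a) p = F a b p.
  by rewrite (self_similar_cov b a Cp) (FC a b).
have : \sum_c p 0 c *: (cov A c (F a b) p + cov A a (F b c) p + cov A b (F c a) p) = 0.
  by apply: big1 => c _; rewrite (bianchi oC sA c a b Cp) scaler0.
under eq_bigr do rewrite !scalerDr.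
rewrite !big_split/= E1 E2 -addrA => /eqP; rewrite addr_eq0 => /eqP ->.
by rewrite scaleNr scaler_nat mulr2n.
Qed.

Let U := @unit_ball R.
Let oU : open U := @open_unit_ball R.
Let Phi := @hyperboloid R.
Let sPhi : smooth_on U Phi := @smooth_on_hyperboloid R.
Let UC y : U y -> C (Phi y) := @hyperboloid_cone R y.

Definition reduced := pull A Phi.
Let a := reduced.

Lemma smooth_on_reduced i : smooth_on U (a i).
Proof. exact: (smooth_on_pull sA oU sPhi UC). Qed.

Let cov_red i B y : smooth_on C B -> U y -> cov a i (fun x => B (Phi x)) y =
  y 0 i *: cov A z B (Phi y) + cov A (l i) B (Phi y).
Proof.
move=> sB Uy; rewrite (cov_pull A sPhi UC i sB Uy) big_ord_recl pd_hyperboloid0//.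
by under eq_bigr do rewrite pd_hyperboloidS; rewrite sum_delta_scale.
Qed.

Lemma curv_reduced i j y : U y -> curv a i j y =
  y 0 i *: F z (l j) (Phi y) - y 0 j *: F z (l i) (Phi y) + F (l i) (l j) (Phi y).
Proof.
move=> Uy; rewrite (curv_pull sA oU sPhi UC i j Uy).
have I b : \sum_c (pd i (fun x => Phi x 0 b) y * pd j (fun x => Phi x 0 c) y) *:
    curv A b c (Phi y) =
    pd i (fun x => Phi x 0 b) y *: (y 0 j *: F b z (Phi y) + F b (l j) (Phi y)).
  under eq_bigr do rewrite -scalerA.
  rewrite -scaler_sumr big_ord_recl pd_hyperboloid0//.
  by under eq_bigr do rewrite pd_hyperboloidS; rewrite sum_delta_scale.
under eq_bigr do rewrite I.
rewrite big_ord_recl pd_hyperboloid0//.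
under eq_bigr do rewrite pd_hyperboloidS; rewrite sum_delta_scale.
by rewrite (curv_diag z) scaler0 add0r (FC (l i) z) scalerN addrA.
Qed.

Let s (y : 'rV[R]_4) : R := (1 + normsq y) / 2.

Let ss0 y : U y -> \sum_(i < 4) y 0 i *: F (l i) z (Phi y) = 0.
Proof.
move=> Uy; have := SS z (UC Uy); rewrite big_ord_recl curv_diag scaler0 add0r.
by under eq_bigr do rewrite eventS.
Qed.

Let ssS y j : U y -> \sum_(i < 4) y 0 i *: F (l i) (l j) (Phi y) = - s y *: F z (l j) (Phi y).
Proof.
move=> Uy; have := SS (l j) (UC Uy); rewrite big_ord_recl event0 addrC => /eqP.
rewrite addr_eq0 scaleNr => /eqP <-.
by apply: eq_bigr => i _; rewrite eventS.
Qed.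

Let scale_normsq (y : 'rV[R]_4) (X : V) : \sum_i y 0 i *: (y 0 i *: X) = normsq y *: X.
Proof. by rewrite /normsq scaler_suml; apply: eq_bigr => i _; rewrite scalerA expr2. Qed.

(** By self-similarity the contraction of the spatial curvature with [y] is [- s y] times the
    electric component, and [normsq y - s y = - (1 - normsq y) / 2]. So the radial curvature of the
    reduced connection sees the electric components only, with a factor vanishing at the
    boundary. *)
Lemma radial_curv_reduced j y : U y -> \sum_i y 0 i *: curv a i j y =
  - ((1 - normsq y) / 2) *: F z (l j) (Phi y).
Proof.
move=> Uy; under eq_bigr do rewrite (curv_reduced _ j Uy) scalerDr scalerBr.
rewrite big_split/= sumrB/= scale_normsq ssS//.
under [X in _ - X]eq_bigr do rewrite scalerA mulrC -scalerA (FC z) scalerN.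
rewrite -scaler_sumr sumrN ss0// oppr0 scaler0 subr0 -scalerDl; congr (_ *: _).
by rewrite /s; lra.
Qed.

(** Conformal invariance by direct computation. After [self_similar_cov], [curv_homogeneous] and the
    equation on the cone, [F z (l j)] remains with coefficient [4 - 2 - 1 - 1 = 0], where 4 is the
    dimension, and its time derivative with coefficient [normsq y - 2 * s y + 1 = 0]. *)
Lemma yang_mills_reduced j y : U y -> \sum_i cov a i (curv a i j) y = 0.
Proof.
move=> Uy; set p := Phi y; have Cp : C p := UC Uy.
have sc i : smooth_on U (fun x : 'rV[R]_4 => x 0 i) by exact: smooth_on_coord.
have sFP b c : smooth_on U (fun x => F b c (Phi x)) by exact: smooth_on_comp UC (sF b c) sPhi.
have E i : cov a i (curv a i j) y = F z (l j) p
   + (y 0 i *: (y 0 i *: cov A z (F z (l j)) p) + y 0 i *: cov A (l i) (F z (l j)) p)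
   - ((i == j)%:R *: F z (l i) p
      + (y 0 j *: (y 0 i *: cov A z (F z (l i)) p) + y 0 j *: cov A (l i) (F z (l i)) p))
   + (y 0 i *: cov A z (F (l i) (l j)) p + cov A (l i) (F (l i) (l j)) p).
  rewrite (cov_eq a oU i (fun x Ux => curv_reduced i j Ux) Uy).
  have s1 := smooth_onZ oU (sc i) (sFP z (l j)).
  have s2 := smooth_onZ oU (sc j) (sFP z (l i)).
  rewrite (covD a i (smooth_onB oU s1 s2) (sFP (l i) (l j)) Uy).
  rewrite (covB a oU i s1 s2 Uy).
  rewrite (covZ a i (sc i) (sFP z (l j)) Uy) (covZ a i (sc j) (sFP z (l i)) Uy).
  by rewrite !pd_coord eqxx scale1r !cov_red// !scalerDr.
have H1 : \sum_i cov A (l i) (F z (l i)) p = 0.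
  have /eqP := YM z Cp; rewrite (eqNr_eq0 (cov_anti z z z Cp)) => /eqP H.
  rewrite (eq_bigr (fun i => - cov A (l i) (F (l i) z) p)) => [|i _]; last exact: cov_anti.
  by rewrite sumrN H oppr0.
have H2 := YM (l j) Cp.
have H3 : \sum_i y 0 i *: cov A (l i) (F z (l j)) p =
    - 2 *: F z (l j) p - s y *: cov A z (F z (l j)) p.
  have := curv_homogeneous z (l j) Cp; rewrite big_ord_recl event0 => <-.
  by rewrite addrC addKr; apply: eq_bigr => i _; rewrite eventS.
have H4 : \sum_i y 0 i *: cov A z (F (l i) (l j)) p =
    - F z (l j) p - s y *: cov A z (F z (l j)) p.
  have := self_similar_cov z (l j) Cp; rewrite big_ord_recl event0 => <-.
  by rewrite addrC addKr; apply: eq_bigr => i _; rewrite eventS.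
have H5 : \sum_i y 0 i *: cov A z (F z (l i)) p = 0.
  have := self_similar_cov z z Cp; rewrite big_ord_recl (eqNr_eq0 (cov_anti z z z Cp)).
  rewrite scaler0 add0r curv_diag oppr0 => H.
  rewrite (eq_bigr (fun i => - (p 0 (l i) *: cov A z (F (l i) z) p))) => [|i _].
    by rewrite sumrN H oppr0.
  by rewrite eventS (cov_anti z z (l i) Cp) scalerN.
under eq_bigr do rewrite E.
rewrite big_split/= sumrB !big_split/= -!scaler_sumr sumr_const card_ord scale_normsq.
have HD : \sum_(i < 4) (i == j)%:R *: F z (l i) p = F z (l j) p.
  under eq_bigr do rewrite eq_sym; exact: sum_delta_scale.
rewrite H3 H4 H5 H1 H2 HD !scaler0 !addr0 -scaler_nat.
by apply/rowP => c; rewrite !mxE /s; field.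
Qed.

End reduction.

(** * The Euclidean Yang-Mills equation *)

Section norm_bounds.
Context {R : realType} {g : metric_lie_algebra R}.
Local Notation V := 'rV[R]_(la_dim g).
Implicit Types (X Y Z : V) (a b c : R).

(** A bound [a] for the norm of [X], stated without the norm; it obeys the triangle inequality and
    Cauchy-Schwarz ([norm_leD], [ip_le]). *)
Definition norm_le X a : Prop := 0 <= a /\ ip X X <= a ^+ 2.

Lemma ip_le X Y a b : norm_le X a -> norm_le Y b -> ip X Y <= a * b.
Proof.
move=> [a0 Xa] [b0 Yb].
case: (eqVneq a 0) => [a00|an0].
  have -> : X = 0 by apply/ip_eq0/le_anti; rewrite ip_ge0 andbT (le_trans Xa)// a00 expr0n.
  by rewrite ip0l mulr_ge0.
case: (eqVneq b 0) => [b00|bn0].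
  have -> : Y = 0 by apply/ip_eq0/le_anti; rewrite ip_ge0 andbT (le_trans Yb)// b00 expr0n.
  by rewrite ip0r mulr_ge0.
have ap : 0 < a by rewrite lt_neqAle eq_sym an0.
have bp : 0 < b by rewrite lt_neqAle eq_sym bn0.
have := ip_young X Y (divr_gt0 bp ap); rewrite invf_div => H.
have H1 : b / a * ip X X <= b * a.
  by rewrite mulrAC ler_pdivrMr// -mulrA -expr2 ler_pM2l.
have H2 : a / b * ip Y Y <= a * b.
  by rewrite mulrAC ler_pdivrMr// -mulrA -expr2 ler_pM2l.
lra.
Qed.

Lemma norm_leD X Y a b : norm_le X a -> norm_le Y b -> norm_le (X + Y) (a + b).
Proof.
move=> Xa Yb; have H := ip_le Xa Yb; move: Xa Yb => [a0 Xa] [b0 Yb].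
by split; [exact: addr_ge0|rewrite ipDl !ipDr (ipC Y X); nra].
Qed.

Lemma norm_le0 : norm_le 0 0.
Proof. by split=> //; rewrite ip0l expr0n. Qed.

Lemma norm_leZ (k : R) X a : norm_le X a -> norm_le (k *: X) (`|k| * a).
Proof.
move=> [a0 Xa]; split; first exact: mulr_ge0.
rewrite ipZl ipZr mulrA exprMn real_normK ?num_real// expr2 ler_wpM2l//.
by rewrite -expr2 sqr_ge0.
Qed.

Lemma norm_le_trans X a b : norm_le X a -> a <= b -> norm_le X b.
Proof.
move=> [a0 Xa] ab; have b0 := le_trans a0 ab; split=> //.
by apply: le_trans Xa _; rewrite ler_sqr.
Qed.

Lemma norm_le_sum (I : Type) (r : seq I) (X : I -> V) (a : I -> R) :
  (forall i, norm_le (X i) (a i)) -> norm_le (\sum_(i <- r) X i) (\sum_(i <- r) a i).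
Proof.
move=> H; elim: r => [|i r IH]; rewrite ?big_nil ?big_cons; first exact: norm_le0.
exact: norm_leD.
Qed.

End norm_bounds.

Lemma sum4 (R : nmodType) (F : 'I_4 -> R) :
  \sum_i F i = F (@Ordinal 4 0 isT) + F (@Ordinal 4 1 isT) + F (@Ordinal 4 2 isT)
    + F (@Ordinal 4 3 isT).
Proof.
rewrite !big_ord_recl big_ord0 addr0 !addrA.
by congr (_ + _ + _ + _); congr F; exact: val_inj.
Qed.

(** * Stress tensor, Pohozaev identity and Bochner formula *)

Section flat_yang_mills.
Context {R : realType} {g : metric_lie_algebra R} {m : nat}.
Local Notation V := 'rV[R]_(la_dim g).
Variable a : 'I_m -> 'rV[R]_m -> V.
Context {U : set 'rV[R]_m} (oU : open U) (sa : forall i, smooth_on U (a i)).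
Local Notation D := (cov a).
Local Notation f := (curv a).
Hypothesis ym : forall j y, U y -> \sum_i D i (f i j) y = 0.

Let sf i j : smooth_on U (f i j) := smooth_on_curv oU sa i j.
Let sD i B : smooth_on U B -> smooth_on U (D i B) := smooth_on_cov oU sa i (B := B).
Let sc i : smooth_on U (fun y : 'rV[R]_m => y 0 i) := smooth_on_coord i oU.
Let sip (B B' : 'rV[R]_m -> V) : smooth_on U B -> smooth_on U B' -> smooth_on U (fun y => ip (B y) (B' y)).
Proof. exact: smooth_on_ip oU B B'. Qed.

Lemma cov_curvC c i j y : U y -> D c (f i j) y = - D c (f j i) y.
Proof.
move=> Uy; rewrite -(covN a c (sf j i) Uy).
by apply: (cov_eq a oU c _ Uy) => x _; exact: curvC.
Qed.

Definition dens (y : 'rV[R]_m) : R := \sum_i \sum_j ip (f i j y) (f i j y).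
Definition radial_curv (j : 'I_m) (y : 'rV[R]_m) : V := \sum_i y 0 i *: f i j y.
Definition radial_dens (y : 'rV[R]_m) : R := \sum_j ip (radial_curv j y) (radial_curv j y).
(** The stress tensor contracted with the position vector. Since [dens] sums over ordered pairs, the
    factor [4^-1] makes the tensor trace free in dimension 4. *)
Definition pohozaev (i : 'I_m) (y : 'rV[R]_m) : R :=
  \sum_k ip (f i k y) (radial_curv k y) - 4^-1 * (y 0 i * dens y).

Let sE j : smooth_on U (radial_curv j).
Proof. by apply: smooth_on_sum => // i; exact: smooth_onZ. Qed.

Lemma smooth_on_dens : smooth_on U dens.
Proof. by do 2 (apply: smooth_on_sum => // ?); exact: sip. Qed.

Lemma smooth_on_radial_dens : smooth_on U radial_dens.
Proof. by apply: smooth_on_sum => // i; exact: sip. Qed.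

Lemma smooth_on_pohozaev i : smooth_on U (pohozaev i).
Proof.
apply: smooth_onB => //; first by apply: smooth_on_sum => // k; exact: sip.
by apply: smooth_onM; [|exact: smooth_on_cst|apply: smooth_onM => //; exact: smooth_on_dens].
Qed.

Lemma dens_ge0 y : 0 <= dens y.
Proof. by do 2 (apply: sumr_ge0 => ? _); exact: ip_ge0. Qed.

Lemma pd_dens k y : U y ->
  pd k dens y = 2 * \sum_i \sum_j ip (f i j y) (D k (f i j) y).
Proof.
move=> Uy; rewrite (pd_sum oU k _ (fun i => smooth_on_sum (index_enum _) predT oU
  (fun j => sip (sf i j) (sf i j))) Uy).
rewrite mulr_sumr; apply: eq_bigr => i _.
rewrite (pd_sum oU k _ (fun j => sip (sf i j) (sf i j)) Uy) mulr_sumr.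
apply: eq_bigr => j _; rewrite (pd_ip a k (sf i j) (sf i j) Uy).
by rewrite (ipC (D _ _ _)) mulr_natl mulr2n.
Qed.

Lemma cov_radial_curv i k y : U y ->
  D i (radial_curv k) y = f i k y + \sum_j y 0 j *: D i (f j k) y.
Proof.
move=> Uy; rewrite (cov_sum a oU i _ (fun j => smooth_onZ oU (sc j) (sf j k)) Uy).
under eq_bigr do rewrite (covZ a i (sc _) (sf _ k) Uy) pd_coord.
by rewrite big_split/= sum_delta_scale.
Qed.

Lemma curv_bianchi_sum j y : U y ->
  2 * \sum_i \sum_k ip (f i k y) (D i (f j k) y) = \sum_i \sum_k ip (f i k y) (D j (f i k) y).
Proof.
move=> Uy; rewrite mulr_natl mulr2n {2}exchange_big -big_split/=.
apply: eq_bigr => i _; rewrite -big_split/=; apply: eq_bigr => k _.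
rewrite (curvC a k i) ipNl (cov_curvC k j i Uy) ipNr opprK -ipDr.
have := bianchi oU sa i j k Uy; rewrite (cov_curvC j k i Uy) => /eqP.
by rewrite addrAC subr_eq0 => /eqP ->.
Qed.

(** The Yang-Mills equation removes the terms with [D i (f i k)], the contracted Bianchi identity
    [curv_bianchi_sum] cancels the derivatives of [dens], and the two undifferentiated multiples of
    [dens y] balance exactly when [m = 4]. *)
Lemma div_pohozaev y : m = 4 -> U y -> \sum_i pd i (pohozaev i) y = 0.
Proof.
move=> m4 Uy.
have E i : pd i (pohozaev i) y = \sum_k ip (D i (f i k) y) (radial_curv k y)
   + \sum_k ip (f i k y) (f i k y)
   + \sum_k \sum_j y 0 j * ip (f i k y) (D i (f j k) y)
   - 4^-1 * (dens y + y 0 i * pd i dens y).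
  have s1 : smooth_on U (fun y => \sum_k ip (f i k y) (radial_curv k y)).
    by apply: smooth_on_sum => // k; exact: sip.
  have s2 := smooth_onM oU (sc i) smooth_on_dens.
  have s3 : smooth_on U (fun _ : 'rV[R]_m => 4^-1 : R) by exact: smooth_on_cst.
  rewrite (pdB oU i s1 (smooth_onM oU s3 s2) Uy) (pdM i s3 s2 Uy) pd_cst mul0r add0r.
  rewrite (pdM i (sc i) smooth_on_dens Uy) pd_coord eqxx mul1r; congr (_ - _).
  rewrite (pd_sum oU i _ (fun k => sip (sf i k) (sE k)) Uy) -!big_split/=.
  apply: eq_bigr => k _; rewrite (pd_ip a i (sf i k) (sE k) Uy) -addrA; congr (_ + _).
  rewrite (cov_radial_curv i k Uy) ipDr ip_sumr; congr (_ + _).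
  by apply: eq_bigr => j _; rewrite ipZr.
under eq_bigr do rewrite E.
rewrite sumrB !big_split/=.
have -> : \sum_i \sum_k ip (D i (f i k) y) (radial_curv k y) = 0.
  by rewrite exchange_big big1// => k _; rewrite -ip_suml ym// ip0l.
have -> : \sum_i \sum_k \sum_j y 0 j * ip (f i k y) (D i (f j k) y) =
    4^-1 * \sum_j y 0 j * pd j dens y.
  under eq_bigr do rewrite exchange_big.
  rewrite exchange_big mulr_sumr/=; apply: eq_bigr => j _.
  rewrite (pd_dens _ Uy) -curv_bianchi_sum// mulrCA.
  under eq_bigr do rewrite -mulr_sumr.
  rewrite -[LHS]mulr_sumr; congr (_ * _); set S := (X in X = _); rewrite -/S; lra.
have M (x : R) : x *+ m = 4 * x by rewrite m4 mulr_natl.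
rewrite -[X in _ - X]mulr_sumr big_split/= sumr_const card_ord M -/(dens y).
by set S := \sum_j _; set S' := dens y; rewrite -/S -/S'; lra.
Qed.

Lemma radial_pohozaev (y : 'rV[R]_m) :
  \sum_i y 0 i * pohozaev i y = radial_dens y - 4^-1 * (normsq y * dens y).
Proof.
under eq_bigr do rewrite mulrBr mulr_sumr.
rewrite sumrB exchange_big/=; congr (_ - _).
  apply: eq_bigr => k _; rewrite {2}/radial_curv ip_suml.
  by apply: eq_bigr => i _; rewrite ipZl.
rewrite /normsq mulr_suml mulr_sumr; apply: eq_bigr => i _; ring.
Qed.

(** The Bianchi identity replaces [D k (f i j)] by derivatives in directions [i] and [j]. Commuting
    these outwards produces the brackets, and what is left is a derivative of the Yang-Mills
    equation. *)
Lemma cov_laplacian i j y : U y ->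
  \sum_k D k (D k (f i j)) y = - \sum_k (br (f k i y) (f j k y) + br (f k j y) (f k i y)).
Proof.
move=> Uy.
have Z l : \sum_k D l (D k (f k i)) y = 0 /\ \sum_k D l (D k (f j k)) y = 0.
  have H b : \sum_k D l (D k (f k b)) y = 0.
    rewrite -(cov_sum a oU l _ (fun k => sD k (sf k b)) Uy).
    by rewrite (cov_eq a oU l (fun x Ux => ym b Ux) Uy) cov0.
  split; first exact: H.
  rewrite (eq_bigr (fun k => - D l (D k (f k j)) y)) => [|k _]; first by rewrite sumrN H oppr0.
  rewrite -(covN a l (sD k (sf k j)) Uy).
  by apply: (cov_eq a oU l _ Uy) => x Ux; exact: cov_curvC.
have E k : D k (D k (f i j)) y = - D k (D i (f j k)) y - D k (D j (f k i)) y.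
  have s1 := sD i (sf j k); have s2 := sD j (sf k i).
  rewrite -opprD -(covD a k s1 s2 Uy) -(covN a k (smooth_onD oU s1 s2) Uy).
  apply: (cov_eq a oU k _ Uy) => x Ux; apply/eqP; rewrite -addr_eq0 addrA.
  by rewrite (bianchi oU sa k i j Ux).
have C p q B : smooth_on U B -> D p (D q B) y = D q (D p B) y + br (f p q y) (B y).
  by move=> sB; rewrite -(cov_comm oU sa p q sB Uy) addrC subrK.
under eq_bigr do rewrite E (C _ i _ (sf j _)) (C _ j _ (sf _ i)) !opprD.
rewrite big_split/= !big_split/= !sumrN (Z i).2 (Z j).1 !oppr0 !add0r.
by rewrite -opprD -big_split.
Qed.

Lemma bochner y : U y -> \sum_k pd k (pd k dens) y =
  2 * \sum_k \sum_i \sum_j ip (D k (f i j) y) (D k (f i j) y)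
  + 2 * \sum_i \sum_j ip (f i j y) (\sum_k D k (D k (f i j)) y).
Proof.
move=> Uy.
have sS k : smooth_on U (fun y => \sum_i \sum_j ip (f i j y) (D k (f i j) y)).
  by do 2 (apply: smooth_on_sum => // ?); apply: sip => //; exact: sD.
have E k : pd k (pd k dens) y =
  2 * \sum_i \sum_j (ip (D k (f i j) y) (D k (f i j) y) + ip (f i j y) (D k (D k (f i j)) y)).
  rewrite (pd_eq oU k (fun x Ux => pd_dens k Ux) Uy).
  have s2 : smooth_on U (fun _ : 'rV[R]_m => 2 : R) by exact: smooth_on_cst.
  rewrite (pdM k s2 (sS k) Uy) pd_cst mul0r add0r; congr (_ * _).
  rewrite (pd_sum oU k _ (fun i => smooth_on_sum (index_enum _) predT oU
    (fun j => sip (sf i j) (sD k (sf i j)))) Uy).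
  apply: eq_bigr => i _; rewrite (pd_sum oU k _ (fun j => sip (sf i j) (sD k (sf i j))) Uy).
  by apply: eq_bigr => j _; rewrite (pd_ip a k (sf i j) (sD k (sf i j)) Uy).
under eq_bigr do rewrite E.
rewrite -mulr_sumr -mulrDr; congr (_ * _).
under eq_bigr do under eq_bigr do rewrite big_split/=.
under eq_bigr do rewrite big_split/=.
rewrite big_split/=; congr (_ + _).
rewrite exchange_big/=; apply: eq_bigr => i _; rewrite exchange_big/=.
by apply: eq_bigr => j _; rewrite ip_sumr.
Qed.

Lemma norm_le_curv i j y (s : R) : 0 <= s -> dens y <= s ^+ 2 -> norm_le (f i j y) s.
Proof.
move=> s0 H; split=> //; apply: le_trans H.
rewrite /dens (bigD1 i)//= (bigD1 j)//= -addrA lerDl addr_ge0//.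
  by apply: sumr_ge0 => ? _; exact: ip_ge0.
by do 2 (apply: sumr_ge0 => ? _); exact: ip_ge0.
Qed.

End flat_yang_mills.

(** In the Bochner formula the squared derivatives are nonnegative and are dropped; by
    [cov_laplacian] the rest is cubic in the curvature. The constant is chosen before the
    connection. *)
Lemma laplacian_dens_ge (R : realType) (g : metric_lie_algebra R) m :
  exists2 C : R, 0 <= C & forall (a : 'I_m -> 'rV[R]_m -> 'rV[R]_(la_dim g)) (U : set 'rV[R]_m),
    open U -> (forall i, smooth_on U (a i)) ->
    (forall j y, U y -> \sum_i cov a i (curv a i j) y = 0) ->
    forall y (s : R), U y -> 0 <= s -> dens a y = s ^+ 2 ->
    - C * s ^+ 3 <= \sum_k pd k (pd k (dens a)) y.
Proof.
have [C C0 HC] := @ip_br_bound R g.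
exists (2 * \sum_(i < m) \sum_(j < m) \sum_(k < m) (C + C)).
  by apply: mulr_ge0 => //; do 3 (apply: sumr_ge0 => ? _); exact: addr_ge0.
move=> a U oU sa ym y s Uy s0 Hs.
rewrite (bochner oU sa Uy) -[leLHS]add0r; apply: lerD.
  by apply: mulr_ge0 => //; do 3 (apply: sumr_ge0 => ? _); exact: ip_ge0.
rewrite mulNr -mulrA -mulrN ler_pM2l// mulr_suml -sumrN; apply: ler_sum => i _.
rewrite mulr_suml -sumrN; apply: ler_sum => j _.
rewrite (cov_laplacian oU sa ym i j Uy) ipNr ip_sumr lerN2 mulr_suml; apply: ler_sum => k _.
have N b c : norm_le (curv a b c y) s by apply: norm_le_curv => //; rewrite Hs.
have H b c d e : ip (curv a i j y) (br (curv a b c y) (curv a d e y)) <= C * s ^+ 3.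
  apply: le_trans (ler_norm _) _.
  have [_ h1] := N i j; have [_ h2] := N b c; have [_ h3] := N d e.
  have := HC _ _ _ _ _ _ s0 s0 s0 h1 h2 h3.
  by rewrite (_ : s * s * s = s ^+ 3); last by ring.
by rewrite ipDr mulrDl lerD.
Qed.

(** * Self-dual and anti-self-dual parts *)

Section radial_rotation.
Context {R : realType} {g : metric_lie_algebra R} {m : nat}.
Local Notation V := 'rV[R]_(la_dim g).
Variable a : 'I_m -> 'rV[R]_m -> V.
Context {U : set 'rV[R]_m} (oU : open U) (sa : forall i, smooth_on U (a i)).
Local Notation D := (cov a).
Local Notation f := (curv a).
Implicit Types (B : 'rV[R]_m -> V) (h : 'rV[R]_m -> R) (om : 'I_m -> 'I_m -> R).

Definition radial B (y : 'rV[R]_m) : V := \sum_i y 0 i *: D i B y.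
Definition rot om B (y : 'rV[R]_m) : V := \sum_i \sum_j (om i j * y 0 i) *: D j B y.
Definition srad h (y : 'rV[R]_m) : R := \sum_i y 0 i * pd i h y.
Definition srot om h (y : 'rV[R]_m) : R := \sum_i \sum_j om i j * y 0 i * pd j h y.
Definition rot_curv om (y : 'rV[R]_m) : V :=
  \sum_i \sum_j (om i j * y 0 i) *: radial_curv a j y.

Let sc i : smooth_on U (fun y : 'rV[R]_m => y 0 i) := smooth_on_coord i oU.
Let sk (c : R) : smooth_on U (fun _ : 'rV[R]_m => c).
Proof. exact: smooth_on_cst. Qed.
Let sD i B : smooth_on U B -> smooth_on U (D i B) := smooth_on_cov oU sa i (B := B).

Lemma smooth_on_radial B : smooth_on U B -> smooth_on U (radial B).
Proof. by move=> sB; apply: smooth_on_sum => // i; apply: smooth_onZ => //; exact: sD. Qed.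

Lemma smooth_on_rot om B : smooth_on U B -> smooth_on U (rot om B).
Proof.
move=> sB; do 2 (apply: smooth_on_sum => // ?); apply: smooth_onZ => //; last exact: sD.
exact: smooth_onM.
Qed.

Lemma smooth_on_srad h : smooth_on U h -> smooth_on U (srad h).
Proof.
move=> sh; apply: smooth_on_sum => // i; apply: smooth_onM => //; exact: smooth_on_pd.
Qed.

Lemma smooth_on_srot om h : smooth_on U h -> smooth_on U (srot om h).
Proof.
move=> sh; do 2 (apply: smooth_on_sum => // ?); apply: smooth_onM => //.
  exact: smooth_onM.
exact: smooth_on_pd.
Qed.

Lemma radial_eq B B' y : (forall x, U x -> B x = B' x) -> U y -> radial B y = radial B' y.
Proof. by move=> BB Uy; apply: eq_bigr => i _; rewrite (cov_eq a oU i BB Uy). Qed.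

Lemma radialZB (c : R) B B' y : smooth_on U B -> smooth_on U B' -> U y ->
  radial (fun x => c *: (B x - B' x)) y = c *: (radial B y - radial B' y).
Proof.
move=> sB sB' Uy; rewrite -sumrB scaler_sumr; apply: eq_bigr => i _.
rewrite (covZ a i (sk c) (smooth_onB oU sB sB') Uy) pd_cst scale0r add0r.
by rewrite (covB a oU i sB sB' Uy) -scalerBr !scalerA mulrC.
Qed.

Lemma srad_eq h h' y : (forall x, U x -> h x = h' x) -> U y -> srad h y = srad h' y.
Proof. by move=> hh Uy; apply: eq_bigr => i _; rewrite (pd_eq oU i hh Uy). Qed.

Lemma sradD h h' y : smooth_on U h -> smooth_on U h' -> U y ->
  srad (fun x => h x + h' x) y = srad h y + srad h' y.
Proof.
move=> sh sh' Uy; rewrite -big_split; apply: eq_bigr => i _.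
by rewrite (pdD i sh sh' Uy) mulrDr.
Qed.

Lemma srad_ip B B' y : smooth_on U B -> smooth_on U B' -> U y ->
  srad (fun x => ip (B x) (B' x)) y = ip (radial B y) (B' y) + ip (B y) (radial B' y).
Proof.
move=> sB sB' Uy; rewrite ip_suml ip_sumr -big_split; apply: eq_bigr => i _.
by rewrite (pd_ip a i sB sB' Uy) mulrDr ipZl ipZr.
Qed.

Lemma sradZ (c : R) h y : smooth_on U h -> U y ->
  srad (fun x => c * h x) y = c * srad h y.
Proof.
move=> sh Uy; rewrite mulr_sumr; apply: eq_bigr => i _.
by rewrite (pdM i (sk c) sh Uy) pd_cst mul0r add0r mulrCA.
Qed.

Lemma srot_ip om B B' y : smooth_on U B -> smooth_on U B' -> U y ->
  srot om (fun x => ip (B x) (B' x)) y = ip (rot om B y) (B' y) + ip (B y) (rot om B' y).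
Proof.
move=> sB sB' Uy; rewrite ip_suml ip_sumr -big_split; apply: eq_bigr => i _.
rewrite ip_suml ip_sumr -big_split; apply: eq_bigr => j _.
by rewrite (pd_ip a j sB sB' Uy) mulrDr ipZl ipZr.
Qed.

Lemma srotZB om (c : R) h h' y : smooth_on U h -> smooth_on U h' -> U y ->
  srot om (fun x => c * (h x - h' x)) y = c * (srot om h y - srot om h' y).
Proof.
move=> sh sh' Uy; rewrite -sumrB mulr_sumr; apply: eq_bigr => i _.
rewrite -sumrB mulr_sumr; apply: eq_bigr => j _.
rewrite (pdM j (sk c) (smooth_onB oU sh sh') Uy) pd_cst mul0r add0r (pdB oU j sh sh' Uy).
ring.
Qed.

(** The Euler field commutes with every linear vector field, so the commutator of the covariant
    derivatives is only the curvature evaluated on the two fields. *)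
Lemma radial_rot om B y : smooth_on U B -> U y ->
  radial (rot om B) y = rot om (radial B) y + br (rot_curv om y) (B y).
Proof.
move=> sB Uy.
have E1 k : D k (rot om B) y = \sum_i \sum_j (om i j * ((k == i)%:R)) *: D j B y
    + \sum_i \sum_j (om i j * y 0 i) *: D k (D j B) y.
  have s1 i j : smooth_on U (fun x => om i j * x 0 i) by exact: smooth_onM.
  have s2 i j := smooth_onZ oU (s1 i j) (sD j sB).
  rewrite (cov_sum a oU k _ (fun i => smooth_on_sum (index_enum _) predT oU (s2 i)) Uy).
  rewrite -big_split; apply: eq_bigr => i _.
  rewrite (cov_sum a oU k _ (s2 i) Uy) -big_split; apply: eq_bigr => j _.
  rewrite (covZ a k (s1 i j) (sD j sB) Uy) (pdM k (sk _) (sc i) Uy) pd_cst mul0r add0r.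
  by rewrite pd_coord.
have E2 j : D j (radial B) y = D j B y + \sum_k y 0 k *: D j (D k B) y.
  rewrite (cov_sum a oU j _ (fun k => smooth_onZ oU (sc k) (sD k sB)) Uy).
  under eq_bigr do rewrite (covZ a j (sc _) (sD _ sB) Uy) pd_coord.
  by rewrite big_split/= sum_delta_scale.
have C k j : D k (D j B) y = D j (D k B) y + br (f k j y) (B y).
  by rewrite -(cov_comm oU sa k j sB Uy) addrC subrK.
have L1 : radial (rot om B) y = rot om B y +
    \sum_k \sum_i \sum_j (y 0 k * (om i j * y 0 i)) *: D k (D j B) y.
  rewrite /radial; under eq_bigr do rewrite E1 scalerDr.
  rewrite big_split/=; congr (_ + _); last first.
    apply: eq_bigr => k _; rewrite scaler_sumr; apply: eq_bigr => i _.
    by rewrite scaler_sumr; apply: eq_bigr => j _; rewrite scalerA.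
  rewrite /rot (eq_bigr (fun k => \sum_i (k == i)%:R *: \sum_j (y 0 k * om i j) *: D j B y)).
    by apply: eq_bigr => k _; rewrite sum_delta_scale; under eq_bigr do rewrite mulrC.
  move=> k _; rewrite scaler_sumr; apply: eq_bigr => i _; rewrite !scaler_sumr.
  by apply: eq_bigr => j _; rewrite !scalerA; congr (_ *: _); ring.
have L2 : rot om (radial B) y = rot om B y +
    \sum_k \sum_i \sum_j (y 0 k * (om i j * y 0 i)) *: D j (D k B) y.
  rewrite [X in _ + X]exchange_big -big_split/=; apply: eq_bigr => i _.
  rewrite [X in _ + X]exchange_big -big_split/=; apply: eq_bigr => j _.
  rewrite E2 scalerDr scaler_sumr; congr (_ + _); apply: eq_bigr => k _.
  by rewrite scalerA mulrC.
have L3 : br (rot_curv om y) (B y) =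
    \sum_k \sum_i \sum_j (y 0 k * (om i j * y 0 i)) *: br (f k j y) (B y).
  rewrite [RHS]exchange_big br_suml/=; apply: eq_bigr => i _.
  rewrite [RHS]exchange_big br_suml/=; apply: eq_bigr => j _.
  rewrite brZl br_suml scaler_sumr; apply: eq_bigr => k _.
  by rewrite brZl scalerA mulrC.
rewrite L1 L2 L3 -addrA; congr (_ + _); rewrite -big_split; apply: eq_bigr => k _.
rewrite -big_split; apply: eq_bigr => i _; rewrite -big_split; apply: eq_bigr => j _.
by rewrite C scalerDr.
Qed.

Lemma norm_le_rot_curv om (y : 'rV[R]_m) (r s : R) : (forall i j, `|om i j| <= 1) ->
  0 <= r -> 0 <= s -> normsq y <= r ^+ 2 -> dens a y <= s ^+ 2 ->
  norm_le (rot_curv om y) (m%:R ^+ 3 * (r ^+ 2 * s)).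
Proof.
move=> om1 r0 s0 yr ys.
have yi i : `|y 0 i| <= r.
  rewrite -ler_sqr ?nnegrE// real_normK ?num_real//; exact: le_trans (normsq_coord _ _) yr.
have NE j : norm_le (radial_curv a j y) (m%:R * (r * s)).
  have -> : m%:R * (r * s) = \sum_(i < m) r * s by rewrite sumr_const card_ord mulr_natl.
  apply: norm_le_sum => i; apply: norm_le_trans (norm_leZ _ (norm_le_curv i j s0 ys)) _.
  by rewrite ler_wpM2r.
have -> : m%:R ^+ 3 * (r ^+ 2 * s) = \sum_(i < m) \sum_(j < m) r * (m%:R * (r * s)) :> R.
  by rewrite !sumr_const !card_ord -[RHS]mulr_natl -[_ *+ m]mulr_natl; ring.
apply: norm_le_sum => i; apply: norm_le_sum => j.
apply: norm_le_trans (norm_leZ _ (NE j)) _; rewrite ler_wpM2r ?mulr_ge0 ?ler0n//.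
by rewrite normrM -[leRHS]mul1r ler_pM.
Qed.

End radial_rotation.

Section self_dual.
Context {R : realType} {g : metric_lie_algebra R}.
Local Notation V := 'rV[R]_(la_dim g).
Variable a : 'I_4 -> 'rV[R]_4 -> V.
Variable sg : R.
Local Notation D := (cov a).
Local Notation f := (curv a).
Local Notation o0 := (@Ordinal 4 0 isT).
Local Notation o1 := (@Ordinal 4 1 isT).
Local Notation o2 := (@Ordinal 4 2 isT).
Local Notation o3 := (@Ordinal 4 3 isT).

(** With [sg] equal to 1 or -1, [sd1], [sd2] and [sd3] are the independent components of the
    curvature plus [sg] times its Hodge dual. *)
Definition sd1 y : V := f o0 o1 y + sg *: f o2 o3 y.
Definition sd2 y : V := f o0 o2 y + sg *: f o3 o1 y.
Definition sd3 y : V := f o0 o3 y + sg *: f o1 o2 y.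
Definition sd_dens y : R := ip (sd1 y) (sd1 y) + ip (sd2 y) (sd2 y) + ip (sd3 y) (sd3 y).

(** The matrix of the 2-form [e_i0 ^ e_i1 + sg e_i2 ^ e_i3]. The three choices [om1], [om2], [om3]
    below span the self-dual or the anti-self-dual forms, and act as rotations of two orthogonal
    planes at once. *)
Definition planes (i0 i1 i2 i3 : 'I_4) (i j : 'I_4) : R :=
  (i == i0)%:R * (j == i1)%:R - (i == i1)%:R * (j == i0)%:R
  + sg * ((i == i2)%:R * (j == i3)%:R - (i == i3)%:R * (j == i2)%:R).

Lemma planes_anti i0 i1 i2 i3 i j : planes i0 i1 i2 i3 i j = - planes i0 i1 i2 i3 j i.
Proof. rewrite /planes; ring. Qed.

Lemma rot_planes i0 i1 i2 i3 B (y : 'rV[R]_4) : rot a (planes i0 i1 i2 i3) B y =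
  y 0 i0 *: D i1 B y - y 0 i1 *: D i0 B y
  + sg *: (y 0 i2 *: D i3 B y - y 0 i3 *: D i2 B y).
Proof.
have S k l : \sum_i \sum_j ((i == k)%:R * (j == l)%:R * y 0 i) *: D j B y = y 0 k *: D l B y.
  rewrite (eq_bigr (fun i => (k == i)%:R *: (y 0 i *: D l B y))) ?sum_delta_scale// => i _.
  rewrite (eq_bigr (fun j => (l == j)%:R *: (((i == k)%:R * y 0 i) *: D j B y))).
    by rewrite sum_delta_scale eq_sym scalerA.
  by move=> j _; rewrite scalerA (eq_sym j); congr (_ *: _); ring.
rewrite -!S -!sumrB scaler_sumr -big_split; apply: eq_bigr => i _.
rewrite -!sumrB scaler_sumr -big_split; apply: eq_bigr => j _.
by apply/rowP => k; rewrite !mxE /planes; ring.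
Qed.

Definition om1 := planes o0 o1 o2 o3.
Definition om2 := planes o0 o2 o3 o1.
Definition om3 := planes o0 o3 o1 o2.

Context {U : set 'rV[R]_4} (oU : open U) (sa : forall i, smooth_on U (a i)).
Hypothesis ym : forall j y, U y -> \sum_i D i (f i j) y = 0.
Hypothesis sg1 : sg = 1 \/ sg = -1.

Let sf i j : smooth_on U (f i j) := smooth_on_curv oU sa i j.
Let sk (c : R) : smooth_on U (fun _ : 'rV[R]_4 => c).
Proof. exact: smooth_on_cst. Qed.

Lemma smooth_on_sd1 : smooth_on U sd1.
Proof. by apply: smooth_onD => //; exact: smooth_onZ. Qed.
Lemma smooth_on_sd2 : smooth_on U sd2.
Proof. by apply: smooth_onD => //; exact: smooth_onZ. Qed.
Lemma smooth_on_sd3 : smooth_on U sd3.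
Proof. by apply: smooth_onD => //; exact: smooth_onZ. Qed.

Lemma smooth_on_sd_dens : smooth_on U sd_dens.
Proof.
have [s1 [s2 s3]] := (smooth_on_sd1, (smooth_on_sd2, smooth_on_sd3)).
by apply: smooth_onD => //; [apply: smooth_onD => //|]; exact: smooth_on_ip.
Qed.

Lemma sd_dens_ge0 y : 0 <= sd_dens y.
Proof. by rewrite /sd_dens !addr_ge0// ip_ge0. Qed.

Let cov_sd i b c d e y : U y -> D i (fun y => f b c y + sg *: f d e y) y =
  D i (f b c) y + sg *: D i (f d e) y.
Proof.
move=> Uy; rewrite (covD a i (sf b c) (smooth_onZ oU (sk sg) (sf d e)) Uy).
by rewrite (covZ a i (sk sg) (sf d e) Uy) pd_cst scale0r add0r.
Qed.

Let D_curv_diag c i y : U y -> D c (f i i) y = 0.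
Proof. by move=> Uy; exact: eqNr_eq0 (cov_curvC oU sa c i i Uy). Qed.

(** Each line combines one component of the Yang-Mills equation with the Bianchi identity of the
    complementary triple of indices; the result is a Dirac-type system for the triple. *)
Let sd_eqs y : U y -> [/\
  D o1 sd1 y = - D o2 sd2 y - D o3 sd3 y,
  D o0 sd1 y = sg *: (D o2 sd3 y - D o3 sd2 y),
  D o0 sd2 y = sg *: (D o3 sd1 y - D o1 sd3 y) &
  D o0 sd3 y = sg *: (D o1 sd2 y - D o2 sd1 y)].
Proof.
move=> Uy.
have Y0 := ym o0 Uy; have Y1 := ym o1 Uy; have Y2 := ym o2 Uy; have Y3 := ym o3 Uy.
rewrite !sum4 !D_curv_diag// in Y0 Y1 Y2 Y3.
have N c i j := cov_curvC oU sa c i j Uy.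
rewrite (N o1 o1 o0) (N o2 o2 o0) (N o3 o3 o0) in Y0.
rewrite (N o2 o2 o1) in Y1; rewrite (N o3 o3 o2) in Y2; rewrite (N o1 o1 o3) in Y3.
have B0 := bianchi oU sa o1 o2 o3 Uy; have B1 := bianchi oU sa o0 o2 o3 Uy.
have B2 := bianchi oU sa o0 o3 o1 Uy; have B3 := bianchi oU sa o0 o1 o2 Uy.
rewrite (N o2 o3 o0) in B1; rewrite (N o3 o1 o0) in B2; rewrite (N o1 o2 o0) in B3.
split; apply/rowP => c; rewrite !cov_sd// !mxE.
- move/rowP: Y0 => /(_ c); move/rowP: B0 => /(_ c); rewrite !mxE.
  by case: sg1 => ->; lra.
- move/rowP: Y1 => /(_ c); move/rowP: B1 => /(_ c); rewrite !mxE.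
  by case: sg1 => ->; lra.
- move/rowP: Y2 => /(_ c); move/rowP: B2 => /(_ c); rewrite !mxE.
  by case: sg1 => ->; lra.
- move/rowP: Y3 => /(_ c); move/rowP: B3 => /(_ c); rewrite !mxE.
  by case: sg1 => ->; lra.
Qed.

Let sg2 : sg * sg = 1. Proof. by case: sg1 => ->; ring. Qed.

(** [sd_eqs] eliminates the derivatives in direction 0 and [D o1 sd1], both from the radial
    derivatives and from the rotations. What appears is a cross product of [(om1, om2, om3)] with
    the triple: a curl in rotation fields. *)
Lemma radial_sd y : U y -> [/\
  radial a sd1 y = sg *: (rot a om2 sd3 y - rot a om3 sd2 y),
  radial a sd2 y = sg *: (rot a om3 sd1 y - rot a om1 sd3 y) &
  radial a sd3 y = sg *: (rot a om1 sd2 y - rot a om2 sd1 y)].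
Proof.
move=> Uy; have [E0 E1 E2 E3] := sd_eqs Uy.
by rewrite /om1 /om2 /om3 !rot_planes /radial !sum4 E1 E2 E3 E0; split;
  apply/rowP => c; rewrite !mxE; case: sg1 => ->; ring.
Qed.

Let p1 := sd1. Let p2 := sd2. Let p3 := sd3.
Let r1 := radial a sd1. Let r2 := radial a sd2. Let r3 := radial a sd3.

(** [sd_h1], [sd_h2] and [sd_h3] are, up to a factor, the components of the cross product of the
    triple with its radial derivative. Their rotations collect the part of the second radial
    derivative that a radial weight integrates to zero ([integral_srot]). *)
Definition sd_h1 y : R := 2 * sg * (ip (p3 y) (r2 y) - ip (p2 y) (r3 y)).
Definition sd_h2 y : R := 2 * sg * (ip (p1 y) (r3 y) - ip (p3 y) (r1 y)).
Definition sd_h3 y : R := 2 * sg * (ip (p2 y) (r1 y) - ip (p1 y) (r2 y)).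

Let sp1 : smooth_on U p1 := smooth_on_sd1.
Let sp2 : smooth_on U p2 := smooth_on_sd2.
Let sp3 : smooth_on U p3 := smooth_on_sd3.
Let sr1 : smooth_on U r1. Proof. exact: smooth_on_radial smooth_on_sd1. Qed.
Let sr2 : smooth_on U r2. Proof. exact: smooth_on_radial smooth_on_sd2. Qed.
Let sr3 : smooth_on U r3. Proof. exact: smooth_on_radial smooth_on_sd3. Qed.
Let sip (B B' : 'rV[R]_4 -> V) :
  smooth_on U B -> smooth_on U B' -> smooth_on U (fun y => ip (B y) (B' y)).
Proof. exact: smooth_on_ip oU B B'. Qed.

Lemma smooth_on_sd_h : [/\ smooth_on U sd_h1, smooth_on U sd_h2 & smooth_on U sd_h3].
Proof.
by split; apply: smooth_onM => //; apply: smooth_onB => //; exact: sip.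
Qed.

Lemma srad_sd_dens y : U y -> srad sd_dens y =
  2 * (ip (p1 y) (r1 y) + ip (p2 y) (r2 y) + ip (p3 y) (r3 y)).
Proof.
move=> Uy; rewrite (sradD (smooth_onD oU (sip sp1 sp1) (sip sp2 sp2)) (sip sp3 sp3) Uy).
rewrite (sradD (sip sp1 sp1) (sip sp2 sp2) Uy).
rewrite (srad_ip a sp1 sp1 Uy) (srad_ip a sp2 sp2 Uy) (srad_ip a sp3 sp3 Uy).
rewrite (ipC (radial a p1 y)) (ipC (radial a p2 y)) (ipC (radial a p3 y)); ring.
Qed.

Let radial_r (B p q : 'rV[R]_4 -> V) om om' y : smooth_on U p -> smooth_on U q ->
  (forall y, U y -> B y = sg *: (rot a om p y - rot a om' q y)) -> U y ->
  radial a B y = sg *: ((rot a om (radial a p) y + br (rot_curv a om y) (p y))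
    - (rot a om' (radial a q) y + br (rot_curv a om' y) (q y))).
Proof.
move=> sp sq HB Uy; rewrite (radial_eq a oU HB Uy).
rewrite (radialZB a oU sg (smooth_on_rot oU sa om sp) (smooth_on_rot oU sa om' sq) Uy).
by rewrite (radial_rot oU sa om sp Uy) (radial_rot oU sa om' sq Uy).
Qed.

Let ip_rot om B B' y : smooth_on U B -> smooth_on U B' -> U y ->
  ip (B y) (rot a om B' y) =
  srot om (fun x => ip (B x) (B' x)) y - ip (rot a om B y) (B' y).
Proof. by move=> sB sB' Uy; rewrite (srot_ip a om sB sB' Uy) addrC addKr. Qed.

(** One half of the factor 4 is the product rule. The other half comes from the second radial
    derivative of the triple: it is replaced through [radial_sd], radial and rotational derivatives
    are exchanged at the cost of [rot_curv], and the rotation is moved to the other factor of [ip],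
    where [radial_sd] recovers the radial derivative once more. *)
Lemma srad_srad_sd_dens y : U y -> srad (srad sd_dens) y =
  4 * (ip (r1 y) (r1 y) + ip (r2 y) (r2 y) + ip (r3 y) (r3 y))
  + (srot om1 sd_h1 y + srot om2 sd_h2 y + srot om3 sd_h3 y)
  + 2 * sg * (ip (p1 y) (br (rot_curv a om2 y) (p3 y)) - ip (p1 y) (br (rot_curv a om3 y) (p2 y))
     + (ip (p2 y) (br (rot_curv a om3 y) (p1 y)) - ip (p2 y) (br (rot_curv a om1 y) (p3 y)))
     + (ip (p3 y) (br (rot_curv a om1 y) (p2 y)) - ip (p3 y) (br (rot_curv a om2 y) (p1 y)))).
Proof.
move=> Uy.
have sS := smooth_onD oU (smooth_onD oU (sip sp1 sr1) (sip sp2 sr2)) (sip sp3 sr3).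
rewrite (srad_eq oU srad_sd_dens Uy) (sradZ 2 sS Uy).
rewrite (sradD (smooth_onD oU (sip sp1 sr1) (sip sp2 sr2)) (sip sp3 sr3) Uy).
rewrite (sradD (sip sp1 sr1) (sip sp2 sr2) Uy).
rewrite (srad_ip a sp1 sr1 Uy) (srad_ip a sp2 sr2 Uy) (srad_ip a sp3 sr3 Uy).
have H1 x : U x -> r1 x = sg *: (rot a om2 p3 x - rot a om3 p2 x) by case/radial_sd.
have H2 x : U x -> r2 x = sg *: (rot a om3 p1 x - rot a om1 p3 x) by case/radial_sd.
have H3 x : U x -> r3 x = sg *: (rot a om1 p2 x - rot a om2 p1 x) by case/radial_sd.
rewrite (radial_r sp3 sp2 H1 Uy) (radial_r sp1 sp3 H2 Uy) (radial_r sp2 sp1 H3 Uy).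
rewrite -/r1 -/r2 -/r3 !ipZr !ipBr !ipDr.
rewrite (ip_rot om2 sp1 sr3 Uy) (ip_rot om3 sp1 sr2 Uy) (ip_rot om3 sp2 sr1 Uy).
rewrite (ip_rot om1 sp2 sr3 Uy) (ip_rot om1 sp3 sr2 Uy) (ip_rot om2 sp3 sr1 Uy).
rewrite (srotZB oU om1 _ (sip sp3 sr2) (sip sp2 sr3) Uy).
rewrite (srotZB oU om2 _ (sip sp1 sr3) (sip sp3 sr1) Uy).
rewrite (srotZB oU om3 _ (sip sp2 sr1) (sip sp1 sr2) Uy).
have K1 : ip (r1 y) (r1 y) = sg * (ip (rot a om2 p3 y) (r1 y) - ip (rot a om3 p2 y) (r1 y)).
  by rewrite {1}H1// ipZl ipBl.
have K2 : ip (r2 y) (r2 y) = sg * (ip (rot a om3 p1 y) (r2 y) - ip (rot a om1 p3 y) (r2 y)).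
  by rewrite {1}H2// ipZl ipBl.
have K3 : ip (r3 y) (r3 y) = sg * (ip (rot a om1 p2 y) (r3 y) - ip (rot a om2 p1 y) (r3 y)).
  by rewrite {1}H3// ipZl ipBl.
move: K1 K2 K3; case: sg1 => ->; lra.
Qed.

Lemma planes_le1 : (forall i j, `|om1 i j| <= 1) /\ (forall i j, `|om2 i j| <= 1)
  /\ (forall i j, `|om3 i j| <= 1).
Proof.
by split; [|split]; do 2 (case; case=> [|[|[|[|//]]]] ?);
  rewrite /om1 /om2 /om3 /planes !eqE/= ler_norml; apply/andP; case: sg1 => ->; split; lra.
Qed.

Lemma sd_dens_le y : sd_dens y <= 4 * dens a y.
Proof.
have H b c d e : ip (f b c y + sg *: f d e y) (f b c y + sg *: f d e y) <=
    2 * (ip (f b c y) (f b c y) + ip (f d e y) (f d e y)).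
  have := ip_CS (f b c y) (sg *: f d e y); rewrite ler_norml => /andP[_].
  have -> : ip (sg *: f d e y) (sg *: f d e y) = ip (f d e y) (f d e y).
    by rewrite ipZl ipZr mulrA sg2 mul1r.
  rewrite ipDl !ipDr (ipC (sg *: f d e y) (f b c y)).
  have -> : ip (sg *: f d e y) (sg *: f d e y) = ip (f d e y) (f d e y).
    by rewrite ipZl ipZr mulrA sg2 mul1r.
  by lra.
have P b c : 0 <= ip (f b c y) (f b c y) by exact: ip_ge0.
rewrite /sd_dens /sd1 /sd2 /sd3 /dens !sum4.
have := H o0 o1 o2 o3; have := H o0 o2 o3 o1; have := H o0 o3 o1 o2.
have := P o0 o0; have := P o1 o0; have := P o1 o1; have := P o1 o3; have := P o2 o0.
have := P o2 o1; have := P o2 o2; have := P o3 o0; have := P o3 o2; have := P o3 o3.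
have := P o0 o1; have := P o2 o3; have := P o0 o2; have := P o3 o1; have := P o0 o3.
have := P o1 o2.
lra.
Qed.

End self_dual.

(** Cauchy-Schwarz in linearized form: the square of the radial derivative minus [l] times the
    component is nonnegative. With [l] independent of [y] the inequality can be integrated first and
    [l] optimized afterwards, at half the frequency. *)
Lemma self_dual_radial_ineq (R : realType) (g : metric_lie_algebra R) :
  exists2 C : R, 0 <= C &
  forall (a : 'I_4 -> 'rV[R]_4 -> 'rV[R]_(la_dim g)) (U : set 'rV[R]_4) (sg : R),
    open U -> (forall i, smooth_on U (a i)) ->
    (forall j y, U y -> \sum_i cov a i (curv a i j) y = 0) ->
    sg = 1 \/ sg = -1 ->
    forall y (l s : R), U y -> 0 <= s -> dens a y <= s ^+ 2 ->
    4 * (l * srad (sd_dens a sg) y - l ^+ 2 * sd_dens a sg y)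
    + (srot (om1 sg) (sd_h1 a sg) y + srot (om2 sg) (sd_h2 a sg) y + srot (om3 sg) (sd_h3 a sg) y)
    - C * (normsq y * s) * sd_dens a sg y <= srad (srad (sd_dens a sg)) y.
Proof.
have [C C0 HC] := @ip_br_bound R g.
(* Six trilinear terms with the common factor 2 give 12; the 64 is [4 ^+ 3] from
   [norm_le_rot_curv]. *)
exists (12 * C * 64); first by rewrite !mulr_ge0.
move=> a U sg oU sa ym sg1 y l s Uy s0 ys.
rewrite (srad_srad_sd_dens oU sa ym sg1 Uy) (srad_sd_dens sg oU sa Uy).
set p1 := sd1 a sg y; set p2 := sd2 a sg y; set p3 := sd3 a sg y.
set r1 := radial a _ y; set r2 := radial a _ y; set r3 := radial a _ y.
have Q (p r : 'rV[R]_(la_dim g)) : 2 * l * ip p r - l ^+ 2 * ip p p <= ip r r :> R.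
  have := @ip_ge0 R g (r - l *: p).
  rewrite ipBl !ipBr !ipZl !ipZr (ipC r p) => H; have -> : l ^+ 2 = l * l by []; lra.
have Q1 := Q p1 r1; have Q2 := Q p2 r2; have Q3 := Q p3 r3.
set q := sd_dens a sg y.
have qE : q = ip p1 p1 + ip p2 p2 + ip p3 p3 by [].
have q0 : 0 <= q by exact: sd_dens_ge0.
have P1 := @ip_ge0 R g p1; have P2 := @ip_ge0 R g p2; have P3 := @ip_ge0 R g p3.
have q2 : Num.sqrt q ^+ 2 = q by rewrite sqr_sqrtr.
have [w1 [w2 w3]] := planes_le1 sg1.
have n2 : Num.sqrt (normsq y) ^+ 2 = normsq y by rewrite sqr_sqrtr// normsq_ge0.
have W om : (forall i j, `|om i j| <= 1) ->
    norm_le (rot_curv a om y) (64 * (normsq y * s)).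
  move=> H; have := @norm_le_rot_curv R g 4 a om y (Num.sqrt (normsq y)) s H (sqrtr_ge0 _) s0.
  by rewrite n2 => /(_ (lexx _) ys); rewrite (_ : 4 ^+ 3 = 64 :> R); last by ring.
pose K := C * 64 * (normsq y * s) * q.
have T om p p' : (forall i j, `|om i j| <= 1) -> ip p p <= q -> ip p' p' <= q ->
    `|ip p (br (rot_curv a om y) p')| <= K.
  move=> /W[W0 Wq] pq pq'; rewrite -q2 in pq pq'.
  have := HC _ _ _ _ _ _ (sqrtr_ge0 q) W0 (sqrtr_ge0 q) pq Wq pq'.
  congr (_ <= _); rewrite /K -[in RHS]q2 expr2; ring.
have e1 : ip p1 p1 <= q by rewrite qE; lra.
have e2 : ip p2 p2 <= q by rewrite qE; lra.
have e3 : ip p3 p3 <= q by rewrite qE; lra.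
have := T _ _ _ w2 e1 e3; have := T _ _ _ w3 e1 e2; have := T _ _ _ w3 e2 e1.
have := T _ _ _ w1 e2 e3; have := T _ _ _ w1 e3 e2; have := T _ _ _ w2 e3 e1.
rewrite !ler_norml => /andP[? ?] /andP[? ?] /andP[? ?] /andP[? ?] /andP[? ?] /andP[? ?].
rewrite [X in l ^+ 2 * X]qE.
have -> : 12 * C * 64 * (normsq y * s) * q = 12 * K by rewrite /K; ring.
clearbody K; set X := (X in 2 * sg * X).
have X1 : - (6 * K) <= X by rewrite /X; lra.
have X2 : X <= 6 * K by rewrite /X; lra.
have HX : - (12 * K) <= 2 * sg * X by clear -X1 X2 sg1; case: sg1 => ->; lra.
clearbody X; lra.
Qed.

Lemma derive_pd (R : realType) m (h : 'rV[R]_m -> R) (x v : 'rV[R]_m) :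
  differentiable h x -> 'D_v h x = \sum_i v 0 i * pd i h x.
Proof.
move=> dh; have := derive_sum_dir (fun i : 'I_m => delta_mx 0 i) (fun i => v 0 i) dh.
rewrite -row_sum_delta => E; rewrite E; apply: eq_bigr => i _.
by rewrite -pdE.
Qed.

Lemma continuous_at_sum (R : realType) (T : topologicalType) (I : Type) (r : seq I)
    (F : I -> T -> R) (x : T) : (forall i, {for x, continuous (F i)}) ->
  {for x, continuous (fun y => \sum_(i <- r) F i y)}.
Proof.
move=> cF; elim: r => [|i r IH].
  rewrite (_ : (fun y => _) = fun=> 0); first exact: (@cst_continuous _ _ (0 : R) x).
  by apply/funext => y; rewrite big_nil.
rewrite (_ : (fun y => _) = fun y => F i y + \sum_(i <- r) F i y); first exact: (cvgD (cF i) IH).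
by apply/funext => y; rewrite big_cons.
Qed.

(** * Radial weights *)

Section radial_weights.
Context {R : realType}.
Local Notation U := (@unit_ball R).
Let oU : open U := @open_unit_ball R.

Lemma is_derive_radial m (phi : R -> R) (d : R) (y : 'rV[R]_m) i :
  is_derive (normsq y) 1 phi d ->
  is_derive y (delta_mx 0 i) (fun z => phi (normsq z)) (d * (2 * y 0 i)).
Proof.
move=> dphi; have sn := smooth_on_normsq (openT : open [set: 'rV[R]_m]).
have dn := smooth_on_diff sn (I : [set: 'rV[R]_m] y).
have dp : differentiable phi (normsq y) by apply/derivable1_diffP; exact: (@ex_derive _ _ _ _ _ _ _ dphi).
apply: DeriveDef; first by apply: diff_derivable; exact: differentiable_comp dn dp.
have E : 'D_(delta_mx 0 i) (@normsq R m) y = 2 * y 0 i.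
  by rewrite -(pd_normsq (openT : open [set: 'rV[R]_m]) i I) -pdE.
rewrite (derive_comp _ dn dp) E.
have L : 'D_((2 * y 0 i) *: (1 : R) + 0) phi (normsq y) = (2 * y 0 i) *: 'D_1 phi (normsq y) + 'D_0 phi (normsq y).
  exact: derive_linear_dir.
have Z : 'D_0 phi (normsq y) = 0 by rewrite deriveE// linear0.
have D1 : 'D_1 phi (normsq y) = d by exact: (@derive_val _ _ _ _ _ _ _ dphi).
have S1 : (2 * y 0 i) *: (1 : R) + 0 = 2 * y 0 i by rewrite addr0; exact: mulr1.
rewrite S1 Z D1 addr0 in L; rewrite L; exact: mulrC.
Qed.

(** The variable of a radial weight is the squared radius. Vanishing from [k < 1] on keeps the
    integrals away from the boundary of the ball, where nothing is known. *)
Definition admissible (phi dphi : R -> R) (k : R) : Prop :=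
  [/\ forall t : R, is_derive t 1 phi (dphi t), continuous dphi, k < 1,
      forall t, k <= t -> phi t = 0 & forall t, k <= t -> dphi t = 0].

Lemma admissible_continuous phi dphi k : admissible phi dphi k -> continuous phi.
Proof. by case=> d _ _ _ _ t; exact: is_derive_continuous (d t). Qed.

Lemma cc_radial (phi : R -> R) k (g : 'rV[R]_4 -> R) : continuous phi -> k < 1 ->
  (forall t, k <= t -> phi t = 0) -> (forall y, U y -> {for y, continuous g}) ->
  cc (fun y => phi (normsq y) * g y).
Proof.
move=> cphi k1 phi0 cg; apply: (cc_cut (k := k)).
- exact: continuous_radial.
- by move=> y ky; exact: phi0.
- by move=> y yk; apply: cg; exact: le_lt_trans yk k1.
Qed.

Lemma radial_div phi dphi k (g : 'I_4 -> 'rV[R]_4 -> R) : admissible phi dphi k ->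
  (forall i, smooth_on U (g i)) ->
  integral4 (fun y => dphi (normsq y) * (2 * \sum_i y 0 i * g i y))
  + integral4 (fun y => phi (normsq y) * \sum_i pd i (g i) y) = 0.
Proof.
move=> adm sg; have cphi := admissible_continuous adm.
case: adm => dp cd k1 p0 d0.
have ycont i (y : 'rV[R]_4) : {for y, continuous (fun y : 'rV[R]_4 => y 0 i)}.
  exact: smooth_on_continuous (smooth_on_coord i (openT : open setT)) I.
have P i : integral4 (fun y : 'rV[R]_4 => dphi (normsq y) * (2 * y 0 i) * g i y)
    + integral4 (fun y => phi (normsq y) * pd i (g i) y) = 0.
  apply: (integral4_parts (k := k) (i := i)).
  - exact: continuous_radial.
  - move=> y; have c1 := continuous_radial cd (x := y).
    exact: (cvgM c1 (cvgM (@cst_continuous _ _ (2 : R) y) (ycont i y))).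
  - by move=> y; exact: is_derive_radial.
  - by move=> y /p0.
  - by move=> y /d0 ->; rewrite mul0r.
  - by move=> y yk; exact: smooth_on_continuous (sg i) (le_lt_trans yk k1).
  - move=> y yk; exact: smooth_on_continuous (smooth_on_pd i (sg i)) (le_lt_trans yk k1).
  - by move=> y yk; apply: (is_derive_pd i (sg i)); exact: le_lt_trans yk k1.
have c1 i : cc (fun y : 'rV[R]_4 => dphi (normsq y) * (2 * y 0 i) * g i y).
  under eq_fun do rewrite -mulrA; apply: cc_radial d0 _ => // y Uy.
  have cg := smooth_on_continuous (sg i) Uy.
  exact: (cvgM (cvgM (@cst_continuous _ _ (2 : R) y) (ycont i y)) cg).
have c2 i : cc (fun y : 'rV[R]_4 => phi (normsq y) * pd i (g i) y).
  apply: cc_radial p0 _ => // y Uy; exact: smooth_on_continuous (smooth_on_pd i (sg i)) Uy.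
rewrite (_ : (fun y => dphi _ * _) =
  fun y => \sum_i dphi (normsq y) * (2 * y 0 i) * g i y); last first.
  by apply/funext => y; rewrite !mulr_sumr; apply: eq_bigr => i _; rewrite !mulrA.
rewrite (_ : (fun y => phi _ * _) = fun y => \sum_i phi (normsq y) * pd i (g i) y); last first.
  by apply/funext => y; rewrite mulr_sumr.
rewrite (integral4_sum _ c1) (integral4_sum _ c2) -big_split big1// => i _.
exact: P.
Qed.

Lemma normsq_dilate m (r : R) (y : 'rV[R]_m) : normsq (r *: y) = r ^+ 2 * normsq y.
Proof. by rewrite /normsq mulr_sumr; apply: eq_bigr => i _; rewrite mxE exprMn. Qed.

Lemma unit_ball_dilate (r : R) y : `|r| <= 1 -> U y -> U (r *: y).
Proof.
move=> r1; rewrite /unit_ball /= normsq_dilate => Uy; apply: le_lt_trans Uy.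
by rewrite ler_piMl ?normsq_ge0// -real_normK ?num_real// expr_le1.
Qed.

Let smooth_on_scale (r : R) : smooth_on U (fun y : 'rV[R]_4 => r *: y).
Proof.
apply: smooth_onZ => //; first exact: smooth_on_cst.
by apply/smooth_onP => k; exact: csmooth_id.
Qed.

Lemma smooth_on_dilate (W : normedModType R) (f : 'rV[R]_4 -> W) (r : R) : `|r| <= 1 ->
  smooth_on U f -> smooth_on U (fun y => f (r *: y)).
Proof.
by move=> r1 sf; apply: (smooth_on_comp oU _ sf) => // y; exact: unit_ball_dilate.
Qed.

Lemma pd_dilate (f : 'rV[R]_4 -> R) (r : R) i y : `|r| <= 1 -> smooth_on U f -> U y ->
  pd i (fun y => f (r *: y)) y = r * pd i f (r *: y).
Proof.
move=> r1 sf Uy.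
have sr := smooth_on_scale r.
rewrite (pd_comp i (fun x => unit_ball_dilate r1) sf sr Uy).
rewrite (eq_bigr (fun b => (i == b)%:R *: (r * pd b f (r *: y)))) ?sum_delta_scale// => b _.
have sb : smooth_on U (fun x : 'rV[R]_4 => x 0 b) by exact: smooth_on_coord.
have sc : smooth_on U (fun _ : 'rV[R]_4 => r) by exact: smooth_on_cst.
under eq_fun do rewrite mxE.
by rewrite (pdM i sc sb Uy) pd_cst mul0r add0r pd_coord scalerA mulrC.
Qed.

(** For antisymmetric [om] the field is divergence free and tangent to spheres, hence annihilates
    both constants and radial weights under integration by parts. *)
Lemma integral_srot phi dphi k om (h : 'rV[R]_4 -> R) (r : R) : admissible phi dphi k ->
  (forall i j, om i j = - om j i) -> smooth_on U h -> `|r| <= 1 ->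
  integral4 (fun y => phi (normsq y) * srot om h (r *: y)) = 0.
Proof.
move=> adm anti sh r1.
have shr := smooth_on_dilate r1 sh.
pose g j := fun y : 'rV[R]_4 => (\sum_i om i j * y 0 i) * h (r *: y).
have sl j : smooth_on U (fun y : 'rV[R]_4 => \sum_i om i j * y 0 i).
  apply: smooth_on_sum => // i; apply: smooth_onM => //; first exact: smooth_on_cst.
  exact: smooth_on_coord.
have sg j : smooth_on U (g j) by exact: smooth_onM.
have := radial_div adm sg.
have -> : (fun y : 'rV[R]_4 => dphi (normsq y) * (2 * \sum_i y 0 i * g i y)) = fun=> 0.
  apply/funext => y.
  suff E : \sum_j \sum_i y 0 j * (om i j * y 0 i) = 0.
    rewrite (_ : \sum_i _ = (\sum_j \sum_i y 0 j * (om i j * y 0 i)) * h (r *: y)).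
      by rewrite E mul0r !mulr0.
    rewrite mulr_suml; apply: eq_bigr => j _; rewrite /g mulrA mulr_sumr; congr (_ * _).
  apply: (@eqNr_eq0 R R^o); rewrite {1}exchange_big -sumrN/=; apply: eq_bigr => j _.
  rewrite -sumrN; apply: eq_bigr => i _; rewrite anti; ring.
rewrite integral4_0 add0r => E; rewrite -[RHS]E.
case: adm => _ _ k1 p0 _.
congr integral4; apply/funext => y.
have [yk|/p0 ->] := ltP (normsq y) k; last by rewrite !mul0r.
have Uy : U y by exact: lt_trans yk k1.
congr (_ * _); rewrite /srot exchange_big; apply: eq_bigr => j _.
rewrite (pdM j (sl j) shr Uy) (pd_dilate j r1 sh Uy).
have -> : pd j (fun y : 'rV[R]_4 => \sum_i om i j * y 0 i) y = 0.
  have si i : smooth_on U (fun y : 'rV[R]_4 => om i j * y 0 i).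
    apply: smooth_onM => //; first exact: smooth_on_cst; exact: smooth_on_coord.
  rewrite (pd_sum oU j _ si Uy) big1// => i _.
  have sb : smooth_on U (fun x : 'rV[R]_4 => x 0 i) by exact: smooth_on_coord.
  have sc : smooth_on U (fun _ : 'rV[R]_4 => om i j) by exact: smooth_on_cst.
  rewrite (pdM j sc sb Uy) pd_cst mul0r add0r pd_coord; case: eqVneq => [->|]; last by rewrite mulr0.
  by rewrite (@eqNr_eq0 R R^o _ (anti i i)) mul0r.
rewrite mul0r add0r mulr_suml; apply: eq_bigr => i _; rewrite mxE; ring.
Qed.

Definition dilation_mean (phi : R -> R) (h : 'rV[R]_4 -> R) (r : R) : R :=
  integral4 (fun y => phi (normsq y) * h (r *: y)).

(** The support of the weight leaves room to dilate a little beyond [r = 1], so the mean is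
    differentiable at [r = 1] itself, an end point of the range used in [frequency_monotone]. *)
Lemma is_derive_dilation_mean phi dphi k h : admissible phi dphi k -> 0 <= k ->
  smooth_on U h -> exists2 v : R, 1 < v & forall r, - v < r < v ->
  is_derive r 1 (dilation_mean phi h)
    (integral4 (fun y => phi (normsq y) * \sum_i y 0 i * pd i h (r *: y))).
Proof.
move=> adm k0 sh; have cphi := admissible_continuous adm.
case: adm => _ _ k1 p0 _.
have [w w1 wk] : exists2 w : R, 1 < w & w ^+ 2 * k < 1.
  (* With [k = 1 - 4 * u], the product [(1 + u)^2 * k] is [1 - 2 u - 7 u^2 - 4 u^3]. *)
  pose u := (1 - k) / 4.
  exists (1 + u); first by rewrite ltrDl divr_gt0// subr_gt0.
  have u0 : 0 < u by rewrite divr_gt0// subr_gt0.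
  have -> : k = 1 - 4 * u by rewrite /u; lra.
  have u1 : u <= 4^-1 by rewrite /u; lra.
  rewrite expr2; nra.
exists w => // r rw.
have NU s y : - w < s < w -> normsq y <= k -> U (s *: y).
  move=> /andP[ws sw] yk; rewrite /unit_ball /=.
  rewrite normsq_dilate; apply: le_lt_trans wk; apply: le_trans (ler_wpM2l (sqr_ge0 s) yk) _.
  by rewrite ler_wpM2r// !expr2; nra.
apply: (integral4_is_derive (u := - w) (v := w) (k := k)
  (F := fun r y => phi (normsq y) * h (r *: y))
  (dF := fun r y => phi (normsq y) * \sum_i y 0 i * pd i h (r *: y))) => //.
- move=> s y sw yk; have dh := smooth_on_diff sh (NU s y sw yk).
  have := @is_derive_line R _ _ h 0 y s; rewrite add0r => /(_ dh).
  under eq_fun do rewrite add0r.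
  move=> H; have := is_deriveZ (phi (normsq y)) H; congr is_derive; congr (_ * _).
  by rewrite -(derive_pd y dh).
- by move=> s y _ /p0 ->; rewrite mul0r.
- by move=> s y _ /p0 ->; rewrite mul0r.
- move=> s sw; apply: (cc_cut (k := k)).
  + exact: continuous_radial.
  + by move=> y /p0.
  + move=> y yk; apply: (@continuous_comp _ _ _ (fun y : 'rV[R]_4 => s *: y) h).
      exact: scaler_continuous.
    exact: smooth_on_continuous sh (NU s y sw yk).
- move=> s y sw yk.
  have cs : {for (s, y), continuous (fun p : R * 'rV[R]_4 => p.1 *: p.2)}.
    exact: scale_continuous.
  have cy i : {for (s, y), continuous (fun p : R * 'rV[R]_4 => p.2 0 i)}.
    apply: (@continuous_comp _ _ _ snd (fun y : 'rV[R]_4 => y 0 i)); first exact: cvg_snd.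
    exact: smooth_on_continuous (smooth_on_coord i (openT : open setT)) I.
  have cp : {for (s, y), continuous (fun p : R * 'rV[R]_4 => phi (normsq p.2))}.
    apply: (@continuous_comp _ _ _ snd (fun y : 'rV[R]_4 => phi (normsq y))); first exact: cvg_snd.
    exact: continuous_radial.
  have cS : {for (s, y), continuous (fun p : R * 'rV[R]_4 => \sum_i p.2 0 i * pd i h (p.1 *: p.2))}.
    apply: continuous_at_sum => i.
    suff C : {for (s, y), continuous (fun p : R * 'rV[R]_4 => pd i h (p.1 *: p.2))}.
      exact: (cvgM (cy i) C).
    apply: (@continuous_comp _ _ _ (fun p : R * 'rV[R]_4 => p.1 *: p.2) (pd i h)) => //.
    exact: smooth_on_continuous (smooth_on_pd i sh) (NU s y sw yk).
  exact: (cvgM cp cS).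
Qed.

End radial_weights.

(** * Energy flux *)

Section real_derivatives.
Context {R : realType}.
Implicit Types (f g : R -> R) (x a b c : R).

Lemma der_eq f x a b : is_derive x 1 f a -> a = b -> is_derive x 1 f b.
Proof. by move=> H <-. Qed.

Lemma der_cst c x : is_derive x 1 (fun _ : R => c) (0 : R).
Proof. exact: is_derive_cst. Qed.

Lemma der_id x : is_derive x 1 (fun t : R => t) (1 : R).
Proof. exact: is_derive_id. Qed.

Lemma derD f g x a b : is_derive x 1 f a -> is_derive x 1 g b ->
  is_derive x 1 (fun t => f t + g t) (a + b).
Proof. exact: is_deriveD. Qed.

Lemma derB f g x a b : is_derive x 1 f a -> is_derive x 1 g b ->
  is_derive x 1 (fun t => f t - g t) (a - b).
Proof. exact: is_deriveB. Qed.

Lemma derM f g x a b : is_derive x 1 f a -> is_derive x 1 g b ->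
  is_derive x 1 (fun t => f t * g t) (a * g x + f x * b).
Proof.
by move=> df dg; apply: der_eq (is_deriveM df dg) _; rewrite addrC mulrC.
Qed.

Lemma derZ c f x a : is_derive x 1 f a -> is_derive x 1 (fun t => c * f t) (c * a).
Proof. by move=> df; apply: der_eq (derM (der_cst c x) df) _; rewrite mul0r add0r. Qed.

Lemma derV f x a : f x != 0 -> is_derive x 1 f a ->
  is_derive x 1 (fun t => (f t)^-1) (- (f x ^+ 2)^-1 * a).
Proof. by move=> f0 df; apply: der_eq (is_deriveV f0 df) _. Qed.

Lemma der_comp f g x a b : is_derive (g x) 1 f a -> is_derive x 1 g b ->
  is_derive x 1 (fun t => f (g t)) (a * b).
Proof. exact: is_derive1_comp. Qed.

Lemma der_near f g x a : (\forall t \near x, f t = g t) -> is_derive x 1 f a ->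
  is_derive x 1 g a.
Proof. by move=> fg; apply: near_eq_is_derive. Qed.

Lemma der_pos_sub n c x :
  is_derive x 1 (fun t => pos (t - c) ^+ n.+2) (n.+2%:R * pos (x - c) ^+ n.+1).
Proof.
apply: der_eq (der_comp (f := fun x : R => pos x ^+ n.+2) (g := fun t => t - c) (is_derive_pos n (x - c)) (derB (der_id x) (der_cst c x))) _.
by rewrite subr0 mulr1.
Qed.

Lemma der_sub_pos n c x :
  is_derive x 1 (fun t => pos (c - t) ^+ n.+2) (- (n.+2%:R * pos (c - x) ^+ n.+1)).
Proof.
apply: der_eq (der_comp (f := fun x : R => pos x ^+ n.+2) (g := fun t => c - t) (is_derive_pos n (c - x)) (derB (der_cst c x) (der_id x))) _.
by rewrite sub0r mulrN1.
Qed.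

Lemma continuousM_at (T : topologicalType) (f g : T -> R) (x : T) :
  {for x, continuous f} -> {for x, continuous g} -> {for x, continuous (fun y => f y * g y)}.
Proof. by move=> cf cg; exact: (cvgM cf cg). Qed.

Lemma continuousD_at (T : topologicalType) (f g : T -> R) (x : T) :
  {for x, continuous f} -> {for x, continuous g} -> {for x, continuous (fun y => f y + g y)}.
Proof. by move=> cf cg; exact: (cvgD cf cg). Qed.

Lemma continuousB_at (T : topologicalType) (f g : T -> R) (x : T) :
  {for x, continuous f} -> {for x, continuous g} -> {for x, continuous (fun y => f y - g y)}.
Proof. by move=> cf cg; exact: (cvgB cf cg). Qed.

Lemma continuousN_at (T : topologicalType) (f : T -> R) (x : T) :
  {for x, continuous f} -> {for x, continuous (fun y => - f y)}.
Proof. by move=> cf; exact: (cvgN cf). Qed.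

Lemma continuousX_at (T : topologicalType) (f : T -> R) n (x : T) :
  {for x, continuous f} -> {for x, continuous (fun y => f y ^+ n)}.
Proof.
move=> cf; apply: (@continuous_comp _ _ _ f (fun x => x ^+ n)) => //.
exact: exprn_continuous.
Qed.

Lemma continuousV_at (T : topologicalType) (f : T -> R) (x : T) :
  f x != 0 -> {for x, continuous f} -> {for x, continuous (fun y => (f y)^-1)}.
Proof. by move=> f0 cf; exact: (cvgV f0 cf). Qed.

Lemma continuous_cst_at (T : topologicalType) (c : R) (x : T) :
  {for x, continuous (fun _ : T => c)}.
Proof. exact: (@cst_continuous _ _ c x). Qed.

Lemma continuous_pos_at (T : topologicalType) (f : T -> R) (x : T) :
  {for x, continuous f} -> {for x, continuous (fun y => pos (f y))}.
Proof.
by move=> cf; apply: (@continuous_comp _ _ _ f pos) => //; exact: continuous_pos.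
Qed.

Lemma continuous_opp_at (x : R) : {for x, continuous (-%R : R -> R)}.
Proof. exact: opp_continuous. Qed.

Lemma continuous_id_at (x : R) : {for x, continuous (fun y : R => y)}.
Proof. exact: cvg_id. Qed.

End real_derivatives.

Ltac contin := repeat first
  [ assumption
  | match goal with
    | |- prop_for _ (inPhantom (continuous (fun=> ?c))) => apply: continuous_cst_at
    | |- prop_for _ (inPhantom (continuous (fun x => x))) => apply: continuous_id_at
    | |- prop_for _ (inPhantom (continuous -%R)) => apply: continuous_opp_at
    | |- prop_for _ (inPhantom (continuous (fun x => _ + _))) => apply: continuousD_at
    | |- prop_for _ (inPhantom (continuous (fun x => - _))) => apply: continuousN_at
    | |- prop_for _ (inPhantom (continuous (fun x => _ * _))) => apply: continuousM_at
    | |- prop_for _ (inPhantom (continuous (fun x => _ ^+ _))) => apply: continuousX_at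
    | |- prop_for _ (inPhantom (continuous (fun x => pos _))) => apply: continuous_pos_at
    | |- prop_for _ (inPhantom (continuous (fun x => _^-1))) => apply: continuousV_at
    end
  | solve [auto] ].

Section ramp.
Context {R : realType}.
Variable eps : R.
Hypothesis eps0 : 0 < eps.

(** A continuously differentiable, nondecreasing cutoff: 0 up to [eps], at least 1/2 from [2 * eps]
    on, and below 1. *)
Definition ramp (z : R) : R := 1 - eps ^+ 2 * (eps ^+ 2 + pos (z - eps) ^+ 2)^-1.
Definition dramp (z : R) : R :=
  2 * eps ^+ 2 * pos (z - eps) * ((eps ^+ 2 + pos (z - eps) ^+ 2) ^+ 2)^-1.

Let den0 z : 0 < eps ^+ 2 + pos (z - eps) ^+ 2.
Proof. by rewrite ltr_pwDl ?exprn_gt0// sqr_ge0. Qed.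

Lemma is_derive_ramp (z : R) : is_derive z 1 ramp (dramp z).
Proof.
have n0 : eps ^+ 2 + pos (z - eps) ^+ 2 != 0 by rewrite gt_eqF.
have H := derV (f := fun t => eps ^+ 2 + pos (t - eps) ^+ 2) n0
  (derD (der_cst (eps ^+ 2) z) (der_pos_sub 0 eps z)).
apply: der_eq (derB (der_cst 1 z) (derZ (eps ^+ 2) H)) _.
rewrite /dramp expr1; ring.
Qed.

Lemma continuous_ramp : continuous ramp.
Proof. by move=> z; exact: is_derive_continuous (is_derive_ramp z). Qed.

Lemma continuous_dramp : continuous dramp.
Proof.
move=> z; suff: {for z, continuous dramp} by [].
rewrite /dramp; contin.
by have := exprn_gt0 2 (den0 z); rewrite lt0r => /andP[].
Qed.

Lemma ramp_ge0 z : 0 <= ramp z.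
Proof. by rewrite /ramp subr_ge0 ler_pdivrMr// mul1r lerDl sqr_ge0. Qed.

Lemma ramp_le1 z : ramp z <= 1.
Proof. by rewrite /ramp gerBl mulr_ge0 ?sqr_ge0// invr_ge0 ltW. Qed.

Lemma dramp_ge0 z : 0 <= dramp z.
Proof.
apply: mulr_ge0; last by rewrite invr_ge0 sqr_ge0.
by apply: mulr_ge0 (pos_ge0 _); rewrite mulr_ge0 ?sqr_ge0.
Qed.

Lemma ramp_eq0 z : z <= eps -> ramp z = 0.
Proof.
move=> ze; rewrite /ramp pos0 ?subr_le0// expr0n addr0 divff ?subrr//.
by rewrite gt_eqF// exprn_gt0.
Qed.

Lemma dramp_eq0 z : z <= eps -> dramp z = 0.
Proof. by move=> ze; rewrite /dramp pos0 ?subr_le0// mulr0 mul0r. Qed.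

Lemma ramp_ge_half z : 2 * eps <= z -> 2^-1 <= ramp z.
Proof.
move=> ze; rewrite /ramp; have zp : eps <= pos (z - eps) by rewrite (le_trans _ (le_pos _))//; lra.
have H : eps ^+ 2 <= pos (z - eps) ^+ 2 by rewrite ler_sqr// nnegrE ?pos_ge0// ltW.
have h : eps ^+ 2 / (eps ^+ 2 + pos (z - eps) ^+ 2) <= 2^-1 by rewrite ler_pdivrMr//; lra.
lra.
Qed.

End ramp.

Section energy_flux.
Context {R : realType}.
Local Notation U := (@unit_ball R).
Local Notation C := (@light_cone R).
Let oU : open U := @open_unit_ball R.
Variable e : 'rV[R]_5 -> R.
Hypotheses (se : smooth_on C e) (e0 : forall p, C p -> 0 <= e p).
Hypothesis euler : forall p, C p -> \sum_b p 0 b * pd b e p = - 4 * e p.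
Variable eps : R.
Hypotheses (eps0 : 0 < eps) (eps1 : eps <= 1).
Local Notation l := (lift ord0).

(* The slices interpolate between the disc {t = 1} (s = 0) and the hyperboloid
   (s = 1). *)
Definition slice (s : R) (y : 'rV[R]_4) : 'rV[R]_5 := event (1 + s * ((normsq y - 1) / 2)) y.
(** The height of the slice minus [y] times the gradient of the height: the flux density of the
    scaling field through the slice, where [t] is the squared radius. *)
Definition slope (s t : R) : R := 1 - s * ((1 + t) / 2).
(** For [t <= 1] this is the squared time minus the squared radius at the point of slice [s] over
    squared radius [t], so it measures the distance to the light cone. [gap_t] and [gap_s] are its
    derivatives. *)
Definition gap (s t : R) : R := pos (1 - t) * (1 - s) + s ^+ 2 * pos (1 - t) ^+ 2 / 4.
Definition gap_t (s t : R) : R := - ((1 - s) + s ^+ 2 * pos (1 - t) / 2).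
Definition gap_s (s t : R) : R := - pos (1 - t) + s * pos (1 - t) ^+ 2 / 2.

(** Over [normsq y <= k] the slices lie in the cone, and from [k] on the gap is at most [eps], so
    the ramp vanishes. Both hold for [s] in a neighbourhood []u, v[] of the unit interval, which
    gives derivatives at its end points. *)
Let k : R := 1 - eps / 2.
Let u : R := - (eps / 16).
Let v : R := 1 + eps / 16.

Let slice_cone (s : R) y : u < s < v -> normsq y <= k -> C (slice s y).
Proof.
have eps_gt0 := eps0; have eps_le1 := eps1.
move=> /andP[us sv] yk; apply/light_cone_event; have y0 := normsq_ge0 y.
move: us sv yk; rewrite /u /v /k; set t := normsq y in y0 * => us sv yk.
pose d := 1 - t; have tE : t = 1 - d by rewrite /d; lra.
have d1 : d <= 1 by rewrite /d; lra.
have d0 : eps / 2 <= d by rewrite /d; lra.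
have dp : 0 < d by apply: lt_le_trans d0; exact: divr_gt0.
clearbody d.
rewrite tE; split; first by nra.
have H : 0 < d * (1 - s) + s ^+ 2 * d ^+ 2 / 4; last by rewrite !expr2 in H *; lra.
have [s1|s1] := lerP s (1 / 2).
  have := sqr_ge0 (s * d); rewrite exprMn => S; have : 0 < d * (1 - s) by apply: mulr_gt0; lra.
  by lra.
have s2 : 1 / 4 <= s ^+ 2 by rewrite expr2; nra.
have [s3|s3] := lerP s 1.
  have : 0 <= d * (1 - s) by apply: mulr_ge0; lra.
  have : 0 < s ^+ 2 * d ^+ 2 by apply: mulr_gt0; apply: exprn_gt0; lra.
  by lra.
have s4 : 1 <= s ^+ 2 by rewrite expr2; nra.
have : d * (s - 1) <= d * (eps / 16) by rewrite ler_pM2l//; lra.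
have : d * (eps / 8) <= d ^+ 2 / 4 by rewrite expr2; nra.
have : d ^+ 2 <= s ^+ 2 * d ^+ 2 by rewrite ler_peMl// sqr_ge0.
have : 0 < d * eps by exact: mulr_gt0.
lra.
Qed.

Let slice_cone_ball (s : R) y : 0 <= s <= 1 -> U y -> C (slice s y).
Proof.
move=> /andP[us sv] yk; apply/light_cone_event; have y0 := normsq_ge0 y.
move: yk; rewrite /unit_ball /=; set t := normsq y in y0 * => yk.
pose d := 1 - t; have tE : t = 1 - d by rewrite /d; lra.
have d1 : d <= 1 by rewrite /d; lra.
have dp : 0 < d by rewrite /d; lra.
rewrite tE; split; first by nra.
have H : 0 < d * (1 - s) + s ^+ 2 * d ^+ 2 / 4; last by rewrite !expr2 in H *; lra.
have [s1|s1] := lerP s (1 / 2).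
  have := sqr_ge0 (s * d); rewrite exprMn => S; have : 0 < d * (1 - s) by apply: mulr_gt0; lra.
  by lra.
have : 0 <= d * (1 - s) by apply: mulr_ge0; lra.
have : 0 < s ^+ 2 * d ^+ 2 by apply: mulr_gt0; apply: exprn_gt0; lra.
by lra.
Qed.

Let k1 : k < 1. Proof. by have := eps0; rewrite /k; lra. Qed.

Let gap_small s t : u < s < v -> k <= t -> gap s t <= eps.
Proof.
have eps_gt0 := eps0; have eps_le1 := eps1.
move=> /andP[us sv] kt; have p0 := pos_ge0 (1 - t).
have p1 : pos (1 - t) <= eps / 2.
  have [h|h] := lerP 0 (1 - t); last by rewrite pos0 ?ltW//; lra.
  rewrite pos_nneg//; move: kt; rewrite /k. lra.
move: us sv; rewrite /gap /u /v; set D := pos _ in p0 p1 * => us sv.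
have h1 : D * (1 - s) <= D * 2 by apply: ler_wpM2l => //; lra.
have h1' : D * (1 - s) <= (eps / 2) * (17 / 16).
  by apply: le_trans (_ : D * (17 / 16) <= _); [apply: ler_wpM2l => //; lra|lra].
have h2 : s ^+ 2 <= 2 by rewrite expr2; nra.
have h3 : D ^+ 2 <= eps / 4 by rewrite expr2; nra.
have h4 : s ^+ 2 * D ^+ 2 <= 2 * (eps / 4) by apply: ler_pM => //; exact: sqr_ge0.
lra.
Qed.

Let ramp_gap_admissible (s : R) : 0 <= s <= 1 ->
  admissible (fun t => ramp eps (gap s t)) (fun t => dramp eps (gap s t) * gap_t s t) k.
Proof.
have eps_gt0 := eps0; have eps_le1 := eps1.
move=> s01; have uv : u < s < v.
  by move: s01 => /andP[s0 s1]; rewrite /u /v; apply/andP; split; lra.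
have [k11 eps00] := (k1, eps0); split; [| |exact: k1| |].
- move=> t; have [t1|t1] := ltP t 1; last first.
    have kt' : k <= t by apply: ltW; exact: lt_le_trans k11 t1.
    rewrite (dramp_eq0 (gap_small uv kt')) mul0r.
    apply: is_derive_near0; have kt : k < t by exact: lt_le_trans k11 t1.
    by apply: filterS (lt_nbhsr kt) => x /ltW kx; apply: ramp_eq0 => //; exact: gap_small.
  have E : \forall x \near t, (1 - x) * (1 - s) + s ^+ 2 * (1 - x) ^+ 2 / 4 = gap s x.
    by apply: filterS (lt_nbhsl t1) => x x1; rewrite /gap pos_nneg// subr_ge0 ltW.
  have d1 := derB (der_cst 1 t) (der_id t).
  have d2 := derD (derM d1 (der_cst (1 - s) t))
    (derM (derZ (s ^+ 2) (derM d1 d1)) (der_cst 4^-1 t)).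
  have H : is_derive t 1 (gap s) (gap_t s t).
    apply: der_near E _; apply: der_eq d2 _.
    by rewrite /gap_t pos_nneg ?subr_ge0 ?ltW//; field.
  exact: der_comp (is_derive_ramp eps0 (gap s t)) H.
- move=> t; suff: {for t, continuous (fun t => dramp eps (gap s t) * gap_t s t)} by [].
  apply: continuousM_at; last by rewrite /gap_t; contin.
  apply: (@continuous_comp _ _ _ (gap s) (dramp eps)); last exact: continuous_dramp.
  by rewrite /gap; contin.
- by move=> t kt; apply: ramp_eq0 => //; exact: gap_small.
- by move=> t kt; rewrite dramp_eq0 ?mul0r//; exact: gap_small.
Qed.

Let der_slice s y : C (slice s y) ->
  is_derive s 1 (fun s => e (slice s y)) ((normsq y - 1) / 2 * pd ord0 e (slice s y)).
Proof.
move=> Cs; have E (r : R) : slice r y = event 1 y + r *: (((normsq y - 1) / 2) *: delta_mx 0 ord0).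
  apply: row5P => [|i].
    by rewrite event0 mxE event0 !mxE eqxx/= mulr1.
  by rewrite eventS mxE eventS !mxE/= !mulr0 addr0.
have := @is_derive_line R _ _ e (event 1 y) (((normsq y - 1) / 2) *: delta_mx 0 ord0) s.
rewrite -E => /(_ (smooth_on_diff se Cs)) H.
rewrite (_ : (fun s => e (slice s y)) = fun t => e (event 1 y + t *: (((normsq y - 1) / 2) *: delta_mx 0 ord0))).
  apply: der_eq H _; rewrite (derive_pd _ (smooth_on_diff se Cs)) (bigD1 ord0)//= big1 ?addr0.
    by rewrite !mxE !eqxx mulr1.
  by move=> b /negPf b0; rewrite !mxE eq_sym eq_sym b0 andbF mulr0 mul0r.
by apply/funext => t; rewrite E.
Qed.

Let smooth_on_slice s : smooth_on U (slice s).
Proof.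
apply: smooth_on_row => // b; case: (unliftP ord0 b) => [i ->|->].
  by under eq_fun do rewrite eventS; exact: smooth_on_coord.
under eq_fun do rewrite event0.
apply: smooth_onD; smooth; exact: smooth_on_normsq.
Qed.

Let pd_slice (s : R) i y : 0 <= s <= 1 -> U y -> pd i (fun y => e (slice s y)) y =
  s * y 0 i * pd ord0 e (slice s y) + pd (l i) e (slice s y).
Proof.
move=> s01 Uy; rewrite (pd_comp i (fun x => slice_cone_ball s01) se (smooth_on_slice s) Uy).
rewrite big_ord_recl; congr (_ + _).
  under eq_fun do rewrite event0.
  have c1 : smooth_on U (fun _ : 'rV[R]_4 => 1 : R) by exact: smooth_on_cst.
  have cs : smooth_on U (fun _ : 'rV[R]_4 => s) by exact: smooth_on_cst.
  have c2 : smooth_on U (fun _ : 'rV[R]_4 => 2^-1 : R) by exact: smooth_on_cst.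
  have sn := smooth_on_normsq oU.
  have sn1 := smooth_onB oU sn c1; have sn2 := smooth_onM oU sn1 c2.
  rewrite (pdD i c1 (smooth_onM oU cs sn2) Uy) (pdM i cs sn2 Uy) (pdM i sn1 c2 Uy).
  rewrite (pdB oU i sn c1 Uy) (pd_normsq oU i Uy) !pd_cst; congr (_ * _); by field.
rewrite (eq_bigr (fun j => (i == j)%:R *: pd (l j) e (slice s y))) ?sum_delta_scale// => j _.
by under eq_fun do rewrite eventS; rewrite pd_coord.
Qed.

(** The position vector times [e] times the velocity of the slice in [s]. Its divergence, once
    weighted, cancels the time derivative of [e] in [dF]. *)
Let w s i (y : 'rV[R]_4) : R := y 0 i * ((normsq y - 1) / 2 * e (slice s y)).

Let smooth_on_w (s : R) i : 0 <= s <= 1 -> smooth_on U (w s i).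
Proof.
move=> s01; apply: smooth_onM => //; first exact: smooth_on_coord.
apply: smooth_onM => //; last first.
  exact: smooth_on_comp oU (fun x => slice_cone_ball s01) se (smooth_on_slice s).
smooth; exact: smooth_on_normsq.
Qed.

Let div_w (s : R) y : 0 <= s <= 1 -> U y -> \sum_i pd i (w s i) y =
  normsq y * e (slice s y) - (normsq y - 1) / 2 * slope s (normsq y) * pd ord0 e (slice s y).
Proof.
move=> s01 Uy.
have sg : smooth_on U (fun y : 'rV[R]_4 => (normsq y - 1) / 2).
  smooth; exact: smooth_on_normsq.
have ses := smooth_on_comp oU (fun x => slice_cone_ball s01) se (smooth_on_slice s).
have E i : pd i (w s i) y = (normsq y - 1) / 2 * e (slice s y) + y 0 i * y 0 i * e (slice s y)
   + (normsq y - 1) / 2 * s * (y 0 i * y 0 i) * pd ord0 e (slice s y)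
   + (normsq y - 1) / 2 * (y 0 i * pd (l i) e (slice s y)).
  have sc : smooth_on U (fun y : 'rV[R]_4 => y 0 i) by exact: smooth_on_coord.
  rewrite (pdM i sc (smooth_onM oU sg ses) Uy) (pdM i sg ses Uy) pd_coord eqxx mul1r.
  rewrite (pd_slice i s01 Uy).
  have -> : pd i (fun y : 'rV[R]_4 => (normsq y - 1) / 2) y = y 0 i.
    have c1 : smooth_on U (fun _ : 'rV[R]_4 => 1 : R) by exact: smooth_on_cst.
    have c2 : smooth_on U (fun _ : 'rV[R]_4 => 2^-1 : R) by exact: smooth_on_cst.
    have sn := smooth_on_normsq oU.
    rewrite (pdM i (smooth_onB oU sn c1) c2 Uy) (pdB oU i sn c1 Uy) (pd_normsq oU i Uy) !pd_cst.
    by field.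
  ring.
have := euler (slice_cone_ball s01 Uy); rewrite big_ord_recl event0.
under eq_bigr do rewrite eventS.
move=> Eu; under eq_bigr do rewrite E.
rewrite !big_split/= -!mulr_sumr -!mulr_suml -mulr_sumr -[X in X *+ _]/(_).
rewrite sumr_const card_ord -mulr_natl.
have N : \sum_i y 0 i * y 0 i = normsq y by apply: eq_bigr => i _; rewrite expr2.
rewrite N /slope; set S := \sum_i _ in Eu *.
have -> : S = - 4 * e (slice s y) - (1 + s * ((normsq y - 1) / 2)) * pd ord0 e (slice s y).
  by rewrite -Eu; ring.
by field.
Qed.

Let H s := integral4 (fun y => ramp eps (gap s (normsq y)) * (e (slice s y) * slope s (normsq y))).
Let dF s (y : 'rV[R]_4) := dramp eps (gap s (normsq y)) * gap_s s (normsq y)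
    * (e (slice s y) * slope s (normsq y))
  + ramp eps (gap s (normsq y)) * ((normsq y - 1) / 2 * pd ord0 e (slice s y) * slope s (normsq y)
     - e (slice s y) * ((1 + normsq y) / 2)).

Let continuous_normsq_snd (p : R * 'rV[R]_4) : {for p, continuous (fun p : R * 'rV[R]_4 => normsq p.2)}.
Proof.
apply: (@continuous_comp _ _ _ snd (@normsq R 4)); first exact: cvg_snd.
exact: continuous_normsq.
Qed.

Let continuous_fst (p : R * 'rV[R]_4) : {for p, continuous (fun p : R * 'rV[R]_4 => p.1)}.
Proof. exact: cvg_fst. Qed.

Let continuous_slice (p : R * 'rV[R]_4) : {for p, continuous (fun p : R * 'rV[R]_4 => slice p.1 p.2)}.
Proof.
have oT : open [set: R * 'rV[R]_4] by exact: openT.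
have s1 : smooth_on setT (fun p : R * 'rV[R]_4 => p.1) by apply/smooth_onP => j; exact: csmooth_fst.
have s2 : smooth_on setT (fun p : R * 'rV[R]_4 => p.2) by apply/smooth_onP => j; exact: csmooth_snd.
have sn : smooth_on setT (fun p : R * 'rV[R]_4 => normsq p.2).
  exact: (smooth_on_comp oT (fun _ _ => I) (smooth_on_normsq (openT : open [set: 'rV[R]_4])) s2).
have S : smooth_on setT (fun p : R * 'rV[R]_4 => slice p.1 p.2).
  apply: smooth_on_row => // b; case: (unliftP ord0 b) => [i ->|->].
    under eq_fun do rewrite eventS.
    exact: (smooth_on_comp oT (fun _ _ => I) (smooth_on_coord i (openT : open [set: 'rV[R]_4])) s2).
  under eq_fun do rewrite event0.
  have c (x : R) : smooth_on [set: R * 'rV[R]_4] (fun=> x) by exact: smooth_on_cst.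
  exact: (smooth_onD oT (c 1) (smooth_onM oT s1 (smooth_onM oT (smooth_onB oT sn (c 1)) (c 2^-1)))).
exact: smooth_on_continuous S I.
Qed.

Let continuous_field (f : 'rV[R]_5 -> R) s y : smooth_on C f -> u < s < v -> normsq y <= k ->
  {for (s, y), continuous (fun p : R * 'rV[R]_4 => f (slice p.1 p.2))}.
Proof.
move=> sf sv yk; apply: (@continuous_comp _ _ _ (fun p : R * 'rV[R]_4 => slice p.1 p.2) f) => //.
exact: smooth_on_continuous sf (slice_cone sv yk).
Qed.

Let continuous_gap (p : R * 'rV[R]_4) : {for p, continuous (fun p : R * 'rV[R]_4 => gap p.1 (normsq p.2))}.
Proof. by rewrite /gap; contin. Qed.

Let is_derive_H s : u < s < v -> is_derive s 1 H (integral4 (dF s)).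
Proof.
move=> sv.
apply: (integral4_is_derive (u := u) (v := v) (k := k)
  (F := fun s y => ramp eps (gap s (normsq y)) * (e (slice s y) * slope s (normsq y)))
  (dF := dF) _ _ _ _ _ sv).
- move=> {sv} s y sv yk.
  have db : is_derive s 1 (fun s => ramp eps (gap s (normsq y)))
      (dramp eps (gap s (normsq y)) * gap_s s (normsq y)).
    apply: der_comp (is_derive_ramp eps0 _) _; rewrite /gap /gap_s.
    set D := pos _; have d1 := derZ D (derB (der_cst 1 s) (der_id s)).
    have d2 := derM (derM (derM (der_id s) (der_id s)) (der_cst (D ^+ 2) s)) (der_cst 4^-1 s).
    by apply: der_eq (derD d1 d2) _; field.
  have de := der_slice (slice_cone sv yk).
  have dm := derB (der_cst 1 s) (derM (der_id s) (der_cst ((1 + normsq y) / 2) s)).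
  apply: der_eq (derM db (derM de dm)) _; rewrite /dF /slope; ring.
- by move=> {sv} s y sv ky; rewrite ramp_eq0 ?mul0r//; exact: gap_small.
- by move=> {sv} s y sv ky; rewrite /dF ramp_eq0 ?dramp_eq0 ?mul0r ?addr0//; exact: gap_small.
- move=> {sv} s sv; apply: (cc_cut (k := k)).
  + move=> y; apply: (@continuous_comp _ _ _ (fun y : 'rV[R]_4 => gap s (normsq y)) (ramp eps)).
      suff: {for y, continuous (fun y : 'rV[R]_4 => gap s (normsq y))} by [].
      have cn : {for y, continuous (@normsq R 4)} by exact: continuous_normsq.
      by rewrite /gap; contin.
    exact: continuous_ramp.
  + by move=> y ky; apply: ramp_eq0 => //; exact: gap_small.
  + move=> y yk.
    have c : {for y, continuous (fun y : 'rV[R]_4 => (s, y))}.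
      have c1 : {for y, continuous (fun _ : 'rV[R]_4 => s)} by exact: cst_continuous.
      have c2 : {for y, continuous (fun y : 'rV[R]_4 => y)} by exact: cvg_id.
      exact: (cvg_pair c1 c2).
    apply: continuousM_at.
      apply: (@continuous_comp _ _ _ (fun y : 'rV[R]_4 => (s, y))
        (fun p : R * 'rV[R]_4 => e (slice p.1 p.2))) => //.
      exact: continuous_field se sv yk.
    have cn : {for y, continuous (@normsq R 4)} by exact: continuous_normsq.
    by rewrite /slope; contin.
- move=> {sv} s y sv yk.
  have ce := continuous_field se sv yk; have cp := continuous_field (smooth_on_pd ord0 se) sv yk.
  have cb : {for (s, y), continuous (fun p : R * 'rV[R]_4 => ramp eps (gap p.1 (normsq p.2)))}.
    apply: (@continuous_comp _ _ _ (fun p : R * 'rV[R]_4 => gap p.1 (normsq p.2)) (ramp eps)) => //.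
    exact: continuous_ramp.
  have cdb : {for (s, y), continuous (fun p : R * 'rV[R]_4 => dramp eps (gap p.1 (normsq p.2)))}.
    apply: (@continuous_comp _ _ _ (fun p : R * 'rV[R]_4 => gap p.1 (normsq p.2)) (dramp eps)) => //.
    exact: continuous_dramp.
  by rewrite /dF /gap_s /slope; contin.
Qed.

Let H_decr (s : R) : 0 <= s <= 1 -> integral4 (dF s) <= 0.
Proof.
have eps_gt0 := eps0; have eps_le1 := eps1.
move=> s01; have uv : u < s < v.
  by move: s01 => /andP[s0 s1]; rewrite /u /v; apply/andP; split; lra.
have adm := ramp_gap_admissible s01.
have sw i := smooth_on_w i s01.
have E := radial_div adm sw.
have ses := smooth_on_comp oU (fun x => slice_cone_ball s01) se (smooth_on_slice s).
have sps := smooth_on_comp oU (fun x => slice_cone_ball s01) (smooth_on_pd ord0 se) (smooth_on_slice s).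
have cn (y : 'rV[R]_4) : {for y, continuous (@normsq R 4)} by exact: continuous_normsq.
have c1 : cc (fun y => ramp eps (gap s (normsq y)) * \sum_i pd i (w s i) y).
  have cb := admissible_continuous adm; case: adm => _ _ _ p0 _.
  apply: (cc_radial cb k1 p0) => y Uy; apply: continuous_at_sum => i.
  exact: smooth_on_continuous (smooth_on_pd i (sw i)) Uy.
have c2 : cc (fun y => dramp eps (gap s (normsq y)) * gap_t s (normsq y) * (2 * \sum_i y 0 i * w s i y)).
  case: adm => _ cd _ _ d0.
  apply: (cc_radial cd k1 d0) => y Uy; apply: continuousM_at; first exact: continuous_cst_at.
  apply: continuous_at_sum => i; apply: continuousM_at; last exact: smooth_on_continuous (sw i) Uy.
  exact: smooth_on_continuous (smooth_on_coord i oU) Uy.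
have c3 : cc (dF s).
  have cb := admissible_continuous adm; case: adm => _ _ _ p0 _.
  apply: ccD; last first.
    apply: (cc_radial cb k1 p0) => y Uy.
    have := smooth_on_continuous ses Uy; have := smooth_on_continuous sps Uy.
    by rewrite /slope => ? ?; contin.
  have cdb : continuous (fun t => dramp eps (gap s t) * gap_s s t).
    move=> t; suff: {for t, continuous (fun t => dramp eps (gap s t) * gap_s s t)} by [].
    apply: continuousM_at; last by rewrite /gap_s; contin.
    apply: (@continuous_comp _ _ _ (gap s) (dramp eps)); last exact: continuous_dramp.
    by rewrite /gap; contin.
  apply: (cc_radial cdb k1) => [t kt|y Uy].
    by rewrite dramp_eq0 ?mul0r//; exact: gap_small.
  by have := smooth_on_continuous ses Uy; rewrite /slope => ?; contin.
(* The added integrals sum to zero by [E]; with them the integrand becomes nonpositive at every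
   point. *)
have S := integral4D c3 (ccD c2 c1); rewrite (integral4D c2 c1) E addr0 in S; rewrite -S.
rewrite -[leRHS](@integral4_0 R); apply: (integral4_le (ccD c3 (ccD c2 c1)) (@cc0 R)) => y.
have [yk|yk] := ltP (normsq y) k; last first.
  have G := gap_small uv yk.
  by rewrite /dF ramp_eq0// dramp_eq0// !mul0r !addr0.
have Uy : U y by exact: lt_trans yk k1.
have ee := e0 (slice_cone_ball s01 Uy).
rewrite (div_w s01 Uy).
have -> : \sum_i y 0 i * w s i y = normsq y * ((normsq y - 1) / 2 * e (slice s y)).
  by rewrite {1}/normsq mulr_suml; apply: eq_bigr => i _; rewrite /w expr2; ring.
rewrite /dF; set t := normsq y in yk *.
have t1 : 0 < 1 - t by move: k1 yk; lra.
have gE : gap s t = (1 - t) * (1 - s) + s ^+ 2 * (1 - t) ^+ 2 / 4 by rewrite /gap pos_nneg ?ltW.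
have gsE : gap_s s t = - (1 - t) + s * (1 - t) ^+ 2 / 2 by rewrite /gap_s pos_nneg ?ltW.
have gtE : gap_t s t = - ((1 - s) + s ^+ 2 * (1 - t) / 2) by rewrite /gap_t pos_nneg ?ltW.
set E0 := e _ in ee *; set P0 := pd _ _ _.
have g0 : 0 <= gap s t.
  move: s01 => /andP[s0 s1]; rewrite gE addr_ge0//.
    by rewrite mulr_ge0 ?subr_ge0// ltW// -subr_gt0.
  by rewrite divr_ge0// mulr_ge0 ?sqr_ge0.
rewrite [leLHS](_ : _ = - (dramp eps (gap s t) * ((1 - t) * gap s t * E0)
    + ramp eps (gap s t) * ((1 - t) / 2 * E0))).
  rewrite oppr_le0 addr_ge0// mulr_ge0 ?dramp_ge0 ?ramp_ge0//.
    by rewrite mulr_ge0// mulr_ge0// ltW.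
  by rewrite mulr_ge0// divr_ge0// ltW.
set B1 := dramp _ _; set B0 := ramp _ _; rewrite gsE gtE gE /slope; by field.
Qed.

(** Since [e] is homogeneous of degree -4, the product of [e] with the scaling field has divergence
    [e >= 0] in five dimensions, so its flux grows from the hyperboloid up to the disc. Nothing
    escapes through the cone, to which the scaling field is tangent; the cutoff is harmless because
    the gap is nondecreasing along that field. *)
Lemma energy_flux :
  integral4 (fun y => ramp eps (gap 1 (normsq y)) * (e (slice 1 y) * slope 1 (normsq y)))
  <= integral4 (fun y => ramp eps (gap 0 (normsq y)) * (e (slice 0 y) * slope 0 (normsq y))).
Proof.
have eps_gt0 := eps0; have eps_le1 := eps1.
have uv (s : R) : 0 <= s <= 1 -> u < s < v.
  by move=> /andP[s0 s1]; rewrite /u /v; apply/andP; split; lra.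
have [c c01 E] := MVT_closed (@ler01 R) (fun s s01 => is_derive_H (uv s s01)).
by rewrite -subr_le0 -/(H 1) -/(H 0) E subr0 mulr1 H_decr.
Qed.

End energy_flux.

(** * Epsilon-regularity *)

Section kernel.
Context {R : realType}.
Implicit Types (y z : 'rV[R]_4) (a b k : R).

Lemma is_derive_comp_R (V : normedModType R) (phi : R -> R) (h : V -> R) (y v : V) (d : R) :
  differentiable h y -> is_derive (h y) 1 phi d ->
  is_derive y v (fun x => phi (h x)) (d * 'D_v h y).
Proof.
move=> dh dphi.
have dp : differentiable phi (h y) by apply/derivable1_diffP; exact: (@ex_derive _ _ _ _ _ _ _ dphi).
apply: DeriveDef; first by apply: diff_derivable; exact: differentiable_comp dh dp.
rewrite (derive_comp _ dh dp).
have L : 'D_(('D_v h y) *: (1 : R) + 0) phi (h y) = ('D_v h y) *: 'D_1 phi (h y) + 'D_0 phi (h y).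
  exact: derive_linear_dir.
have Z : 'D_0 phi (h y) = 0 by rewrite deriveE// linear0.
have D1 : 'D_1 phi (h y) = d by exact: (@derive_val _ _ _ _ _ _ _ dphi).
have S1 : ('D_v h y) *: (1 : R) + 0 = 'D_v h y by rewrite addr0; exact: mulr1.
rewrite S1 Z D1 addr0 in L; rewrite L; exact: mulrC.
Qed.

Lemma normsqD_le m (x y : 'rV[R]_m) : normsq (x + y) <= 2 * normsq x + 2 * normsq y.
Proof.
rewrite /normsq !mulr_sumr -big_split/=; apply: ler_sum => i _; rewrite mxE.
by have := sqr_ge0 (x 0 i - y 0 i); rewrite !expr2; lra.
Qed.

Definition ker n b z y : R := pos (b - normsq (y - z)) ^+ n.

Let oT : open [set: 'rV[R]_4]. Proof. exact: openT. Qed.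

Lemma smooth_normsq_sub z : smooth_on [set: 'rV[R]_4] (fun y => normsq (y - z)).
Proof.
apply: (smooth_on_comp oT (Q := setT)) => //; first exact: smooth_on_normsq.
apply: smooth_onB => //; last exact: smooth_on_cst.
by apply/smooth_onP => k; exact: csmooth_id.
Qed.

Lemma pd_normsq_sub z i y : pd i (fun y => normsq (y - z)) y = 2 * (y - z) 0 i.
Proof.
have ss : smooth_on [set: 'rV[R]_4] (fun y => y - z).
  apply: smooth_onB => //; last exact: smooth_on_cst.
  by apply/smooth_onP => k; exact: csmooth_id.
rewrite (pd_comp i (fun _ _ => I) (smooth_on_normsq oT) ss I).
rewrite (eq_bigr (fun j => (i == j)%:R *: (2 * (y - z) 0 j))) ?sum_delta_scale// => j _.
rewrite (pd_normsq oT j I); congr (_ *: _).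
rewrite (_ : (fun x => _) = fun x : 'rV[R]_4 => x 0 j - z 0 j); last first.
  by apply/funext => x; rewrite !mxE.
have sb : smooth_on [set: 'rV[R]_4] (fun x => x 0 j) by exact: smooth_on_coord.
have sc : smooth_on [set: 'rV[R]_4] (fun=> z 0 j) by exact: smooth_on_cst.
by rewrite (pdB oT i sb sc I) pd_cst subr0 pd_coord.
Qed.

Lemma is_derive_ker n b z i y : is_derive y (delta_mx 0 i) (ker n.+2 b z)
  (- (2 * n.+2%:R * (ker n.+1 b z y * (y - z) 0 i))).
Proof.
have := is_derive_comp_R (delta_mx 0 i) (smooth_on_diff (smooth_normsq_sub z) (I : setT y))
  (der_sub_pos n b (normsq (y - z))).
have -> : 'D_(delta_mx 0 i) (fun y => normsq (y - z)) y = 2 * (y - z) 0 i.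
  by rewrite -pd_normsq_sub -pdE.
by congr is_derive; rewrite /ker; ring.
Qed.

Lemma ker_ge0 n b z y : 0 <= ker n b z y.
Proof. by rewrite /ker exprn_ge0// pos_ge0. Qed.

Lemma ker_eq0 n b z y : b <= normsq (y - z) -> ker n.+1 b z y = 0.
Proof. by move=> h; rewrite /ker pos0 ?subr_le0// expr0n. Qed.

Lemma continuous_normsq_sub z y : {for y, continuous (fun y => normsq (y - z))}.
Proof. exact: smooth_on_continuous (smooth_normsq_sub z) I. Qed.

Lemma continuous_ker n b z : continuous (ker n b z).
Proof.
move=> y; suff: {for y, continuous (ker n b z)} by [].
have c : {for y, continuous (fun y => normsq (y - z))} by exact: continuous_normsq_sub.
by rewrite /ker; contin.
Qed.

Section kernel_mean.
Variables (O : set 'rV[R]_4) (oO : open O) (g : 'rV[R]_4 -> R) (sg : smooth_on O g).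
Variables (k a : R) (z : 'rV[R]_4).
Hypotheses (kO : forall y, normsq y <= k -> O y)
  (ak : forall y, normsq (y - z) < a -> normsq y < k).

Definition kmean n b : R := integral4 (fun y => ker n b z y * g y).
Definition laplacian (y : 'rV[R]_4) : R := \sum_i pd i (pd i g) y.

Let ker_out n b y : b < a -> k <= normsq y -> ker n.+1 b z y = 0.
Proof.
move=> ba ky; apply: ker_eq0; apply: ltW; apply: lt_le_trans ba _.
by rewrite leNgt; apply/negP => /ak; rewrite ltNge ky.
Qed.

Let coord_cont i y : {for y, continuous (fun y : 'rV[R]_4 => (y - z) 0 i)}.
Proof.
rewrite (_ : (fun y => _) = fun y : 'rV[R]_4 => y 0 i - z 0 i); last first.
  by apply/funext => x; rewrite !mxE.
apply: continuousB_at; last exact: continuous_cst_at.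
exact: smooth_on_continuous (smooth_on_coord i oT) I.
Qed.

Lemma cc_ker n b (h : 'rV[R]_4 -> R) : b < a -> (forall y, O y -> {for y, continuous h}) ->
  cc (fun y => ker n.+1 b z y * h y).
Proof.
move=> ba ch; apply: (cc_cut (k := k)).
- exact: continuous_ker.
- by move=> y; exact: ker_out.
- by move=> y /kO; exact: ch.
Qed.

Let cg y : O y -> {for y, continuous g}. Proof. exact: smooth_on_continuous. Qed.

(** Two integrations by parts move the Laplacian to the kernel, where it gives [48 |y - z|^2] times
    the power 2 minus 32 times the power 3. Writing [|y - z|^2] as [b - (b - |y - z|^2)] leads to
    [48 * b] and [48 + 32 = 80]. *)
Lemma ker_laplacian b : b < a ->
  integral4 (fun y => ker 4 b z y * laplacian y) = 48 * b * kmean 2 b - 80 * kmean 3 b.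
Proof.
move=> ba.
have sgi i := smooth_on_pd i sg; have sgii i := smooth_on_pd i (sgi i).
have P1 i : integral4 (fun y => - (8 * (ker 3 b z y * (y - z) 0 i)) * pd i g y)
    + integral4 (fun y => ker 4 b z y * pd i (pd i g) y) = 0.
  apply: (integral4_parts (k := k) (i := i)).
  - exact: continuous_ker.
  - move=> y; suff: {for y, continuous (fun y => - (8 * (ker 3 b z y * (y - z) 0 i)))} by [].
    have c1 : {for y, continuous (ker 3 b z)} by exact: continuous_ker.
    have c2 := @coord_cont i y; by contin.
  - move=> y; have := is_derive_ker 2 b z i y; congr is_derive; ring.
  - by move=> y; exact: ker_out.
  - by move=> y ky; rewrite ker_out// mul0r mulr0 oppr0.
  - move=> y /kO; exact: smooth_on_continuous (sgi i).
  - move=> y /kO; exact: smooth_on_continuous (sgii i).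
  - by move=> y /kO Oy; apply: (is_derive_pd i (sgi i) Oy).
have P2 i : integral4 (fun y => (48 * (ker 2 b z y * ((y - z) 0 i) ^+ 2) - 8 * ker 3 b z y) * g y)
    + integral4 (fun y => - (8 * (ker 3 b z y * (y - z) 0 i)) * pd i g y) = 0.
  have dc y : is_derive y (delta_mx 0 i) (fun y : 'rV[R]_4 => (y - z) 0 i) (1 : R).
    rewrite (_ : (fun y => _) = fun y : 'rV[R]_4 => y 0 i - z 0 i); last first.
      by apply/funext => x; rewrite !mxE.
    have sb : smooth_on [set: 'rV[R]_4] (fun x => x 0 i) by exact: smooth_on_coord.
    have sc : smooth_on [set: 'rV[R]_4] (fun=> z 0 i) by exact: smooth_on_cst.
    have := is_derive_pd i (smooth_onB oT sb sc) (I : setT y).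
    by rewrite (pdB oT i sb sc I) pd_cst subr0 pd_coord eqxx.
  apply: (integral4_parts (k := k) (i := i)).
  - move=> y; suff: {for y, continuous (fun y => - (8 * (ker 3 b z y * (y - z) 0 i)))} by [].
    have c1 : {for y, continuous (ker 3 b z)} by exact: continuous_ker.
    have c2 := @coord_cont i y; by contin.
  - move=> y; suff: {for y, continuous (fun y => 48 * (ker 2 b z y * ((y - z) 0 i) ^+ 2) - 8 * ker 3 b z y)} by [].
    have c1 : {for y, continuous (ker 3 b z)} by exact: continuous_ker.
    have c3 : {for y, continuous (ker 2 b z)} by exact: continuous_ker.
    have c2 := @coord_cont i y; by contin.
  - move=> y; have H := is_deriveM (is_derive_ker 1 b z i y) (dc y).
    have := is_deriveN (is_deriveZ 8 H); congr is_derive.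
    rewrite /GRing.scale/=; ring.
  - by move=> y ky; rewrite ker_out// mul0r mulr0 oppr0.
  - by move=> y ky; rewrite !ker_out// mul0r !mulr0 subr0.
  - by move=> y /kO; exact: cg.
  - move=> y /kO; exact: smooth_on_continuous (sgi i).
  - by move=> y /kO Oy; apply: (is_derive_pd i sg Oy).
have E i : integral4 (fun y => ker 4 b z y * pd i (pd i g) y) =
    integral4 (fun y => (48 * (ker 2 b z y * ((y - z) 0 i) ^+ 2) - 8 * ker 3 b z y) * g y).
  by have := P1 i; have := P2 i; lra.
have c4 i : cc (fun y => ker 4 b z y * pd i (pd i g) y).
  by apply: cc_ker ba _ => y Oy; exact: smooth_on_continuous (sgii i) Oy.
have c2 : cc (fun y => ker 2 b z y * g y) by exact: cc_ker.
have c3 : cc (fun y => ker 3 b z y * g y) by exact: cc_ker.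
have cE i : cc (fun y => (48 * (ker 2 b z y * ((y - z) 0 i) ^+ 2) - 8 * ker 3 b z y) * g y).
  have -> : (fun y => (48 * (ker 2 b z y * ((y - z) 0 i) ^+ 2) - 8 * ker 3 b z y) * g y) =
    (fun y => 48 * (ker 2 b z y * (((y - z) 0 i) ^+ 2 * g y)) + (- 8) * (ker 3 b z y * g y)).
    by apply/funext => y; ring.
  apply: ccD; apply: ccZ => //; apply: cc_ker ba _ => y Oy.
  by apply: continuousM_at; [apply: continuousX_at; exact: coord_cont|exact: cg].
rewrite (_ : (fun y => _) = fun y => \sum_i ker 4 b z y * pd i (pd i g) y); last first.
  by apply/funext => y; rewrite mulr_sumr.
rewrite (integral4_sum _ c4) (eq_bigr _ (fun i _ => E i)) -(integral4_sum _ cE).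
rewrite (_ : (fun y => _) = fun y => (48 * b) * (ker 2 b z y * g y) + (- 80) * (ker 3 b z y * g y)).
  by rewrite (integral4D (ccZ _ c2) (ccZ _ c3)) (integral4Z _ c2) (integral4Z _ c3) mulNr.
apply/funext => y; rewrite -mulr_suml sumrB -!mulr_sumr sumr_const card_ord -mulr_natl.
rewrite -/(normsq (y - z)) /ker.
have [yb|yb] := lerP b (normsq (y - z)).
  by rewrite pos0 ?subr_le0// !expr0n/=; ring.
by rewrite pos_nneg ?subr_ge0 ?ltW//; ring.
Qed.

Lemma is_derive_kmean b : 0 < b < a -> is_derive b 1 (kmean 3) (3 * kmean 2 b).
Proof.
move=> ba.
have b' : b < a by case/andP: ba.
have c2 : cc (fun y => ker 2 b z y * g y) by exact: cc_ker.
rewrite /kmean -(integral4Z _ c2).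
apply: (integral4_is_derive (u := 0) (v := a) (k := k)
  (F := fun b y => ker 3 b z y * g y) (dF := fun b y => 3 * (ker 2 b z y * g y)) _ _ _ _ _ ba).
- move=> s y sa yk.
  apply: der_eq (derM (der_pos_sub 1 (normsq (y - z)) s) (der_cst (g y) s)) _.
  by rewrite /ker; ring.
- by move=> s y /andP[_ sa] ky; rewrite ker_out// mul0r.
- by move=> s y /andP[_ sa] ky; rewrite ker_out// mul0r mulr0.
- by move=> s /andP[_ sa]; exact: cc_ker.
- move=> s y sa yk.
  have c1 : {for (s, y), continuous (fun p : R * 'rV[R]_4 => g p.2)}.
    by apply: (@continuous_comp _ _ _ snd g); [exact: cvg_snd|apply: cg; exact: kO].
  have c3 : {for (s, y), continuous (fun p : R * 'rV[R]_4 => p.1)} by exact: cvg_fst.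
  have c4 : {for (s, y), continuous (fun p : R * 'rV[R]_4 => normsq (p.2 - z))}.
    apply: (@continuous_comp _ _ _ snd (fun y => normsq (y - z))); first exact: cvg_snd.
    exact: continuous_normsq_sub.
  by rewrite /ker; contin.
Qed.

(** [b ^+ 5] is the scaling of the mass of the kernel: [b] is a squared radius, so the volume
    contributes [b^2] and the height [b^3]. With this normalization the derivative
    [3 b^(-5) kmean 2 - 5 b^(-6) kmean 3] is exactly one sixteenth of [b^(-6)] times
    [ker_laplacian]. *)
Lemma is_derive_kmean_scaled b : 0 < b < a ->
  is_derive b 1 (fun b => (b ^+ 5)^-1 * kmean 3 b)
    ((b ^+ 6)^-1 / 16 * integral4 (fun y => ker 4 b z y * laplacian y)).
Proof.
move=> ba; have /andP[b0 b1] := ba.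
have bn0 : b != 0 by rewrite gt_eqF.
have d5 : is_derive b 1 (fun b : R => b ^+ 5) (5 * b ^+ 4).
  apply: DeriveDef; first exact: exprn_derivable.
  by rewrite exp_derive /GRing.scale/= mulr1.
have n5 : b ^+ 5 != 0 by rewrite expf_neq0.
have d1 := derV (f := fun b => b ^+ 5) n5 d5.
apply: der_eq (derM (f := fun b => (b ^+ 5)^-1) (g := kmean 3) d1 (is_derive_kmean ba)) _.
rewrite (ker_laplacian b1); by field.
Qed.

End kernel_mean.

(** The constant 1 is harmonic, so its scaled mean does not depend on [b] and can be evaluated at
    [b = 4]. There the kernel at [z] dominates 8 times the unit kernel at 0, because
    [4 - |y - z|^2 >= 2 (1 - |y|^2)] when [|z| <= 1]. *)
Lemma kmean_one b z : normsq z <= 1 -> 0 < b <= 4 ->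
  8 * (4 ^+ 5)^-1 * kmean (fun=> 1) 0 3 1 * b ^+ 5 <= kmean (fun=> 1) z 3 b.
Proof.
move=> z1 /andP[b0 b4].
have s1 : smooth_on [set: 'rV[R]_4] (fun=> 1 : R) by exact: smooth_on_cst.
(* From [|y|^2 <= 2 |y - z|^2 + 2 |z|^2], with values below 5 and at most 1. *)
have ak y : normsq (y - z) < 5 -> normsq y < 12.
  by have := normsqD_le (y - z) z; rewrite subrK; lra.
have kO y : normsq y <= 12 -> [set: 'rV[R]_4] y by [].
have L0 c : integral4 (fun y => ker 4 c z y * laplacian (fun=> 1) y) = 0.
  rewrite -[RHS](@integral4_0 R); congr integral4; apply/funext => y.
  rewrite /laplacian big1 ?mulr0// => i _.
  have P1 : pd i (fun _ : 'rV[R]_4 => 1 : R) = (fun=> 0) by apply/funext => x; exact: pd_cst.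
  by rewrite P1 pd_cst.
have E : (4 ^+ 5)^-1 * kmean (fun=> 1) z 3 4 = (b ^+ 5)^-1 * kmean (fun=> 1) z 3 b.
  have := @MVT_closed R _ (fun c => (c ^+ 6)^-1 / 16 * integral4 (fun y => ker 4 c z y * laplacian (fun=> 1) y)) b 4 b4.
  move=> /(_ (fun b => (b ^+ 5)^-1 * kmean (fun=> 1) z 3 b))[|c _].
    move=> c /andP[bc c4]; have c5 : 0 < c < 5 by rewrite (lt_le_trans b0 bc)/=; lra.
    have H := is_derive_kmean_scaled s1 kO ak c5; exact: H.
  by rewrite L0 mulr0 mul0r => /eqP; rewrite subr_eq0 => /eqP.
have H : 8 * kmean (fun=> 1) 0 3 1 <= kmean (fun=> 1) z 3 4.
  have c0 : cc (fun y => ker 3 1 0 y * (1 : R)).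
    apply: (@cc_ker [set: 'rV[R]_4] 12 5 0) => //; try by lra.
    - by move=> y; rewrite subr0; lra.
    - by move=> y _; exact: continuous_cst_at.
  have cz : cc (fun y => ker 3 4 z y * (1 : R)).
    apply: (@cc_ker [set: 'rV[R]_4] 12 5 z) => //; try by lra.
    by move=> y _; exact: continuous_cst_at.
  rewrite /kmean -(integral4Z _ c0); apply: integral4_le => //; first exact: ccZ.
  move=> y; rewrite !mulr1 /ker subr0.
  have -> : 8 * pos (1 - normsq y) ^+ 3 = (2 * pos (1 - normsq y)) ^+ 3 by ring.
  apply: lerXn2r; rewrite ?nnegrE ?mulr_ge0 ?pos_ge0//.
  have := normsqD_le y (- z).
  have -> : normsq (- z) = normsq z by apply: eq_bigr => i _; rewrite mxE sqrrN.
  move=> N; have [h|h] := lerP 0 (1 - normsq y); last by rewrite (pos0 (ltW h)) mulr0 pos_ge0.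
  by rewrite pos_nneg//; apply: le_trans (le_pos _); lra.
have b5 : 0 < b ^+ 5 by rewrite exprn_gt0.
rewrite -ler_pdivlMr// [leRHS]mulrC -E mulrAC -mulrA mulrCA [leLHS]mulrC.
by rewrite [8 / _]mulrC -mulrA ler_pM2l ?invr_gt0 ?exprn_gt0.
Qed.

Lemma kmean_one_gt0 : 0 < kmean (fun=> 1) 0 3 1.
Proof.
apply: (integral4_gt0 (y0 := 0)).
- apply: (@cc_ker [set: 'rV[R]_4] 12 5 0) => //; try by lra.
  + by move=> y; rewrite subr0; lra.
  + by move=> y _; exact: continuous_cst_at.
- by move=> y; rewrite mulr1 ker_ge0.
- rewrite mulr1 /ker subrr normsq0 subr0 pos_nneg ?exprn_gt0//.
Qed.

(** The scaled mean times [expR (K / 16 * b)] is nondecreasing in [b]: the Laplacian costs at most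
    [K] times the mean with power 4, and this is at most [b] times the mean with power 3. Small [b]
    bring in the value at [z], with the constant of [kmean_one]. *)
Lemma mean_value_ineq (O : set 'rV[R]_4) (g : 'rV[R]_4 -> R) (k a K : R) z :
  open O -> smooth_on O g -> (forall y, normsq y <= k -> O y) ->
  (forall y, normsq (y - z) < a -> normsq y < k) -> a <= 4 -> normsq z <= 1 -> 0 <= K ->
  (forall y, normsq (y - z) < a -> 0 <= g y /\ - (K * g y) <= laplacian g y) ->
  forall b, 0 < b < a ->
  8 * (4 ^+ 5)^-1 * kmean (fun=> 1) 0 3 1 * g z * b ^+ 5 <= kmean g z 3 b * expR (K / 16 * b).
Proof.
move=> oO sg kO ak a4 z1 K0 Hg b ba.
set c0 := 8 * _ * _.
have c00 : 0 < c0 by rewrite /c0 !mulr_gt0 ?kmean_one_gt0// invr_gt0 exprn_gt0.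
have cg y : O y -> {for y, continuous g} by exact: smooth_on_continuous.
have cl y : O y -> {for y, continuous (laplacian g)}.
  move=> Oy; apply: continuous_at_sum => i.
  exact: smooth_on_continuous (smooth_on_pd i (smooth_on_pd i sg)) Oy.
pose M c := (c ^+ 5)^-1 * kmean g z 3 c * expR (K / 16 * c).
have dM (c : R) : 0 < c < a -> is_derive c 1 M
   ((c ^+ 6)^-1 / 16 * integral4 (fun y => ker 4 c z y * laplacian g y) * expR (K / 16 * c)
    + (c ^+ 5)^-1 * kmean g z 3 c * (expR (K / 16 * c) * (K / 16))).
  move=> ca; have H := is_derive_kmean_scaled sg kO ak ca.
  apply: (derM H).
  have dE : is_derive (K / 16 * c) 1 (@expR R) (expR (K / 16 * c)) by exact: is_derive_expR.
  have dL := derZ (K / 16) (der_id c); rewrite mulr1 in dL.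
  exact: (der_comp (f := expR) (g := fun c => K / 16 * c) dE dL).
have dM0 (c : R) : 0 < c < a ->
   0 <= (c ^+ 6)^-1 / 16 * integral4 (fun y => ker 4 c z y * laplacian g y) * expR (K / 16 * c)
    + (c ^+ 5)^-1 * kmean g z 3 c * (expR (K / 16 * c) * (K / 16)).
  move=> /andP[cp ca].
  have H : - (K * c * kmean g z 3 c) <= integral4 (fun y => ker 4 c z y * laplacian g y).
    have c3 := cc_ker kO ak 2 ca cg; have c4 := cc_ker kO ak 3 ca cl.
    rewrite -mulNr -(integral4Z _ c3); apply: integral4_le => //; first exact: ccZ.
    move=> y; have [yc|yc] := lerP c (normsq (y - z)).
      by rewrite !ker_eq0// !mul0r mulr0.
    have [g0 lg] := Hg y (lt_trans yc ca).
    apply: le_trans (ler_wpM2l (ker_ge0 4 c z y) lg).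
    rewrite /ker mulrN mulNr lerN2 (_ : pos _ ^+ 4 * _ = K * (pos (c - normsq (y - z)) * (pos (c - normsq (y - z)) ^+ 3 * g y))); last by ring.
    rewrite -[leRHS]mulrA ler_wpM2l//; apply: ler_wpM2r; first by rewrite mulr_ge0 ?exprn_ge0 ?pos_ge0.
    by rewrite pos_nneg ?subr_ge0 ?(ltW yc)// gerBl normsq_ge0.
  have cn : c != 0 by rewrite gt_eqF.
  rewrite (_ : _ + _ = (c ^+ 6)^-1 / 16 * expR (K / 16 * c) *
     (integral4 (fun y => ker 4 c z y * laplacian g y) + K * c * kmean g z 3 c)); last by field.
  apply: mulr_ge0; last by lra.
  by rewrite mulr_ge0 ?expR_ge0// divr_ge0// invr_ge0 exprn_ge0// ltW.
have /andP[b0 b1] := ba.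
have mono (c : R) : 0 < c <= b -> M c <= M b.
  move=> /andP[cp cb].
  have xa (x : R) : c <= x <= b -> 0 < x < a.
    by move=> /andP[cx xb]; rewrite (lt_le_trans cp cx) (le_lt_trans xb b1).
  have [x xcb E] := MVT_closed cb (fun x xb => dM x (xa x xb)).
  by rewrite -subr_ge0 E mulr_ge0 ?subr_ge0//; exact: dM0 (xa x xcb).
have small (e : R) : 0 < e -> c0 * (g z - e) <= M b.
  move=> e0; have Oz : O z by apply: kO; apply: ltW; apply: ak; rewrite subrr normsq0 (lt_trans b0).
  have Ng : \forall y \near z, g z - e < g y .
    have ge : g z - e < g z by lra.
    exact: (cg z Oz _ (lt_nbhsr ge)).
  have [c [cp cb Hc]] : exists c : R, [/\ 0 < c, c <= b & forall y, normsq (y - z) < c -> g z - e < g y].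
    have /nbhs_ballP[r r0 Hr] := Ng.
    exists (Num.min b (r ^+ 2)); split; first by rewrite lt_min b0 exprn_gt0.
      by rewrite ge_min lexx.
    move=> y; rewrite lt_min => /andP[_ yr]; apply: Hr; rewrite -ball_normE /ball_/=.
    rewrite -[`|_|]/(mx_norm _) mx_normrE; apply: bigmax_lt => // -[i j] _ /=.
    rewrite (ord1 i) -ltr_sqr ?nnegrE ?(ltW r0)//.
    rewrite real_normK ?num_real//; apply: le_lt_trans yr.
    by have := normsq_coord (y - z) j; rewrite !mxE -sqrrN opprB.
  apply: le_trans (mono c _); last by rewrite cp cb.
  have ca := le_lt_trans cb b1.
  have c3 := cc_ker kO ak 2 ca cg.
  have one y : {for y, continuous (fun _ : 'rV[R]_4 => 1 : R)} by exact: continuous_cst_at.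
  have c31 := cc_ker kO ak 2 ca (fun y _ => one y).
  have [neg|nneg] := lerP (g z - e) 0.
    apply: (@le_trans _ _ 0); first by rewrite mulr_ge0_le0// ltW.
    rewrite /M mulr_ge0 ?expR_ge0// mulr_ge0 ?invr_ge0 ?exprn_ge0 ?(ltW cp)//.
    apply: integral4_ge0 => y; have [yc|yc] := lerP c (normsq (y - z)).
      by rewrite ker_eq0 ?mul0r.
    by rewrite mulr_ge0 ?ker_ge0//; have [] := Hg y (lt_trans yc ca).
  have S1 : (g z - e) * kmean (fun=> 1) z 3 c <= kmean g z 3 c.
    rewrite /kmean -(integral4Z _ c31); apply: integral4_le => //; first exact: ccZ.
    move=> y; rewrite mulr1; have [yc|yc] := lerP c (normsq (y - z)).
      by rewrite ker_eq0// mul0r mulr0.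
    by rewrite mulrC ler_wpM2l ?ker_ge0// ltW// Hc.
  have S2 : c0 * c ^+ 5 <= kmean (fun=> 1) z 3 c.
    by apply: kmean_one => //; rewrite cp (le_trans (ltW ca)).
  have c5 : 0 < c ^+ 5 by rewrite exprn_gt0.
  have S3 : c0 * (g z - e) <= (c ^+ 5)^-1 * kmean g z 3 c.
    rewrite [leRHS]mulrC ler_pdivlMr//; apply: le_trans S1.
    by rewrite mulrAC mulrC ler_wpM2l// ltW.
  apply: le_trans S3 _; rewrite /M ler_peMr//; last by rewrite -expR0 ler_expR mulr_ge0 ?divr_ge0// ltW.
  rewrite mulr_ge0 ?invr_ge0 ?(ltW c5)//; apply: le_trans S1.
  by rewrite mulr_ge0 ?(ltW nneg)//; apply: le_trans S2; rewrite mulr_ge0 ?ltW.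
have F : c0 * g z <= M b.
  rewrite leNgt; apply/negP => H.
  have e0 : 0 < (c0 * g z - M b) / (2 * c0) by apply: divr_gt0; [rewrite subr_gt0|apply: mulr_gt0].
  have := small _ e0; rewrite mulrBr (_ : c0 * ((c0 * g z - M b) / (2 * c0)) = (c0 * g z - M b) / 2).
    by lra.
  by field; rewrite gt_eqF.
have b5 : 0 < b ^+ 5 by rewrite exprn_gt0.
rewrite -(ler_pM2r b5) in F; apply: le_trans F _; rewrite /M.
rewrite (_ : _ * _ * _ * _ = kmean g z 3 b * expR (K / 16 * b))//.
by field; rewrite gt_eqF.
Qed.

End kernel.

(** * The Euclidean norm *)

Section euclidean_norm.
Context {R : realType} {m : nat}.
Implicit Types (x y : 'rV[R]_m).

Definition enorm x : R := Num.sqrt (normsq x).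

Lemma enorm_ge0 x : 0 <= enorm x. Proof. exact: sqrtr_ge0. Qed.

Lemma enorm_sqr x : enorm x ^+ 2 = normsq x.
Proof. by rewrite sqr_sqrtr// normsq_ge0. Qed.

Lemma dot_le x y : \sum_i x 0 i * y 0 i <= enorm x * enorm y.
Proof.
set P := \sum_i _.
have Q (l : R) : 0 <= l ^+ 2 * normsq x - 2 * l * P + normsq y.
  rewrite /normsq /P !mulr_sumr -sumrB -big_split/=; apply: sumr_ge0 => i _.
  by have := sqr_ge0 (l * x 0 i - y 0 i); rewrite !expr2; lra.
have ex := enorm_ge0 x; have ey := enorm_ge0 y.
rewrite -enorm_sqr -[normsq y]enorm_sqr in Q.
case: (eqVneq (enorm x) 0) => [x0|x0].
  have {}Q (l : R) : 2 * l * P <= enorm y ^+ 2 by have := Q l; rewrite x0; lra.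
  rewrite x0 mul0r leNgt; apply/negP => P0.
  have := Q ((enorm y ^+ 2 + 1) / (2 * P)).
  by rewrite (_ : 2 * _ * P = enorm y ^+ 2 + 1); [lra|field; rewrite gt_eqF].
have xp : 0 < enorm x by rewrite lt_neqAle eq_sym x0.
have := Q (enorm y / enorm x).
rewrite (_ : _ ^+ 2 * _ - _ + _ = 2 * enorm y * (enorm x * enorm y - P) / enorm x); last by field.
case: (eqVneq (enorm y) 0) => [y0|y0] H.
  have := Q (-1); have := Q 1; rewrite y0 mulr0 => h1 h2.
  have {}Q (l : R) : 0 <= l ^+ 2 * enorm x ^+ 2 - 2 * l * P by have := Q l; rewrite y0; lra.
  rewrite leNgt; apply/negP => P0.
  have := Q (P / enorm x ^+ 2); rewrite (_ : _ - _ = - (P ^+ 2 / enorm x ^+ 2)); last by field.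
  by rewrite oppr_ge0 leNgt divr_gt0// exprn_gt0.
have yp : 0 < enorm y by rewrite lt_neqAle eq_sym y0.
have : 0 <= 2 * enorm y * (enorm x * enorm y - P).
  by move: H; rewrite pmulr_lge0// invr_gt0.
by rewrite pmulr_rge0 ?mulr_gt0// subr_ge0.
Qed.

Lemma enormD x y : enorm (x + y) <= enorm x + enorm y.
Proof.
rewrite -ler_sqr ?nnegrE ?addr_ge0 ?enorm_ge0// enorm_sqr.
rewrite sqrrD !enorm_sqr; have := dot_le x y; set P := \sum_i _ => H.
have -> : normsq (x + y) = normsq x + P *+ 2 + normsq y; last by lra.
rewrite /normsq /P -mulr_natl mulr_sumr -!big_split/=; apply: eq_bigr => i _.
by rewrite mxE; ring.
Qed.

Lemma enormN x : enorm (- x) = enorm x.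
Proof. by congr Num.sqrt; apply: eq_bigr => i _; rewrite mxE sqrrN. Qed.

Lemma enorm_subC x y : enorm (x - y) = enorm (y - x).
Proof. by rewrite -enormN opprB. Qed.

Lemma enorm_dist x y z : enorm (x - z) <= enorm (x - y) + enorm (y - z).
Proof. by have := enormD (x - y) (y - z); rewrite addrA subrK. Qed.

Lemma enorm_le_add x y : enorm x <= enorm (x - y) + enorm y.
Proof. by have := enormD (x - y) y; rewrite subrK. Qed.

Lemma normsq_lt x (r : R) : 0 <= r -> (normsq x < r ^+ 2) = (enorm x < r).
Proof. by move=> r0; rewrite -enorm_sqr ltr_sqr ?nnegrE ?enorm_ge0. Qed.

Lemma normsq_le x (r : R) : 0 <= r -> (normsq x <= r ^+ 2) = (enorm x <= r).
Proof. by move=> r0; rewrite -enorm_sqr ler_sqr ?nnegrE ?enorm_ge0. Qed.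

Lemma continuous_enorm x : {for x, continuous enorm}.
Proof.
apply: (@continuous_comp _ _ _ (@normsq R m) Num.sqrt); first exact: continuous_normsq.
exact: sqrt_continuous.
Qed.

End euclidean_norm.

(* [weight d t] is a C^1 truncation of 1 / (1 - t) at distance d from t = 1. *)
Definition cutoff {R : realType} (d t : R) : R := pos (1 - d - t).
Definition weight {R : realType} (d t : R) : R :=
  cutoff d t ^+ 2 / (d ^+ 3 + cutoff d t ^+ 3).

Section weights.
Context {R : realType}.
Implicit Types (d t : R).

Lemma weight_den d t : 0 < d -> 0 < d ^+ 3 + cutoff d t ^+ 3.
Proof. by move=> d0; rewrite ltr_pwDl ?exprn_gt0// exprn_ge0// pos_ge0. Qed.

Lemma weight_ge0 d t : 0 < d -> 0 <= weight d t.
Proof. by move=> d0; rewrite divr_ge0 ?sqr_ge0// ltW// weight_den. Qed.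

Lemma weight_eq0 d t : 1 - d <= t -> weight d t = 0.
Proof. by move=> h; rewrite /weight /cutoff pos0 ?expr0n ?mul0r//; lra. Qed.

Lemma continuous_weight d : 0 < d -> continuous (weight d).
Proof.
move=> d0 t; suff: {for t, continuous (weight d)} by [].
rewrite /weight /cutoff; contin.
by have := weight_den t d0; rewrite lt0r => /andP[].
Qed.

Lemma weight_ge d t : 0 < d -> d <= 1 - d - t -> (2 * (1 - d - t))^-1 <= weight d t.
Proof.
move=> d0 h; rewrite /weight /cutoff pos_nneg; last by lra.
set w := 1 - d - t in h *; have w0 : 0 < w by exact: lt_le_trans h.
have h3 : d ^+ 3 <= w ^+ 3 by rewrite lerXn2r// nnegrE ltW.
have den : 0 < d ^+ 3 + w ^+ 3 by rewrite addr_gt0// exprn_gt0.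
rewrite ler_pdivlMr// mulrC ler_pdivrMr ?mulr_gt0//.
have E : w ^+ 2 * (2 * w) = w ^+ 3 + w ^+ 3 by ring.
by rewrite E lerD2r.
Qed.

End weights.

Section eps_regularity.
Context {R : realType}.
Local Notation U := (@unit_ball R).
Let oU : open U := @open_unit_ball R.
Variables (g : 'rV[R]_4 -> R) (C K : R).
Hypotheses (sg : smooth_on U g) (g0 : forall y, 0 <= g y) (C0 : 0 <= C) (K0 : 0 <= K).
Hypothesis bochner_g : forall y (s : R), U y -> 0 <= s -> g y = s ^+ 2 ->
  - C * s ^+ 3 <= laplacian g y.
Hypothesis energy_g : forall d, 0 < d < 1 ->
  integral4 (fun y => weight d (normsq y) * (normsq y * g y)) <= K.

Let unitE y : U y <-> enorm y < 1.
Proof. by rewrite /unit_ball /= -normsq_lt ?ler01// expr1n. Qed.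

Let c0 : R := 8 * (4 ^+ 5)^-1 * kmean (fun=> 1) 0 3 1.
Let c00 : 0 < c0.
Proof. by rewrite /c0 !mulr_gt0 ?kmean_one_gt0// invr_gt0 exprn_gt0. Qed.

(** On a ball where the distance to the boundary is between [d] and [3 * d], the weight is at least
    [1 / (12 d)] and [normsq] at least 1/4, which gives 48. The factor [d] is the gain over a plain
    energy bound. *)
Let energy_ball z b d : 0 < b -> 0 < d < 1 ->
  (forall y, normsq (y - z) < b -> [/\ d <= 1 - enorm y, 1 - enorm y <= 3 * d & 1 / 2 <= enorm y]) ->
  kmean g z 3 b <= b ^+ 3 * (48 * d * K).
Proof.
move=> b0 d01 H; have /andP[d0 d1] := d01.
(* The weight truncated at [d / 4] is still of full size at distance [d] from the boundary. *)
have d4 : 0 < d / 4 < 1 by apply/andP; split; lra.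
have d40 : 0 < d / 4 by case/andP: d4.
have cg y : U y -> {for y, continuous g} by exact: smooth_on_continuous.
have cw : cc (fun y => weight (d / 4) (normsq y) * (normsq y * g y)).
  apply: (cc_radial (k := 1 - d / 4)) => //.
  - exact: continuous_weight.
  - by lra.
  - by move=> t; exact: weight_eq0.
  - move=> y Uy; apply: continuousM_at; last exact: cg.
    exact: smooth_on_continuous (smooth_on_normsq oU) Uy.
have bU y : normsq (y - z) < b -> U y.
  by move=> /H[h _ _]; apply/unitE; lra.
have ck : cc (fun y => ker 3 b z y * g y).
  apply: (cc_cut (k := 1 - d / 4)).
  - exact: continuous_ker.
  - move=> y ky; apply: ker_eq0; rewrite leNgt; apply/negP => /H[h _ _].
    have := enorm_sqr y; have := enorm_ge0 y; rewrite expr2; nra.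
  - by move=> y yk; apply: cg; apply: le_lt_trans yk _; lra.
have P : integral4 (fun y => ker 3 b z y * g y) <=
    integral4 (fun y => (b ^+ 3 * (48 * d)) * (weight (d / 4) (normsq y) * (normsq y * g y))).
  apply: integral4_le => //; first exact: ccZ.
  move=> y; have gy := g0 y; have ny := normsq_ge0 y; have wy := weight_ge0 (normsq y) d40.
  have [yb|yb] := lerP b (normsq (y - z)).
    rewrite ker_eq0// mul0r; apply: mulr_ge0; last by apply: mulr_ge0 => //; exact: mulr_ge0.
    by apply: mulr_ge0; [apply/exprn_ge0/ltW|apply: mulr_ge0 => //; exact: ltW].
  have [h1 h2 h3] := H y yb.
  have kb : ker 3 b z y <= b ^+ 3.
    rewrite /ker lerXn2r ?nnegrE ?pos_ge0 ?(ltW b0)//.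
    by rewrite pos_nneg ?subr_ge0 ?(ltW yb)// gerBl normsq_ge0.
  have e2 := enorm_sqr y; rewrite expr2 in e2.
  have n4 : 1 / 4 <= normsq y by rewrite -e2; nra.
  have t1 : d <= 1 - normsq y by rewrite -e2; nra.
  have t2 : 1 - normsq y <= 6 * d by rewrite -e2; nra.
  have W : (12 * d)^-1 <= weight (d / 4) (normsq y).
    apply: le_trans (weight_ge d40 _); last by lra.
    by rewrite lef_pV2 ?posrE; lra.
  have W0 : 0 <= (12 * d)^-1 by rewrite invr_ge0 mulr_ge0// ltW.
  have W1 : 1 <= (48 * d) * (weight (d / 4) (normsq y) * normsq y).
    have d48 : 0 < 48 * d by exact: mulr_gt0.
    have e1 : (48 * d) * ((12 * d)^-1 * (1 / 4)) = 1 by field; rewrite gt_eqF.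
    rewrite -[leLHS]e1; apply: ler_wpM2l; first exact: ltW.
    by apply: ler_pM => //; lra.
  apply: le_trans (ler_wpM2r gy kb) _.
  rewrite (_ : b ^+ 3 * _ * _ = (b ^+ 3 * g y) * ((48 * d) * (weight (d / 4) (normsq y) * normsq y))).
    by rewrite ler_peMr// mulr_ge0// exprn_ge0// ltW.
  by move: (weight _ _) => w; ring.
rewrite (integral4Z _ cw) in P; apply: le_trans P _.
rewrite [leRHS]mulrA; apply: ler_wpM2l; last exact: energy_g.
by apply: mulr_ge0; [apply/exprn_ge0/ltW|apply: mulr_ge0 => //; exact: ltW].
Qed.

(* Schoen's trick: at a maximum of the scale-invariant quantity
   (d - |y - z|)^4 g(y) the density is comparable to its maximum on a ball of
   the right size, where the Bochner inequality is linear. *)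
Let schoen z d : 0 < d -> enorm z = 1 - 2 * d -> 2 / 3 <= enorm z ->
  48 * d * K * expR (C / 4) < c0 ->
  g z * d ^+ 3 <= 16 * (192 * K * expR (C / 4) / c0).
Proof.
move=> d0 zd z23 small.
have d6 : d <= 1 / 6 by lra.
have cg y : U y -> {for y, continuous g} by exact: smooth_on_continuous.
pose f y := pos (d - enorm (y - z)) ^+ 4 * g y.
pose A := [set y : 'rV[R]_4 | normsq y <= (1 - d) ^+ 2].
have d1 : 0 <= 1 - d by lra.
have inA y : enorm (y - z) <= d -> A y.
  by move=> yz; rewrite /A /= normsq_le//; have := enorm_le_add y z; lra.
have Az : A z by apply: inA; rewrite subrr /enorm normsq0 sqrtr0 ltW.
have AU y : A y -> U y by rewrite /A /= normsq_le// => h; apply/unitE; lra.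
have cf : {within A, continuous f}.
  apply: continuous_in_subspaceT => y; rewrite inE => Ay.
  suff: {for y, continuous f} by [].
  apply: continuousM_at; last exact: cg (AU _ Ay).
  apply: continuousX_at; apply: continuous_pos_at; apply: continuousB_at; first exact: continuous_cst_at.
  apply: (@continuous_comp _ _ _ (fun y : 'rV[R]_4 => y - z) enorm); last exact: continuous_enorm.
  exact: (cvgB cvg_id (@cst_continuous _ _ z y)).
have [y1] := EVT_max_rV (ex_intro _ z Az) (@compact_normsq R 4 ((1 - d) ^+ 2)) cf.
rewrite inE => Ay1 ymax.
have fmax y : enorm (y - z) <= d -> f y <= f y1 by move=> /inA Ay; apply: ymax; rewrite inE.
have fz : f z = d ^+ 4 * g z.
  by rewrite /f subrr /enorm normsq0 sqrtr0 subr0 pos_nneg// ltW.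
have fzmax : d ^+ 4 * g z <= f y1 by rewrite -fz; apply: fmax; rewrite subrr /enorm normsq0 sqrtr0 ltW.
have B0 : 0 <= 16 * (192 * K * expR (C / 4) / c0).
  by rewrite !mulr_ge0 ?invr_ge0 ?expR_ge0// ltW.
have [fy1|fy1] := lerP (f y1) 0.
  have gz : g z <= 0 by rewrite -(pmulr_rle0 _ (exprn_gt0 4 d0)); exact: le_trans fzmax fy1.
  by apply: le_trans B0; rewrite mulr_le0_ge0// exprn_ge0// ltW.
pose M := g y1.
have M0 : 0 < M.
  rewrite lt_neqAle g0 andbT; apply: contraTneq fy1 => E.
  by rewrite /f -/M -E mulr0 ltxx.
(* Half of the distance left at the maximum point: within [rho] of it that distance at most halves,
   so [g] grows at most by the factor [2^4 = 16]. *)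
pose rho := (d - enorm (y1 - z)) / 2.
have rho0 : 0 < rho.
  rewrite divr_gt0// ltNge; apply: contraTN fy1 => h.
  by rewrite -leNgt /f pos0// expr0n/= mul0r.
have f1 : f y1 = 16 * rho ^+ 4 * M.
  rewrite /f (_ : pos _ = 2 * rho); last first.
    by rewrite pos_nneg; [rewrite /rho; field|move: rho0; rewrite /rho; lra].
  by rewrite /M; ring.
have rhod : rho <= d / 2 by rewrite /rho; have := enorm_ge0 (y1 - z); lra.
have near_y1 y : normsq (y - y1) < rho ^+ 2 -> enorm (y - z) <= d - rho /\ g y <= 16 * M.
  rewrite normsq_lt ?(ltW rho0)// => yy.
  have yz : enorm (y - z) <= d - rho.
    by have := enorm_dist y y1 z; rewrite /rho in yy *; lra.
  split=> //; have yd : enorm (y - z) <= d by lra.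
  have := fmax y yd; rewrite f1 /f.
  have r4 : 0 < rho ^+ 4 by exact: exprn_gt0.
  have h : rho ^+ 4 * g y <= pos (d - enorm (y - z)) ^+ 4 * g y.
    apply: ler_wpM2r => //; apply: lerXn2r; rewrite ?nnegrE ?pos_ge0 ?(ltW rho0)//.
    by apply: le_trans (le_pos _); lra.
  move=> h2; rewrite -(ler_pM2l r4); apply: le_trans h _; apply: le_trans h2 _.
  by rewrite le_eqVlt; apply/orP; left; apply/eqP; ring.
(* The square root of [g] is at most [4 * q] on the ball, so there the Bochner inequality is linear
   with constant [4 * C * q]. *)
pose q := Num.sqrt M.
have q0 : 0 < q by rewrite sqrtr_gt0.
have q2 : q ^+ 2 = M by rewrite sqr_sqrtr// ltW.
have ball_y1 y : normsq (y - y1) < rho ^+ 2 ->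
    [/\ d <= 1 - enorm y, 1 - enorm y <= 3 * d & 1 / 2 <= enorm y].
  move=> /near_y1[yz _].
  have h1 := enorm_le_add y z; have h2 := enorm_le_add z y; rewrite enorm_subC in h2.
  by split; lra.
have y1U : enorm y1 <= 1 by move: Ay1; rewrite /A /= normsq_le//; lra.
have n1 : normsq y1 <= 1 by rewrite -(expr1n R 2) normsq_le.
have rho1 : rho <= 1 by lra.
have r21 : rho ^+ 2 <= 4 by rewrite expr2; nra.
have kU y : normsq y <= (1 - d / 2) ^+ 2 -> U y.
  by rewrite normsq_le; [move=> h; apply/unitE; lra|lra].
have ak y : normsq (y - y1) < rho ^+ 2 -> normsq y < (1 - d / 2) ^+ 2.
  by move=> /ball_y1[h _ _]; rewrite normsq_lt; lra.
have MV b : 0 < b < rho ^+ 2 ->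
    c0 * M * b ^+ 5 <= b ^+ 3 * (48 * d * K) * expR (C * q / 4 * b).
  move=> bb; have K1 : 0 <= 4 * C * q by rewrite !mulr_ge0// ltW.
  have Hg y : normsq (y - y1) < rho ^+ 2 -> 0 <= g y /\ - ((4 * C * q) * g y) <= laplacian g y.
    move=> yy; split=> //; have [yz gM] := near_y1 y yy.
    have Uy : U y by apply: kU; exact/ltW/ak.
    have s0 := sqrtr_ge0 (g y); have s2 : g y = Num.sqrt (g y) ^+ 2 by rewrite sqr_sqrtr.
    apply: le_trans (bochner_g Uy s0 s2); rewrite [X in - (_ * X)]s2.
    have sq : Num.sqrt (g y) <= 4 * q.
      rewrite -ler_sqr ?nnegrE ?mulr_ge0 ?(ltW q0)// -s2 exprMn q2; lra.
    rewrite mulNr lerN2 (_ : C * _ = C * Num.sqrt (g y) ^+ 2 * Num.sqrt (g y)); last by ring.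
    rewrite (_ : 4 * C * q * _ = C * Num.sqrt (g y) ^+ 2 * (4 * q)); last by ring.
    by rewrite ler_wpM2l// mulr_ge0// sqr_ge0.
  have /andP[b0 b1] := bb.
  have := mean_value_ineq oU sg kU ak r21 n1 K1 Hg bb; rewrite -/c0 -/M => H.
  apply: le_trans H _; rewrite (_ : 4 * C * q / 16 * b = C * q / 4 * b); last by field.
  rewrite ler_wpM2r ?expR_ge0//; apply: energy_ball => //; first by apply/andP; split; lra.
  by move=> y yb; apply: ball_y1; exact: lt_trans yb b1.
have MV2 b : 0 < b < rho ^+ 2 -> q * b <= 1 -> c0 * M * b ^+ 2 <= 48 * d * K * expR (C / 4).
  move=> bb qb; have /andP[b0 b1] := bb; have b3 : 0 < b ^+ 3 by exact: exprn_gt0.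
  rewrite -(ler_pM2l b3) (_ : b ^+ 3 * (c0 * M * b ^+ 2) = c0 * M * b ^+ 5); last by ring.
  apply: le_trans (MV b bb) _; rewrite [leRHS]mulrA; apply: ler_wpM2l.
    by rewrite !mulr_ge0// ltW.
  rewrite ler_expR; have : C * (q * b) <= C * 1 by exact: ler_wpM2l.
  lra.
(* [b] is a squared radius, and up to [b = q^-1] the exponential stays bounded by [expR (C / 4)]. If
   the ball is small on this scale, [b = rho^2 / 2] gives the estimate; otherwise [b = q^-1] is
   allowed and yields a lower bound [c0] for the energy term, against [small]. *)
have [qr|qr] := lerP (q * (rho ^+ 2 / 2)) 1.
  have bb : 0 < rho ^+ 2 / 2 < rho ^+ 2.
    have r2 : 0 < rho ^+ 2 by exact: exprn_gt0.
    by apply/andP; split; lra.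
  have H := MV2 _ bb qr.
  have H2 : rho ^+ 4 * M <= d * (192 * K * expR (C / 4) / c0).
    rewrite mulrA ler_pdivlMr// (_ : _ * c0 = 4 * (c0 * M * (rho ^+ 2 / 2) ^+ 2)); last by field.
    by apply: le_trans (ler_wpM2l _ H) _ => //; rewrite le_eqVlt; apply/orP; left; apply/eqP; ring.
  rewrite -(ler_pM2l d0); apply: le_trans (_ : f y1 <= _); first by rewrite (_ : d * _ = d ^+ 4 * g z)//; ring.
  by rewrite f1; move: H2; set X := _ / c0; lra.
have bb : 0 < q^-1 < rho ^+ 2.
  rewrite invr_gt0 q0/=.
  have : q^-1 < rho ^+ 2 / 2 by rewrite -(ltr_pM2l q0) divff ?gt_eqF.
  have r2 : 0 < rho ^+ 2 by exact: exprn_gt0.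
  by lra.
have qb : q * q^-1 <= 1 by rewrite divff// gt_eqF.
have := MV2 _ bb qb; rewrite -q2 exprVn -mulrA divff ?mulr1; last by rewrite expf_neq0// gt_eqF.
by rewrite leNgt small.
Qed.

(** Near the boundary [energy_ball] provides the smallness that [schoen] asks for; on the remaining
    compact ball [g] is bounded. As [s^2] is at most the distance to the boundary, this is
    [g = O(distance^(-3))]. *)
Lemma eps_regularity : exists2 B : R, 0 <= B & forall (s : R) y, 0 < s <= 1 ->
  normsq y <= (1 - s ^+ 2) ^+ 2 -> g y * s ^+ 6 <= B.
Proof.
pose D := 48 * K * expR (C / 4).
have D0 : 0 <= D by rewrite !mulr_ge0// expR_ge0.
(* Below the first value [d * D < c0] holds, which is the smallness; 1/6 ensures that the points at
   distance [2 * d] from the boundary have norm at least 2/3. *)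
pose ds := Num.min (c0 / (D + 1) / 2) (1 / 6).
have ds0 : 0 < ds by rewrite lt_min !divr_gt0//= ltr_wpDl.
have dsD d : d < ds -> 0 < d -> 48 * d * K * expR (C / 4) < c0.
  move=> dd d0; have : d < c0 / (D + 1) / 2 by move: dd; rewrite lt_min => /andP[].
  move=> h; have {}h : d * (D + 1) < c0.
    rewrite -ltr_pdivlMr; last by rewrite ltr_wpDl.
    have p : 0 < c0 / (D + 1) by apply: divr_gt0 => //; lra.
    by lra.
  rewrite (_ : _ * _ = d * D); last by rewrite /D; ring.
  by apply: le_lt_trans h; rewrite ler_wpM2l ?(ltW d0)//; lra.
have ds6 : ds <= 1 / 6 by rewrite ge_min lexx orbT.
have r0 : 0 <= 1 - 2 * ds by lra.
have cg y : normsq y <= (1 - 2 * ds) ^+ 2 -> {for y, continuous g}.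
  rewrite normsq_le// => h; apply: smooth_on_continuous sg _; apply/unitE; lra.
have [B B0 HB] := compact_bound cg.
pose E := 16 * (192 * K * expR (C / 4) / c0).
have E0 : 0 <= E by rewrite !mulr_ge0 ?invr_ge0 ?expR_ge0// ltW.
exists (8 * E + B); first by lra.
move=> s y /andP[s0 s1] ys.
have s2 : s ^+ 2 <= 1 by rewrite expr_le1// ltW.
have s20 : 0 < s ^+ 2 by exact: exprn_gt0.
rewrite normsq_le in ys; last by lra.
have [yd|yd] := lerP (enorm y) (1 - 2 * ds).
  have h : g y <= B by rewrite -(ger0_norm (g0 y)); apply: HB; rewrite normsq_le.
  apply: (@le_trans _ _ (g y)); last by lra.
  by rewrite ler_piMr// exprn_ile1// ltW.
pose d := (1 - enorm y) / 2.
have d0 : 0 < d by rewrite /d; lra.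
have dd : d < ds by rewrite /d; lra.
have H := @schoen y d d0 _ _ (dsD _ dd d0); have {}H : g y * d ^+ 3 <= E.
  by apply: H; rewrite /d; lra.
have sd : s ^+ 2 <= 2 * d by rewrite /d; lra.
apply: (@le_trans _ _ (8 * (g y * d ^+ 3))); last by lra.
rewrite (_ : 8 * _ = g y * (2 * d) ^+ 3); last by ring.
rewrite (_ : s ^+ 6 = (s ^+ 2) ^+ 3); last by ring.
by rewrite ler_wpM2l// lerXn2r// nnegrE ltW//; lra.
Qed.

End eps_regularity.

(** * Monotonicity of dilation means *)

Section log_weights.
Context {R : realType}.
Implicit Types (d t : R).

Lemma MVT_open (F dF : R -> R) (a b : R) : a < b ->
  (forall x, a <= x <= b -> is_derive x 1 F (dF x)) ->
  exists2 c, a < c < b & F b - F a = dF c * (b - a).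
Proof.
move=> ab Fd; have [||c] := @MVT R F dF a b ab.
- by move=> z; rewrite in_itv /= => /andP[z0 zh]; apply: Fd; rewrite !ltW.
- apply: derivable_within_continuous => z; rewrite in_itv/= => /Fd H.
  exact: (@ex_derive _ _ _ _ _ _ _ H).
- by rewrite in_itv/= => cab E; exists c.
Qed.

(** The primitive of minus the weight that vanishes near [t = 1]. As a cutoff in the divergence
    theorem it makes the weight appear. *)
Definition theta d t : R := 3^-1 * ln (1 + cutoff d t ^+ 3 / d ^+ 3).

Definition dweight d t : R :=
  (- 2 * cutoff d t * (d ^+ 3 + cutoff d t ^+ 3) + 3 * cutoff d t ^+ 4)
  / (d ^+ 3 + cutoff d t ^+ 3) ^+ 2.

Let arg_gt0 d t : 0 < d -> 0 < 1 + cutoff d t ^+ 3 / d ^+ 3.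
Proof.
by move=> d0; rewrite ltr_pwDl// divr_ge0// exprn_ge0 ?pos_ge0// ltW.
Qed.

Lemma is_derive_theta d t : 0 < d -> is_derive t 1 (theta d) (- weight d t).
Proof.
move=> d0.
have dl : is_derive (1 + cutoff d t ^+ 3 / d ^+ 3) 1 (@ln R) (1 + cutoff d t ^+ 3 / d ^+ 3)^-1.
  exact: is_derive1_ln (arg_gt0 t d0).
have di := derD (der_cst 1 t) (derM (der_sub_pos 1 (1 - d) t) (der_cst (d ^+ 3)^-1 t)).
have H := der_comp (f := @ln R) (g := fun t => 1 + cutoff d t ^+ 3 / d ^+ 3) dl di.
apply: der_eq (derZ 3^-1 H) _.
rewrite /weight -/(cutoff d t).
have n1 : d ^+ 3 + cutoff d t ^+ 3 != 0 by rewrite gt_eqF// weight_den.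
have n2 : d != 0 by rewrite gt_eqF.
by field; rewrite n2 n1.
Qed.

Lemma theta_ge0 d t : 0 < d -> 0 <= theta d t.
Proof.
move=> d0; rewrite mulr_ge0 ?invr_ge0// ln_ge0// lerDl.
by rewrite divr_ge0 ?exprn_ge0 ?pos_ge0// ltW.
Qed.

Lemma theta_eq0 d t : 1 - d <= t -> theta d t = 0.
Proof.
by move=> h; rewrite /theta /cutoff pos0 ?expr0n/= ?mul0r ?addr0 ?ln1 ?mulr0//; lra.
Qed.

Lemma is_derive_weight d t : 0 < d -> is_derive t 1 (weight d) (dweight d t).
Proof.
move=> d0; have n1 : d ^+ 3 + cutoff d t ^+ 3 != 0 by rewrite gt_eqF// weight_den.
have d2 := der_sub_pos 0 (1 - d) t.
have d3 := derD (der_cst (d ^+ 3) t) (der_sub_pos 1 (1 - d) t).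
have dv := derV (f := fun t => d ^+ 3 + cutoff d t ^+ 3) n1 d3.
apply: der_eq (derM (f := fun t => cutoff d t ^+ 2) d2 dv) _.
rewrite /dweight -/(cutoff d t) expr1.
by field.
Qed.

Lemma continuous_dweight d : 0 < d -> continuous (dweight d).
Proof.
move=> d0 t; suff: {for t, continuous (dweight d)} by [].
rewrite /dweight /cutoff; contin.
have := exprn_gt0 2 (weight_den t d0); rewrite lt0r => /andP[+ _].
by [].
Qed.

Lemma dweight_eq0 d t : 1 - d <= t -> dweight d t = 0.
Proof.
move=> h; rewrite /dweight /cutoff pos0; last by lra.
by rewrite mulr0 mul0r expr0n/= mulr0 addr0 mul0r.
Qed.

Lemma admissible_theta d : 0 < d -> admissible (theta d) (fun t => - weight d t) (1 - d).
Proof.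
move=> d0; split.
- by move=> t; exact: is_derive_theta.
- move=> t; suff: {for t, continuous (fun t => - weight d t)} by [].
  by apply: continuousN_at; exact: continuous_weight.
- by lra.
- by move=> t; exact: theta_eq0.
- by move=> t /weight_eq0 ->; rewrite oppr0.
Qed.

(** The weight to which [frequency_monotone] is applied; the factor [t] is the [normsq y] of the
    weighted energy. *)
Lemma admissible_tweight d : 0 < d ->
  admissible (fun t => t * weight d t) (fun t => weight d t + t * dweight d t) (1 - d).
Proof.
move=> d0; split.
- by move=> t; apply: der_eq (derM (der_id t) (is_derive_weight t d0)) _; rewrite mul1r.
- move=> t; suff: {for t, continuous (fun t => weight d t + t * dweight d t)} by [].
  apply: continuousD_at; first exact: continuous_weight.
  by apply: continuousM_at; [exact: continuous_id_at|exact: continuous_dweight].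
- by lra.
- by move=> t /weight_eq0 ->; rewrite mulr0.
- by move=> t h; rewrite weight_eq0// dweight_eq0// mulr0 addr0.
Qed.

End log_weights.

Section pohozaev_identity.
Context {R : realType}.
Local Notation U := (@unit_ball R).
Let oU : open U := @open_unit_ball R.

(** The divergence theorem with cutoff [theta d]: the divergence is zero, so the radial component of
    the field has zero mean against the weight, which balances [rd] with a quarter of the
    density. *)
Lemma pohozaev_energy (w : 'I_4 -> 'rV[R]_4 -> R) (rd g : 'rV[R]_4 -> R) (d : R) :
  0 < d -> (forall i, smooth_on U (w i)) -> smooth_on U rd -> smooth_on U g ->
  (forall y, U y -> \sum_i pd i (w i) y = 0) ->
  (forall y, U y -> \sum_i y 0 i * w i y = rd y - 4^-1 * (normsq y * g y)) ->
  integral4 (fun y => weight d (normsq y) * (normsq y * g y)) =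
  4 * integral4 (fun y => weight d (normsq y) * rd y).
Proof.
move=> d0 sw srd sg div rad.
have adm := admissible_theta d0; have := radial_div adm sw.
have d1 : 1 - d < 1 by lra.
have w0 t : 1 - d <= t -> weight d t = 0 by exact: weight_eq0.
have -> : (fun y => theta d (normsq y) * \sum_i pd i (w i) y) = fun=> 0.
  apply/funext => y; have [h|h] := lerP (1 - d) (normsq y).
    by rewrite theta_eq0// mul0r.
  by rewrite div ?mulr0//; exact: lt_trans h d1.
have c1 : cc (fun y => weight d (normsq y) * rd y).
  apply: (cc_radial _ d1 w0); first exact: continuous_weight.
  by move=> y; exact: smooth_on_continuous.
have c2 : cc (fun y => weight d (normsq y) * (normsq y * g y)).
  apply: (cc_radial _ d1 w0); first exact: continuous_weight.
  move=> y Uy; apply: continuousM_at; first exact: smooth_on_continuous (smooth_on_normsq oU) Uy.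
  exact: smooth_on_continuous sg Uy.
have -> : (fun y => - weight d (normsq y) * (2 * \sum_i y 0 i * w i y)) =
    fun y => (- 2) * (weight d (normsq y) * rd y) + 2^-1 * (weight d (normsq y) * (normsq y * g y)).
  apply/funext => y; have [h|h] := lerP (1 - d) (normsq y).
    by rewrite weight_eq0// !mul0r !mulr0 addr0 mulNr mul0r oppr0.
  rewrite rad; last exact: lt_trans h d1.
  by move: (weight _ _) => W; field.
rewrite integral4_0 addr0 (integral4D (ccZ _ c1) (ccZ _ c2)) (integral4Z _ c1) (integral4Z _ c2).
by lra.
Qed.

End pohozaev_identity.

Section frequency.
Context {R : realType}.
Local Notation U := (@unit_ball R).
Let oU : open U := @open_unit_ball R.
Variables (q : 'rV[R]_4 -> R) (C B : R) (g : 'rV[R]_4 -> R).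
Variables (om1 om2 om3 : 'I_4 -> 'I_4 -> R) (h1 h2 h3 : 'rV[R]_4 -> R).
Hypotheses (sq : smooth_on U q) (q0 : forall y, 0 <= q y) (C0 : 0 <= C) (B0 : 0 <= B).
Hypotheses (a1 : forall i j, om1 i j = - om1 j i) (a2 : forall i j, om2 i j = - om2 j i)
  (a3 : forall i j, om3 i j = - om3 j i).
Hypotheses (sh1 : smooth_on U h1) (sh2 : smooth_on U h2) (sh3 : smooth_on U h3).
Hypothesis convex : forall y (l s : R), U y -> 0 <= s -> g y <= s ^+ 2 ->
  4 * (l * srad q y - l ^+ 2 * q y) + (srot om1 h1 y + srot om2 h2 y + srot om3 h3 y)
  - C * (normsq y * s) * q y <= srad (srad q) y.
Hypothesis g_bound : forall (s : R) y, 0 < s <= 1 ->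
  normsq y <= (1 - s ^+ 2) ^+ 2 -> g y * s ^+ 6 <= B.

Variables (phi dphi : R -> R) (k : R).
Hypotheses (adm : admissible phi dphi k) (k0 : 0 <= k) (phi0 : forall t, 0 <= t -> 0 <= phi t).

Let v := dilation_mean phi q.
Let w := dilation_mean phi (srad q).
Let srq : smooth_on U (srad q) := smooth_on_srad oU sq.
Let srrq : smooth_on U (srad (srad q)) := smooth_on_srad oU srq.
Let dv r := integral4 (fun y => phi (normsq y) * \sum_i y 0 i * pd i q (r *: y)).
Let dw r := integral4 (fun y => phi (normsq y) * \sum_i y 0 i * pd i (srad q) (r *: y)).
Let A := C * Num.sqrt B.

Let A0 : 0 <= A. Proof. by rewrite /A mulr_ge0// sqrtr_ge0. Qed.

Let cc_dilate (h : 'rV[R]_4 -> R) (r : R) : `|r| <= 1 -> smooth_on U h ->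
  cc (fun y => phi (normsq y) * h (r *: y)).
Proof.
move=> r1 sh; have cphi := admissible_continuous adm; case: adm => _ _ k1 p0 _.
by apply: (cc_radial cphi k1 p0) => y; exact: smooth_on_continuous (smooth_on_dilate r1 sh).
Qed.

Let srad_dilate (h : 'rV[R]_4 -> R) (r : R) :
  (fun y => phi (normsq y) * srad h (r *: y)) =
  (fun y => r * (phi (normsq y) * \sum_i y 0 i * pd i h (r *: y))).
Proof.
apply/funext => y; rewrite mulrCA; congr (_ * _); rewrite /srad mulr_sumr.
by apply: eq_bigr => i _; rewrite mxE mulrA.
Qed.

Let dil_mul (h : 'rV[R]_4 -> R) (r : R) : `|r| <= 1 -> smooth_on U h ->
  dilation_mean phi (srad h) r = r * integral4 (fun y => phi (normsq y) * \sum_i y 0 i * pd i h (r *: y)).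
Proof.
move=> r1 sh; rewrite /dilation_mean srad_dilate integral4Z//.
have cphi := admissible_continuous adm; case: adm => _ _ k1 p0 _.
apply: (cc_radial cphi k1 p0) => y Uy; apply: continuous_at_sum => i; apply: continuousM_at.
  exact: smooth_on_continuous (smooth_on_coord i oU) Uy.
exact: smooth_on_continuous (smooth_on_dilate r1 (smooth_on_pd i sh)) Uy.
Qed.

Let v_ge0 r : 0 <= v r.
Proof. by apply: integral4_ge0 => y; rewrite mulr_ge0// phi0// normsq_ge0. Qed.

(* The substitution r = 1 - s^2 turns the curvature bound O((1 - r)^(-3/2)) into
   the error A / s^3, whose product with dr = - 2 s ds is the derivative of 2 A / s. *)
Let w_convex (s l r : R) : 0 < s < 1 -> r = 1 - s ^+ 2 ->
  4 * (l * w r - l ^+ 2 * v r) - A / s ^+ 3 * r * v r <= r * dw r.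
Proof.
move=> /andP[s0 s1]; have s2 : s ^+ 2 < 1 by rewrite expr_lt1// ltW.
have s20 : 0 < s ^+ 2 by exact: exprn_gt0.
move=> rE; have r0 : 0 < r by rewrite rE subr_gt0.
have r11 : r <= 1 by rewrite rE; lra.
have r1 : `|r| <= 1 by rewrite (ger0_norm (ltW r0)).
rewrite -(dil_mul r1 srq).
have cr := cc_dilate r1 srq; have cq := cc_dilate r1 sq; have crr := cc_dilate r1 srrq.
have c1 := cc_dilate r1 (smooth_on_srot oU om1 sh1).
have c2 := cc_dilate r1 (smooth_on_srot oU om2 sh2).
have c3 := cc_dilate r1 (smooth_on_srot oU om3 sh3).
have I1 := integral_srot adm a1 sh1 r1; have I2 := integral_srot adm a2 sh2 r1.
have I3 := integral_srot adm a3 sh3 r1.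
pose F y := (4 * l) * (phi (normsq y) * srad q (r *: y))
  + (- (4 * l ^+ 2 + A / s ^+ 3 * r)) * (phi (normsq y) * q (r *: y))
  + ((phi (normsq y) * srot om1 h1 (r *: y) + phi (normsq y) * srot om2 h2 (r *: y))
     + phi (normsq y) * srot om3 h3 (r *: y)).
have cA := ccD (ccZ (4 * l) cr) (ccZ (- (4 * l ^+ 2 + A / s ^+ 3 * r)) cq).
have cB := ccD (ccD c1 c2) c3.
have E : integral4 F = 4 * (l * w r - l ^+ 2 * v r) - A / s ^+ 3 * r * v r.
  rewrite /F (integral4D cA cB) (integral4D (ccZ _ cr) (ccZ _ cq)).
  rewrite (integral4D (ccD c1 c2) c3) (integral4D c1 c2) I1 I2 I3 !addr0.
  rewrite (integral4Z _ cr) (integral4Z _ cq) -/(dilation_mean phi (srad q) r) -/(w r).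
  by rewrite -/(dilation_mean phi q r) -/(v r); ring.
rewrite -E; apply: (integral4_le (ccD cA cB) crr) => y; rewrite /F.
have n0 := normsq_ge0 y; have p0 := phi0 n0.
have [ky|ky] := lerP k (normsq y).
  have [_ _ _ z0 _] := adm; rewrite (z0 _ ky).
  by rewrite !mul0r !mulr0 !addr0.
have k1 : k < 1 by case: adm.
have Uy : U y by exact: lt_trans ky k1.
have Ury := unit_ball_dilate r1 Uy.
have nry : normsq (r *: y) <= r ^+ 2.
  by rewrite normsq_dilate ler_piMr ?sqr_ge0// ltW.
have S0 : 0 <= Num.sqrt B / s ^+ 3 by rewrite divr_ge0 ?sqrtr_ge0// exprn_ge0// ltW.
have gS : g (r *: y) <= (Num.sqrt B / s ^+ 3) ^+ 2.
  rewrite expr_div_n sqr_sqrtr// -exprM ler_pdivlMr ?exprn_gt0//.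
  by apply: g_bound; [rewrite s0 ltW|rewrite -rE].
have := convex l Ury S0 gS.
set SR := srad q _; set Q := q _; set T := srot _ _ _ + _ + _; set RR := srad _ _ => H.
have Q0 : 0 <= Q by exact: q0.
have HH : C * (normsq (r *: y) * (Num.sqrt B / s ^+ 3)) * Q <= A / s ^+ 3 * r * Q.
  apply: ler_wpM2r => //.
  rewrite (_ : A / s ^+ 3 * r = C * (r * (Num.sqrt B / s ^+ 3))); last by rewrite /A; ring.
  rewrite ler_wpM2l// ler_wpM2r//; apply: le_trans nry _.
  by rewrite expr2 ler_piMl// ltW.
have {}H : 4 * (l * SR - l ^+ 2 * Q) + T - A / s ^+ 3 * r * Q <= RR by lra.
apply: le_trans (ler_wpM2l p0 H); rewrite le_eqVlt; apply/orP; left; apply/eqP.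
rewrite /T; ring.
Qed.

Let w0 : w 0 = 0.
Proof.
rewrite /w /dilation_mean -[RHS](@integral4_0 R); congr integral4; apply/funext => y.
by rewrite scale0r /srad big1 ?mulr0// => i _; rewrite mxE mul0r.
Qed.

(** Two monotone quantities in [s], where [r = 1 - s^2]: first the frequency corrected by
    [2 * A / s], then the mean corrected by an exponential. *)
Lemma frequency_monotone (r0 : R) : 0 < r0 < 1 ->
  dilation_mean phi q r0 <= expR (4 * A) * dilation_mean phi q 1.
Proof.
move=> r01; rewrite -/v.
have [V V1 dvE] := is_derive_dilation_mean adm k0 sq.
have [W W1 dwE] := is_derive_dilation_mean adm k0 srq.
have C00 := A0.
have wE (s : R) : 0 <= s <= 1 -> w (1 - s ^+ 2) = (1 - s ^+ 2) * dv (1 - s ^+ 2).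
  move=> /andP[s0 s1]; apply: dil_mul => //.
  have s2 : s ^+ 2 <= 1 by rewrite expr_le1.
  by rewrite ger0_norm; have := sqr_ge0 s; lra.
have dr (s : R) : is_derive s 1 (fun s => 1 - s ^+ 2) (- (2 * s)).
  have := derB (der_cst 1 s) (derM (der_id s) (der_id s)); rewrite mul1r mulr1 sub0r.
  by under eq_fun do rewrite -expr2; rewrite mulr_natl mulr2n.
have range (s : R) : 0 <= s <= 1 -> - V < 1 - s ^+ 2 < V /\ - W < 1 - s ^+ 2 < W.
  move=> /andP[s0 s1]; have s2 : s ^+ 2 <= 1 by rewrite expr_le1.
  by have := sqr_ge0 s; split; apply/andP; split; lra.
have dvs (s : R) : 0 <= s <= 1 -> is_derive s 1 (fun s => v (1 - s ^+ 2)) (dv (1 - s ^+ 2) * - (2 * s)).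
  move=> /range[sV _]; exact: (der_comp (f := v) (g := fun s => 1 - s ^+ 2) (dvE _ sV) (dr s)).
have dws (s : R) : 0 <= s <= 1 -> is_derive s 1 (fun s => w (1 - s ^+ 2)) (dw (1 - s ^+ 2) * - (2 * s)).
  move=> /range[_ sW]; exact: (der_comp (f := w) (g := fun s => 1 - s ^+ 2) (dwE _ sW) (dr s)).
have main (e : R) : 0 < e -> v r0 + e <= expR (4 * A) * (v 1 + e).
  move=> e0.
  (* The mean may vanish; adding [e > 0] permits division by it, and [e] is removed at the end. *)
  pose X s := v (1 - s ^+ 2) + e.
  have X0 s : 0 < X s by rewrite /X ltr_wpDl.
  pose N s := w (1 - s ^+ 2) / X s.
  have freq (s : R) : 0 < s < 1 -> 2 * A - 2 * A / s <= N s.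
    move=> /andP[s0 s1].
    (* [P] is nonincreasing in [s], and [s = 1] is the centre [r = 0], where the frequency is zero
       and [P] equals [2 * A]. *)
    pose P s := N s + 2 * A / s.
    pose dP s := dw (1 - s ^+ 2) * - (2 * s) * (X s)^-1
      + w (1 - s ^+ 2) * (- (X s ^+ 2)^-1 * (dv (1 - s ^+ 2) * - (2 * s)))
      + (2 * A) * (- (s ^+ 2)^-1 * 1).
    have dPE x : s <= x <= 1 -> is_derive x 1 P (dP x).
      move=> /andP[sx x1]; have x0 := lt_le_trans s0 sx.
      have x01 : 0 <= x <= 1 by rewrite ltW.
      have xn0 : x != 0 by rewrite gt_eqF.
      have Xn0 : X x != 0 by rewrite gt_eqF.
      have dX : is_derive x 1 X (dv (1 - x ^+ 2) * - (2 * x)).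
        by apply: der_eq (derD (dvs x x01) (der_cst e x)) _; rewrite addr0.
      apply: derD; last exact: derZ (derV (f := fun x => x) xn0 (der_id x)).
      exact: (derM (f := fun s => w (1 - s ^+ 2)) (dws x x01) (derV Xn0 dX)).
    have [c /andP[sc c1] E] := MVT_open s1 dPE.
    have c0 := lt_trans s0 sc; have c01 : 0 < c < 1 by rewrite c0.
    have c2 : 0 < c ^+ 2 by exact: exprn_gt0.
    have c21 : c ^+ 2 < 1 by rewrite expr_lt1// ltW.
    have Hdp : dP c <= 0.
      have Xc := X0 c; have vc : 0 <= v (1 - c ^+ 2) by exact: v_ge0.
      have XE : X c = v (1 - c ^+ 2) + e by [].
      (* Half the frequency is the optimal [l]: with [X] in place of the mean,
         [4 * (l * w - l ^+ 2 * X)] then equals [w ^+ 2 / X]. *)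
      have := w_convex (N c / 2) c01 erefl.
      have wN : w (1 - c ^+ 2) = N c * X c by rewrite /N divfK// gt_eqF.
      have wv := wE c _; rewrite (ltW c0) (ltW c1) in wv; have {}wv := wv isT.
      rewrite /dP; rewrite wN in wv *.
      set r := 1 - c ^+ 2 in wv vc XE *; set DW := dw r; set DV := dv r in wv *.
      set vv := v r in vc XE *; set NN := N c in wv *; set XX := X c in Xc XE wv *.
      have rp : 0 < r by rewrite /r subr_gt0.
      move=> H.
      have H2 : - (A / c ^+ 3) * XX <= (DW * XX - NN * XX * DV) / XX.
        rewrite ler_pdivlMr// -(ler_pM2l rp).
        have -> : r * (DW * XX - NN * XX * DV) = r * DW * XX - NN * XX * (r * DV) by ring.
        rewrite -wv.
        have H3 := ler_wpM2r (ltW Xc) H.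
        have Ac0 : 0 <= A / c ^+ 3 by rewrite divr_ge0// exprn_ge0// ltW.
        have H4 : A / c ^+ 3 * r * vv * XX <= A / c ^+ 3 * r * XX * XX.
          apply: ler_wpM2r; first exact: ltW.
          by apply: ler_wpM2l; [exact: mulr_ge0 Ac0 (ltW rp)|rewrite XE; lra].
        have H5 : NN ^+ 2 * vv * XX <= NN ^+ 2 * XX * XX.
          apply: ler_wpM2r; first exact: ltW.
          by apply: ler_wpM2l; [exact: sqr_ge0|rewrite XE; lra].
        move: H3 H4 H5; rewrite !expr2; lra.
      have XXn : XX != 0 by rewrite gt_eqF.
      have cn : c != 0 by rewrite gt_eqF.
      have -> : DW * - (2 * c) / XX + NN * XX * (- (XX ^+ 2)^-1 * (DV * - (2 * c)))
          + 2 * A * (- (c ^+ 2)^-1 * 1)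
        = - (2 * c / XX) * ((DW * XX - NN * XX * DV) / XX + (A / c ^+ 3) * XX) by field; rewrite XXn cn.
      rewrite mulNr oppr_le0 mulr_ge0//; last by lra.
      by rewrite divr_ge0 ?mulr_ge0// ltW.
    have P1 : P 1 = 2 * A.
      by rewrite /P /N expr1n subrr w0 mul0r add0r divr1.
    have : P 1 - P s <= 0.
      by rewrite E mulr_le0_ge0// subr_ge0 ltW.
    by rewrite P1 /P; lra.
  pose s0 := Num.sqrt (1 - r0).
  have /andP[r00 r011] := r01.
  have s02 : s0 ^+ 2 = 1 - r0 by rewrite sqr_sqrtr; lra.
  have s00 : 0 < s0 by rewrite sqrtr_gt0; lra.
  have s01 : s0 < 1.
    by rewrite -(ltr_pXn2r (n := 2))// ?nnegrE ?(ltW s00)// expr1n s02; lra.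
  (* By [freq], the derivative of the mean in [r] is at least [- (2 * A / s)] times [X], since
     [1 - s <= 1 - s^2]. The factor [- (2 * s)] from the substitution cancels the singularity and
     leaves the rate [4 * A]. *)
  pose M s := X s * expR (- (4 * A) * s).
  pose dM s := (dv (1 - s ^+ 2) * - (2 * s)) * expR (- (4 * A) * s)
     + X s * (expR (- (4 * A) * s) * (- (4 * A))).
  have dME x : 0 <= x <= s0 -> is_derive x 1 M (dM x).
    move=> /andP[x0 xs]; have x01 : 0 <= x <= 1 by rewrite x0 (le_trans xs)// ltW.
    have dE : is_derive (- (4 * A) * x) 1 (@expR R) (expR (- (4 * A) * x)) by exact: is_derive_expR.
    have dL := derZ (- (4 * A)) (der_id x); rewrite mulr1 in dL.
    have dX : is_derive x 1 X (dv (1 - x ^+ 2) * - (2 * x)).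
      by apply: der_eq (derD (dvs x x01) (der_cst e x)) _; rewrite addr0.
    exact: (derM dX (der_comp (f := expR) (g := fun x => - (4 * A) * x) dE dL)).
  have [c /andP[c0 cs] E] := MVT_open s00 dME.
  have c1 := lt_trans cs s01; have c01 : 0 < c < 1 by rewrite c0.
  have c2 : 0 < c ^+ 2 by exact: exprn_gt0.
  have c21 : c ^+ 2 < 1 by rewrite expr_lt1// ltW.
  have Hdm : dM c <= 0.
    have := freq c c01; rewrite /N wE ?(ltW c0) ?(ltW c1)//.
    rewrite ler_pdivlMr// /dM; have Xc := X0 c; have ec := expR_gt0 (- (4 * A) * c).
    set r := 1 - c ^+ 2; set DV := dv r; set XX := X c in Xc *; set ee := expR _ in ec * => H.
    have rp : 0 < r by rewrite /r subr_gt0.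
    have H2 : - (2 * A / c) * XX <= DV.
      rewrite -(ler_pM2l rp); apply: le_trans H.
      rewrite mulrA; apply: ler_wpM2r; first exact: ltW.
      have -> : 2 * A - 2 * A / c = - (2 * A / c * (1 - c)) by field; rewrite gt_eqF.
      rewrite mulrN lerN2 [leRHS]mulrC; apply: ler_wpM2l; first by rewrite divr_ge0 ?mulr_ge0// ltW.
      by rewrite /r expr2; nra.
    have -> : DV * - (2 * c) * ee + XX * (ee * - (4 * A)) = - (2 * c * ee) * (DV + (2 * A / c) * XX).
      by field; rewrite gt_eqF.
    rewrite mulNr oppr_le0 mulr_ge0 ?mulr_ge0 ?(ltW c0) ?(ltW ec)//.
    by lra.
  have : M s0 <= M 0.
    by rewrite -subr_le0 E mulr_le0_ge0// subr_ge0 ltW.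
  rewrite /M /X s02 expr0n/= mulr0 expR0 mulr1 subr0 opprB addrCA subrr addr0 => H.
  have E4 : expR (- (4 * A)) <= expR (- (4 * A) * s0).
    by rewrite ler_expR mulNr lerN2 ler_piMr ?mulr_ge0// ltW.
  have vr : 0 <= v r0 + e by rewrite addr_ge0 ?v_ge0// ltW.
  have {}H : (v r0 + e) * expR (- (4 * A)) <= v 1 + e.
    by apply: le_trans H; exact: ler_wpM2l.
  by move: H; rewrite expRN ler_pdivrMr ?expR_gt0// mulrC.
rewrite leNgt; apply/negP => H.
pose E := expR (4 * A); have E0 : 0 < E by exact: expR_gt0.
(* With this [e] the extra term [E * e] is only half of the supposed excess [v r0 - E * v 1], a
   contradiction. *)
have := main ((v r0 - E * v 1) / (2 * E)).
rewrite divr_gt0 ?subr_gt0 ?mulr_gt0// => /(_ isT); rewrite -/E mulrDr.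
have -> : E * ((v r0 - E * v 1) / (2 * E)) = (v r0 - E * v 1) / 2 by field; rewrite gt_eqF.
have : 0 < (v r0 - E * v 1) / (2 * E) by rewrite divr_gt0 ?subr_gt0 ?mulr_gt0.
move: H; rewrite -/E; lra.
Qed.

End frequency.

(** * Vanishing of the curvature *)

Section log_vanishing.
Context {R : realType}.

(* [theta d] grows like ln (1 / d) as d goes to 0. *)
Lemma theta_ge (d0 d t : R) : 0 < d <= d0 -> 0 <= t -> 2 * d0 < 1 ->
  3^-1 * ln ((d0 / d) ^+ 3) * pos (1 - 2 * d0 - t) <= theta d t.
Proof.
move=> /andP[dp dd] t0 d01; have d0p := lt_le_trans dp dd.
have q1 : 1 <= d0 / d by rewrite ler_pdivlMr// mul1r.
have q31 : 1 <= (d0 / d) ^+ 3 by rewrite exprn_ege1.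
have [h|h] := lerP (1 - 2 * d0 - t) 0.
  by rewrite pos0// mulr0 theta_ge0.
apply: (@le_trans _ _ (3^-1 * ln ((d0 / d) ^+ 3))).
  rewrite ler_piMr ?mulr_ge0 ?invr_ge0 ?ln_ge0//.
  by rewrite pos_nneg ?(ltW h)//; lra.
have c0 : d0 <= cutoff d t by rewrite /cutoff pos_nneg; lra.
have d3 : 0 < d ^+ 3 by exact: exprn_gt0.
rewrite /theta ler_wpM2l ?invr_ge0// ler_ln ?posrE; first last.
- by rewrite ltr_pwDl// divr_ge0 ?exprn_ge0 ?pos_ge0// ltW.
- exact: lt_le_trans ltr01 q31.
rewrite expr_div_n; apply: (@le_trans _ _ (cutoff d t ^+ 3 / d ^+ 3)); last by lra.
rewrite ler_pM2r ?invr_gt0// lerXn2r// ?nnegrE ?pos_ge0//.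
exact: ltW.
Qed.

Variables (z : 'rV[R]_4) (z1 : normsq z = 1).
Implicit Types (y : 'rV[R]_4).

Let dot y := \sum_i y 0 i * z 0 i.

Let normsq_sub2 y : normsq (y - 2 *: z) = normsq y - 4 * dot y + 4.
Proof.
transitivity (normsq y - 4 * dot y + 4 * normsq z); last by rewrite z1 mulr1.
rewrite /normsq /dot !mulr_sumr -sumrB -big_split/=.
by apply: eq_bigr => i _; rewrite !mxE; ring.
Qed.

Let normsq_sub1 y : normsq (y - z) = normsq y - 2 * dot y + 1.
Proof.
transitivity (normsq y - 2 * dot y + normsq z); last by rewrite z1.
rewrite /normsq /dot !mulr_sumr -sumrB -big_split/=.
by apply: eq_bigr => i _; rewrite !mxE; ring.
Qed.

Let K n b y := ker n b (2 *: z) y.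
Let dK b y : R := \sum_i y 0 i * (- (2 * 2%:R * (K 1 b y * (y - 2 *: z) 0 i))).

Let dKE b y : dK b y = - (4 * (K 1 b y * (normsq y - 2 * dot y))).
Proof.
rewrite /dK /normsq /dot mulr_sumr -sumrB !mulr_sumr -sumrN; apply: eq_bigr => i _.
by rewrite !mxE; ring.
Qed.

(** In the support [4 * dot y > normsq y + 4 - b], and with [b <= 2] and [normsq y < 1] this gives
    [2 * dot y > normsq y]. *)
Let dK_ge0 b y : b <= 2 -> normsq y < 1 -> 0 <= dK b y.
Proof.
move=> b2 y1; rewrite dKE oppr_ge0 mulr_ge0_le0//.
have [h|h] := lerP b (normsq (y - 2 *: z)); first by rewrite /K ker_eq0// mul0r.
rewrite mulr_ge0_le0 ?ker_ge0//; move: h; rewrite normsq_sub2 => h.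
by lra.
Qed.

Let cont_coord i y : {for y, continuous (fun y => y 0 i)}.
Proof. exact: smooth_on_continuous (smooth_on_coord i (openT : open setT)) I. Qed.

Let is_derive_lens b i y : is_derive y (delta_mx 0 i) (fun y => y 0 i * K 2 b y)
  (K 2 b y + y 0 i * (- (2 * 2%:R * (K 1 b y * (y - 2 *: z) 0 i)))).
Proof.
have sc := smooth_on_coord i (openT : open [set: 'rV[R]_4]).
have d1 := is_derive_pd i sc (I : setT y); rewrite pd_coord eqxx in d1.
have := @is_deriveM R _ (fun y => y 0 i) (K 2 b) y _ _ _ d1 (is_derive_ker 0 b (2 *: z) i y).
by move/is_derive_eq; apply; rewrite /GRing.scale/= mulr1 addrC.
Qed.

(* The kernel is centred outside the ball, at 2 z, so that it is radially
   increasing on the ball while its support meets the ball only near z. *)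
Let lens_identity b d : 0 < d ->
  2 * integral4 (fun y => weight d (normsq y) * (normsq y * K 2 b y)) =
  integral4 (fun y => theta d (normsq y) * (4 * K 2 b y + dK b y)).
Proof.
move=> d0; have adm := admissible_theta d0.
have cphi := admissible_continuous adm; case: adm => dp cd k1 p0 q0.
have cK n : continuous (K n b) by exact: continuous_ker.
pose dw i y := K 2 b y + y 0 i * (- (2 * 2%:R * (K 1 b y * (y - 2 *: z) 0 i))).
have cdw i y : {for y, continuous (dw i)}.
  apply: continuousD_at; first exact: cK.
  apply: continuousM_at; first exact: cont_coord.
  apply: continuousN_at; apply: continuousM_at; first exact: cst_continuous.
  apply: continuousM_at; first exact: cK.
  rewrite (_ : (fun y => _) = fun y => y 0 i - (2 *: z) 0 i); last by apply/funext => x; rewrite !mxE.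
  by apply: continuousB_at; [exact: cont_coord|exact: cst_continuous].
have cw i y : {for y, continuous (fun y => y 0 i * K 2 b y)}.
  by apply: continuousM_at; [exact: cont_coord|exact: cK].
have c2y i y : {for y, continuous (fun y => - weight d (normsq y) * (2 * y 0 i))}.
  have c1 := continuous_radial cd (x := y).
  apply: continuousM_at; first exact: c1.
  by apply: continuousM_at; [exact: cst_continuous|exact: cont_coord].
have P i : integral4 (fun y => - weight d (normsq y) * (2 * y 0 i) * (y 0 i * K 2 b y))
    + integral4 (fun y => theta d (normsq y) * dw i y) = 0.
  apply: (integral4_parts (k := 1 - d) (i := i)).
  - exact: continuous_radial.
  - by move=> y; exact: c2y.
  - by move=> y; exact: is_derive_radial.
  - by move=> y /p0.
  - by move=> y /q0 ->; rewrite mul0r.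
  - by move=> y _; exact: cw.
  - by move=> y _; exact: cdw.
  - by move=> y _; exact: is_derive_lens.
have c1 i : cc (fun y => - weight d (normsq y) * (2 * y 0 i) * (y 0 i * K 2 b y)).
  apply: (cc_cut (k := 1 - d)) => [y|y /q0 ->|y _]; [exact: c2y|by rewrite mul0r|exact: cw].
have c2 i : cc (fun y => theta d (normsq y) * dw i y).
  by apply: cc_radial p0 _ => // y _; exact: cdw.
have : \sum_i (integral4 (fun y => - weight d (normsq y) * (2 * y 0 i) * (y 0 i * K 2 b y))
    + integral4 (fun y => theta d (normsq y) * dw i y)) = 0 by rewrite big1.
rewrite big_split/= -(integral4_sum _ c1) -(integral4_sum _ c2).
rewrite (_ : (fun y => \sum_i theta d _ * _) =
    fun y => theta d (normsq y) * (4 * K 2 b y + dK b y)); last first.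
  apply/funext => y; rewrite -mulr_sumr big_split/= sumr_const card_ord.
  by rewrite -[_ *+ 4]mulr_natl.
have cX : cc (fun y => weight d (normsq y) * (normsq y * K 2 b y)).
  apply: (cc_radial _ k1); first exact: continuous_weight.
    by move=> t; exact: weight_eq0.
  by move=> y _; apply: continuousM_at; [exact: continuous_normsq|exact: cK].
rewrite (_ : (fun y => \sum_i - _ * _ * _) =
    fun y => (- 2) * (weight d (normsq y) * (normsq y * K 2 b y))); last first.
  apply/funext => y; rewrite /normsq mulr_suml !mulr_sumr; apply: eq_bigr => i _.
  by ring.
by rewrite (integral4Z _ cX); lra.
Qed.

Lemma log_mass_eq0 (f : 'rV[R]_4 -> R) (M : R) :
  (forall y, normsq y <= 1 -> {for y, continuous f}) -> (forall y, 0 <= f y) ->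
  (forall d, 0 < d < 1 ->
    integral4 (fun y => normsq y * weight d (normsq y) * f y) <= M) ->
  f z = 0.
Proof.
move=> cf f0 fM; apply/eqP; rewrite eq_le f0 andbT leNgt; apply/negP => fz.
pose m := f z / 2; have m0 : 0 < m by rewrite divr_gt0.
have : \forall y \near z, m < f y.
  have := cf z; rewrite z1 lexx => /(_ isT) cz.
  by apply: (cvgr_gt (f z) cz); rewrite /m; lra.
move=> /nbhs_ballP[r /= r0 rf].
(* For [normsq y < 1], the condition [|y - 2 z|^2 < 1 + rho] implies [|y - z|^2 < rho / 2], so the
   lens cut out of the ball lies within [r] of [z]. *)
pose rho := Num.min 1 (r ^+ 2).
have rho0 : 0 < rho by rewrite lt_min ltr01 exprn_gt0.
have rho1 : rho <= 1 by rewrite ge_min lexx.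
have rhor : rho <= r ^+ 2 by rewrite ge_min lexx orbT.
pose b := 1 + rho.
have lens y : normsq y < 1 -> normsq (y - 2 *: z) < b -> m < f y.
  move=> y1 yb; apply: rf; split=> // i j; rewrite (ord1 i) /ball/=.
  have yz : normsq (z - y) < r ^+ 2.
    rewrite (_ : normsq (z - y) = normsq (y - z)); last first.
      by apply: eq_bigr => k _; rewrite !mxE; ring.
    by move: yb; rewrite normsq_sub2 normsq_sub1 /b; lra.
  have := le_lt_trans (normsq_coord (z - y) j) yz; rewrite !mxE -[X in X < _]real_normK ?num_real//.
  by rewrite ltr_sqr ?nnegrE ?normr_ge0// (ltW r0).
have kle y : K 2 b y <= 4.
  rewrite /K /ker -[leRHS](_ : 2 ^+ 2 = 4 :> R); last by ring.
  rewrite lerXn2r// ?nnegrE ?pos_ge0// /pos ge_max ler0n/=.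
  by have := normsq_ge0 (y - 2 *: z); rewrite /b; lra.
have fk y : normsq y < 1 -> m / 4 * K 2 b y <= f y.
  move=> y1; have [h|h] := lerP b (normsq (y - 2 *: z)).
    by rewrite /K ker_eq0// mulr0.
  apply: le_trans (ltW (lens _ y1 h)); rewrite -[leRHS](_ : m / 4 * 4 = m); last by field.
  by rewrite ler_pM2l ?divr_gt0.
pose d0 := rho / 16.
have d00 : 0 < d0 by rewrite divr_gt0.
have cK n : continuous (K n b) by exact: continuous_ker.
have cpos (y : 'rV[R]_4) : {for y, continuous (fun y => pos (1 - 2 * d0 - normsq y))}.
  have c : {for y, continuous (@normsq R 4)} by exact: continuous_normsq.
  by contin.
have ccL : cc (fun y => pos (1 - 2 * d0 - normsq y) * K 2 b y).
  apply: (cc_cut (k := 1 - 2 * d0)) => [y|y h|y _]; [exact: cpos|by rewrite pos0 //; lra|exact: cK].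
pose c1 := integral4 (fun y => pos (1 - 2 * d0 - normsq y) * K 2 b y).
have c10 : 0 < c1.
  (* A point of the lens at which both factors are positive: its norm is [1 - rho / 4] and its
     distance to [2 z] is [1 + rho / 4]. *)
  apply: (integral4_gt0 (y0 := (1 - rho / 4) *: z)) => //.
    by move=> y; rewrite mulr_ge0 ?pos_ge0 ?ker_ge0.
  rewrite /K /ker.
  have -> : (1 - rho / 4) *: z - 2 *: z = - (1 + rho / 4) *: z by rewrite -scalerBl; congr (_ *: _); ring.
  rewrite !normsq_dilate z1 !mulr1 mulr_gt0 ?exprn_gt0//.
    rewrite (lt_le_trans _ (le_pos _))// /d0 expr2.
    have : rho * rho <= 1 * rho by rewrite ler_pM2r.
    by lra.
  rewrite (lt_le_trans _ (le_pos _))// /b expr2.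
  have : rho * rho <= 1 * rho by rewrite ler_pM2r.
  by lra.
have M0 : 0 <= M.
  have h2 : 0 < (2^-1 : R) < 1 by lra.
  apply: le_trans (fM _ h2); apply: integral4_ge0 => y.
  rewrite mulr_ge0// mulr_ge0 ?normsq_ge0//; apply: weight_ge0.
  by rewrite invr_gt0.
(* Chosen so that the final lower bound [m / 4 * (2 * (L / 3) * c1)] equals [M + m * c1 / 2]; then
   [d = d0 / expR L] makes the logarithm in [theta_ge] at least [L]. *)
pose L := 3 * (2 * M / (m * c1) + 1).
have L0 : 0 <= L by rewrite mulr_ge0// addr_ge0// divr_ge0 ?mulr_ge0// ltW.
pose d := d0 / expR L.
have eL := expR_gt0 L.
have eL1 : 1 <= expR L by rewrite -expR0 ler_expR.
have dp : 0 < d by rewrite divr_gt0.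
have dd : d <= d0 by rewrite ler_pdivrMr// ler_peMr// ltW.
have d1 : 0 < d < 1 by rewrite dp (le_lt_trans dd)// /d0; lra.
have lnL : L <= ln ((d0 / d) ^+ 3).
  have -> : d0 / d = expR L by rewrite /d; field; rewrite !gt_eqF.
  rewrite -[leLHS]expRK ler_ln ?posrE ?exprn_gt0// -[leLHS]expr1.
  exact: ler_weXn2l.
have := fM d d1; apply/negP; rewrite -ltNge.
have th y : 3^-1 * ln ((d0 / d) ^+ 3) * pos (1 - 2 * d0 - normsq y) <= theta d (normsq y).
  apply: theta_ge; rewrite ?dp ?normsq_ge0//; rewrite /d0; lra.
have k1 : 1 - d < 1 by lra.
have cphi := admissible_continuous (admissible_theta dp).
have w0 t : 1 - d <= t -> weight d t = 0 by exact: weight_eq0.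
have cf1 : cc (fun y => normsq y * weight d (normsq y) * f y).
  rewrite (_ : (fun y => _) = fun y => weight d (normsq y) * (normsq y * f y)); last first.
    by apply/funext => y; ring.
  apply: (cc_radial _ k1 w0); first exact: continuous_weight.
  move=> y Uy; apply: continuousM_at; first exact: continuous_normsq.
  by apply: cf; exact: ltW.
have cX : cc (fun y => weight d (normsq y) * (normsq y * K 2 b y)).
  apply: (cc_radial _ k1 w0); first exact: continuous_weight.
  by move=> y _; apply: continuousM_at; [exact: continuous_normsq|exact: cK].
have I1 : m / 4 * integral4 (fun y => weight d (normsq y) * (normsq y * K 2 b y)) <=
    integral4 (fun y => normsq y * weight d (normsq y) * f y).
  rewrite -(integral4Z _ cX); apply: integral4_le => //; first exact: ccZ.
  move=> y; have [h|h] := lerP (1 - d) (normsq y); first by rewrite w0// mulr0 !mul0r mulr0.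
  have -> : m / 4 * (weight d (normsq y) * (normsq y * K 2 b y)) =
    normsq y * weight d (normsq y) * (m / 4 * K 2 b y) by ring.
  apply: ler_wpM2l; first exact: mulr_ge0 (normsq_ge0 y) (weight_ge0 _ dp).
  by apply: fk; exact: lt_trans h k1.
have cdK (y : 'rV[R]_4) : {for y, continuous (dK b)}.
  rewrite (_ : dK b = fun y => - (4 * (K 1 b y * (normsq y - 2 * dot y)))); last first.
    by apply/funext => x; exact: dKE.
  have h1 : {for y, continuous (K 1 b)} by exact: cK.
  have h2 : {for y, continuous (@normsq R 4)} by exact: continuous_normsq.
  have h3 : {for y, continuous dot}.
    apply: continuous_at_sum => i; apply: continuousM_at; [exact: cont_coord|exact: cst_continuous].
  by contin.
have cY : cc (fun y => theta d (normsq y) * (4 * K 2 b y + dK b y)).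
  apply: (cc_radial cphi k1) => [t|y _]; first exact: theta_eq0.
  apply: continuousD_at; last exact: cdK.
  by apply: continuousM_at; [exact: cst_continuous|exact: cK].
have I2 : 4 * (L / 3) * c1 <= integral4 (fun y => theta d (normsq y) * (4 * K 2 b y + dK b y)).
  rewrite /c1 -(integral4Z _ ccL); apply: integral4_le => //; first exact: ccZ.
  move=> y; have Ky : 0 <= K 2 b y by exact: ker_ge0.
  have P0 := pos_ge0 (1 - 2 * d0 - normsq y).
  have [h|h] := lerP (1 - d) (normsq y).
    rewrite pos0 ?mul0r ?mulr0 ?theta_eq0 ?mul0r//.
    by have := dd; have := d00; lra.
  have dk : 0 <= dK b y by apply: dK_ge0; [rewrite /b; lra|exact: lt_trans h k1].
  apply: (@le_trans _ _ (theta d (normsq y) * (4 * K 2 b y))); last first.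
    by rewrite ler_wpM2l ?theta_ge0// lerDl.
  have -> : 4 * (L / 3) * (pos (1 - 2 * d0 - normsq y) * K 2 b y) =
    (3^-1 * L * pos (1 - 2 * d0 - normsq y)) * (4 * K 2 b y) by ring.
  apply: ler_wpM2r; first exact: mulr_ge0 (ler0n R 4) Ky.
  apply: le_trans (th y).
  by rewrite ler_wpM2r// ler_wpM2l ?invr_ge0.
rewrite -(lens_identity b dp) in I2.
apply: lt_le_trans I1.
apply: (@lt_le_trans _ _ (m / 4 * (2 * (L / 3) * c1))); last first.
  by rewrite ler_pM2l ?divr_gt0//; lra.
rewrite (_ : m / 4 * (2 * (L / 3) * c1) = M + m * c1 / 2); last first.
  by rewrite /L; field; rewrite !gt_eqF.
by rewrite ltrDl divr_gt0// mulr_gt0.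
Qed.

End log_vanishing.

(** * From the cone to the ball and back *)

Section reduction_to_ball.
Context {R : realType} {g : metric_lie_algebra R}.
Local Notation V := 'rV[R]_(la_dim g).
Variable A : 'I_5 -> 'rV[R]_5 -> V.
Local Notation C := (@light_cone R).
Local Notation l := (lift ord0).
Local Notation z := (@ord0 4).
Local Notation U := (@unit_ball R).
Local Notation Phi := (@hyperboloid R).
Local Notation F := (curv A).
Hypothesis sA : forall b, smooth_on C (A b).
Hypothesis YM : forall b p, C p ->
  \sum_(i < 4) cov A (l i) (curv A (l i) b) p = cov A z (curv A z b) p.
Hypothesis SS : forall b p, C p -> \sum_a p 0 a *: curv A a b p = 0.
Let oC : open C := open_light_cone.
Let oU : open U := @open_unit_ball R.
Let sF a b : smooth_on C (F a b) := smooth_on_curv oC sA a b.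

Let sFF a b : smooth_on C (fun x => ip (F a b x) (F a b x)).
Proof. exact: smooth_on_ip. Qed.

Lemma curv_normsq_homogeneous a b p : C p ->
  \sum_c p 0 c * pd c (fun x => ip (F a b x) (F a b x)) p = - 4 * ip (F a b p) (F a b p).
Proof.
move=> Cp; have H := curv_homogeneous sA SS a b Cp.
transitivity (2 * ip (\sum_c p 0 c *: cov A c (F a b) p) (F a b p)).
  rewrite ip_suml mulr_sumr; apply: eq_bigr => c _.
  by rewrite (pd_ip A c (sF a b) (sF a b) Cp) (ipC (F a b p)) ipZl; ring.
by rewrite H ipZl; ring.
Qed.

(** By homogeneity, [s^4] times the squared norm of the curvature at [s *: p] has derivative zero in
    [s], so vanishing propagates along rays. *)
Lemma curv_ray a b (p : 'rV[R]_5) (r : R) : C p -> 0 < r ->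
  F a b p = 0 -> F a b (r *: p) = 0.
Proof.
move=> Cp r0 F0; pose u x := ip (F a b x) (F a b x).
have Cs (s : R) : 0 < s -> C (s *: p).
  move=> s0; move: Cp; rewrite !light_coneE => -[p0 H]; rewrite mxE; split; first exact: mulr_gt0.
  rewrite exprMn; under eq_bigr do rewrite mxE exprMn.
  by rewrite -mulr_sumr ltr_pM2l// exprn_gt0.
pose h (s : R) := (s * s) * (s * s) * u (s *: p).
have dh (s : R) : 0 < s -> is_derive s 1 h 0.
  move=> s0; have du := smooth_on_diff (sFF a b) (Cs s s0).
  have := @is_derive_line R _ _ u 0 p s; rewrite add0r => /(_ du).
  under eq_fun do rewrite add0r.
  move=> dl; have d2 := derM (der_id s) (der_id s).
  apply: der_eq (derM (derM d2 d2) dl) _.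
  rewrite (derive_pd p du); have := curv_normsq_homogeneous a b (Cs s s0).
  under eq_bigr do rewrite mxE -mulrA; rewrite -mulr_sumr -/u => H.
  have -> : s * s * (s * s) * \sum_i p 0 i * pd i u (s *: p) =
    s ^+ 3 * (s * \sum_i p 0 i * pd i u (s *: p)) by ring.
  by rewrite H /u; ring.
have const (s t : R) : 0 < s -> s < t -> h t = h s.
  move=> s0 st; have [|c _ E] := @MVT_open R h (fun=> 0) s t st.
    by move=> x /andP[sx _]; apply: dh; exact: lt_le_trans sx.
  by apply/eqP; rewrite -subr_eq0 E mul0r.
have h1 : h 1 = 0 by rewrite /h scale1r /u F0 ip0l mulr0.
have hr : h r = 0.
  have [r1|r1|->//] := ltgtP r 1; first by rewrite -(const r 1).
  by rewrite (const 1 r).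
apply: ip_eq0; move: hr => /eqP; rewrite !mulf_eq0 (gt_eqF r0)/=.
by move/eqP.
Qed.

(** With [y = x / r], lying on the surface means [r^2 - 2 t r + |x|^2 = 0]. The larger root
    [t + sqrt (t^2 - |x|^2)] is the one for which [|y| < 1]. *)
Lemma hyperboloid_ray p : C p -> exists r y, [/\ 0 < r, U y & p = r *: Phi y].
Proof.
move=> /light_coneE; set x := \row_i p 0 (l i).
have -> : \sum_i p 0 (l i) ^+ 2 = normsq x by apply: eq_bigr => i _; rewrite mxE.
move=> [p0 px]; pose q := Num.sqrt (p 0 z ^+ 2 - normsq x).
have q0 : 0 < q by rewrite sqrtr_gt0 subr_gt0.
have q2 : q ^+ 2 = p 0 z ^+ 2 - normsq x by rewrite sqr_sqrtr// subr_ge0 ltW.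
pose r := p 0 z + q; have r0 : 0 < r by exact: addr_gt0.
have r2 : r ^+ 2 + normsq x = 2 * p 0 z * r.
  have -> : normsq x = p 0 z ^+ 2 - q ^+ 2 by rewrite q2; ring.
  by rewrite /r; ring.
exists r, (r^-1 *: x); split=> //.
  rewrite /unit_ball /= normsq_dilate exprVn mulrC ltr_pdivrMr ?exprn_gt0// mul1r.
  apply: (lt_trans px); rewrite ltr_sqr ?nnegrE ?ltW// /r; lra.
apply: row5P => [|i]; rewrite mxE; last by rewrite eventS !mxE mulVKf// gt_eqF.
rewrite event0 normsq_dilate exprVn.
have -> : r * ((1 + (r ^+ 2)^-1 * normsq x) / 2) = (r ^+ 2 + normsq x) / (2 * r).
  by field; rewrite gt_eqF.
by rewrite r2; field; rewrite gt_eqF.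
Qed.

(** If the reduced curvature vanishes, so does its radial part, hence the electric components, the
    factor [1 - normsq y] being positive; [curv_reduced] then removes the spatial components, and
    rays cover the cone. *)
Lemma curv_eq0 : (forall i j y, U y -> curv (reduced A) i j y = 0) ->
  forall a b p, C p -> F a b p = 0.
Proof.
move=> f0 a b p /hyperboloid_ray[r [y [r0 Uy ->]]].
have Cy := hyperboloid_cone Uy; apply: curv_ray => //.
have Fz j : F z (l j) (Phi y) = 0.
  have := radial_curv_reduced sA SS j Uy.
  rewrite big1 => [/esym/eqP|i _]; last by rewrite f0// scaler0.
  rewrite scaler_eq0 oppr_eq0 => /orP[/eqP|/eqP//].
  by move: Uy; rewrite /unit_ball /= => Uy H; exfalso; lra.
have Fl i j : F (l i) (l j) (Phi y) = 0.
  by have := curv_reduced sA i j Uy; rewrite f0// !Fz !scaler0 subr0 add0r => /esym.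
case: (unliftP z a) => [i ->|->]; case: (unliftP z b) => [j ->|->] //.
- by rewrite curvC Fz oppr0.
- exact/eqNr_eq0/curvC.
Qed.

(** The electric part alone is transported by [energy_flux]: it is nonnegative and homogeneous of
    degree -4, and by [radial_curv_reduced] it determines the radial curvature. *)
Definition electric_dens (p : 'rV[R]_5) : R := \sum_j ip (F z (l j) p) (F z (l j) p).

Let e := electric_dens.

Let se : smooth_on C e.
Proof. by apply: smooth_on_sum => // j; exact: sFF. Qed.

Let e0 p : 0 <= e p.
Proof. by apply: sumr_ge0 => j _; exact: ip_ge0. Qed.

Let euler p : C p -> \sum_b p 0 b * pd b e p = - 4 * e p.
Proof.
move=> Cp; under eq_bigr => b _.
  rewrite (pd_sum oC b (index_enum _) (fun j => sFF z (l j)) Cp) mulr_sumr; over.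
rewrite exchange_big/= /e /electric_dens mulr_sumr; apply: eq_bigr => j _.
exact: curv_normsq_homogeneous.
Qed.

Variable K : R.
Hypothesis disc_energy : forall eps, 0 < eps <= 1 ->
  integral4 (fun y => ramp eps (pos (1 - normsq y)) * electric_dens (event 1 y)) <= K.

Let a := reduced A.
Let sa i : smooth_on U (a i) := smooth_on_reduced sA i.
Let ym j y : U y -> \sum_i cov a i (curv a i j) y = 0.
Proof. exact: yang_mills_reduced. Qed.

Let radial_densE y : U y -> radial_dens a y = ((1 - normsq y) / 2) ^+ 2 * e (Phi y).
Proof.
move=> Uy; rewrite /radial_dens /e /electric_dens mulr_sumr; apply: eq_bigr => j _.
by rewrite /radial_curv (radial_curv_reduced sA SS j Uy) ipZl ipZr; ring.
Qed.

(** The flux through the hyperboloid carries the factor [slope 1 t = (1 - t) / 2], whereas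
    [radial_dens] contains its square. The quotient leaves room for a weight of size
    [1 / (1 - t)]. *)
Lemma radial_energy_le d : 0 < d < 1 ->
  integral4 (fun y => weight d (normsq y) * radial_dens a y) <= 2 * K.
Proof.
(* On the support of the weight [1 - t >= d], so the gap [(1 - t)^2 / 4] is at least [2 * eps] and
   the ramp at least 1/2. *)
move=> /andP[d0 d1]; pose eps := d ^+ 2 / 8.
have d2 : 0 < d ^+ 2 by exact: exprn_gt0.
have d21 : d ^+ 2 < 1 by rewrite expr_lt1// ltW.
have eps0 : 0 < eps by rewrite divr_gt0.
have eps1 : eps <= 1 by rewrite /eps; lra.
have := energy_flux se (fun p _ => e0 p) euler eps0 eps1.
have -> : (fun y : 'rV[R]_4 => ramp eps (gap 0 (normsq y)) * (e (slice 0 y) * slope 0 (normsq y)))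
    = fun y => ramp eps (pos (1 - normsq y)) * electric_dens (event 1 y).
  apply/funext => y; rewrite /gap /slice /slope !mul0r subr0 addr0 !mulr1.
  by rewrite expr0n/= mul0r mul0r addr0.
have -> : (fun y : 'rV[R]_4 => ramp eps (gap 1 (normsq y)) * (e (slice 1 y) * slope 1 (normsq y)))
    = fun y => (ramp eps (pos (1 - normsq y) ^+ 2 / 4) * ((1 - normsq y) / 2)) * e (Phi y).
  apply/funext => y; rewrite /gap /slice /slope subrr mulr0 add0r expr1n !mul1r.
  have -> : event (1 + (normsq y - 1) / 2) y = Phi y by congr event; field.
  by rewrite -mulrA; congr (_ * _); rewrite mulrC; congr (_ * _); field.
move=> flux; have {flux} E := le_trans flux (@disc_energy eps _); rewrite eps0 eps1 in E.
have {}E := E isT.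
have cw := continuous_weight d0.
have c1 : cc (fun y => weight d (normsq y) * radial_dens a y).
  apply: (cc_radial (k := 1 - d) cw); first by lra.
    by move=> t; exact: weight_eq0.
  by move=> y; exact: smooth_on_continuous (smooth_on_radial_dens oU sa).
have ce y : U y -> {for y, continuous (fun y => e (Phi y))}.
  by apply: smooth_on_continuous; exact: smooth_on_comp (@hyperboloid_cone R) se (@smooth_on_hyperboloid R).
have c2 : cc (fun y => (ramp eps (pos (1 - normsq y) ^+ 2 / 4) * ((1 - normsq y) / 2)) * e (Phi y)).
  apply: (cc_radial (phi := fun t : R => ramp eps (pos (1 - t) ^+ 2 / 4) * ((1 - t) / 2)) (k := 1 - d / 2)) => //.
  - move=> t; suff: {for t, continuous (fun t : R => ramp eps (pos (1 - t) ^+ 2 / 4) * ((1 - t) / 2))} by [].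
    apply: continuousM_at; last by contin.
    apply: (@continuous_comp _ _ _ (fun t : R => pos (1 - t) ^+ 2 / 4) (ramp eps)); last exact: continuous_ramp.
    suff: {for t, continuous (fun t : R => pos (1 - t) ^+ 2 / 4)} by [].
    by contin.
  - by lra.
  - move=> t h; rewrite ramp_eq0 ?mul0r// /eps.
    have : pos (1 - t) <= d / 2 by rewrite /pos ge_max; apply/andP; split; lra.
    by have := pos_ge0 (1 - t); rewrite !expr2; nra.
rewrite -(ler_pM2l (x := 2^-1)) ?invr_gt0// mulKf// -(integral4Z _ c1).
apply: le_trans E; apply: integral4_le c2 _; first exact: ccZ.
move=> y; have [h|h] := lerP (1 - d) (normsq y).
  rewrite weight_eq0// mul0r mulr0; have [h1|h1] := lerP 1 (normsq y).
    rewrite pos0 ?subr_le0// expr0n/= mul0r ramp_eq0 ?mul0r//; exact: ltW.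
  rewrite mulr_ge0// mulr_ge0 ?ramp_ge0// divr_ge0// subr_ge0; exact: ltW.
have Uy : U y by rewrite /unit_ball /=; lra.
rewrite radial_densE//.
have -> : 2^-1 * (weight d (normsq y) * (((1 - normsq y) / 2) ^+ 2 * e (Phi y))) =
  2^-1 * (weight d (normsq y) * ((1 - normsq y) / 2) ^+ 2) * e (Phi y) by ring.
apply: ler_wpM2r => //.
set w := 1 - d - normsq y; have w0 : 0 < w by rewrite /w; lra.
have rE : 1 - normsq y = w + d by rewrite /w; ring.
have wr : 0 < w + d by exact: addr_gt0.
have r1 : 2^-1 <= ramp eps (pos (1 - normsq y) ^+ 2 / 4).
  apply: ramp_ge_half => //; rewrite rE pos_nneg; last exact: ltW.
  have : d ^+ 2 <= (w + d) ^+ 2 by rewrite lerXn2r// ?nnegrE ?(ltW wr) ?(ltW d0)// lerDr ltW.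
  by rewrite /eps; lra.
apply: (@le_trans _ _ (2^-1 * ((w + d) / 2))); last first.
  by rewrite rE; apply: ler_wpM2r; [rewrite divr_ge0// ltW|rewrite -rE].
rewrite ler_pM2l ?invr_gt0// rE /weight /cutoff pos_nneg; last exact: ltW.
have den : 0 < d ^+ 3 + w ^+ 3 by rewrite addr_gt0// exprn_gt0.
rewrite -/w mulrAC ler_pdivrMr//.
have -> : w ^+ 2 * ((w + d) / 2) ^+ 2 = (w + d) / 2 * (w ^+ 2 * (w + d) / 2) by field.
rewrite ler_pM2l ?divr_gt0// ler_pdivrMr//.
(* There remains [w^2 (w + d) <= 2 (d^3 + w^3)], where [w^2 d] is at most the cube of the larger of
   [w] and [d]. *)
have [wd|wd] := lerP d w.
  have : w ^+ 2 * d <= w ^+ 2 * w by rewrite ler_pM2l ?exprn_gt0.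
  by have := exprn_gt0 3 d0; rewrite !exprS !expr0; lra.
have : w ^+ 2 * d <= d ^+ 2 * d.
  by rewrite ler_pM2r// lerXn2r// ?nnegrE ?ltW.
by have := exprn_gt0 3 w0; have := exprn_gt0 3 d0; rewrite !exprS !expr0; lra.
Qed.

Lemma weighted_energy_le d : 0 < d < 1 ->
  integral4 (fun y => weight d (normsq y) * (normsq y * dens a y)) <= 8 * K.
Proof.
move=> d01; have := radial_energy_le d01.
have d0 : 0 < d by case/andP: d01.
rewrite (pohozaev_energy d0 (smooth_on_pohozaev oU sa) (smooth_on_radial_dens oU sa)
  (smooth_on_dens oU sa) (fun y => div_pohozaev oU sa ym erefl)
  (fun y _ => radial_pohozaev a y)).
by lra.
Qed.

Let K0 : 0 <= K.
Proof.
have h : 0 < (1 : R) <= 1 by rewrite ltr01 lexx.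
apply: le_trans (disc_energy h); apply: integral4_ge0 => y.
by rewrite mulr_ge0 ?ramp_ge0//; exact: e0.
Qed.

Lemma self_dual_eq0 sg y : sg = 1 \/ sg = -1 -> U y -> sd_dens a sg y = 0.
Proof.
move=> sg1 Uy; pose q := sd_dens a sg.
have sq : smooth_on U q := smooth_on_sd_dens sg oU sa.
have q0 x : 0 <= q x by exact: sd_dens_ge0.
have [C1 C10 HC1] := @laplacian_dens_ge R g 4.
have [C2 C20 HC2] := @self_dual_radial_ineq R g.
have K8 : 0 <= 8 * K by rewrite mulr_ge0.
have [B B0 HB] := eps_regularity (smooth_on_dens oU sa) (dens_ge0 a) C10 K8
  (fun y s Uy s0 ys => HC1 a U oU sa ym y s Uy s0 ys) weighted_energy_le.
have [sh1 sh2 sh3] := smooth_on_sd_h sg oU sa.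
(* The bound is uniform in [r0] and [d]: at [r = 1] the mean is at most four times the weighted
   energy, and the constants of the frequency estimate involve neither. *)
have mean r0 d : 0 < r0 < 1 -> 0 < d < 1 ->
    integral4 (fun y => normsq y * weight d (normsq y) * q (r0 *: y)) <=
    expR (4 * (C2 * Num.sqrt B)) * (4 * (8 * K)).
  move=> r01 d01; have /andP[d0 d1] := d01.
  have k0 : 0 <= 1 - d by lra.
  have p0 t : 0 <= t -> 0 <= t * weight d t by move=> t0; rewrite mulr_ge0// weight_ge0.
  have adm := admissible_tweight d0.
  have := frequency_monotone sq q0 C20 B0 (@planes_anti _ sg _ _ _ _) (@planes_anti _ sg _ _ _ _)
    (@planes_anti _ sg _ _ _ _) sh1 sh2 sh3
    (fun y l s Uy s0 ys => HC2 a U sg oU sa ym sg1 y l s Uy s0 ys) HB adm k0 p0 r01.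
  move/le_trans; apply; rewrite ler_pM2l ?expR_gt0//.
  have cg : cc (fun y => weight d (normsq y) * (normsq y * dens a y)).
    apply: (cc_radial (k := 1 - d) (continuous_weight d0)); first by lra.
      by move=> t; exact: weight_eq0.
    move=> x Ux; apply: continuousM_at; first exact: continuous_normsq.
    exact: smooth_on_continuous (smooth_on_dens oU sa) Ux.
  apply: (@le_trans _ _ (4 * integral4 (fun y => weight d (normsq y) * (normsq y * dens a y)))); last first.
    by rewrite ler_pM2l// weighted_energy_le.
  rewrite -(integral4Z _ cg) /dilation_mean.
  have -> : (fun x : 'rV[R]_4 => normsq x * weight d (normsq x) * q (1 *: x)) =
    fun x => normsq x * weight d (normsq x) * q x by apply/funext => x; rewrite scale1r.
  apply: integral4_le.
  - have cphi := admissible_continuous adm; case: adm => _ _ k1 z0 _.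
    apply: (cc_radial cphi k1 z0) => x Ux; exact: smooth_on_continuous sq Ux.
  - exact: ccZ.
  - move=> x; have -> : 4 * (weight d (normsq x) * (normsq x * dens a x)) =
      normsq x * weight d (normsq x) * (4 * dens a x) by ring.
    by apply: ler_wpM2l; [exact: p0 (normsq_ge0 x)|exact: sd_dens_le].
have sphere r0 x : 0 < r0 < 1 -> normsq x = 1 -> q (r0 *: x) = 0.
  move=> r01 x1; have /andP[r00 r011] := r01.
  apply: (log_mass_eq0 x1 (f := fun y => q (r0 *: y)) (M := expR (4 * (C2 * Num.sqrt B)) * (4 * (8 * K)))).
  - move=> w w1; apply: (@continuous_comp _ _ _ (fun y : 'rV[R]_4 => r0 *: y) q).
      exact: scaler_continuous.
    apply: smooth_on_continuous sq _; rewrite /unit_ball /= normsq_dilate.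
    apply: (@le_lt_trans _ _ (r0 ^+ 2)); first by rewrite ler_piMr ?sqr_ge0.
    by rewrite expr_lt1// ltW.
  - by move=> w; exact: q0.
  - by move=> d; exact: mean.
have off0 x : U x -> 0 < normsq x -> q x = 0.
  rewrite /unit_ball /= => Ux x0; pose r0 := enorm x.
  have r00 : 0 < r0 by rewrite sqrtr_gt0.
  have r01 : 0 < r0 < 1.
    by rewrite r00 -normsq_lt ?ler01// expr1n.
  have := sphere r0 (r0^-1 *: x) r01; rewrite scalerA divff ?gt_eqF// scale1r; apply.
  by rewrite normsq_dilate exprVn enorm_sqr mulVf// gt_eqF.
(* The origin lies on no sphere of positive radius; it is reached by continuity from nearby points
   [x]. *)
have [y0|y0] := ltP 0 (normsq y); first exact: off0.
have yE : y = 0.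
  apply/rowP => i; rewrite mxE; apply/eqP; rewrite -sqrf_eq0 eq_le sqr_ge0 andbT.
  exact: le_trans (normsq_coord y i) y0.
apply/eqP; rewrite eq_le q0 andbT leNgt; apply/negP => qy.
have cq := smooth_on_continuous sq Uy.
have : \forall x \near y, 0 < q x /\ U x.
  by apply: filterI; [exact: (cvgr_gt (q y) cq)|exact: open_nbhs_nbhs].
move=> /nbhs_ballP[r /= r0 rq].
pose x : 'rV[R]_4 := (r / 2) *: delta_mx 0 0.
have x0 : 0 < normsq x.
  apply: lt_le_trans (normsq_coord x 0); rewrite !mxE/= mulr1.
  by rewrite exprn_gt0// divr_gt0.
have [|qx Ux] := rq x.
  split=> // i j; rewrite (ord1 i) yE !mxE/= /ball/= sub0r normrN normrM ger0_norm ?divr_ge0 ?(ltW r0)//.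
  case: (j == 0); rewrite ?normr1 ?normr0 ?mulr0 ?mulr1//; lra.
by rewrite off0// ltxx in qx.
Qed.

(** By the parallelogram law the densities of the two parts add up to twice the sum over the six
    planes, which is [dens]. *)
Lemma dens_eq0 y : U y -> dens a y = 0.
Proof.
move=> Uy; have := self_dual_eq0 (or_introl erefl) Uy.
have := self_dual_eq0 (or_intror erefl) Uy.
rewrite /sd_dens /sd1 /sd2 /sd3 /dens !sum4 !ipDl !ipDr !ipZl !ipZr.
have D i : ip (curv a i i y) (curv a i i y) = 0.
  by rewrite (_ : curv a i i y = 0) ?ip0l//; exact/eqNr_eq0/curvC.
have S i j : ip (curv a i j y) (curv a i j y) = ip (curv a j i y) (curv a j i y).
  by rewrite curvC ipNl ipNr opprK.
rewrite !D.
rewrite (S (@Ordinal 4 1 isT) (@Ordinal 4 0 isT)) (S (@Ordinal 4 2 isT) (@Ordinal 4 0 isT)).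
rewrite (S (@Ordinal 4 3 isT) (@Ordinal 4 0 isT)) (S (@Ordinal 4 2 isT) (@Ordinal 4 1 isT)).
rewrite (S (@Ordinal 4 3 isT) (@Ordinal 4 1 isT)) (S (@Ordinal 4 3 isT) (@Ordinal 4 2 isT)).
by lra.
Qed.

Lemma flat_of_disc_energy : forall b c p, C p -> F b c p = 0.
Proof.
apply: curv_eq0 => i j y Uy.
have [_ H] := norm_le_curv i j (lexx 0) (eq_ind_r (fun t => t <= 0 ^+ 2) (sqr_ge0 0) (dens_eq0 Uy)).
by apply: ip_eq0; apply/eqP; rewrite eq_le ip_ge0 andbT (le_trans H)// expr0n.
Qed.

End reduction_to_ball.

(** * Finite energy of the disc, and conclusion *)

Lemma ramp_integral_le (R : realType) (h H : 'rV[R]_4 -> R) (eps : R) : 0 < eps ->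
  (forall y, unit_ball y -> {for y, continuous h}) ->
  (forall y, unit_ball y -> {for y, continuous H}) ->
  (forall y, unit_ball y -> 0 <= h y <= H y) ->
  (\int[@lebesgue_measure4 R]_(x in vec4 @^-1` @unit_ball R) (H (vec4 x))%:E < +oo)%E ->
  integral4 (fun y => ramp eps (pos (1 - normsq y)) * h y) <=
  fine (\int[@lebesgue_measure4 R]_(x in vec4 @^-1` @unit_ball R) (H (vec4 x))%:E)%E.
Proof.
move=> eps0 ch cH hH Hfin; pose f (y : 'rV[R]_4) := ramp eps (pos (1 - normsq y)) * h y.
have ccf : cc f.
  apply: (cc_radial (phi := fun t : R => ramp eps (pos (1 - t))) (k := 1 - eps)) => //.
  - move=> t; apply: (@continuous_comp _ _ _ (fun t : R => pos (1 - t)) (ramp eps)).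
      by suff: {for t, continuous (fun t : R => pos (1 - t))} by []; contin.
    exact: continuous_ramp.
  - by lra.
  - by move=> t t1; rewrite ramp_eq0// /pos ge_max; apply/andP; split; lra.
have out y : ~ unit_ball y -> f y = 0.
  move=> /negP; rewrite -leNgt => y1.
  by rewrite /f pos0 ?subr_le0// ramp_eq0 ?mul0r// ltW.
have H0 y : unit_ball y -> 0 <= H y by move=> /hH/andP[+]; exact: le_trans.
have mD : measurable (vec4 @^-1` @unit_ball R).
  exact: measurable_vec4_open (@open_unit_ball R).
have iF := cc_integrable ccf.
rewrite /integral4 /Rintegral -/f; apply: fine_le.
- exact: integrable_fin_num iF.
- rewrite ge0_fin_numE//; apply: integral_ge0 => x Ux; rewrite lee_fin; exact: H0.
rewrite [leRHS]integral_mkcond; apply: ge0_le_integral => //.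
- move=> x _; rewrite lee_fin; have [Ux|nUx] := pselect (@unit_ball R (vec4 x)).
    by have /andP[h0 _] := hH _ Ux; rewrite mulr_ge0// ramp_ge0.
  by rewrite -/(f (vec4 x)) out.
- exact: measurable_int iF.
- apply/(measurable_restrictT _ mD)/measurable_EFinP.
  exact: measurable_vec4_continuous (@open_unit_ball R) cH.
move=> x _; rewrite patchE; case: ifPn => [/set_mem Ux|/negP nUx]; rewrite lee_fin.
  have /andP[h0 hH'] := hH _ Ux; apply: le_trans hH'.
  by rewrite ler_piMl// ramp_le1.
by rewrite -/(f (vec4 x)) out// => Ux; apply: nUx; exact: mem_set.
Qed.

Lemma spacetime_pointE (R : realType) (t : R) (x : R4 R) : spacetime_point t x = event t (vec4 x).
Proof.
by apply: row5P => [|i]; rewrite ?event0 ?eventS !mxE//.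
Qed.

Theorem theorem6p1 (R : realType) (n : nat) (G : topologicalGroupType)
    (atlas : set (chart R n G)) (G_lie : is_lie_group atlas)
    (G_compact : compact [set: G])
    (G_noncommutative : exists g h : G, (g * h)%g <> (h * g)%g)
    (e : chart R n G) (atlas_e : atlas e) (dom_e : dom e 1%g)
    (ip : 'rV[R]_n -> 'rV[R]_n -> R)
    (ip_biinvariant : is_biinvariant_inner_product e ip)
    (A : 'I_5 -> 'rV[R]_5 -> 'rV[R]_n)
    (A_smooth : forall a : 'I_5, smooth_on (@light_cone R) (A a))
    (A_yang_mills : yang_mills e A)
    (A_self_similar : self_similar e A)
    (A_finite_energy : forall t : R, 0 < t -> (energy e ip A t < +oo)%E) :
  forall (a b : 'I_5) (p : 'rV[R]_5), light_cone p -> curvature e A a b p = 0.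
Proof.
pose g : metric_lie_algebra R := @MetricLieAlgebra R n (lie_bracket e) ip
  (lie_bracket_linear G_lie atlas_e dom_e) (lie_bracketC e)
  (lie_bracket_jacobi G_lie atlas_e dom_e) (ip_sym ip_biinvariant)
  (ip_linear ip_biinvariant) (ip_posdef ip_biinvariant)
  (ip_bracket G_lie atlas_e dom_e ip_biinvariant).
have FE a b : curvature e A a b = curv (g := g) A a b.
  by rewrite curvE; apply/funext => p; rewrite -!pdE.
have covariantE a B : covariant_deriv e A a B = cov (g := g) A a B.
  by rewrite covE; apply/funext => p; rewrite -!pdE.
have SS b p : light_cone p -> \sum_a p 0 a *: curv (g := g) A a b p = 0.
  by move=> Cp; have := A_self_similar b p Cp; under eq_bigr do rewrite FE.
have YM b p : light_cone p -> \sum_(i < 4) cov (g := g) A (lift ord0 i) (curv (g := g) A (lift ord0 i) b) p =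
    cov (g := g) A ord0 (curv (g := g) A ord0 b) p.
  move=> Cp; have := A_yang_mills b p Cp.
  (* Raising the index merely changes the sign of the time component, so the equation takes the form
     of space terms equal to time term. *)
  have D a : \sum_c Defs.minkowski R a c *: covariant_deriv e A c (curvature e A a b) p =
      (if a == 0 then -1 else 1 : R) *: cov (g := g) A a (curv (g := g) A a b) p.
    rewrite (bigD1 a)//= big1 ?addr0 => [|c /negPf ca].
      by rewrite !mxE eqxx mulr1n covariantE FE.
    by rewrite !mxE [a == c]eq_sym ca mulr0n scale0r.
  under eq_bigr do rewrite D.
  rewrite big_ord_recl eqxx scaleN1r addrC => /eqP; rewrite subr_eq0 => /eqP <-.
  by apply: eq_bigr => i _; rewrite scale1r.
(* The energy density on the disc [t = 1], the slice from which [energy_flux] starts; the trace of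
   the light cone there is the unit ball. *)
pose H y : R := \sum_(a < 5) \sum_(b < 5 | (a < b)%N)
  ip (curv (g := g) A a b (event 1 y)) (curv (g := g) A a b (event 1 y)).
have energyE : energy e ip A 1 =
    (\int[@lebesgue_measure4 R]_(x in vec4 @^-1` @unit_ball R) (H (vec4 x))%:E)%E.
  rewrite /energy; congr integral.
  - apply/seteqP; split => x /=; rewrite spacetime_pointE => h.
      have : light_cone (event 1 (vec4 x)) by rewrite /light_cone /= event0.
      by move=> /light_cone_event[_]; rewrite expr1n.
    suff : light_cone (event 1 (vec4 x)) by rewrite /light_cone /= event0.
    by apply/light_cone_event; rewrite expr1n.
  - apply/funext => x; rewrite /H spacetime_pointE.
    by congr (_%:E); do 2 (apply: eq_bigr => ? _); rewrite !FE.
have oC := @open_light_cone R; have oU := @open_unit_ball R.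
have UC y : unit_ball y -> light_cone (event (1 : R) y).
  by move=> Uy; apply/light_cone_event; rewrite expr1n.
have sE : smooth_on (@unit_ball R) (event 1).
  apply: smooth_on_row => // b; case: (unliftP ord0 b) => [i ->|->].
    by under eq_fun do rewrite eventS; exact: smooth_on_coord.
  by under eq_fun do rewrite event0; exact: smooth_on_cst.
have sP a b : smooth_on (@unit_ball R) (fun y => ip (curv (g := g) A a b (event 1 y)) (curv (g := g) A a b (event 1 y))).
  have sF := smooth_on_comp oU UC (smooth_on_curv (g := g) oC A_smooth a b) sE.
  exact: (smooth_on_ip (g := g) oU sF sF).
have P0 a b p : 0 <= ip (curv (g := g) A a b p) (curv (g := g) A a b p) by exact: (@ip_ge0 R g).
have disc eps : 0 < eps <= 1 ->
    integral4 (fun y => ramp eps (pos (1 - normsq y)) * electric_dens (g := g) A (event 1 y)) <=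
    fine (energy e ip A 1).
  move=> /andP[eps0 _]; rewrite energyE; apply: ramp_integral_le => //.
  - move=> y; apply: smooth_on_continuous; apply: smooth_on_sum => // j; exact: sP.
  - move=> y; apply: smooth_on_continuous; do 2 (apply: smooth_on_sum => // ?); exact: sP.
  - move=> y _; apply/andP; split; first by apply: sumr_ge0 => j _; exact: P0.
    (* In [H] the terms with [a = 0] form the electric density; the magnetic terms are
       nonnegative. *)
    rewrite /H big_ord_recl /electric_dens -[leLHS]addr0 lerD//.
      by rewrite [leRHS]big_mkcond [leRHS]big_ord_recl/= add0r.
    by do 2 (apply: sumr_ge0 => ? _); exact: P0.
  - by rewrite -energyE; apply: A_finite_energy.
by move=> a b p Cp; rewrite FE; exact: (flat_of_disc_energy (g := g) A_smooth YM SS disc).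
Qed.
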